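(* Let $s\in(0,\infty)$, $q\in(0,\infty)$, $r\in\mathbb N$ with $r>s$, and let $\varphi$ be the scaling function of a Daubechies wavelet system of regularity $L$. (a) Let $p\in(0,\infty)$ and assume $L>\max\{s,\,n(\max\{1/p,1/q,1\}-1)-s\}$ and $L\ge r-1$. Then, for every $f\in\Lambda_s$, $$\mathrm{dist}\left(f,F^s_{p,q}\cap\Lambda_s\right)_{\Lambda_s}\sim\inf\left\{\varepsilon\in(0,\infty):\left\|\left[\int_0^1\mathbf 1_{S_r(s,f,\varepsilon)}(\cdot,y)\frac{dy}{y}\right]^{1/q}\right\|_{L^p}<\infty\right\}+\limsup_{k\in\mathbb Z^n,|k|\to\infty}\left|\int_{\mathbb R^n}\varphi(x-k)f(x)\,dx\right|.$$ (b) Assume $L>\max\{s,\,n(\max\{1/q,1\}-1)-s\}$ and $L\ge r-1$. Then, for every $f\in\Lambda_s$, $$\mathrm{dist}\left(f,F^s_{\infty,q}\right)_{\Lambda_s}\sim\inf\left\{\varepsilon\in(0,\infty):M\big(S_r(s,f,\varepsilon)\big)<\infty\right\}.$$ All positive equivalence constants are independent of $f$.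
   Context: $\Delta_hf(x):=f(x+h/2)-f(x-h/2)$, $\Delta^{k+1}_h:=\Delta^k_h\Delta_h$, $\Delta_rf(x,y):=\sup_{|h|=y}|\Delta_h^rf(x)|$. $\Lambda_s$: bounded continuous $f$ with $\|f\|_{\Lambda_s}:=\|f\|_{L^\infty}+\sup_{x,\,y\in(0,1]}\Delta_{\lfloor s\rfloor+1}f(x,y)/y^s<\infty$; $\mathrm{dist}(f,V)_{\Lambda_s}:=\inf_{g\in V\cap\Lambda_s}\|f-g\|_{\Lambda_s}$. $S_r(s,f,\varepsilon):=\{(x,y)\in\mathbb R^n\times(0,\infty):\Delta_rf(x,y)/y^s>\varepsilon\}$. Daubechies wavelet system of regularity $L$: $\varphi,\psi_\ell\in C^L_c(\mathbb R^n)$, $\ell=1,\dots,2^n-1$, $\psi_\ell$ with vanishing moments up to order $L$, such that $\{\varphi(\cdot-k)\}_{k\in\mathbb Z^n}\cup\{2^{jn/2}\psi_\ell(2^j\cdot-k)\}_{\ell,j\ge0,k}$ is an orthonormal basis of $L^2$. $\mathcal D$: dyadic cubes $2^{-j}(k+[0,1)^n)$, $j\in\mathbb Z_+$; $M(A):=\sup_{I\in\mathcal D}\frac1{|I|}\int_I\int_0^{\ell(I)}\mathbf 1_A(x,y)\frac{dy}ydx$. Littlewood–Paley system: $\eta\in\mathcal S$ with $0\le\eta\le1$, $\eta=1$ on $|x|\le1$, $\eta=0$ on $|x|\ge3/2$, $\theta:=\eta-\eta(2\cdot)$, $\phi_0:=\mathcal F^{-1}\eta$, $\phi_k:=2^{kn}(\mathcal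 F^{-1}\theta)(2^k\cdot)$. $F^s_{p,q}$ ($p<\infty$): $f\in\mathcal S'$ with $\|(\sum_j|2^{js}\phi_j*f|^q)^{1/q}\|_{L^p}<\infty$; $F^s_{\infty,q}$: $f\in\mathcal S'$ with $\sup_{l\in\mathbb Z_+,m\in\mathbb Z^n}(\frac1{|I_{l,m}|}\int_{I_{l,m}}\sum_{j\ge l}|2^{js}\phi_j*f|^q)^{1/q}<\infty$, $I_{l,m}=2^{-l}(m+[0,1)^n)$. ($F^s_{\infty,q}\subset\Lambda_s$.) *)

(* Defs.v *)
From mathcomp Require Import all_boot all_order all_algebra.
From mathcomp Require Import all_classical all_reals all_analysis.
Set Implicit Arguments. Unset Strict Implicit. Unset Printing Implicit Defensive.
Import Order.TTheory GRing.Theory Num.Theory numFieldNormedType.Exports.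
Local Open Scope classical_set_scope.
Local Open Scope ring_scope.

Definition enorm (R : realType) (n : nat) (x : 'rV[R]_n) : R :=
  Num.sqrt (\sum_(i < n) x 0%R i ^+ 2).

Definition zpt (R : realType) (n : nat) (k : 'rV[int]_n) : 'rV[R]_n :=
  map_mx (fun z : int => z%:~R) k.
Arguments zpt R {n} k.

(* n-dimensional Lebesgue integral of a nonnegative [0,+oo]-valued function,
   realised as the iterated one-dimensional Lebesgue integral
   (Tonelli: equals the integral w.r.t. n-dim Lebesgue measure for
   Borel functions). For n = 0 it is evaluation at the unique point. *)
Fixpoint intn (R : realType) (n : nat) : ('rV[R]_n -> \bar R) -> \bar R :=
  match n with
  | 0 => fun F => F 0
  | m.+1 => fun F =>
      (\int[@lebesgue_measure R]_t
          intn (fun v : 'rV[R]_m => F (row_mx (\row_(_ < 1) t) v)))%E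
  end.

Definition Rintn (R : realType) (n : nat) (f : 'rV[R]_n -> R) : R :=
  fine (intn (fun x => (Num.max (f x) 0)%:E))
  - fine (intn (fun x => (Num.max (- f x) 0)%:E)).

Definition borel_fun (R : realType) (n : nat) (f : 'rV[R]_n -> R) : Prop :=
  forall U : set R, open U ->
    <<s [set A : set 'rV[R]_n | open A] >> (f @^-1` U).

Definition evec (R : realType) (n : nat) (i : 'I_n) : 'rV[R]_n := delta_mx 0 i.
Arguments evec R {n} i.

Definition partial (R : realType) (n : nat) (i : 'I_n) (f : 'rV[R]_n -> R)
  : 'rV[R]_n -> R := fun x => 'D_(evec R i) f x.

Definition dpow (R : realType) (n : nat) (b : seq 'I_n) (f : 'rV[R]_n -> R)
  : 'rV[R]_n -> R := foldr (@partial R n) f b.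

Definition Ck (R : realType) (n : nat) (k : nat) (f : 'rV[R]_n -> R) : Prop :=
  (forall b : seq 'I_n, (size b < k)%N ->
     forall (i : 'I_n) (x : 'rV[R]_n), derivable (dpow b f) x (evec R i))
  /\ (forall b : seq 'I_n, (size b <= k)%N -> continuous (dpow b f)).

Definition smooth (R : realType) (n : nat) (f : 'rV[R]_n -> R) : Prop :=
  forall k, Ck k f.

Definition monomial (R : realType) (n : nat) (a : 'I_n -> nat) (x : 'rV[R]_n) : R :=
  \prod_(i < n) x 0%R i ^+ a i.

Definition schwartz (R : realType) (n : nat) (f : 'rV[R]_n -> R) : Prop :=
  smooth f /\
  forall (a : 'I_n -> nat) (b : seq 'I_n), exists M : R,
    forall x, `|monomial a x * dpow b f x| <= M.

Definition compact_support (R : realType) (n : nat) (f : 'rV[R]_n -> R) : Prop :=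
  exists B : R, forall x, B < enorm x -> f x = 0.

Definition wav_fun (R : realType) (n : nat) (phi : 'rV[R]_n -> R)
  (psi : 'I_(2 ^ n - 1) -> 'rV[R]_n -> R)
  (ix : option ('I_(2 ^ n - 1) * nat)) (k : 'rV[int]_n) : 'rV[R]_n -> R :=
  match ix with
  | None => fun x => phi (x - zpt R k)
  | Some (l, j) => fun x =>
      powR 2 (j%:R * n%:R / 2) * psi l ((2 ^+ j : R) *: x - zpt R k)
  end.

(* Orthonormal basis of L^2(R^n): orthonormality, and completeness
   (the only L^2 function orthogonal to the whole system is 0 a.e.) *)
Definition L2fun (R : realType) (n : nat) (g : 'rV[R]_n -> R) : Prop :=
  borel_fun g /\ (intn (fun x => (g x ^+ 2)%:E) < +oo)%E.

Definition daubechies (R : realType) (n : nat) (L : nat) (phi : 'rV[R]_n -> R)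
  (psi : 'I_(2 ^ n - 1) -> 'rV[R]_n -> R) : Prop :=
  [/\ Ck L phi /\ compact_support phi,
      (forall l, Ck L (psi l) /\ compact_support (psi l)),
      (forall l (a : 'I_n -> nat), (\sum_(i < n) a i <= L)%N ->
          Rintn (fun x => monomial a x * psi l x) = 0),
      (forall ix k ix' k',
          Rintn (fun x => wav_fun phi psi ix k x * wav_fun phi psi ix' k' x)
          = if (ix == ix') && (k == k') then 1 else 0) &
      (forall g, L2fun g ->
          (forall ix k, Rintn (fun x => g x * wav_fun phi psi ix k x) = 0) ->
          intn (fun x => (g x ^+ 2)%:E) = 0%E)].

Definition daubechies_scaling (R : realType) (n L : nat) (phi : 'rV[R]_n -> R) :=
  exists psi, daubechies L phi psi.

Definition diff1 (R : realType) (n : nat) (h : 'rV[R]_n) (f : 'rV[R]_n -> R)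
  : 'rV[R]_n -> R := fun x => f (x + 2^-1 *: h) - f (x - 2^-1 *: h).

Fixpoint diffk (R : realType) (n : nat) (k : nat) (h : 'rV[R]_n)
  (f : 'rV[R]_n -> R) : 'rV[R]_n -> R :=
  match k with
  | 0 => f
  | k'.+1 => diffk k' h (diff1 h f)
  end.

Definition Dr (R : realType) (n : nat) (r : nat) (f : 'rV[R]_n -> R)
  (x : 'rV[R]_n) (y : R) : \bar R :=
  ereal_sup [set (`|diffk r h f x|)%:E | h in [set h | enorm h = y]].

Definition sup_norm (R : realType) (n : nat) (f : 'rV[R]_n -> R) : \bar R :=
  ereal_sup [set (`|f x|)%:E | x in [set: 'rV[R]_n]].

Definition Lam_norm (R : realType) (n : nat) (s : R) (f : 'rV[R]_n -> R) : \bar R :=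
  (sup_norm f +
   ereal_sup [set (Dr (Num.truncn s).+1 f xy.1 xy.2 * ((powR xy.2 s)^-1)%:E)%E
             | xy in [set xy : 'rV[R]_n * R | (0 < xy.2 <= 1)%R]])%E.

Definition inLambda (R : realType) (n : nat) (s : R) (f : 'rV[R]_n -> R) : Prop :=
  continuous f /\ (sup_norm f < +oo)%E /\ (Lam_norm s f < +oo)%E.

Definition distLam (R : realType) (n : nat) (s : R) (f : 'rV[R]_n -> R)
  (V : set ('rV[R]_n -> R)) : \bar R :=
  ereal_inf [set Lam_norm s (f \- g) | g in [set g | V g /\ inLambda s g]].

Definition Sset (R : realType) (n : nat) (r : nat) (s : R) (f : 'rV[R]_n -> R)
  (eps : R) : set ('rV[R]_n * R) :=
  [set xy | 0 < xy.2 /\ (Dr r f xy.1 xy.2 * ((powR xy.2 s)^-1)%:E > eps%:E)%E].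

Definition yint (R : realType) (n : nat) (A : set ('rV[R]_n * R)) (x : 'rV[R]_n)
  (b : R) : \bar R :=
  (\int[@lebesgue_measure R]_(y in [set y : R | (0 < y <= b)%R])
     (((\1_A (x, y) : R) / y)%R)%:E)%E.

Definition dcube (R : realType) (n : nat) (j : nat) (m : 'rV[int]_n) : set 'rV[R]_n :=
  [set x | forall i : 'I_n,
      (m 0%R i)%:~R / 2 ^+ j <= x 0%R i < ((m 0%R i)%:~R + 1) / 2 ^+ j].
Arguments dcube R {n} j m.

Definition Mcar (R : realType) (n : nat) (A : set ('rV[R]_n * R)) : \bar R :=
  ereal_sup [set ((2 ^+ (jm.1 * n) : R)%:E *
                  intn (fun x => (\1_(dcube R jm.1 jm.2) x : R)%:E
                                  * yint A x (2 ^- jm.1)))%E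
            | jm in [set: nat * 'rV[int]_n]].

Definition dotp (R : realType) (n : nat) (x y : 'rV[R]_n) : R :=
  \sum_(i < n) x 0%R i * y 0%R i.

Definition LP_eta (R : realType) (n : nat) (eta : 'rV[R]_n -> R) : Prop :=
  [/\ schwartz eta, (forall x, 0 <= eta x <= 1),
      (forall x, enorm x <= 1 -> eta x = 1) &
      (forall x, 3 / 2 <= enorm x -> eta x = 0)].

Definition LP_theta (R : realType) (n : nat) (eta : 'rV[R]_n -> R) : 'rV[R]_n -> R :=
  fun x => eta x - eta (2 *: x).

Definition invFT (R : realType) (n : nat) (u : 'rV[R]_n -> R) (x : 'rV[R]_n) : R * R :=
  (Rintn (fun xi => u xi * cos (2 * pi * dotp x xi)),
   Rintn (fun xi => u xi * sin (2 * pi * dotp x xi))).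

Definition LPphi (R : realType) (n : nat) (eta : 'rV[R]_n -> R) (j : nat)
  (x : 'rV[R]_n) : R * R :=
  match j with
  | 0 => invFT eta x
  | _ => let c := (2 ^+ (j * n) : R) in
         let v := invFT (LP_theta eta) ((2 ^+ j : R) *: x) in (c * v.1, c * v.2)
  end.

Definition LPconv_abs (R : realType) (n : nat) (eta : 'rV[R]_n -> R) (j : nat)
  (g : 'rV[R]_n -> R) (x : 'rV[R]_n) : R :=
  Num.sqrt ((Rintn (fun y => (LPphi eta j (x - y)).1 * g y)) ^+ 2
          + (Rintn (fun y => (LPphi eta j (x - y)).2 * g y)) ^+ 2).

Definition LPterm (R : realType) (n : nat) (eta : 'rV[R]_n -> R) (s q : R) (j : nat)
  (g : 'rV[R]_n -> R) (x : 'rV[R]_n) : \bar R :=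
  (powR (powR 2 (j%:R * s) * LPconv_abs eta j g x) q)%:E.

(* membership of a (bounded continuous) function in F^s_{p,q}, p < oo:
   || (sum_j |2^{js} phi_j * g|^q)^{1/q} ||_{L^p} < oo *)
Definition inF (R : realType) (n : nat) (eta : 'rV[R]_n -> R) (s p q : R)
  (g : 'rV[R]_n -> R) : Prop :=
  (intn (fun x => poweR (\sum_(j <oo) LPterm eta s q j g x)%E (p / q)) < +oo)%E.

Definition inFinf (R : realType) (n : nat) (eta : 'rV[R]_n -> R) (s q : R)
  (g : 'rV[R]_n -> R) : Prop :=
  (ereal_sup [set ((2 ^+ (lm.1 * n) : R)%:E *
                   intn (fun x => (\1_(dcube R lm.1 lm.2) x : R)%:E *
                          \sum_(j <oo) LPterm eta s q (j + lm.1)%N g x))%E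
             | lm in [set: nat * 'rV[int]_n]]
   < +oo)%E.

Definition epsA (R : realType) (n : nat) (r : nat) (s p q : R) (f : 'rV[R]_n -> R)
  : \bar R :=
  ereal_inf [set e%:E | e in [set e : R | 0 < e /\
     (intn (fun x => poweR (yint (Sset r s f e) x 1) (p / q)) < +oo)%E]].

Definition coef_limsup (R : realType) (n : nat) (phi f : 'rV[R]_n -> R) : \bar R :=
  ereal_inf [set ereal_sup [set (`|Rintn (fun x => phi (x - zpt R k) * f x)|)%:E
                           | k in [set k : 'rV[int]_n | N%:R < enorm (zpt R k)]]
            | N in [set: nat]].

Definition epsB (R : realType) (n : nat) (r : nat) (s : R) (f : 'rV[R]_n -> R)
  : \bar R :=
  ereal_inf [set e%:E | e in [set e : R | 0 < e /\ (Mcar (Sset r s f e) < +oo)%E]].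

(* Main.v *)
Require Import Defs.
From mathcomp Require Import all_boot all_order all_algebra.
From mathcomp Require Import finmap.
From mathcomp Require Import all_classical all_reals all_analysis.
From mathcomp Require Import measurable_realfun.
From mathcomp Require Import ring lra zify.
Import Order.TTheory GRing.Theory Num.Theory numFieldNormedType.Exports.
Local Open Scope classical_set_scope.
Local Open Scope ring_scope.
Set Implicit Arguments.
Unset Strict Implicit.
Unset Printing Implicit Defensive.

(** Let f = sum_j Phi_j f be the Littlewood-Paley decomposition. A difference
    |Delta_h^r f(x)| > eps |h|^s with |h| ~ 2^-j forces |Phi_i f| > c 2^(-i s) at a
    nearby point for some i close to j; conversely |Phi_j f(x)| > C eps 2^(-j s)
    forces a whole box (a cube times an interval of y's) of size ~ 2^-j near
    (x, 2^-j) to lie in S_r(s, f, eps), since differences at scale 2^-j vary by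
    little, relative to 2^(-j s), on a small multiple of that scale. Both integral
    conditions thus count, at each point, the dyadic ancestors lying in a marked
    family of cubes. Moving marks by N cubes costs only a power of N: in the sum of
    the a-th powers of the counts, each mark is charged rank^(a-1).

    Lower bound for the distance: if g is in F and |f - g| <= d in Lambda_s, then
    S(f, C d) is contained in S(g, d). Upper bound: clip every Phi_j f at height
    C eps 2^(-j s) and resynthesize. The clipped part G has norm O(eps), and the
    pieces of f - G are concentrated near marked cubes with fast decaying tails. For
    p < oo the low frequency Phi_0 f must in addition be small at infinity. Far away
    f is O(eps)-close to its average at a large fixed scale, which is nearly
    constant, hence controlled by the coefficients because int phi <> 0. If int phi
    were 0, every wavelet would have mean zero, and so would a tent function, whose
    wavelet expansion converges uniformly. *)

(** * Iterated integrals of continuous functions *)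

(** The integral [intn] is iterated, one variable at a time, and the counts
    [yint (Sset r s f e) x 1] are never shown to be measurable in [x]. This forces two regimes.
    Smooth objects live in the class [good] (continuous and dominated by a product of
    [1 / (1 + t ^ 2)]), where Fubini and dominated convergence follow by induction on the dimension.
    Counting quantities are only squeezed between functions constant on dyadic cubes, whose
    integrals are lattice sums; beyond that only monotonicity is used. Moving marks to neighbouring
    cubes would classically call for a vector-valued maximal inequality. The charging by ranks
    replaces it, but for [p / q > 1] it produces a term with doubled radius, which has to be
    absorbed by an iteration over radii. Complex kernels are avoided: a phase [a] runs through the
    cosine transform [FT a], and the real parts of the pieces already reconstruct [f]. *)

Section OneDimIntegral.
Context {R : realType}.
Local Notation mu := (@lebesgue_measure R).

Lemma continuous_slice2 (T U V : topologicalType) (F : T -> U -> V) :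
  continuous (fun p : T * U => F p.1 p.2) -> forall s, continuous (F s).
Proof.
move=> cF s t.
apply: (@cvg_comp _ _ _ (fun t => (s, t)) (fun p => F p.1 p.2) _ (nbhs (s, t))); last exact: (cF (s, t)).
by apply: cvg_pair; [exact: cvg_cst|exact: cvg_id].
Qed.

Lemma continuous_slice1 (T U V : topologicalType) (F : T -> U -> V) :
  continuous (fun p : T * U => F p.1 p.2) -> forall t, continuous (F ^~ t).
Proof.
move=> cF t s.
apply: (@cvg_comp _ _ _ (fun s => (s, t)) (fun p => F p.1 p.2) _ (nbhs (s, t))); last exact: (cF (s, t)).
by apply: cvg_pair; [exact: cvg_id|exact: cvg_cst].
Qed.

(** Dominated convergence speaks of sequences, so continuity in a parameter is reached through
    sequences. *)
Lemma seq_continuous (T : pseudoMetricType R) (G : T -> R) :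
  (forall (u : nat -> T) p, u @ \oo --> p -> G (u k) @[k --> \oo] --> G p) ->
  continuous G.
Proof.
move=> sG p; apply/cvgrPdist_lt => e e0; apply: contrapT => np.
have H k : exists y, ball p (k.+1%:R^-1) y /\ e <= `|G p - G y|.
  apply: contrapT => /forallNP h; apply: np.
  apply/nbhs_ballP; exists (k.+1%:R^-1); first by rewrite /= invr_gt0.
  move=> y by_; have := h y; apply: contra_notT; rewrite -leNgt => ?.
  by split.
pose u k := projT1 (cid (H k)).
have u1 k : ball p (k.+1%:R^-1) (u k) by have [] := projT2 (cid (H k)).
have u2 k : e <= `|G p - G (u k)| by have [] := projT2 (cid (H k)).
have up : u @ \oo --> p.
  apply/cvg_ballP => d d0.
  have [N _ HN] := near_infty_natSinv_lt (PosNum d0).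
  exists N => // k Nk /=; apply: le_ball (u1 k); apply: ltW; exact: HN.
have /cvgrPdist_lt /(_ _ e0) [N _ HN] := sG _ _ up.
by have := HN N (leqnn N); rewrite /= ltNge u2.
Qed.

(** The one-dimensional majorant: its integral is [pi], and an affine change of variable costs only
    a constant factor. *)
Definition rho (t : R) : R := (1 + t ^+ 2)^-1.

Lemma rhoE : rho = fun t => (oneDsqr t)^-1. Proof. by []. Qed.

Lemma rho_gt0 t : 0 < rho t.
Proof. by rewrite invr_gt0 ltr_pwDl // sqr_ge0. Qed.

Lemma rho_ge0 t : 0 <= rho t. Proof. exact/ltW/rho_gt0. Qed.

Lemma rho_le1 t : rho t <= 1.
Proof. by rewrite invf_le1 ?lerDl ?sqr_ge0 // ltr_pwDl // sqr_ge0. Qed.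

Lemma rhoN t : rho (- t) = rho t. Proof. by rewrite /rho sqrrN. Qed.

Lemma continuous_rho : continuous rho.
Proof. exact: continuous_oneDsqrV. Qed.

(* Peetre's inequality [1 + b^2 <= 2 (1 + a^2) (1 + (a - b)^2)] *)
Lemma rho_shift a b : rho (a - b) <= 2 * (1 + a ^+ 2) * rho b.
Proof.
have h1 : 0 < 1 + b ^+ 2 by rewrite ltr_pwDl // sqr_ge0.
have h2 : 0 < 1 + (a - b) ^+ 2 by rewrite ltr_pwDl // sqr_ge0.
rewrite /rho ler_pdivlMr // mulrC ler_pdivrMr //.
have := sqr_ge0 (a * (a - b)); have := sqr_ge0 (2 * a - b); rewrite !expr2; nra.
Qed.

Lemma integral_rho : (\int[mu]_x (rho x)%:E = pi%:E)%E.
Proof.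
rewrite ge0_symfun_integralT; last 3 first.
- by move=> x; exact: rho_ge0.
- exact: continuous_rho.
- by move=> x /=; rewrite rhoN.
rewrite -set_itvcy rhoE integral0y_oneDsqr -EFinM; congr EFin.
by rewrite mulrC mulfVK.
Qed.

Lemma integrable_rho C : mu.-integrable setT (EFin \o (fun x : R => C * rho x)%R).
Proof.
have mr : measurable_fun [set: R] (EFin \o (fun x : R => C * rho x)%R).
  apply/measurable_EFinP; apply: continuous_measurable_fun => x.
  by apply: cvgMl_tmp; exact: continuous_rho.
apply/integrableP; split => //.
have -> : (\int[mu]_x `|(EFin \o (fun x : R => C * rho x)%R) x| =
           \int[mu]_x (`|C|%:E * (rho x)%:E))%E.
  by apply: eq_integral => x _ /=; rewrite normrM (ger0_norm (rho_ge0 _)).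
rewrite ge0_integralZl //.
- by rewrite integral_rho -EFinM ltry.
- by apply/measurable_EFinP; apply: continuous_measurable_fun; exact: continuous_rho.
- by move=> x _; rewrite lee_fin rho_ge0.
Qed.

Lemma integrable_good1 (f : R -> R) C : continuous f ->
  (forall x, `|f x| <= C * rho x) -> mu.-integrable setT (EFin \o f).
Proof.
move=> cf fC; apply: (le_integrable _ _ _ (integrable_rho C)) => //.
  by apply/measurable_EFinP; apply: continuous_measurable_fun.
move=> x _ /=; rewrite lee_fin; apply: (le_trans (fC x)); exact: ler_norm.
Qed.

Lemma Rintegral_rho : \int[mu]_x rho x = pi.
Proof. by rewrite /Rintegral integral_rho. Qed.

Lemma Rintegral_good_le (f : R -> R) C : continuous f ->
  (forall x, `|f x| <= C * rho x) -> `|\int[mu]_x f x| <= C * pi.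
Proof.
move=> cf fC; have ig := integrable_good1 cf fC.
apply: (le_trans (le_normr_Rintegral measurableT ig)).
have ir : mu.-integrable setT (EFin \o rho).
  by have := integrable_rho 1; under eq_fun do rewrite mul1r.
rewrite -Rintegral_rho -RintegralZl //.
apply: le_Rintegral => //; last exact: integrable_rho.
apply: (@integrable_good1 _ C) => [x|x]; last by rewrite normr_id.
by apply: continuous_comp; [exact: cf|exact: norm_continuous].
Qed.

Lemma Rintegral_dct (f_ : nat -> R -> R) (f : R -> R) C :
  (forall k, continuous (f_ k)) -> continuous f ->
  (forall k x, `|f_ k x| <= C * rho x) ->
  (forall x, f_ k x @[k --> \oo] --> f x) ->
  (\int[mu]_x f_ k x) @[k --> \oo] --> \int[mu]_x f x.
Proof.
move=> cf_ cf fC fl.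
have [] := @dominated_convergence _ _ R mu setT measurableT
  (fun k => EFin \o f_ k) (EFin \o f) (EFin \o (fun x : R => C * rho x)%R).
- by move=> k; apply/measurable_EFinP; apply: continuous_measurable_fun.
- by apply/measurable_EFinP; apply: continuous_measurable_fun.
- by apply: aeW => x _; apply: cvg_EFin; [near=> k|exact: fl].
- exact: integrable_rho.
- by apply: aeW => x k _ /=; rewrite lee_fin.
move=> igf _ cv.
have fin : (\int[mu]_x (EFin \o f) x)%E \is a fin_num by exact: integrable_fin_num.
rewrite /Rintegral; apply: fine_cvg.
by rewrite fineK.
Unshelve. all: by end_near. Qed.

Lemma ge0_integral_affine (f : R -> R) (c a : R) : 0 < c -> continuous f ->
  (forall x, 0 <= f x) ->
  (\int[mu]_x (f x)%:E = \int[mu]_x (f (c * x + a) * c)%:E)%E.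
Proof.
move=> c0 cf f0.
pose F : R -> R := fun x => c * x + a.
have dF (x : R) : is_derive x 1 F c.
  rewrite /F; apply: is_derive_eq; by rewrite /GRing.scale /= ?mulr1 ?addr0.
have F1 : derive1 F = cst c by apply/funext => x; rewrite derive1E derive_val.
rewrite (@increasing_ge0_integration_by_substitutionT R F f) //.
- by rewrite F1.
- by move=> x y xy; rewrite /F ltrD2r ltr_pM2l.
- by rewrite F1; exact: cst_continuous.
- by rewrite F1; exact: is_cvg_cst.
- by rewrite F1; exact: is_cvg_cst.
- apply/cvgrNyPle => A; have := nbhs_ninfty_le (num_real ((A - a) / c)).
  by apply: filterS => x h; rewrite /F -lerBrDr mulrC -ler_pdivlMr.
- apply/cvgryPge => A; have := nbhs_pinfty_ge (num_real ((A - a) / c)).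
  by apply: filterS => x h; rewrite /F -lerBlDr mulrC -ler_pdivrMr.
Qed.

Lemma ge0_integral_opp (f : R -> R) : continuous f -> (forall x, 0 <= f x) ->
  (\int[mu]_x (f x)%:E = \int[mu]_x (f (- x))%:E)%E.
Proof.
move=> cf f0.
have cfN : continuous (fun x => f (- x)).
  by move=> x; apply: continuous_comp; [exact: opp_continuous|exact: cf].
have mf (g : R -> R) : continuous g -> measurable_fun [set: R] (fun x => (g x)%:E).
  by move=> cg; apply/measurable_EFinP; exact: continuous_measurable_fun.
have split (g : R -> R) : continuous g -> (forall x, 0 <= g x) ->
   (\int[mu]_x (g x)%:E = \int[mu]_(x in `]-oo, 0%R]) (g x)%:E +
                         \int[mu]_(x in `[0%R, +oo[) (g x)%:E)%E.
  move=> cg g0.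
  have -> : [set: R] = `]-oo, 0] `|` `]0, +oo[.
    by apply/seteqP; split => x //= _; rewrite !in_itv /= andbT; case: leP; [left|right].
  rewrite ge0_integral_setU //=.
  - congr (_ + _)%E; rewrite -integral_itv_obnd_cbnd //.
    by apply: measurable_funS (mf _ cg).
  - by apply: measurable_funS (mf _ cg).
  - by move=> x _; rewrite lee_fin.
  - apply/disj_setPS => x /= [] /[!in_itv]/= x0 /andP[x1 _]; by rewrite ltNge x0 in x1.
rewrite (split f) // (split (fun x => f (- x))) // addeC; congr (_ + _)%E.
- have := @ge0_integration_by_substitutionNy R (fun x => f (- x)) 0.
  rewrite oppr0 => -> //.
  + by apply: eq_integral => x _ /=; rewrite opprK.
  + by apply: continuous_subspaceT.
- have := @ge0_integration_by_substitutionNy R f 0.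
  rewrite oppr0 => -> //.
  by apply: continuous_subspaceT.
Qed.

Lemma integral_good1E (f : R -> R) C : continuous f ->
  (forall x, `|f x| <= C * rho x) ->
  (\int[mu]_x (f x)%:E = (\int[mu]_x f x)%:E)%E.
Proof.
move=> cf fC; rewrite /Rintegral fineK //.
by apply: integrable_fin_num => //; exact: integrable_good1 fC.
Qed.

Lemma continuous_maxr0 (T : topologicalType) (f : T -> R) :
  continuous f -> continuous (fun x => Num.max (f x) 0).
Proof. by move=> cf x; apply: continuous_max; [exact: cf|exact: cst_continuous]. Qed.

Lemma normr_max0 (a b : R) : `|a| <= b -> `|Num.max a 0| <= b.
Proof.
move=> ab; have b0 := le_trans (normr_ge0 _) ab; rewrite ger0_norm ?le_max ?lexx ?orbT //.
by rewrite ge_max b0 (le_trans (ler_norm _)).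
Qed.

Lemma subr_max0 (a : R) : a = Num.max a 0 - Num.max (- a) 0.
Proof.
case: (leP 0 a) => a0.
  by rewrite max_r ?subr0 // oppr_le0.
by rewrite max_l ?oppr_ge0 ?ltW // opprK add0r.
Qed.

Lemma continuous_oppf (T : topologicalType) (f : T -> R) :
  continuous f -> continuous (fun x => - f x).
Proof. by move=> cf x; apply: cvgN; exact: cf. Qed.

Lemma Rintegral_posneg (f : R -> R) C : continuous f ->
  (forall x, `|f x| <= C * rho x) ->
  \int[mu]_x f x = \int[mu]_x Num.max (f x) 0 - \int[mu]_x Num.max (- f x) 0.
Proof.
move=> cf fC; rewrite -RintegralB //.
- by apply: eq_Rintegral => x _; exact: subr_max0.
- apply: (@integrable_good1 _ C); first exact: continuous_maxr0.
  by move=> x; exact: normr_max0.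
- apply: (@integrable_good1 _ C); first exact/continuous_maxr0/continuous_oppf.
  by move=> x; apply: normr_max0; rewrite normrN.
Qed.

Lemma rho_affine (c a x : R) : 0 < c ->
  rho (c * x + a) <= 2 * (1 + a ^+ 2) * (1 + c ^- 2) * rho x.
Proof.
move=> c0; have := rho_shift a (- (c * x)); rewrite opprK addrC rhoN => /le_trans; apply.
rewrite -(mulrA (2 * _)) ler_wpM2l ?mulr_ge0 ?addr_ge0 ?sqr_ge0 //.
have h1 : 0 < 1 + x ^+ 2 by rewrite ltr_pwDl // sqr_ge0.
have h2 : 0 < 1 + (c * x) ^+ 2 by rewrite ltr_pwDl // sqr_ge0.
rewrite /rho ler_pdivlMr // mulrC ler_pdivrMr // mulrDl mul1r exprMn.
rewrite [X in _ <= _ + X](_ : _ = c ^- 2 + x ^+ 2); last by field; rewrite gt_eqF.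
have h3 : 0 <= c ^- 2 by rewrite invr_ge0 sqr_ge0.
have h4 : 0 <= c ^+ 2 * x ^+ 2 by rewrite mulr_ge0 // sqr_ge0.
lra.
Qed.

Lemma Rintegral_affine (f : R -> R) (c a C : R) : 0 < c -> continuous f ->
  (forall x, `|f x| <= C * rho x) ->
  \int[mu]_x f (c * x + a) = c^-1 * \int[mu]_x f x.
Proof.
move=> c0 cf fC0.
(* [K] is the constant of [rho_affine]; once [C] is multiplied by it, one constant dominates both
   [f] and its affine image. *)
pose K := 2 * (1 + a ^+ 2) * (1 + c ^- 2).
have C0 : 0 <= C by have := le_trans (normr_ge0 _) (fC0 0); rewrite pmulr_lge0 // rho_gt0.
have K1 : 1 <= K.
  have h : 0 <= c ^- 2 by rewrite invr_ge0 sqr_ge0.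
  have := sqr_ge0 a; rewrite /K => h'; nra.
have fC' x : `|f (c * x + a)| <= C * K * rho x.
  apply: (le_trans (fC0 _)); rewrite -mulrA ler_wpM2l //; exact: rho_affine.
have {fC0} fC x : `|f x| <= C * K * rho x.
  by apply: (le_trans (fC0 _)); rewrite ler_wpM2r ?rho_ge0 // ler_peMr.
move: {C0 K1} (C * K) fC fC' => {}C fC fC'.
have cfa : continuous (fun x : R => f (c * x + a)).
  move=> x; apply: continuous_comp; last exact: cf.
  by apply: cvgD; [apply: cvgMl_tmp; exact: cvg_id|exact: cvg_cst].
have key (g : R -> R) : continuous g -> (forall x, 0 <= g x) ->
   (forall x, `|g x| <= C * rho x) -> (forall x, `|g (c * x + a)| <= C * rho x) ->
   \int[mu]_x g (c * x + a) = c^-1 * \int[mu]_x g x.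
  move=> cg g0 gC gC'.
  have cga : continuous (fun x : R => g (c * x + a)).
    move=> x; apply: continuous_comp; last exact: cg.
    by apply: cvgD; [apply: cvgMl_tmp; exact: cvg_id|exact: cvg_cst].
  rewrite [in RHS]/Rintegral (ge0_integral_affine a c0) //.
  under [in RHS]eq_integral do rewrite EFinM.
  rewrite -[X in _ = _ * X]/(Rintegral mu setT (fun x => g (c * x + a) * c)).
  rewrite RintegralZr //; last exact: integrable_good1 gC'.
  by rewrite mulrC mulfK // gt_eqF.
rewrite (Rintegral_posneg cf fC) (Rintegral_posneg cfa fC') mulrBr.
congr (_ - _).
- apply: (key (fun x => Num.max (f x) 0)).
  + exact: continuous_maxr0.
  + by move=> x; rewrite le_max lexx orbT.
  + by move=> x; exact: normr_max0.
  + by move=> x; exact: normr_max0.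
- apply: (key (fun x => Num.max (- f x) 0)).
  + exact/continuous_maxr0/continuous_oppf.
  + by move=> x; rewrite le_max lexx orbT.
  + by move=> x; apply: normr_max0; rewrite normrN.
  + by move=> x; apply: normr_max0; rewrite normrN.
Qed.

Lemma Rintegral_opp (f : R -> R) (C : R) : continuous f ->
  (forall x, `|f x| <= C * rho x) ->
  \int[mu]_x f (- x) = \int[mu]_x f x.
Proof.
move=> cf fC.
have cfN : continuous (fun x : R => f (- x)).
  by move=> x; apply: continuous_comp; [exact: opp_continuous|exact: cf].
have fC' x : `|f (- x)| <= C * rho x by rewrite -rhoN.
rewrite (Rintegral_posneg cf fC) (Rintegral_posneg cfN fC').
congr (_ - _); rewrite /Rintegral; congr fine.
- rewrite -(@ge0_integral_opp (fun x => Num.max (f x) 0)) //.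
  + exact: continuous_maxr0.
  + by move=> x; rewrite le_max lexx orbT.
- rewrite -(@ge0_integral_opp (fun x => Num.max (- f x) 0)) //.
  + exact/continuous_maxr0/continuous_oppf.
  + by move=> x; rewrite le_max lexx orbT.
Qed.

Lemma floor_cvg (s : R) :
  ((Num.floor (s * k.+1%:R))%:~R / k.+1%:R : R) @[k --> \oo] --> s.
Proof.
apply/cvgrPdist_lt => e e0.
have [N _ HN] := near_infty_natSinv_lt (PosNum e0).
exists N => // k Nk /=; apply: le_lt_trans (HN k Nk).
have k0 : 0 < k.+1%:R :> R by [].
have := floor_le (s * k.+1%:R); have := floorD1_gt (s * k.+1%:R).
rewrite intrD1 => h1 h2.
rewrite ger0_norm ?subr_ge0 ?ler_pdivrMr //.
by rewrite lerBlDr -[X in X + _]mul1r -mulrDl ler_pdivlMr // addrC ltW.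
Qed.

(** Freezing the first variable at grid points of mesh [1 / (k + 1)] gives finite sums of products
    of one-variable measurable functions, which converge pointwise. *)
Lemma measurable_jointly_continuous (F : R -> R -> R) :
  continuous (fun p : R * R => F p.1 p.2) ->
  measurable_fun setT (fun p : R * R => F p.1 p.2).
Proof.
move=> cF.
have cF2 := continuous_slice2 cF.
pose nod (k : nat) (z : int) : R := z%:~R / k.+1%:R.
(* With [k (k + 1)] cells on each side of 0 the grid reaches from [-k] to [k], hence eventually
   covers any given point. *)
pose N (k : nat) := (k * k.+1)%N.
pose zz (k i : nat) : int := i%:Z - (N k)%:Z.
pose G k (p : R * R) := \sum_(i < (N k).*2)
  (\1_[set s : R | Num.floor (s * k.+1%:R) = zz k i] p.1 : R) * F (nod k (zz k i)) p.2.
apply: (measurable_fun_cvg (h := G)) => [k|p _].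
  apply: measurable_sum => i; apply: measurable_funM.
    apply: (measurableT_comp _ measurable_fst).
    apply: measurable_indic.
    rewrite [X in measurable X](_ : _ = [set` `[nod k (zz k i), nod k (zz k i + 1)[]).
      exact: measurable_itv.
    apply/seteqP; split => s /=; rewrite in_itv /= /nod.
      by move/eqP; rewrite floor_eq => /andP[h1 h2]; rewrite ler_pdivrMr // h1 ltr_pdivlMr.
    by move=> /andP[h1 h2]; apply/eqP; rewrite floor_eq -ler_pdivrMr // h1 -ltr_pdivlMr.
  apply: (measurableT_comp _ measurable_snd).
  exact: continuous_measurable_fun.
have H : F (nod k (Num.floor (p.1 * k.+1%:R))) p.2 @[k --> \oo] --> F p.1 p.2.
  by apply: (@cvg_comp _ _ _ (fun k => nod k (Num.floor (p.1 * k.+1%:R))) (F ^~ p.2));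
    [exact: floor_cvg|exact: (continuous_slice1 cF)].
apply: cvg_trans H; apply: near_eq_cvg.
have [K HK] : exists K : nat, `|p.1| < K%:R.
  by exists (Num.bound `|p.1|); exact: archi_boundP.
exists K => // k Kk /=; rewrite /G.
have hp : `|p.1 * k.+1%:R| < (N k)%:R.
  rewrite normrM /N natrM (ger0_norm (ler0n _ _)) ltr_pM2r //.
  by apply: (lt_le_trans HK); rewrite ler_nat.
set z := Num.floor _; have h1 := floor_le (p.1 * k.+1%:R).
have h2 := floorD1_gt (p.1 * k.+1%:R).
have zlo : (- (N k)%:Z <= z)%R.
  by rewrite /z floor_ge_int mulrNz; move: hp; rewrite ltr_norml => /andP[/ltW].
have zhi : (z < (N k)%:Z)%R.
  by rewrite /z floor_lt_int; move: hp; rewrite ltr_norml => /andP[_].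
have ib : (absz (z + (N k)%:Z)%R < (N k).*2)%N by lia.
rewrite (bigD1 (Ordinal ib)) //= big1 ?addr0.
  have -> : zz k (absz (z + (N k)%:Z)%R) = z by rewrite /zz; lia.
  by rewrite indicE mem_set // mul1r.
move=> i; rewrite -val_eqE /= => ii; rewrite indicE memNset ?mul0r //=.
by move=> zi; move: ii; rewrite /z zi /zz; lia.
Qed.

Lemma Rintegral_swap (F : R -> R -> R) C :
  continuous (fun p : R * R => F p.1 p.2) ->
  (forall s t, `|F s t| <= C * rho s * rho t) ->
  \int[mu]_s \int[mu]_t F s t = \int[mu]_t \int[mu]_s F s t.
Proof.
move=> cF FC.
have C0 : 0 <= C.
  have := le_trans (normr_ge0 _) (FC 0 0); rewrite -mulrA pmulr_lge0 //.
  by rewrite mulr_gt0 // rho_gt0.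
have cF2 := continuous_slice2 cF.
have cF1 := continuous_slice1 cF.
have mF : measurable_fun [set: R * R] (fun p => (F p.1 p.2)%:E).
  by apply/measurable_EFinP; exact: measurable_jointly_continuous.
have E1 s : (\int[mu]_t (F s t)%:E = (\int[mu]_t F s t)%:E)%E.
  exact: (integral_good1E (cF2 s) (FC s)).
have E2 t : (\int[mu]_s (F s t)%:E = (\int[mu]_s F s t)%:E)%E.
  apply: (@integral_good1E _ (C * rho t)) => // s.
  by rewrite mulrAC.
have IF : (mu \x mu)%E.-integrable setT (fun p : R * R => (F p.1 p.2)%:E).
  apply/integrable12ltyP => //.
  have le1 s : (\int[mu]_t `|(F s t)%:E| <= (C * pi)%:E * (rho s)%:E)%E.
    have cn : continuous (fun t => `|F s t|).
      by move=> t; apply: continuous_comp; [exact: cF2|exact: norm_continuous].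
    under eq_integral do rewrite abse_EFin.
    have nb t : `| `|F s t| | <= C * rho s * rho t by rewrite normr_id.
    rewrite (integral_good1E cn nb) -EFinM lee_fin.
    by apply: le_trans (ler_norm _) _; apply: le_trans (Rintegral_good_le cn nb) _; rewrite mulrAC.
  apply: (@le_lt_trans _ _ (\int[mu]_s ((C * pi)%:E * (rho s)%:E))%E).
    apply: ge0_le_integral => //.
    - by move=> s _; exact: integral_ge0.
    - apply: (@measurable_fun_fubini_tonelli_F _ _ _ _ R mu (fun p => `|(F p.1 p.2)%:E|%E)) => //.
      exact: measurableT_comp mF.
    - by apply: measurable_funeM; apply/measurable_EFinP; apply: continuous_measurable_fun; exact: continuous_rho.
    - by move=> s _; exact: le1.
  rewrite ge0_integralZl //.
  - by rewrite integral_rho -EFinM ltry.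
  - by apply/measurable_EFinP; apply: continuous_measurable_fun; exact: continuous_rho.
  - by move=> x _; rewrite lee_fin rho_ge0.
  - by rewrite lee_fin mulr_ge0 // pi_ge0.
have := Fubini IF => /= H.
rewrite /Rintegral; congr fine.
under eq_integral do rewrite -E1; rewrite H.
by apply: eq_integral => t _; rewrite E2.
Qed.

End OneDimIntegral.

(** * Row vectors and the class of dominated continuous functions *)

Section RowVectors.
Context {R : realType}.

(** Same shape as in the recursion of [intn], so that both integrals unfold onto it. *)
Definition cns n (t : R) (v : 'rV[R]_n) : 'rV[R]_n.+1 := row_mx (\row_(_ < 1) t) v.
Definition tl n (x : 'rV[R]_n.+1) : 'rV[R]_n := \row_i x 0 (lift ord0 i).

Lemma cns0 n t (v : 'rV[R]_n) : cns t v 0 ord0 = t.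
Proof.
rewrite /cns (_ : ord0 = lshift n (0 : 'I_1)); last exact/val_inj.
exact: (etrans (row_mxEl _ _ _ _) (mxE _ _ _ _)).
Qed.

Lemma cnsS n t (v : 'rV[R]_n) i : cns t v 0 (lift ord0 i) = v 0 i.
Proof.
rewrite /cns (_ : lift ord0 i = rshift 1 i); last exact/val_inj.
exact: row_mxEr.
Qed.

Lemma rV_affineE n c (x z : 'rV[R]_n) i : (c *: x + z) 0 i = c * x 0 i + z 0 i.
Proof. by rewrite !mxE. Qed.

Lemma rV_oppE n (x : 'rV[R]_n) i : (- x) 0 i = - x 0 i.
Proof. by rewrite mxE. Qed.

Lemma rV_ext n (x y : 'rV[R]_n) : (forall i, x 0 i = y 0 i) -> x = y.
Proof. by move=> h; apply/matrixP => a i; rewrite ord1. Qed.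

Lemma cns_affine n (c t : R) (v : 'rV[R]_n) (z : 'rV[R]_n.+1) :
  c *: cns t v + z = cns (c * t + z 0 ord0) (c *: v + tl z).
Proof.
apply: rV_ext => i; rewrite rV_affineE.
by case: (unliftP ord0 i) => [j|] ->; rewrite ?cnsS ?cns0 ?rV_affineE ?mxE.
Qed.

Lemma cns_opp n t (v : 'rV[R]_n) : - cns t v = cns (- t) (- v).
Proof.
apply: rV_ext => i; rewrite rV_oppE.
by case: (unliftP ord0 i) => [j|] ->; rewrite ?cnsS ?cns0 ?rV_oppE.
Qed.

Lemma rV_continuous (T : topologicalType) n (h : T -> 'rV[R]_n) :
  (forall i, continuous (fun t => h t 0 i)) -> continuous h.
Proof.
move=> H t A [P nP sA].
apply: (@filterS _ _ _ [set u | forall i, P 0 i (h u 0 i)]) => [u Pu|].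
  by apply: sA => a b; rewrite (ord1 a).
apply: filter_forall => i; apply: (H i t); exact: nP.
Qed.

Lemma continuous_pair (T U V : topologicalType) (f : T -> U) (g : T -> V) :
  continuous f -> continuous g -> continuous (fun x => (f x, g x)).
Proof. by move=> cf cg x; apply: cvg_pair; [exact: cf|exact: cg]. Qed.

Lemma continuous_comp2 (T U V W : topologicalType) (F : U -> V -> W) (f : T -> U) (g : T -> V) :
  continuous (fun p : U * V => F p.1 p.2) ->
  continuous f -> continuous g -> continuous (fun x => F (f x) (g x)).
Proof.
move=> cF cf cg x.
by apply: (@continuous_comp _ _ _ (fun x => (f x, g x)) (fun p => F p.1 p.2));
  [exact: (continuous_pair cf cg)|exact: cF].
Qed.

Lemma continuous_fst (T U : topologicalType) : continuous (@fst T U).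
Proof. by move=> x; exact: cvg_fst. Qed.

Lemma continuous_snd (T U : topologicalType) : continuous (@snd T U).
Proof. by move=> x; exact: cvg_snd. Qed.

Lemma continuous_compf (T U V : topologicalType) (F : U -> V) (f : T -> U) :
  continuous F -> continuous f -> continuous (fun x => F (f x)).
Proof. by move=> cF cf x; apply: continuous_comp; [exact: cf|exact: cF]. Qed.

Lemma continuous_coord n i : continuous (fun x : 'rV[R]_n => x 0 i).
Proof. exact: coord_continuous. Qed.

Lemma continuous_cns (T : topologicalType) n (f : T -> R) (g : T -> 'rV[R]_n) :
  continuous f -> continuous g -> continuous (fun x => cns (f x) (g x)).
Proof.
move=> cf cg; apply: rV_continuous => i.
case: (unliftP ord0 i) => [j|] ->.
  under eq_fun do rewrite cnsS; exact: (continuous_compf (@continuous_coord n j) cg).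
by under eq_fun do rewrite cns0.
Qed.

Lemma continuous_addf (T : topologicalType) (f g : T -> R) :
  continuous f -> continuous g -> continuous (fun x => f x + g x).
Proof. by move=> cf cg x; apply: cvgD; [exact: cf|exact: cg]. Qed.

Lemma continuous_mulf (T : topologicalType) (f g : T -> R) :
  continuous f -> continuous g -> continuous (fun x => f x * g x).
Proof. by move=> cf cg x; apply: cvgM; [exact: cf|exact: cg]. Qed.

Lemma continuous_cstf (T : topologicalType) (c : R) : continuous (fun _ : T => c).
Proof. by move=> x; exact: cvg_cst. Qed.

Lemma continuous_normf (T : topologicalType) (f : T -> R) :
  continuous f -> continuous (fun x => `|f x|).
Proof. by move=> cf; apply: continuous_compf cf; exact: norm_continuous. Qed.

Lemma continuous_sumf (T : topologicalType) (I : Type) (r : seq I) (P : pred I) (f : I -> T -> R) :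
  (forall i, P i -> continuous (f i)) -> continuous (fun x => \sum_(i <- r | P i) f i x).
Proof.
move=> cf; elim: r => [|i r IH].
  by under eq_fun do rewrite big_nil; exact: continuous_cstf.
under eq_fun do rewrite big_cons; case Pi: (P i) => //.
by apply: continuous_addf => //; exact: cf.
Qed.

Lemma continuous_prodf (T : topologicalType) (I : Type) (r : seq I) (P : pred I) (f : I -> T -> R) :
  (forall i, P i -> continuous (f i)) -> continuous (fun x => \prod_(i <- r | P i) f i x).
Proof.
move=> cf; elim: r => [|i r IH].
  by under eq_fun do rewrite big_nil; exact: continuous_cstf.
under eq_fun do rewrite big_cons; case Pi: (P i) => //.
by apply: continuous_mulf => //; exact: cf.
Qed.

Lemma continuous_rV_affine (T : topologicalType) n (c : R) (f g : T -> 'rV[R]_n) :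
  continuous f -> continuous g -> continuous (fun x => c *: f x + g x).
Proof.
move=> cf cg; apply: rV_continuous => i; under eq_fun do rewrite !mxE.
apply: continuous_addf; last exact: (continuous_compf (@continuous_coord n i) cg).
apply: continuous_mulf; first exact: continuous_cstf.
exact: (continuous_compf (@continuous_coord n i) cf).
Qed.

(** Multiplicative under [cns], so that bounds pass from one dimension to the next. *)
Definition maj n (x : 'rV[R]_n) : R := \prod_(i < n) rho (x 0 i).

Lemma maj_cns n t (v : 'rV[R]_n) : maj (cns t v) = rho t * maj v.
Proof.
rewrite /maj big_ord_recl cns0; congr (_ * _).
by apply: eq_bigr => i _; rewrite cnsS.
Qed.

Lemma maj_gt0 n (x : 'rV[R]_n) : 0 < maj x.
Proof. by apply: prodr_gt0 => i _; exact: rho_gt0. Qed.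

Lemma maj_ge0 n (x : 'rV[R]_n) : 0 <= maj x. Proof. exact/ltW/maj_gt0. Qed.

Lemma maj_le1 n (x : 'rV[R]_n) : maj x <= 1.
Proof. by apply: prodr_ile1 => i _; rewrite rho_ge0 rho_le1. Qed.

Lemma continuous_maj n : continuous (@maj n).
Proof.
apply: continuous_prodf => i _.
exact: (continuous_compf continuous_rho (@continuous_coord n i)).
Qed.

Lemma majN n (x : 'rV[R]_n) : maj (- x) = maj x.
Proof. by apply: eq_bigr => i _; rewrite mxE rhoN. Qed.

Lemma maj_affine n (c : R) (z : 'rV[R]_n) : 0 < c ->
  exists2 K, 0 < K & forall x, maj (c *: x + z) <= K * maj x.
Proof.
move=> c0; exists (\prod_(i < n) (2 * (1 + z 0 i ^+ 2) * (1 + c ^- 2))).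
  apply: prodr_gt0 => i _; rewrite !mulr_gt0 ?ltr_pwDl ?sqr_ge0 // invr_ge0 sqr_ge0 //.
move=> x; rewrite /maj -big_split /=; apply: ler_prod => i _.
rewrite rho_ge0 /= !mxE; exact: rho_affine.
Qed.

Definition good n (C : R) (F : 'rV[R]_n -> R) :=
  continuous F /\ forall x, `|F x| <= C * maj x.

Lemma good_ge0 n C (F : 'rV[R]_n -> R) : good C F -> 0 <= C.
Proof.
by move=> [_ h]; have := le_trans (normr_ge0 _) (h 0); rewrite pmulr_lge0 // maj_gt0.
Qed.

Lemma good_slice n C (F : 'rV[R]_n.+1 -> R) t :
  good C F -> good (C * rho t) (fun v => F (cns t v)).
Proof.
move=> [cF FC]; split.
  apply: (continuous_compf cF); apply: continuous_cns; first exact: continuous_cstf.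
  by move=> x; exact: cvg_id.
by move=> v; rewrite -mulrA -maj_cns.
Qed.

Lemma good_le n C D (F : 'rV[R]_n -> R) : C <= D -> good C F -> good D F.
Proof.
move=> CD [cF FC]; split => // x; apply: (le_trans (FC x)).
by rewrite ler_wpM2r ?maj_ge0.
Qed.

Lemma goodD n C D (F G : 'rV[R]_n -> R) :
  good C F -> good D G -> good (C + D) (fun x => F x + G x).
Proof.
move=> [cF FC] [cG GC]; split; first exact: continuous_addf.
by move=> x; rewrite mulrDl (le_trans (ler_normD _ _)) // lerD.
Qed.

Lemma goodM n C D (F G : 'rV[R]_n -> R) : good C F -> continuous G ->
  (forall x, `|G x| <= D) -> good (C * D) (fun x => F x * G x).
Proof.
move=> gF cG GD; have [cF FC] := gF; split; first exact: continuous_mulf.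
by move=> x; rewrite normrM mulrAC ler_pM.
Qed.

Lemma goodZ n C a (F : 'rV[R]_n -> R) : good C F -> good (`|a| * C) (fun x => a * F x).
Proof.
move=> [cF FC]; split; first by apply: continuous_mulf => //; exact: continuous_cstf.
by move=> x; rewrite normrM -mulrA ler_wpM2l.
Qed.

Lemma goodN n C (F : 'rV[R]_n -> R) : good C F -> good C (fun x => - F x).
Proof.
by move=> [cF FC]; split; [exact: continuous_oppf|move=> x; rewrite normrN].
Qed.

Lemma good_norm n C (F : 'rV[R]_n -> R) : good C F -> good C (fun x => `|F x|).
Proof.
by move=> [cF FC]; split; [exact: continuous_normf|move=> x; rewrite normr_id].
Qed.

Lemma good_max0 n C (F : 'rV[R]_n -> R) : good C F -> good C (fun x => Num.max (F x) 0).
Proof.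
by move=> [cF FC]; split; [exact: continuous_maxr0|move=> x; exact: normr_max0].
Qed.

Lemma good_affine n C (F : 'rV[R]_n -> R) c z : 0 < c -> good C F ->
  exists D, good D (fun x => F (c *: x + z)).
Proof.
move=> c0 gF; have [cF FC] := gF; have [K K0 HK] := maj_affine z c0.
exists (C * K); split.
  apply: (continuous_compf cF); apply: continuous_rV_affine; [by move=> x; exact: cvg_id|exact: cst_continuous].
by move=> x; rewrite (le_trans (FC _)) // -mulrA ler_wpM2l // (good_ge0 gF).
Qed.

Lemma good_opp n C (F : 'rV[R]_n -> R) : good C F -> good C (fun x => F (- x)).
Proof.
move=> [cF FC]; split; last by move=> x; rewrite -majN.
apply: (continuous_compf cF); apply: rV_continuous => i; under eq_fun do rewrite mxE.
exact/continuous_oppf/continuous_coord.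
Qed.

Lemma good_maj n : good 1 (@maj n).
Proof.
by split; [exact: continuous_maj|move=> x; rewrite mul1r ger0_norm ?maj_ge0].
Qed.

End RowVectors.

(** * The iterated integral on dominated continuous functions *)

Section IteratedIntegral.
Context {R : realType}.
Local Notation mu := (@lebesgue_measure R).

Fixpoint RI n : ('rV[R]_n -> R) -> R :=
  match n with
  | 0 => fun F => F 0
  | m.+1 => fun F => \int[mu]_t RI (fun v : 'rV[R]_m => F (cns t v))
  end.

Lemma eq_RI n (F G : 'rV[R]_n -> R) : F =1 G -> RI F = RI G.
Proof. by move=> /funext ->. Qed.

(** The two properties are proved together: dominated convergence in dimension [n] makes the inner
    integral continuous in the outer variable, which the one-dimensional theorem requires in
    dimension [n + 1]. *)
Definition bound_dct n :=
  (forall C F, good C F -> `|@RI n F| <= C * pi ^+ n) /\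
  (forall C (F_ : nat -> 'rV[R]_n -> R) F, (forall k, good C (F_ k)) -> good C F ->
     (forall x, F_ k x @[k --> \oo] --> F x) -> RI (F_ k) @[k --> \oo] --> RI F).

Lemma bound_dct_param n : bound_dct n -> forall (T : pseudoMetricType R) (G : T -> 'rV[R]_n -> R) C,
  (forall p, good C (G p)) -> (forall x, continuous (G ^~ x)) ->
  continuous (fun p => RI (G p)).
Proof.
move=> [_ dct] T G C gG cG; apply: seq_continuous => u p up.
by apply: (dct C) => // x; exact: (cvg_comp u (G ^~ x) up (cG x p)).
Qed.

Lemma good_slice_le n C (F : 'rV[R]_n.+1 -> R) : good C F ->
  forall t, good C (fun v => F (cns t v)).
Proof.
move=> gF t; apply: good_le (good_slice t gF).
by rewrite ler_piMr ?rho_le1 // (good_ge0 gF).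
Qed.

Lemma good_slice_continuous n C (F : 'rV[R]_n.+1 -> R) : good C F ->
  forall v, continuous (fun t => F (cns t v)).
Proof.
move=> [cF _] v; apply: (continuous_compf cF); apply: continuous_cns.
  by move=> x; exact: cvg_id.
exact: cst_continuous.
Qed.

Lemma RI_bound_dct n : bound_dct n.
Proof.
elim: n => [|n IH].
  split=> [C F [_ FC]|C F_ F _ _ H] /=; last exact: H.
  by rewrite expr0 mulr1; have := FC 0; rewrite /maj big_ord0 mulr1.
have cS C F (gF : good C F) : continuous (fun t => RI (fun v : 'rV[R]_n => F (cns t v))).
  exact: (bound_dct_param IH (good_slice_le gF) (good_slice_continuous gF)).
have bS C F (gF : good C F) t : `|RI (fun v : 'rV[R]_n => F (cns t v))| <= C * pi ^+ n * rho t.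
  by rewrite mulrAC; apply: IH.1; exact: good_slice.
split=> [C F gF|C F_ F gF_ gF FF] /=.
  rewrite exprSr mulrA; apply: Rintegral_good_le; [exact: cS gF|exact: bS].
apply: (@Rintegral_dct _ _ _ (C * pi ^+ n)).
- by move=> k; exact: cS (gF_ k).
- exact: cS gF.
- by move=> k x; exact: bS.
- move=> t; apply: (IH.2 C); [by move=> k; exact: (good_slice_le (gF_ k) t)|exact: (good_slice_le gF t)|].
  by move=> v; exact: FF.
Qed.

Lemma RI_bound n C F : good C F -> `|@RI n F| <= C * pi ^+ n.
Proof. exact: (RI_bound_dct n).1. Qed.

Lemma RI_dct n C (F_ : nat -> 'rV[R]_n -> R) F : (forall k, good C (F_ k)) -> good C F ->
  (forall x, F_ k x @[k --> \oo] --> F x) -> RI (F_ k) @[k --> \oo] --> RI F.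
Proof. exact: (RI_bound_dct n).2. Qed.

Lemma RI_param_continuous n (T : pseudoMetricType R) (G : T -> 'rV[R]_n -> R) C :
  (forall p, good C (G p)) -> (forall x, continuous (G ^~ x)) ->
  continuous (fun p => RI (G p)).
Proof. by move=> gG cG; exact: (bound_dct_param (RI_bound_dct n) gG cG). Qed.

Lemma RI_slice_continuous n C (F : 'rV[R]_n.+1 -> R) : good C F ->
  continuous (fun t => RI (fun v : 'rV[R]_n => F (cns t v))).
Proof. by move=> gF; apply: (RI_param_continuous (good_slice_le gF) (good_slice_continuous gF)). Qed.

Lemma RI_slice_bound n C (F : 'rV[R]_n.+1 -> R) t : good C F ->
  `|RI (fun v : 'rV[R]_n => F (cns t v))| <= C * pi ^+ n * rho t.
Proof. by move=> gF; rewrite mulrAC; apply: RI_bound; exact: good_slice. Qed.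

Lemma RI_slice_integrable n C (F : 'rV[R]_n.+1 -> R) : good C F ->
  mu.-integrable setT (EFin \o (fun t => RI (fun v : 'rV[R]_n => F (cns t v)))).
Proof.
move=> gF; apply: (@integrable_good1 _ _ (C * pi ^+ n)); first exact: RI_slice_continuous gF.
by move=> t; exact: RI_slice_bound.
Qed.

Lemma RID n C D (F G : 'rV[R]_n -> R) : good C F -> good D G ->
  RI (fun x => F x + G x) = RI F + RI G.
Proof.
elim: n C D F G => [//|n IH] C D F G gF gG /=.
rewrite -RintegralD //; last 2 first.
- exact: RI_slice_integrable gF.
- exact: RI_slice_integrable gG.
apply: eq_Rintegral => t _; exact: (IH _ _ _ _ (good_slice t gF) (good_slice t gG)).
Qed.

Lemma RIZ n C a (F : 'rV[R]_n -> R) : good C F -> RI (fun x => a * F x) = a * RI F.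
Proof.
elim: n C F => [//|n IH] C F gF /=.
rewrite -RintegralZl //; last exact: RI_slice_integrable gF.
apply: eq_Rintegral => t _; exact: (IH _ _ (good_slice t gF)).
Qed.

Lemma RIN n C (F : 'rV[R]_n -> R) : good C F -> RI (fun x => - F x) = - RI F.
Proof.
by move=> gF; under eq_RI do rewrite -mulN1r; rewrite (RIZ _ gF) mulN1r.
Qed.

Lemma RIB n C D (F G : 'rV[R]_n -> R) : good C F -> good D G ->
  RI (fun x => F x - G x) = RI F - RI G.
Proof. by move=> gF gG; rewrite (RID gF (goodN gG)) (RIN gG). Qed.

Lemma RI_ge0 n (F : 'rV[R]_n -> R) : (forall x, 0 <= F x) -> 0 <= RI F.
Proof.
elim: n F => [|n IH] F F0 /=; first exact: F0.
by rewrite /Rintegral fine_ge0 // integral_ge0 // => t _; rewrite lee_fin IH.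
Qed.

Lemma RI_le n C D (F G : 'rV[R]_n -> R) : good C F -> good D G ->
  (forall x, F x <= G x) -> RI F <= RI G.
Proof.
move=> gF gG FG; rewrite -subr_ge0 -(RIB gG gF); apply: RI_ge0 => x.
by rewrite subr_ge0.
Qed.

Lemma RI_norm n C (F : 'rV[R]_n -> R) : good C F -> `|RI F| <= RI (fun x => `|F x|).
Proof.
move=> gF; have gn := good_norm gF.
rewrite ler_norml (RI_le gF gn) => [|x]; last exact: ler_norm.
rewrite andbT lerNl -(RIN gF) (RI_le (goodN gF) gn) // => x.
by rewrite -normrN ler_norm.
Qed.

Lemma RI0 n : RI (fun _ : 'rV[R]_n => 0) = 0.
Proof.
have g : good 0 (fun _ : 'rV[R]_n => 0 : R).
  by split; [exact: continuous_cstf|move=> x; rewrite normr0 mul0r].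
by have := RIZ 0 g; under eq_RI do rewrite mul0r; rewrite mul0r.
Qed.

Lemma good0 n C : 0 <= C -> good C (fun _ : 'rV[R]_n => 0 : R).
Proof.
move=> C0; split; first exact: continuous_cstf.
by move=> x; rewrite normr0 mulr_ge0 // maj_ge0.
Qed.

Lemma good_sum n (I : Type) (r : seq I) (P : pred I) (D : I -> R) (F : I -> 'rV[R]_n -> R) :
  (forall i, P i -> good (D i) (F i)) ->
  good (\sum_(i <- r | P i) D i) (fun x => \sum_(i <- r | P i) F i x).
Proof.
move=> gF; elim: r => [|i r IH].
  by rewrite big_nil; under eq_fun do rewrite big_nil; exact: good0.
have -> : (fun x => \sum_(j <- i :: r | P j) F j x) =
    (fun x => if P i then F i x + \sum_(j <- r | P j) F j x else \sum_(j <- r | P j) F j x).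
  by apply/funext => x; rewrite big_cons.
rewrite big_cons; case Pi: (P i) => //.
by apply: goodD => //; exact: gF.
Qed.

Lemma RI_sum n (I : Type) (r : seq I) (P : pred I) (D : I -> R) (F : I -> 'rV[R]_n -> R) :
  (forall i, P i -> good (D i) (F i)) ->
  RI (fun x => \sum_(i <- r | P i) F i x) = \sum_(i <- r | P i) RI (F i).
Proof.
move=> gF; elim: r => [|i r IH].
  by under eq_RI do rewrite big_nil; rewrite big_nil RI0.
under eq_RI do rewrite big_cons; rewrite big_cons; case Pi: (P i) => //.
by rewrite (RID (gF i Pi) (good_sum r gF)) IH.
Qed.

Lemma RI_affine n C (F : 'rV[R]_n -> R) c z : 0 < c -> good C F ->
  RI (fun x => F (c *: x + z)) = c ^- n * RI F.
Proof.
move=> c0; elim: n C F z => [|n IH] C F z gF /=.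
  by rewrite invr1 mul1r; congr F; apply: rV_ext => -[].
under eq_Rintegral => t _.
  have -> : RI (fun v : 'rV[R]_n => F (c *: cns t v + z)) =
      c ^- n * RI (fun v => F (cns (c * t + z 0 ord0) v)).
    rewrite -(IH _ (fun v => F (cns (c * t + z 0 ord0) v)) (tl z) (good_slice _ gF)).
    by apply: eq_RI => v; rewrite cns_affine.
  over.
have gS := RI_slice_bound _ gF.
have cS := RI_slice_continuous gF.
have cA : continuous (fun t : R => RI (fun v : 'rV[R]_n => F (cns (c * t + z 0 ord0) v))).
  apply: (continuous_compf cS); apply: continuous_addf; last exact: continuous_cstf.
  by apply: continuous_mulf; [exact: continuous_cstf|move=> x; exact: cvg_id].
rewrite RintegralZl //; last first.
  apply: (@integrable_good1 _ _ (C * pi ^+ n * (2 * (1 + z 0 ord0 ^+ 2) * (1 + c ^- 2)))) => //.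
  move=> t; apply: (le_trans (gS _)); rewrite -[leRHS]mulrA ler_wpM2l ?rho_affine //.
  by rewrite mulr_ge0 ?exprn_ge0 ?pi_ge0 // (good_ge0 gF).
rewrite (@Rintegral_affine _ (fun t => RI (fun v : 'rV[R]_n => F (cns t v))) c (z 0 ord0) _ c0 cS gS).
by rewrite mulrA -invfM -exprSr.
Qed.

Lemma RI_shift n C (F : 'rV[R]_n -> R) z : good C F -> RI (fun x => F (x + z)) = RI F.
Proof.
move=> gF; have := RI_affine z ltr01 gF; rewrite expr1n invr1 mul1r => <-.
by apply: eq_RI => x; rewrite scale1r.
Qed.

Lemma RI_scale n C (F : 'rV[R]_n -> R) c : 0 < c -> good C F ->
  RI (fun x => F (c *: x)) = c ^- n * RI F.
Proof.
move=> c0 gF; rewrite -(RI_affine 0 c0 gF).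
by apply: eq_RI => x; rewrite addr0.
Qed.

Lemma RI_opp n C (F : 'rV[R]_n -> R) : good C F -> RI (fun x => F (- x)) = RI F.
Proof.
elim: n C F => [|n IH] C F gF /=; first by congr F; apply: rV_ext => -[].
under eq_Rintegral => t _.
  have -> : RI (fun v : 'rV[R]_n => F (- cns t v)) = RI (fun v => F (cns (- t) v)).
    by rewrite -(IH _ _ (good_slice (- t) gF)); apply: eq_RI => v; rewrite cns_opp.
  over.
apply: (@Rintegral_opp _ (fun t => RI (fun v : 'rV[R]_n => F (cns t v))) (C * pi ^+ n)).
  exact: RI_slice_continuous gF.
by move=> t; exact: RI_slice_bound.
Qed.

Lemma RI_subl n C (F : 'rV[R]_n -> R) z : good C F -> RI (fun x => F (z - x)) = RI F.
Proof.
move=> gF; have [D gD] := good_affine z ltr01 gF.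
have gF' : good D (fun x => F (x + z)).
  by move: gD; under eq_fun do rewrite scale1r.
rewrite -(RI_shift z gF) -(RI_opp gF').
by apply: eq_RI => x; rewrite addrC.
Qed.

(** One outer variable is moved past the variables of [RI], one exchange at a time; [RI_swap]
    repeats this for each outer variable. *)
Lemma RI_swap1 m C (G : R -> 'rV[R]_m -> R) :
  continuous (fun p : R * 'rV[R]_m => G p.1 p.2) ->
  (forall s y, `|G s y| <= C * rho s * maj y) ->
  \int[mu]_s RI (fun y => G s y) = RI (fun y => \int[mu]_s G s y).
Proof.
elim: m C G => [//|m IH] C G cG GC /=.
have C0 : 0 <= C.
  have := le_trans (normr_ge0 _) (GC 0 0); rewrite -mulrA pmulr_lge0 //.
  by rewrite mulr_gt0 ?rho_gt0 ?maj_gt0.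
have cGc : continuous (fun p : (R * R) * 'rV[R]_m => G p.1.1 (cns p.1.2 p.2)).
  apply: (@continuous_comp2 _ _ _ _ G (fun p : (R * R) * 'rV[R]_m => p.1.1) (fun p => cns p.1.2 p.2) cG).
    exact: (continuous_compf (@continuous_fst _ _) (@continuous_fst _ _)).
  apply: continuous_cns (@continuous_snd _ _).
  exact: (continuous_compf (@continuous_snd _ _) (@continuous_fst _ _)).
have gG p : good (C * rho p.1 * rho p.2) (fun v : 'rV[R]_m => G p.1 (cns p.2 v)).
  split; first exact: (continuous_slice2 (F := fun (p : R * R) v => G p.1 (cns p.2 v)) cGc).
  by move=> v; rewrite -[leRHS]mulrA -maj_cns.
rewrite (@Rintegral_swap _ (fun s t => RI (fun v : 'rV[R]_m => G s (cns t v))) (C * pi ^+ m)); last 2 first.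
- apply: (@RI_param_continuous _ _ (fun (p : R * R) v => G p.1 (cns p.2 v)) C).
    move=> p; apply: good_le (gG p); rewrite -mulrA ler_piMr //.
    by rewrite mulr_ile1 ?rho_ge0 ?rho_le1.
  by move=> v; exact: (continuous_slice1 (F := fun (p : R * R) v => G p.1 (cns p.2 v)) cGc).
- move=> s t; rewrite (_ : _ * _ * _ = C * rho s * rho t * pi ^+ m); last by ring.
  exact: (RI_bound (gG (s, t))).
apply: eq_Rintegral => t _; apply: (IH (C * rho t)).
  apply: (continuous_comp2 (F := fun (p : R * R) v => G p.1 (cns p.2 v)) (f := fun q => (q.1, t)) cGc).
    by apply: continuous_pair (@continuous_fst _ _) _; exact: cst_continuous.
  exact: continuous_snd.
move=> s v; rewrite (_ : _ * _ * _ = C * rho s * (rho t * maj v)); last by ring.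
by rewrite -maj_cns.
Qed.

Lemma RI_swap n m C (F : 'rV[R]_n -> 'rV[R]_m -> R) :
  continuous (fun p : 'rV[R]_n * 'rV[R]_m => F p.1 p.2) ->
  (forall x y, `|F x y| <= C * maj x * maj y) ->
  RI (fun x => RI (fun y => F x y)) = RI (fun y => RI (fun x => F x y)).
Proof.
elim: n C F => [//|n IH] C F cF FC /=.
have C0 : 0 <= C.
  have := le_trans (normr_ge0 _) (FC 0 0); rewrite -mulrA pmulr_lge0 //.
  by rewrite mulr_gt0 ?maj_gt0.
have cFs s : continuous (fun p : 'rV[R]_n * 'rV[R]_m => F (cns s p.1) p.2).
  apply: (continuous_comp2 cF _ (@continuous_snd _ _)).
  apply: continuous_cns (@continuous_fst _ _); exact: continuous_cstf.
transitivity (\int[mu]_s RI (fun y : 'rV[R]_m => RI (fun v : 'rV[R]_n => F (cns s v) y))).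
  apply: eq_Rintegral => s _; apply: (IH (C * rho s)) => // v y.
  rewrite (_ : _ * _ * _ = C * (rho s * maj v) * maj y); last by ring.
  by rewrite -maj_cns.
have cG : continuous (fun p : (R * 'rV[R]_m) * 'rV[R]_n => F (cns p.1.1 p.2) p.1.2).
  apply: (continuous_comp2 cF).
    apply: continuous_cns (@continuous_snd _ _).
    exact: (continuous_compf (@continuous_fst _ _) (@continuous_fst _ _)).
  exact: (continuous_compf (@continuous_snd _ _) (@continuous_fst _ _)).
have gG (p : R * 'rV[R]_m) : good (C * rho p.1 * maj p.2) (fun v : 'rV[R]_n => F (cns p.1 v) p.2).
  split; first exact: (continuous_slice2 (F := fun (p : R * 'rV[R]_m) v => F (cns p.1 v) p.2) cG).
  move=> v; rewrite (_ : _ * _ * _ * _ = C * (rho p.1 * maj v) * maj p.2); last by ring.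
  by rewrite -maj_cns.
apply: (@RI_swap1 m (C * pi ^+ n) (fun s y => RI (fun v : 'rV[R]_n => F (cns s v) y))).
  apply: (@RI_param_continuous _ _ (fun (p : R * 'rV[R]_m) v => F (cns p.1 v) p.2) C).
    move=> p; apply: good_le (gG p); rewrite -mulrA ler_piMr //.
    by rewrite mulr_ile1 ?rho_ge0 ?rho_le1 ?maj_ge0 ?maj_le1.
  by move=> v; exact: (continuous_slice1 (F := fun (p : R * 'rV[R]_m) v => F (cns p.1 v) p.2) cG).
move=> s y; rewrite (_ : _ * _ * _ = C * rho s * maj y * pi ^+ n); last by ring.
exact: (RI_bound (gG (s, y))).
Qed.

Lemma intn_RI n C (F : 'rV[R]_n -> R) : good C F -> (forall x, 0 <= F x) ->
  intn (fun x => (F x)%:E) = (RI F)%:E.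
Proof.
elim: n C F => [//|n IH] C F gF F0 /=.
rewrite -(@integral_good1E _ _ (C * pi ^+ n)); last 2 first.
- exact: RI_slice_continuous gF.
- by move=> t; exact: RI_slice_bound.
by apply: eq_integral => t _; exact: (IH _ _ (good_slice t gF)).
Qed.

(** Bridge from the integrals of the definitions to the calculus of [RI], through positive and
    negative parts. *)
Lemma Rintn_RI n C (F : 'rV[R]_n -> R) : good C F -> Rintn F = RI F.
Proof.
move=> gF; have g1 := good_max0 gF; have g2 := good_max0 (goodN gF).
rewrite /Rintn (intn_RI g1) ?(intn_RI g2) /=; last 2 first.
- by move=> x; rewrite le_max lexx orbT.
- by move=> x; rewrite le_max lexx orbT.
by rewrite -(RIB g1 g2); apply: eq_RI => x; rewrite -subr_max0.
Qed.

Lemma RI_maj n : RI (@maj R n) = pi ^+ n.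
Proof.
elim: n => [|n IH] /=; first by rewrite /maj big_ord0.
under eq_Rintegral => t _.
  have -> : RI (fun v : 'rV[R]_n => maj (cns t v)) = pi ^+ n * rho t.
    rewrite -IH mulrC -(RIZ _ (@good_maj R n)).
    by apply: eq_RI => v; rewrite maj_cns.
  over.
have ir : mu.-integrable setT (EFin \o @rho R).
  by have := integrable_rho (1 : R); under eq_fun do rewrite mul1r.
by rewrite RintegralZl // Rintegral_rho exprSr.
Qed.

End IteratedIntegral.

(** * Fourier transforms of compactly supported multipliers *)

Section DifferenceClass.
Context {R : realType}.

Lemma ler_norm_MVT (f df : R -> R) (C a b : R) :
  (forall x : R, is_derive x 1 f (df x)) -> (forall x, `|df x| <= C) ->
  `|f b - f a| <= C * `|b - a|.
Proof.
move=> fd fC.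
have cf : continuous f.
  by move=> z; apply/differentiable_continuous/derivable1_diffP; case: (fd z).
have key x y : x < y -> `|f y - f x| <= C * `|y - x|.
  move=> xy; have [c _ ->] := @MVT _ f df x y xy (fun z _ => fd z) (continuous_subspaceT cf).
  by rewrite normrM ler_wpM2r.
case: (ltgtP a b) => [/key //|/key|->]; last by rewrite !subrr normr0 mulr0.
by rewrite distrC (distrC b).
Qed.

Lemma ler_norm_sin (x : R) : `|sin x| <= `|x|.
Proof.
have := @ler_norm_MVT sin cos 1 0 x; rewrite sin0 !subr0 mul1r; apply.
by move=> y; exact: cos_max.
Qed.

Variable n : nat.
Implicit Types (u v : 'rV[R]_n -> R) (x : 'rV[R]_n) (i : 'I_n).

Definition inbox (b : R) x := forall i, `|x 0 i| <= b.
Definition csupp (b : R) u := forall x, ~ inbox b x -> u x = 0.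

Lemma evecE i k : evec R i 0 k = (k == i)%:R.
Proof. by rewrite mxE eqxx. Qed.

Lemma inboxD b c x y : inbox b x -> inbox c y -> inbox (b + c) (x + y).
Proof. by move=> hx hy i; rewrite mxE (le_trans (ler_normD _ _)) // lerD. Qed.

Lemma inbox_evec t i : inbox `|t| (t *: evec R i).
Proof.
by move=> k; rewrite mxE evecE normrM ler_piMr // normr_nat; case: (_ == _).
Qed.

Lemma inbox_le b c x : b <= c -> inbox b x -> inbox c x.
Proof. by move=> bc h i; exact: le_trans bc. Qed.

(* Iterated difference quotients in the direction e_i, with independent steps t; the
   box shrinks by 1 at each order because |t| <= 1. *)
Fixpoint dclass i (m : nat) (b C : R) u : Prop :=
  match m with
  | 0 => forall x, inbox b x -> `|u x| <= C
  | m'.+1 => (forall x, inbox b x -> `|u x| <= C) /\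
      forall t, t != 0 -> `|t| <= 1 ->
        dclass i m' (b - 1) C (fun x => (u (x + t *: evec R i) - u x) / t)
  end.

Lemma dclass_bound i m b C u : dclass i m b C u -> forall x, inbox b x -> `|u x| <= C.
Proof. by case: m => [//|m []]. Qed.

Lemma eq_dclass i m b C u v : u =1 v -> dclass i m b C u -> dclass i m b C v.
Proof. by move=> /funext ->. Qed.

Lemma dclass_mono i m b b' C C' u : b' <= b -> C <= C' ->
  dclass i m b C u -> dclass i m b' C' u.
Proof.
elim: m b b' C C' u => [|m IH] b b' C C' u bb CC /=.
  by move=> h x bx; apply: le_trans CC; apply: h; exact: inbox_le bx.
move=> [h1 h2]; split.
  by move=> x bx; apply: le_trans CC; apply: h1; exact: inbox_le bx.
by move=> t t0 t1; apply: (IH (b - 1) _ C) => //; [rewrite lerD2r|exact: h2].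
Qed.

Lemma dclass_pred i m b C u : dclass i m.+1 b C u -> dclass i m b C u.
Proof.
elim: m b C u => [|m IH] b C u; first by case.
move=> [h1 h2]; split => // t t0 t1; apply: IH; exact: h2.
Qed.

Lemma dclass_shift i m b C u z : inbox 1 z ->
  dclass i m b C u -> dclass i m (b - 1) C (fun x => u (x + z)).
Proof.
move=> z1; elim: m b C u => [|m IH] b C u /=.
  by move=> h x bx; apply: h; rewrite -(subrK 1 b); exact: inboxD.
move=> [h1 h2]; split.
  by move=> x bx; apply: h1; rewrite -(subrK 1 b); exact: inboxD.
move=> t t0 t1; have := IH _ _ _ (h2 t t0 t1).
by apply: eq_dclass => x; rewrite (addrAC x).
Qed.

Lemma dclassD i m b C C' u v : dclass i m b C u -> dclass i m b C' v ->
  dclass i m b (C + C') (fun x => u x + v x).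
Proof.
elim: m b C C' u v => [|m IH] b C C' u v /=.
  by move=> h h' x bx; rewrite (le_trans (ler_normD _ _)) // lerD ?h ?h'.
move=> [h1 h2] [h1' h2']; split.
  by move=> x bx; rewrite (le_trans (ler_normD _ _)) // lerD ?h1 ?h1'.
move=> t t0 t1; have := IH _ _ _ _ _ (h2 t t0 t1) (h2' t t0 t1).
by apply: eq_dclass => x; rewrite -mulrDl; congr (_ / _); ring.
Qed.

Lemma dclassZ i m b C a u : dclass i m b C u -> dclass i m b (`|a| * C) (fun x => a * u x).
Proof.
elim: m b C u => [|m IH] b C u /=.
  by move=> h x bx; rewrite normrM ler_wpM2l // h.
move=> [h1 h2]; split; first by move=> x bx; rewrite normrM ler_wpM2l // h1.
move=> t t0 t1; have := IH _ _ _ (h2 t t0 t1).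
by apply: eq_dclass => x; rewrite mulrA mulrBr.
Qed.

(** Discrete Leibniz rule: the quotient of a product splits into two products, so each order doubles
    the constant. One factor sits at the shifted point, which the shrinking boxes allow. *)
Lemma dclassM i m b C C' u v : dclass i m b C u -> dclass i m b C' v ->
  dclass i m b (2 ^+ m * C * C') (fun x => u x * v x).
Proof.
elim: m b C C' u v => [|m IH] b C C' u v /=.
  by move=> h h' x bx; rewrite expr0 mul1r normrM ler_pM // ?h ?h'.
move=> hu hv; have [h1 h2] := hu; have [h1' h2'] := hv.
split.
  move=> x bx; have a := h1 x bx; have b' := h1' x bx.
  rewrite normrM (le_trans (ler_pM _ _ a b')) // -mulrA ler_peMl ?exprn_ege1 ?ler1n //.
  by rewrite mulr_ge0 //; [exact: le_trans a|exact: le_trans b'].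
move=> t t0 t1.
have tb : inbox 1 (t *: evec R i) by apply: inbox_le (inbox_evec t i).
have e1 := IH _ _ _ _ _ (h2 t t0 t1) (dclass_shift tb (dclass_pred hv)).
have bb : b - 1 <= b by rewrite lerBlDr lerDl.
have e2 := IH _ _ _ _ _ (dclass_mono bb (lexx C) (dclass_pred hu)) (h2' t t0 t1).
rewrite (_ : 2 ^+ m.+1 * C * C' = 2 ^+ m * C * C' + 2 ^+ m * C * C'); last by rewrite exprS; ring.
apply: eq_dclass (dclassD e1 e2) => x.
by field.
Qed.

Lemma dclass_cst i m b a : dclass i m b `|a| (fun _ => a).
Proof.
elim: m b a => [|m IH] b a; first by move=> x _.
split => [x _|t t0 t1]; first by [].
by apply: (dclass_mono (lexx _) _ (IH (b - 1) ((a - a) / t))); rewrite subrr mul0r normr0.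
Qed.

Lemma dclass_expM i m b C C' u v k : dclass i m b C u -> dclass i m b C' v ->
  dclass i m b ((2 ^+ m * C) ^+ k * C') (fun x => u x ^+ k * v x).
Proof.
move=> hu hv; elim: k => [|k IH].
  by rewrite expr0 mul1r; apply: eq_dclass hv => x; rewrite expr0 mul1r.
rewrite exprS -mulrA; apply: eq_dclass (dclassM hu IH) => x.
by rewrite exprS mulrA.
Qed.

Lemma dclass_inv i m C (c : R) : 0 < c -> exists2 C', 0 < C' & forall v b,
  (forall x, inbox b x -> c <= v x) -> dclass i m b C v ->
  dclass i m b C' (fun x => (v x)^-1).
Proof.
move=> c0; elim: m => [|m [C' C'0 IH]].
  exists c^-1; first by rewrite invr_gt0.
  move=> v b vc _ x bx; have h := vc x bx.
  have v0 := lt_le_trans c0 h.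
  by rewrite ger0_norm ?invr_ge0 ?(ltW v0) // lef_pV2 // posrE.
exists (C' + `|2 ^+ m * (2 ^+ m * C * C') * C'|); first by rewrite ltr_wpDr.
move=> v b vc hv; have [h1 h2] := hv.
have hI := IH v b vc (dclass_pred hv).
have le1 : C' <= C' + `|2 ^+ m * (2 ^+ m * C * C') * C'| by rewrite lerDl.
split; first by move=> x bx; exact: le_trans (dclass_bound hI bx) le1.
move=> t t0 t1.
have tb : inbox 1 (t *: evec R i) by apply: inbox_le (inbox_evec t i).
have bb : b - 1 <= b by rewrite lerBlDr lerDl.
have vc1 x : inbox (b - 1) x -> v x != 0.
  by move=> bx; rewrite gt_eqF // (lt_le_trans c0) // vc //; exact: inbox_le bx.
have vc2 x : inbox (b - 1) x -> v (x + t *: evec R i) != 0.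
  move=> bx; rewrite gt_eqF // (lt_le_trans c0) // vc //.
  by rewrite -(subrK 1 b); exact: inboxD.
have e := dclassM (dclassM (h2 t t0 t1) (dclass_mono bb (lexx _) hI)) (dclass_shift tb hI).
have {e} e := dclassZ (-1) e.
rewrite normrN1 mul1r in e.
have {e} e := dclass_mono (lexx _) (le_trans (ler_norm _) (_ : _ <= C' + `|2 ^+ m * (2 ^+ m * C * C') * C'|)) e.
have {}e : dclass i m (b - 1) (C' + `|2 ^+ m * (2 ^+ m * C * C') * C'|)
   (fun x => -1 * ((v (x + t *: evec R i) - v x) / t * (v x)^-1 * (v (x + t *: evec R i))^-1)).
  by apply: e; rewrite lerDr ltW.
(* the two functions agree on the box only *)
have gen k d E u1 u2 : (forall x, inbox d x -> u1 x = u2 x) ->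
    dclass i k d E u1 -> dclass i k d E u2.
  elim: k d E u1 u2 => [|k IHk] d E u1 u2 h12 /=.
    by move=> h x bx; rewrite -h12 // h.
  move=> [g1 g2]; split; first by move=> x bx; rewrite -h12 // g1.
  move=> s s0 s1; apply: IHk (g2 s s0 s1) => x bx.
  rewrite !h12 //; first by apply: inbox_le bx; rewrite lerBlDr lerDl.
  by rewrite -(subrK 1 d); apply: inboxD => //; exact: inbox_le (inbox_evec s i).
apply: gen e => x bx.
by field; rewrite t0 vc1 // vc2.
Qed.

Lemma dotpDr x y z : dotp x (y + z) = dotp x y + dotp x z.
Proof. by rewrite /dotp -big_split; apply: eq_bigr => k _; rewrite mxE mulrDr. Qed.

Lemma dotpDl x y z : dotp (x + y) z = dotp x z + dotp y z.
Proof. by rewrite /dotp -big_split; apply: eq_bigr => k _; rewrite mxE mulrDl. Qed.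

Lemma dotpZr c x y : dotp x (c *: y) = c * dotp x y.
Proof. by rewrite /dotp big_distrr; apply: eq_bigr => k _; rewrite mxE mulrCA. Qed.

Lemma dotpZl c x y : dotp (c *: x) y = c * dotp x y.
Proof. by rewrite /dotp big_distrr; apply: eq_bigr => k _; rewrite mxE -mulrA. Qed.

Lemma dotpNr x y : dotp x (- y) = - dotp x y.
Proof. by rewrite -scaleN1r dotpZr mulN1r. Qed.

Lemma dotpNl x y : dotp (- x) y = - dotp x y.
Proof. by rewrite -scaleN1r dotpZl mulN1r. Qed.

Lemma dotpC x y : dotp x y = dotp y x.
Proof. by apply: eq_bigr => k _; rewrite mulrC. Qed.

Lemma dotp_evec x i : dotp x (evec R i) = x 0 i.
Proof.
rewrite /dotp (bigD1 i) //= evecE eqxx mulr1 big1 ?addr0 // => k ki.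
by rewrite evecE (negbTE ki) mulr0.
Qed.

Lemma sinE (z : R) : sin z = cos (z - pi / 2). Proof. by rewrite cosBpihalf. Qed.

Lemma cosB_cos (z d : R) : cos (z + d) - cos z = -2 * sin (d / 2) * cos (z + d / 2 - pi / 2).
Proof.
rewrite cosBpihalf.
have -> : z + d = (z + d / 2) + d / 2 by field.
have -> : cos z = cos ((z + d / 2) - d / 2) by congr cos; field.
by rewrite cosD cosB; ring.
Qed.

(** A difference quotient of a cosine is a cosine with another phase and an amplitude larger by at
    most [2 pi H], so the family is stable. *)
Lemma dclass_cos i m b (C H c a : R) h : `|c| <= C -> inbox H h ->
  dclass i m b (C * (1 + 2 * pi * H) ^+ m) (fun x => c * cos (2 * pi * dotp h x - a)).
Proof.
elim: m b C c a => [|m IH] b C c a cC hH /=.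
  move=> x _; rewrite expr0 mulr1 normrM (le_trans _ cC) // ler_piMr //; exact: cos_max.
have H0 : 0 <= H by exact: le_trans (hH i).
have P0 : 0 <= 2 * pi * H by rewrite !mulr_ge0 ?pi_ge0.
have C0 : 0 <= C by exact: le_trans cC.
split.
  move=> x _; rewrite normrM (@le_trans _ _ `|c|) //; first by rewrite ler_piMr //; exact: cos_max.
  by rewrite (le_trans cC) // ler_peMr // exprn_ege1 // lerDl.
move=> t t0 t1; set h' := 2 * pi * h 0 i * t.
have cC' : `|c * (-2 * sin (h' / 2)) / t| <= C * (1 + 2 * pi * H).
  have hs : `|sin (h' / 2)| * 2 <= `|h'|.
    have := ler_norm_sin (h' / 2); rewrite normrM [ `|2^-1| ]ger0_norm ?invr_ge0 //.
    by rewrite ler_pdivlMr.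
  rewrite -mulrA normrM ler_pM //.
  rewrite normrM normrM normrN normfV normr_nat ler_pdivrMr ?normr_gt0 // mulrC (le_trans hs) //.
  rewrite /h' normrM ler_wpM2r // !normrM normr_nat (ger0_norm (pi_ge0 _)).
  apply: (@le_trans _ _ (2 * pi * H)); last by rewrite lerDr.
  by rewrite ler_wpM2l // mulr_ge0 // pi_ge0.
have := IH (b - 1) _ _ (a - h' / 2 + pi / 2) cC' hH.
rewrite -mulrA -exprS; apply: eq_dclass => x.
rewrite -mulrBr dotpDr dotpZr dotp_evec.
have -> : 2 * pi * (dotp h x + t * h 0 i) - a = (2 * pi * dotp h x - a) + h' by rewrite /h'; ring.
rewrite cosB_cos.
have -> : 2 * pi * dotp h x - a + h' / 2 - pi / 2 = 2 * pi * dotp h x - (a - h' / 2 + pi / 2) by ring.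
by field.
Qed.

Lemma is_derive_line u x w y (d : R) : is_derive (x + y *: w) w u d ->
  is_derive (y : R) 1 (fun s : R => u (x + s *: w)) d.
Proof.
move=> [du e]; have E : (fun h : R => h^-1 *: ((fun s : R => u (x + s *: w)) (h *: (1 : R) + y) - u (x + y *: w)))
    = (fun h : R => h^-1 *: (u (h *: w + (x + y *: w)) - u (x + y *: w))).
  apply/funext => h; congr (_ *: (u _ - _)).
  by rewrite /GRing.scale /= mulr1 -/(GRing.scale _ _) scalerDl addrCA.
by split; [rewrite /derivable /shift /= E|rewrite /derive /shift /= E].
Qed.

(** The mean value theorem trades one derivative for one difference quotient. The induction needs
    the whole chain [g], since the quotients of its members again form a chain. *)
Lemma dclass_deriv i m b C (g : nat -> 'rV[R]_n -> R) :
  (forall k x, (k < m)%N -> is_derive x (evec R i) (g k) (g k.+1 x)) ->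
  (forall k x, (k <= m)%N -> `|g k x| <= C) -> dclass i m b C (g 0%N).
Proof.
elim: m b g => [|m IH] b g gd gC /=; first by move=> x _; exact: gC.
split; first by move=> x _; exact: gC.
move=> t t0 t1.
apply: (IH (b - 1) (fun k x => (g k (x + t *: evec R i) - g k x) / t)) => k x km.
- have d1 := gd k x (ltnW km); have d2 := gd k (x + t *: evec R i) (ltnW km).
  have d3 : is_derive x (evec R i) (fun x => g k (x + t *: evec R i)) (g k.+1 (x + t *: evec R i)).
    case: d2 => d2 e2.
    have E : (fun h : R => h^-1 *: (g k (h *: evec R i + x + t *: evec R i) - g k (x + t *: evec R i)))
     = (fun h : R => h^-1 *: (g k (h *: evec R i + (x + t *: evec R i)) - g k (x + t *: evec R i))).
      by apply/funext => h; rewrite addrA.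
    by split; [rewrite /derivable /shift /= E|rewrite /derive /shift /= E].
  have -> : (fun x => (g k (x + t *: evec R i) - g k x) / t) =
    (fun x => t^-1 *: (g k (x + t *: evec R i) - g k x)).
    by apply/funext => z; rewrite mulrC.
  by apply: is_derive_eq; rewrite /GRing.scale /= mulrC.
- have kd (s : R) : is_derive s 1 (fun s : R => g k (x + s *: evec R i)) (g k.+1 (x + s *: evec R i)).
    by apply: is_derive_line; apply: gd.
  have := @ler_norm_MVT _ _ C 0 t kd (fun s => gC k.+1 _ km).
  by rewrite scale0r addr0 subr0 normrM normfV ler_pdivrMr ?normr_gt0.
Qed.

Lemma csupp_good B M u : 0 <= B -> continuous u -> csupp B u -> (forall x, `|u x| <= M) ->
  good (M * (1 + B ^+ 2) ^+ n) u.
Proof.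
move=> B0 cu sB uM; split => // x.
have M0 : 0 <= M by exact: le_trans (uM 0).
have P0 : 0 < 1 + B ^+ 2 by rewrite ltr_pwDl // sqr_ge0.
case: (pselect (inbox B x)) => [bx|/sB ->]; last first.
  by rewrite normr0 !mulr_ge0 ?exprn_ge0 ?maj_ge0 // ltW.
rewrite (le_trans (uM x)) // -mulrA ler_peMr //.
have -> : (1 + B ^+ 2) ^+ n = \prod_(k < n) (1 + B ^+ 2) by rewrite prodr_const card_ord.
rewrite /maj -big_split /=; apply: (big_ind (fun z => 1 <= z)) => //.
  by move=> a b a1 b1; exact: mulr_ege1.
move=> k _; rewrite ler_pdivlMr ?ltr_pwDl ?sqr_ge0 // mul1r.
by rewrite lerD2l -real_normK ?num_real // lerXn2r ?nnegrE.
Qed.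

End DifferenceClass.

(** * Cosine transforms and their decay *)

Section FourierTransform.
Context {R : realType} {n : nat}.
Implicit Types (u v : 'rV[R]_n -> R) (x : 'rV[R]_n) (i : 'I_n).

(* Phase-shifted cosine transform: [FT 0] and [FT (pi / 2)] are the real and
   imaginary parts of the inverse Fourier transform. *)
Definition FT (a : R) u x : R := RI (fun xi => u xi * cos (2 * pi * dotp x xi - a)).

Lemma continuous_dotp (T : topologicalType) (f g : T -> 'rV[R]_n) :
  continuous f -> continuous g -> continuous (fun t => dotp (f t) (g t)).
Proof.
move=> cf cg; apply: continuous_sumf => k _.
by apply: continuous_mulf; apply: (continuous_compf (@continuous_coord R n k)).
Qed.

Lemma continuous_cosf (T : topologicalType) (f : T -> R) :
  continuous f -> continuous (fun t => cos (f t)).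
Proof. by move=> cf; apply: continuous_compf cf; exact: continuous_cos. Qed.

Lemma continuous_idf (T : topologicalType) : continuous (fun x : T => x).
Proof. by move=> x; exact: cvg_id. Qed.

Lemma continuous_phase (T : topologicalType) (f g : T -> 'rV[R]_n) (a : R) :
  continuous f -> continuous g -> continuous (fun t => cos (2 * pi * dotp (f t) (g t) - a)).
Proof.
move=> cf cg; apply: continuous_cosf; apply: continuous_addf; last exact: continuous_cstf.
by apply: continuous_mulf; [exact: continuous_cstf|exact: continuous_dotp].
Qed.

Lemma good_phase C a u x : good C u -> good C (fun xi => u xi * cos (2 * pi * dotp x xi - a)).
Proof.
move=> gu; rewrite -[C]mulr1; apply: goodM gu _ _; last by move=> y; exact: cos_max.
by apply: continuous_phase; [exact: cst_continuous|exact: continuous_idf].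
Qed.

Lemma FT_bound C a u x : good C u -> `|FT a u x| <= C * pi ^+ n.
Proof. by move=> gu; apply: RI_bound; exact: good_phase. Qed.

Lemma continuous_FT C a u : good C u -> continuous (FT a u).
Proof.
move=> gu; apply: (RI_param_continuous (C := C)); first by move=> p; exact: good_phase.
move=> xi; apply: continuous_mulf; first exact: continuous_cstf.
by apply: continuous_phase; [exact: continuous_idf|exact: cst_continuous].
Qed.

Lemma FTB C D a u v x : good C u -> good D v ->
  FT a (fun xi => u xi - v xi) x = FT a u x - FT a v x.
Proof.
move=> gu gv; rewrite -(RIB (good_phase a x gu) (good_phase a x gv)).
by apply: eq_RI => xi; rewrite mulrBl.
Qed.

Lemma FT_shift C a u x z : good C u ->
  FT a (fun xi => u (xi + z)) x = FT (a + 2 * pi * dotp x z) u x.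
Proof.
move=> gu; rewrite /FT -(RI_shift z (good_phase (a + 2 * pi * dotp x z) x gu)).
by apply: eq_RI => xi; congr (_ * cos _); rewrite dotpDr; ring.
Qed.

Lemma FT_pi a u x C : good C u -> FT (a + pi) u x = - FT a u x.
Proof.
move=> gu; rewrite -(RIN (good_phase a x gu)); apply: eq_RI => xi.
rewrite (_ : _ - (a + pi) = (2 * pi * dotp x xi - a) - pi); last by ring.
by rewrite cosB cospi sinpi; ring.
Qed.

Lemma FT_scale C a u x c : 0 < c -> good C u ->
  FT a (fun xi => u (c *: xi)) x = c ^- n * FT a u (c^-1 *: x).
Proof.
move=> c0 gu; rewrite -(RI_scale c0 (good_phase a (c^-1 *: x) gu)).
apply: eq_RI => xi; congr (_ * cos _).
by rewrite dotpZl dotpZr mulKf ?gt_eqF.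
Qed.

Definition fdiff (t : R) i u : 'rV[R]_n -> R := fun xi => u (xi + t *: evec R i) - u xi.

Lemma fdiff_dclass i m b C u t : t != 0 -> `|t| <= 1 -> dclass i m b C u ->
  forall x, inbox (b - m%:R) x -> `|iter m (fdiff t i) u x| <= C * `|t| ^+ m.
Proof.
move=> t0 t1; elim: m b C u => [|m IH] b C u.
  by move=> h x; rewrite subr0 expr0 mulr1 => /h.
move=> [_ /(_ t t0 t1) h] x bx; rewrite iterSr exprS mulrA [C * _]mulrC.
apply: (IH (b - 1)).
  by apply: eq_dclass (dclassZ t h) => y; rewrite /fdiff mulrC mulfVK.
by move: bx; rewrite -addrA -opprD -natr1 [1 + _]addrC.
Qed.

Lemma fdiff_csupp B u t i : `|t| <= 1 -> csupp B u -> csupp (B + 1) (fdiff t i u).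
Proof.
move=> t1 sB x nx; rewrite /fdiff !sB ?subrr //.
  by move=> h; apply: nx; apply: inbox_le h; rewrite lerDl.
move=> h; apply: nx; rewrite (_ : x = x + t *: evec R i + - t *: evec R i); last first.
  by rewrite scaleNr addrK.
apply: inboxD => //; apply: inbox_le (inbox_evec _ _); by rewrite normrN.
Qed.

Lemma fdiff_continuous u t i : continuous u -> continuous (fdiff t i u).
Proof.
move=> cu; apply: continuous_addf; last exact: continuous_oppf.
apply: (continuous_compf cu); have := @continuous_rV_affine R 'rV[R]_n n 1 id (fun _ => t *: evec R i).
move=> /(_ (@continuous_idf _) (@cst_continuous _ _ _)).
by under eq_fun do rewrite scale1r.
Qed.

Lemma fdiff_iter_csupp B u t i k : `|t| <= 1 -> csupp B u -> csupp (B + k%:R) (iter k (fdiff t i) u).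
Proof.
move=> t1 sB; elim: k => [|k IH]; first by rewrite addr0.
by rewrite iterS -natr1 addrA; exact: fdiff_csupp.
Qed.

Lemma fdiff_iter_continuous u t i k : continuous u -> continuous (iter k (fdiff t i) u).
Proof. by move=> cu; elim: k => [//|k IH]; rewrite iterS; exact: fdiff_continuous. Qed.

(* Shifting the frequency by half a period of the i-th oscillation flips the sign. *)
Lemma FT_fdiff C a u x i : good C u -> x 0 i != 0 ->
  FT a (fdiff (2 * x 0 i)^-1 i u) x = -2 * FT a u x.
Proof.
move=> gu xi0; set t := (2 * x 0 i)^-1.
have [D gD] := good_affine (t *: evec R i) ltr01 gu.
have gs : good D (fun xi => u (xi + t *: evec R i)).
  by move: gD; under eq_fun do rewrite scale1r.
rewrite /fdiff (FTB a x gs gu) (FT_shift _ _ _ gu) dotpZr dotp_evec.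
rewrite (_ : 2 * pi * (t * x 0 i) = pi); last by rewrite /t; field.
by rewrite (FT_pi _ _ gu); ring.
Qed.

(** Each of the [M + M] half-period shifts multiplies the transform by [-2] and the bound by
    [|t| = 1 / (2 |x_i|)]; two shifts together pay for one factor [rho (x_i)]. *)
Lemma FT_decay1 B M C a u x i : 0 <= B -> continuous u -> csupp B u ->
  dclass i (M + M) (B + (M + M)%:R + (M + M)%:R) C u ->
  `|FT a u x| <= C * ((1 + (B + (M + M)%:R) ^+ 2) ^+ n * pi ^+ n * 5 ^+ M) * rho (x 0 i) ^+ M.
Proof.
move=> B0 cu sB du; set N := (M + M)%N.
have BN : 0 <= B + N%:R by rewrite addr_ge0.
have uC y : `|u y| <= C.
  case: (pselect (inbox B y)) => by_.
    by apply: (dclass_bound du); apply: inbox_le by_; rewrite -addrA lerDl.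
  rewrite sB // normr0.
  have h0 : inbox (B + N%:R + N%:R) (0 : 'rV[R]_n) by move=> k; rewrite mxE normr0 addr_ge0.
  exact: le_trans (normr_ge0 _) (dclass_bound du h0).
have C0 : 0 <= C by exact: le_trans (uC 0).
have P1 : 1 <= 1 + (B + N%:R) ^+ 2 by rewrite lerDl sqr_ge0.
have gu : good (C * (1 + B ^+ 2) ^+ n) u by exact: csupp_good.
(* The step [t] has length at most 1 exactly when [|x_i| >= 1 / 2]. For smaller [|x_i|] the factor
   [5 * rho] is at least 1 and the trivial bound is enough. *)
case: (leP (1 / 2) `|x 0 i|) => xi.
- have xi0 : x 0 i != 0 by rewrite -normr_gt0 (lt_le_trans _ xi).
  set t := (2 * x 0 i)^-1.
  have t0 : t != 0 by rewrite invr_neq0 // mulf_neq0.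
  have t1 : `|t| <= 1 by rewrite normfV invf_le1 ?normr_gt0 ?mulf_neq0 // normrM normr_nat; lra.
  have gk k : exists D, good D (iter k (fdiff t i) u).
    elim: k => [|k [D IH]]; first by exists (C * (1 + B ^+ 2) ^+ n).
    have [D' gD] := good_affine (t *: evec R i) ltr01 IH.
    exists (D' + D); rewrite iterS; apply: goodD; last exact: goodN.
    by move: gD; under eq_fun do rewrite scale1r.
  have FTk k : FT a (iter k (fdiff t i) u) x = (-2) ^+ k * FT a u x.
    elim: k => [|k IH]; first by rewrite expr0 mul1r.
    by have [D gD] := gk k; rewrite iterS (FT_fdiff a gD) // IH exprS mulrA.
  have bk y : `|iter N (fdiff t i) u y| <= C * `|t| ^+ N.
    case: (pselect (inbox (B + N%:R) y)) => by_.
      by apply: (fdiff_dclass t0 t1 du); rewrite addrK.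
    rewrite (@fdiff_iter_csupp B u t i N t1 sB) // normr0 mulr_ge0 ?exprn_ge0 //.
  have gN := csupp_good BN (@fdiff_iter_continuous u t i N cu) (@fdiff_iter_csupp B u t i N t1 sB) bk.
  have := FT_bound a x gN; rewrite FTk normrM normrX normrN normr_nat => h.
  have h2 : 0 < 2 ^+ N :> R by rewrite exprn_gt0.
  have r0 := rho_gt0 (x 0 i).
  have key : `|t| ^+ N <= (5 * rho (x 0 i)) ^+ M * 2 ^+ N.
    rewrite /N addnn -mul2n !exprM -exprMn lerXn2r ?nnegrE ?sqr_ge0 ?mulr_ge0 ?rho_ge0 ?exprn_ge0 //.
    rewrite /t normfV exprVn real_normK ?num_real // /rho.
    have X0 : 0 < x 0 i ^+ 2 by rewrite exprn_even_gt0.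
    have X1 : 1 / 4 <= x 0 i ^+ 2.
      rewrite -real_normK ?num_real //; apply: (@le_trans _ _ ((1 / 2) ^+ 2)); first by rewrite expr2; lra.
      by rewrite lerXn2r ?nnegrE.
    rewrite exprMn -[leLHS]mul1r ler_pdivrMr; last by rewrite mulr_gt0.
    rewrite (_ : 5 / _ * _ * _ = 80 * x 0 i ^+ 2 / (1 + x 0 i ^+ 2)); last first.
      by field; rewrite gt_eqF // ltr_pwDl // ltW.
    by rewrite ler_pdivlMr ?ltr_pwDl ?ltW //; lra.
  rewrite -(ler_pM2l h2) (le_trans h) //.
  rewrite [leRHS](_ : _ = C * ((5 * rho (x 0 i)) ^+ M * 2 ^+ N) * (1 + (B + N%:R) ^+ 2) ^+ n * pi ^+ n); last first.
    by rewrite exprMn; ring.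
  by rewrite !ler_wpM2r ?exprn_ge0 ?pi_ge0 ?(le_trans ler01 P1) // ler_wpM2l.
- have := FT_bound a x gu => /le_trans; apply.
  rewrite [leRHS](_ : _ = C * ((1 + (B + N%:R) ^+ 2) ^+ n * (5 * rho (x 0 i)) ^+ M) * pi ^+ n); last first.
    by rewrite exprMn; ring.
  rewrite ler_wpM2r ?exprn_ge0 ?pi_ge0 // ler_wpM2l //.
  have PB : 1 <= 1 + B ^+ 2 by rewrite lerDl sqr_ge0.
  rewrite -[leLHS]mulr1 ler_pM ?exprn_ge0 ?(le_trans ler01 PB) //.
    by rewrite lerXn2r ?nnegrE ?(le_trans ler01) // lerD2l lerXn2r ?nnegrE // lerDl.
  rewrite exprn_ege1 // /rho ler_pdivlMr ?ltr_pwDl ?sqr_ge0 // mul1r.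
  rewrite -real_normK ?num_real //.
  have : `|x 0 i| ^+ 2 <= 1 by rewrite exprn_ile1 // ltW // (lt_trans xi) // ltr_pdivrMr //; lra.
  by move=> ?; lra.
Qed.

(** The order [m], the box [b] and the constant [K] are chosen before [u]; this uniformity is used
    for symbols depending on a step [h]. *)
Lemma FT_decay B P : (0 < n)%N -> 0 <= B -> exists2 K, 0 < K & exists m b, forall C a u,
  continuous u -> csupp B u -> (forall i, dclass i m b C u) ->
  forall x, `|FT a u x| <= C * K * maj x ^+ P.
Proof.
move=> n0 B0; set M := (n * P)%N.
exists ((1 + (B + (M + M)%:R) ^+ 2) ^+ n * pi ^+ n * 5 ^+ M).
  by rewrite !mulr_gt0 ?exprn_gt0 ?pi_gt0 // ltr_pwDl // sqr_ge0.
exists (M + M)%N, (B + (M + M)%:R + (M + M)%:R) => C a u cu sB du x.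
(* The coordinate with the smallest [rho] satisfies [rho (x_i) ^ n <= maj x], which is why
   [M = n * P] factors are collected. *)
pose i0 := Ordinal n0; pose i := [arg min_(k < i0) rho (x 0 k)]%O.
have himin k : rho (x 0 i) <= rho (x 0 k) by rewrite /i; case: arg_minP => // j _ h; exact: h.
apply: (le_trans (FT_decay1 a x B0 cu sB (du i))).
have C0 : 0 <= C.
  have h0 : inbox (B + (M + M)%:R + (M + M)%:R) (0 : 'rV[R]_n) by move=> k; rewrite mxE normr0 !addr_ge0.
  exact: le_trans (normr_ge0 _) (dclass_bound (du i) h0).
rewrite ler_wpM2l //.
  by rewrite !mulr_ge0 ?exprn_ge0 ?pi_ge0 // addr_ge0 // sqr_ge0.
rewrite /M exprM lerXn2r ?nnegrE ?exprn_ge0 ?rho_ge0 ?maj_ge0 //.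
have -> : rho (x 0 i) ^+ n = \prod_(k < n) rho (x 0 i) by rewrite prodr_const card_ord.
by apply: ler_prod => k _; rewrite rho_ge0 himin.
Qed.

Lemma diff1_FT C a u h x : good C u ->
  diff1 h (FT a u) x = FT (a + pi / 2) (fun xi => -2 * sin (pi * dotp h xi) * u xi) x.
Proof.
move=> gu; rewrite /diff1 -(RIB (good_phase a _ gu) (good_phase a _ gu)).
apply: eq_RI => xi; rewrite -mulrBr dotpDl dotpDl dotpNl dotpZl.
set A := 2 * pi * dotp x xi - a.
rewrite (_ : 2 * pi * (dotp x xi + 2^-1 * dotp h xi) - a = A + pi * dotp h xi); last by rewrite /A; field.
rewrite (_ : 2 * pi * (dotp x xi - 2^-1 * dotp h xi) - a = A - pi * dotp h xi); last by rewrite /A; field.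
rewrite (_ : 2 * pi * dotp x xi - (a + pi / 2) = A - pi / 2); last by rewrite /A; ring.
rewrite cosBpihalf; move: A (pi * dotp h xi) => {}A D.
by rewrite cosD cosB; ring.
Qed.

Lemma good_sin C u h c : good C u -> good (C * `|c|) (fun xi => c * sin (pi * dotp h xi) * u xi).
Proof.
move=> gu.
have -> : (fun xi => c * sin (pi * dotp h xi) * u xi) = (fun xi => u xi * (c * sin (pi * dotp h xi))).
  by apply/funext => xi; rewrite mulrC.
apply: goodM gu _ _; last by move=> xi; rewrite normrM ler_piMr // sin_max.
apply: continuous_mulf; first exact: continuous_cstf.
apply: (continuous_compf (@continuous_sin R)).
apply: continuous_mulf; first exact: continuous_cstf.
by apply: continuous_dotp; [exact: cst_continuous|exact: continuous_idf].
Qed.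

(** Each symmetric difference multiplies the symbol by [-2 sin (pi h . xi)] and advances the phase
    by a quarter turn. *)
Lemma diffk_FT C a u h k x : good C u ->
  diffk k h (FT a u) x = FT (a + k%:R * (pi / 2)) (fun xi => (-2 * sin (pi * dotp h xi)) ^+ k * u xi) x.
Proof.
elim: k C a u x => [|k IH] C a u x gu /=.
  by rewrite mul0r addr0; congr FT; apply/funext => xi; rewrite expr0 mul1r.
rewrite (_ : diff1 h (FT a u) = FT (a + pi / 2) (fun xi => -2 * sin (pi * dotp h xi) * u xi)); last first.
  by apply/funext => y; exact: diff1_FT gu.
rewrite (IH _ _ _ _ (good_sin h (-2) gu)).
rewrite (_ : a + pi / 2 + k%:R * (pi / 2) = a + k.+1%:R * (pi / 2)); last by rewrite -natr1; ring.
by apply: eq_RI => xi; rewrite exprSr -!mulrA.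
Qed.

End FourierTransform.

(** * The transform of [exp (- |t|)] and the Poisson kernel *)

Section Poisson1.
Context {R : realType}.
Local Notation mu := (@lebesgue_measure R).

(** The summability factor for Fourier inversion, chosen because its transform is explicit and
    positive. *)
Definition eabs (t : R) : R := expR (- `|t|).

Lemma continuous_eabs : continuous eabs.
Proof.
apply: (continuous_compf (@continuous_expR R)); apply: continuous_oppf.
by apply: continuous_normf; exact: continuous_idf.
Qed.

Lemma eabs_ge0 t : 0 <= eabs t. Proof. exact: expR_ge0. Qed.

Lemma eabs_le_rho t : eabs t <= 5 * rho t.
Proof.
rewrite /eabs /rho ler_pdivlMr ?ltr_pwDl ?sqr_ge0 // expRN mulrC ler_pdivrMr ?expR_gt0 //.
have h : 1 + `|t| / 2 <= expR (`|t| / 2) by exact: expR_ge1Dx.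
have -> : expR `|t| = expR (`|t| / 2) ^+ 2 by rewrite expr2 -expRD; congr expR; field.
have h2 : (1 + `|t| / 2) ^+ 2 <= expR (`|t| / 2) ^+ 2.
  by rewrite lerXn2r ?nnegrE ?expR_ge0 // addr_ge0 // divr_ge0.
have := normr_ge0 t; rewrite -real_normK ?num_real // => h0.
apply: le_trans (_ : 5 * (1 + `|t| / 2) ^+ 2 <= _); last by rewrite ler_wpM2l.
by rewrite !expr2; nra.
Qed.

Lemma good_eabsM (f : R -> R) : continuous f -> (forall t, `|f t| <= 1) ->
  continuous (fun t => eabs t * f t) /\ forall t, `|eabs t * f t| <= 5 * rho t.
Proof.
move=> cf f1; split; first by apply: continuous_mulf => //; exact: continuous_eabs.
move=> t; rewrite normrM (ger0_norm (eabs_ge0 t)) (le_trans _ (eabs_le_rho t)) //.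
by rewrite ler_piMr // eabs_ge0.
Qed.

(** The added 1 makes the integrand nonnegative, as the fundamental theorem for nonnegative
    functions on a half-line requires. It is removed in [integral_eabs_cos] by comparison with
    frequency 0. *)
Lemma integral_exp_1cos (w : R) :
  (\int[mu]_(t in `[0%R, +oo[) (expR (- t) * (1 + cos (w * t)))%:E = (1 + (1 + w ^+ 2)^-1)%:E)%E.
Proof.
have w0 : 1 + w ^+ 2 != 0 by rewrite gt_eqF // ltr_pwDl // sqr_ge0.
pose F (t : R) := expR (- t) * (- 1 + (w * sin (w * t) - cos (w * t)) / (1 + w ^+ 2)).
have dF (t : R) : is_derive t 1 F (expR (- t) * (1 + cos (w * t))).
  rewrite /F; apply: is_derive_eq.
  rewrite /GRing.scale /=; by field.
have cw : continuous (fun t : R => w * t).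
  by apply: continuous_mulf; [exact: continuous_cstf|exact: continuous_idf].
have cf : continuous (fun t : R => expR (- t) * (1 + cos (w * t))).
  apply: continuous_mulf.
    by apply: (continuous_compf (@continuous_expR R)); apply: continuous_oppf; exact: continuous_idf.
  by apply: continuous_addf; [exact: continuous_cstf|exact: continuous_cosf].
rewrite (@ge0_continuous_FTC2y R _ F 0 0).
- rewrite /F oppr0 expR0 mulr0 sin0 cos0 mulr0 sub0r mul1r -EFinB; congr EFin.
  by field.
- move=> t t0; apply: mulr_ge0; first exact: expR_ge0.
  by have := cos_geN1 (w * t); lra.
- exact: continuous_subspaceT.
- apply/cvgrPdist_le => e e0.
  have c0 : 0 < 1 + (`|w| + 1) by rewrite ltr_pwDl // addr_ge0.
  have := @cvgr_expR R => /cvgrPdist_le /(_ (e / (1 + (`|w| + 1)))) /(_ (divr_gt0 e0 c0)).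
  move=> h; have h' : \forall t \near +oo, `|0 - expR (- t)| <= e / (1 + (`|w| + 1)).
    by [].
  apply: filterS h' => t; rewrite !sub0r !normrN (ger0_norm (expR_ge0 _)) => ht.
  rewrite /F normrM (ger0_norm (expR_ge0 _)).
  apply: (@le_trans _ _ (expR (- t) * (1 + (`|w| + 1)))); last by rewrite -ler_pdivlMr.
  rewrite ler_wpM2l ?expR_ge0 // (le_trans (ler_normD _ _)) // normrN1 lerD2l.
  have w1 : 1 <= 1 + w ^+ 2 by rewrite lerDl sqr_ge0.
  rewrite normrM normfV ler_pdivrMr ?normr_gt0 // (ger0_norm (le_trans ler01 w1)).
  apply: (@le_trans _ _ (`|w| + 1)); last by rewrite ler_peMr // addr_ge0.
  rewrite (le_trans (ler_normB _ _)) // normrM lerD ?cos_max //.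
  by rewrite ler_piMr // sin_max.
- by move=> t _; case: (dF t).
- apply: cvg_at_right_filter; apply: differentiable_continuous.
  by apply/derivable1_diffP; case: (dF 0).
- by move=> t _; rewrite derive1E; case: (dF t).
Qed.

Lemma integral_eabs_cos (w : R) : \int[mu]_t (eabs t * cos (w * t)) = 2 / (1 + w ^+ 2).
Proof.
have cw (v : R) : continuous (fun t : R => cos (v * t)).
  apply: continuous_cosf.
  by apply: continuous_mulf; [exact: continuous_cstf|exact: continuous_idf].
have key (v : R) : \int[mu]_t (eabs t * (1 + cos (v * t))) = 2 * (1 + (1 + v ^+ 2)^-1).
  rewrite /Rintegral ge0_symfun_integralT.
  - rewrite -set_itvcy (_ : (\int[mu]_(t in `[0%R, +oo[) _ = (1 + (1 + v ^+ 2)^-1)%:E)%E) //.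
    rewrite -integral_exp_1cos; apply: eq_integral => t; rewrite inE /= in_itv /= andbT => t0.
    by rewrite /eabs ger0_norm.
  - by move=> t; rewrite mulr_ge0 ?eabs_ge0 //; have := cos_geN1 (v * t); lra.
  - apply: continuous_mulf; first exact: continuous_eabs.
    by apply: continuous_addf; [exact: continuous_cstf|exact: cw].
  - by move=> t /=; rewrite /eabs normrN mulrN cosN.
have g1 (v : R) := good_eabsM (@cw v) (fun t => cos_max (v * t)).
have i1 (v : R) : mu.-integrable setT (EFin \o (fun t => eabs t * cos (v * t))).
  exact: integrable_good1 (g1 v).1 (g1 v).2.
have E (v : R) : \int[mu]_t (eabs t * (1 + cos (v * t))) =
    \int[mu]_t (eabs t * cos (0 * t)) + \int[mu]_t (eabs t * cos (v * t)).
  rewrite -RintegralD //; apply: eq_Rintegral => t _.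
  by rewrite mul0r cos0 mulrDr.
have := key 0; rewrite E expr0n /= addr0 invr1 => h0.
have := key w; rewrite E => hw.
have w0 : 1 + w ^+ 2 != 0 by rewrite gt_eqF // ltr_pwDl // sqr_ge0.
have -> : \int[mu]_t (eabs t * cos (w * t)) = 2 * (1 + (1 + w ^+ 2)^-1) - 2.
  by move: h0 hw; set A := Rintegral _ _ _; set B := Rintegral _ _ _ => ? ?; lra.
by field.
Qed.

Lemma integral_eabs_phase (w b : R) :
  \int[mu]_t (eabs t * cos (w * t - b)) = cos b * (2 / (1 + w ^+ 2)).
Proof.
have cw : continuous (fun t : R => w * t).
  by apply: continuous_mulf; [exact: continuous_cstf|exact: continuous_idf].
have [c1 b1] := good_eabsM (continuous_cosf cw) (fun t => cos_max (w * t)).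
have [c2 b2] := good_eabsM (continuous_compf (@continuous_sin R) cw) (fun t => sin_max (w * t)).
have i1 := integrable_good1 c1 b1; have i2 := integrable_good1 c2 b2.
have odd : \int[mu]_t (eabs t * sin (w * t)) = 0.
  have := Rintegral_opp c2 b2.
  have -> : \int[mu]_t (eabs (- t) * sin (w * - t)) = - \int[mu]_t (eabs t * sin (w * t)).
    rewrite -mulN1r -RintegralZl //; apply: eq_Rintegral => t _.
    by rewrite /eabs normrN mulrN sinN; ring.
  by move: (\int[mu]_t (eabs t * sin (w * t))) => A ?; lra.
rewrite -integral_eabs_cos -RintegralZl // -[RHS]addr0 -[X in _ + X](mulr0 (sin b)) -odd.
rewrite -[X in _ + X]RintegralZl // -RintegralD //.
- by apply: eq_Rintegral => t _; rewrite cosB; ring.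
- apply: (@integrable_good1 _ _ (`|cos b| * 5)).
    by apply: continuous_mulf c1; exact: continuous_cstf.
  by move=> t; rewrite normrM -mulrA ler_wpM2l.
- apply: (@integrable_good1 _ _ (`|sin b| * 5)).
    by apply: continuous_mulf c2; exact: continuous_cstf.
  by move=> t; rewrite normrM -mulrA ler_wpM2l.
Qed.

(** The cosine transform of [eabs] at frequency [z], a Poisson kernel. *)
Definition poisson (z : R) : R := 2 * rho (2 * pi * z).

Lemma continuous_poisson : continuous poisson.
Proof.
apply: continuous_mulf; first exact: continuous_cstf.
apply: (continuous_compf (@continuous_rho R)).
by apply: continuous_mulf; [exact: continuous_cstf|exact: continuous_idf].
Qed.

Lemma poisson_ge0 z : 0 <= poisson z. Proof. by rewrite mulr_ge0 // rho_ge0. Qed.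

Lemma poisson_le z : poisson z <= 4 * (1 + (2 * pi) ^- 2) * rho z.
Proof.
have p0 : 0 < 2 * pi :> R by rewrite mulr_gt0 // pi_gt0.
have := rho_affine 0 z p0; rewrite addr0 expr0n /= addr0 mulr1 /poisson => h.
have -> : 4 * (1 + (2 * pi) ^- 2) * rho z = 2 * (2 * (1 + (2 * pi) ^- 2) * rho z).
  by ring.
by rewrite ler_wpM2l.
Qed.

Lemma integral_poisson : \int[mu]_z poisson z = 1.
Proof.
have p0 : 0 < 2 * pi :> R by rewrite mulr_gt0 // pi_gt0.
have b t : `|rho t| <= 1 * rho t :> R by rewrite mul1r ger0_norm ?rho_ge0.
have := Rintegral_affine 0 p0 (@continuous_rho R) b; rewrite Rintegral_rho.
under eq_Rintegral do rewrite addr0.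
move=> h; rewrite /poisson RintegralZl // ?h.
  by rewrite invfM -mulrA mulVf ?mulr1 ?mulfV ?pnatr_eq0 // gt_eqF // pi_gt0.
apply: (@integrable_good1 _ _ (2 * (1 + (2 * pi) ^- 2))) => [|t].
  apply: (continuous_compf (@continuous_rho R)).
  by apply: continuous_mulf; [exact: continuous_cstf|exact: continuous_idf].
rewrite ger0_norm ?rho_ge0 //; have := rho_affine 0 t p0.
by rewrite addr0 expr0n /= addr0 mulr1.
Qed.

End Poisson1.

(** * Fourier inversion at the origin *)

Section Inversion.
Context {R : realType}.

Lemma good_scale n C (F : 'rV[R]_n -> R) (c : R) : 0 < c -> good C F ->
  exists D, good D (fun x => F (c *: x)).
Proof.
move=> c0 gF; have [D gD] := good_affine 0 c0 gF; exists D.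
by rewrite (_ : (fun x => F (c *: x)) = (fun x => F (c *: x + 0))) //; apply/funext => x; rewrite addr0.
Qed.

Lemma good_shift n C (F : 'rV[R]_n -> R) z : good C F ->
  exists D, good D (fun x => F (x + z)).
Proof.
move=> gF; have [D gD] := good_affine z ltr01 gF; exists D.
by rewrite (_ : (fun x => F (x + z)) = (fun x => F (1 *: x + z))) //; apply/funext => x; rewrite scale1r.
Qed.

Local Notation mu := (@lebesgue_measure R).

Definition eabsn n (y : 'rV[R]_n) : R := \prod_(i < n) eabs (y 0 i).
Definition poissonn n (z : 'rV[R]_n) : R := \prod_(i < n) poisson (z 0 i).

Lemma good_prodn n (f : R -> R) (C : R) : continuous f -> (forall t, 0 <= f t <= C * rho t) ->
  good (C ^+ n) (fun y : 'rV[R]_n => \prod_(i < n) f (y 0 i)).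
Proof.
move=> cf f0; split.
  by apply: continuous_prodf => i _; exact: (continuous_compf cf (@continuous_coord R n i)).
move=> y; have h i : 0 <= f (y 0 i) by case/andP: (f0 (y 0 i)).
rewrite ger0_norm; last by apply: prodr_ge0 => i _; exact: h.
have -> : C ^+ n = \prod_(i < n) C by rewrite prodr_const card_ord.
by rewrite /maj -big_split /=; apply: ler_prod => i _.
Qed.

Lemma good_eabsn n : good (5 ^+ n) (@eabsn n).
Proof.
apply: good_prodn; first exact: continuous_eabs.
by move=> t; rewrite eabs_ge0 eabs_le_rho.
Qed.

Lemma good_poissonn n : good ((4 * (1 + (2 * pi) ^- 2)) ^+ n) (@poissonn n).
Proof.
apply: good_prodn; first exact: continuous_poisson.
by move=> t; rewrite poisson_ge0 poisson_le.
Qed.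

Lemma RI_poissonn n : RI (@poissonn n) = 1.
Proof.
elim: n => [|n IH] /=; first by rewrite /poissonn big_ord0.
under eq_Rintegral => t _.
  have -> : RI (fun v : 'rV[R]_n => poissonn (cns t v)) = poisson t.
    rewrite -[RHS]mulr1 -IH -(RIZ _ (@good_poissonn n)); apply: eq_RI => v.
    by rewrite /poissonn big_ord_recl cns0; congr (_ * _); apply: eq_bigr => i _; rewrite cnsS.
  over.
exact: integral_poisson.
Qed.

Lemma FT_eabsn n (z : 'rV[R]_n) b : FT b (@eabsn n) z = cos b * poissonn z.
Proof.
rewrite /FT; elim: n z b => [|n IH] z b /=.
  by rewrite /eabsn /poissonn /dotp !big_ord0 mulr0 sub0r cosN mulr1 mul1r.
under eq_Rintegral => t _.
  have -> : RI (fun v : 'rV[R]_n => eabsn (cns t v) * cos (2 * pi * dotp z (cns t v) - b)) =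
     eabs t * cos (2 * pi * z 0 ord0 * t - b) * poissonn (tl z).
    rewrite -mulrA -[cos _]cosN opprB.
    rewrite -IH -(RIZ _ (good_phase _ _ (@good_eabsn n))); apply: eq_RI => v.
    rewrite mulrA; congr (_ * cos _).
      by rewrite /eabsn big_ord_recl cns0; congr (_ * _); apply: eq_bigr => i _; rewrite cnsS.
    rewrite /dotp big_ord_recl cns0.
    under eq_bigr do rewrite cnsS.
    by under [in RHS]eq_bigr do rewrite mxE; ring.
  over.
have [c1 b1] := good_eabsM (continuous_cosf (f := fun t => 2 * pi * z 0 ord0 * t - b)
  (continuous_addf (continuous_mulf (@continuous_cstf R R _) (@continuous_idf _)) (@continuous_cstf R R _)))
  (fun t => cos_max _).
rewrite RintegralZr //; last exact: integrable_good1 c1 b1.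
rewrite integral_eabs_phase -(mulrA (cos b)); congr (_ * _).
rewrite /poissonn big_ord_recl; congr (_ * _).
by apply: eq_bigr => i _; rewrite mxE.
Qed.

(** Abel-Poisson summation: the factor [eabsn (e k *: y)] makes the double integral absolutely
    convergent, the exchange turns it into a Poisson mean of [v], and both sides converge by
    domination as [e k] tends to 0. *)
Lemma FT_inversion0 n C D (v : 'rV[R]_n -> R) : good C v -> good D (FT 0 v) ->
  RI (FT 0 v) = v 0.
Proof.
move=> gv gFv; pose e (k : nat) : R := k.+1%:R^-1.
have e0 k : 0 < e k by rewrite invr_gt0.
have ec : e k @[k --> \oo] --> (0 : R) by exact: cvg_harmonic.
have C0 := good_ge0 gv.
have step k : RI (fun y => FT 0 v y * eabsn (e k *: y)) = RI (fun z => v (e k *: z) * poissonn z).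
  have [E gE] := good_scale (e0 k) (@good_eabsn n).
  have [V gV] := good_scale (e0 k) gv.
  transitivity (RI (fun y => RI (fun xi => v xi * cos (2 * pi * dotp y xi - 0) * eabsn (e k *: y)))).
    apply: eq_RI => y; rewrite mulrC -(RIZ _ (good_phase 0 y gv)).
    by apply: eq_RI => xi; rewrite mulrC.
  rewrite (@RI_swap _ _ _ (C * E)); last 2 first.
  - apply: continuous_mulf; last exact: (continuous_compf gE.1 (@continuous_fst _ _)).
    apply: continuous_mulf; first exact: (continuous_compf gv.1 (@continuous_snd _ _)).
    by apply: continuous_phase; [exact: continuous_fst|exact: continuous_snd].
  - move=> y xi; rewrite (_ : C * E * _ * _ = C * maj xi * (E * maj y)); last by ring.
    rewrite normrM ler_pM ?gE.2 //; exact: (good_phase 0 y gv).2.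
  have gvp : good (C * (4 * (1 + (2 * pi) ^- 2)) ^+ n) (fun z => v (e k *: z) * poissonn z).
    have [cp bp] := @good_poissonn n; have [cv bv] := gv.
    split; first exact: continuous_mulf gV.1 cp.
    move=> z; rewrite normrM -mulrA ler_pM // (le_trans (bv _)) // ler_piMr //; exact: maj_le1.
  transitivity (RI (fun xi => (e k) ^- n * (v (e k *: ((e k)^-1 *: xi)) * poissonn ((e k)^-1 *: xi)))).
    apply: eq_RI => xi; rewrite scalerA mulfV ?gt_eqF // scale1r.
    have := FT_scale 0 xi (e0 k) (@good_eabsn n).
    rewrite FT_eabsn cos0 mul1r => h; rewrite mulrCA -h -(RIZ _ (good_phase 0 xi gE)).
    by apply: eq_RI => y; rewrite (dotpC y xi) -mulrA [cos _ * _]mulrC.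
  have ei0 : 0 < (e k)^-1 by rewrite invr_gt0.
  have [V' gV'] := good_scale ei0 gvp.
  rewrite (RIZ _ gV').
  rewrite (@RI_scale _ _ _ (fun z => v (e k *: z) * poissonn z) (e k)^-1 _ gvp) ?invr_gt0 //.
  move: (e k) (gt_eqF (e0 k)) (RI _) => c /negbT c0 A.
  by rewrite exprVn invrK mulKf // expf_neq0.
have sc y : (e k *: y) @[k --> \oo] --> (0 : 'rV[R]_n).
  by rewrite -(scale0r y); apply: cvgZr_tmp.
have L1 : RI (fun y => FT 0 v y * eabsn (e k *: y)) @[k --> \oo] --> RI (FT 0 v).
  have e1 y : `|eabsn y| <= 1 :> R.
    rewrite ger0_norm; last by apply: prodr_ge0 => i _; exact: eabs_ge0.
    by apply: prodr_ile1 => i _; rewrite eabs_ge0 /= /eabs -expR0 ler_expR oppr_le0.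
  apply: (@RI_dct _ _ D) => //.
    move=> k; rewrite -[D]mulr1; apply: goodM gFv _ _ => //.
    by have [E []] := good_scale (e0 k) (@good_eabsn n).
  move=> y; rewrite -[X in _ --> X]mulr1; apply: cvgM; first exact: cvg_cst.
  have <- : eabsn (0 : 'rV[R]_n) = 1.
    by rewrite /eabsn big1 // => i _; rewrite mxE /eabs normr0 oppr0 expR0.
  by apply: (@cvg_comp _ _ _ (fun k => e k *: y) (@eabsn n)) (sc y) _; exact: (@good_eabsn n).1.
have L2 : RI (fun z => v (e k *: z) * poissonn z) @[k --> \oo] --> v 0 * RI (@poissonn n).
  rewrite -(RIZ _ (@good_poissonn n)).
  apply: (@RI_dct _ _ (C * (4 * (1 + (2 * pi) ^- 2)) ^+ n)).
  - move=> k; have [cp bp] := @good_poissonn n; have [cv bv] := gv.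
    have [V gV] := good_scale (e0 k) gv.
    split; first exact: continuous_mulf gV.1 cp.
    move=> z; rewrite normrM -mulrA ler_pM // (le_trans (bv _)) // ler_piMr //; exact: maj_le1.
  - apply: good_le (goodZ (v 0) (@good_poissonn n)).
    rewrite ler_wpM2r ?exprn_ge0 ?mulr_ge0 ?addr_ge0 ?invr_ge0 ?sqr_ge0 //.
    by rewrite (le_trans (gv.2 _)) // ler_piMr //; exact: maj_le1.
  - move=> z; apply: cvgM; last exact: cvg_cst.
    by apply: (@cvg_comp _ _ _ (fun k => e k *: z) v) (sc z) _; exact: gv.1.
rewrite RI_poissonn mulr1 in L2.
have L1' : RI (fun z => v (e k *: z) * poissonn z) @[k --> \oo] --> RI (FT 0 v).
  by under eq_fun do rewrite -step.
exact: cvg_unique L1' L2.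
Qed.

End Inversion.

(** * Convolutions and Bernstein's inequality *)

Section Convolution.
Context {R : realType} {n : nat}.
Implicit Types (u v K H g : 'rV[R]_n -> R) (x z : 'rV[R]_n) (i : 'I_n).

Lemma eq_good C u v : u =1 v -> good C u -> good C v.
Proof. by move=> /funext ->. Qed.

Lemma eq_continuous (T U : topologicalType) (f g : T -> U) :
  f =1 g -> continuous f -> continuous g.
Proof. by move=> /funext ->. Qed.

Lemma continuous_shiftv (T : topologicalType) (g : 'rV[R]_n -> T) z : continuous g ->
  continuous (fun y : 'rV[R]_n => g (y + z)).
Proof.
move=> cg; apply: (continuous_compf cg).
apply: eq_continuous (@continuous_rV_affine R 'rV[R]_n n 1 id (fun _ => z) (@continuous_idf _) (@cst_continuous _ _ _)).
by move=> y; rewrite scale1r.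
Qed.

Lemma FT0_even C v y : good C v -> FT 0 v (- y) = FT 0 v y.
Proof.
move=> gv; apply: eq_RI => xi.
by rewrite dotpNl mulrN !subr0 cosN.
Qed.

(** Inversion at 0 is applied to the translates of [v] by [xi] and [- xi]. Their average keeps only
    the cosine part, and evenness of [v] makes the two values equal. *)
Lemma RI_FT_phase C D v xi b : good C v -> (forall y, v (- y) = v y) ->
  good D (FT 0 v) -> good D (FT (pi / 2) v) ->
  RI (fun y => FT 0 v y * cos (2 * pi * dotp y xi - b)) = cos b * v xi.
Proof.
move=> gv ev g0 g1.
have gc : good D (fun y => FT 0 v y * cos (2 * pi * dotp y xi)).
  by apply: eq_good (good_phase 0 xi g0) => y; rewrite subr0 dotpC.
have gs : good D (fun y => FT 0 v y * sin (2 * pi * dotp y xi)).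
  by apply: eq_good (good_phase (pi / 2) xi g0) => y; rewrite -cosBpihalf dotpC.
have odd : RI (fun y => FT 0 v y * sin (2 * pi * dotp y xi)) = 0.
  have := RI_opp gs.
  have -> : RI (fun y => FT 0 v (- y) * sin (2 * pi * dotp (- y) xi)) =
            - RI (fun y => FT 0 v y * sin (2 * pi * dotp y xi)).
    rewrite -(RIN gs); apply: eq_RI => y.
    by rewrite (FT0_even _ gv) dotpNl mulrN sinN mulrN.
  by move: (RI _) => A ?; lra.
have shiftE z y : FT 0 (fun zeta => v (zeta + z)) y =
    FT 0 v y * cos (2 * pi * dotp y z) + FT (pi / 2) v y * sin (2 * pi * dotp y z).
  rewrite (FT_shift _ _ _ gv) add0r /FT.
  rewrite [_ * cos (2 * pi * dotp y z)]mulrC [_ * sin _]mulrC -(RIZ _ (good_phase 0 y gv)) -(RIZ _ (good_phase (pi / 2) y gv)).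
  rewrite -(RID (goodZ _ (good_phase 0 y gv)) (goodZ _ (good_phase (pi / 2) y gv))).
  by apply: eq_RI => zeta; rewrite cosB subr0 cosBpihalf; ring.
have gsh z : good (D + D) (FT 0 (fun zeta => v (zeta + z))).
  rewrite (_ : FT 0 _ = fun y => FT 0 v y * cos (2 * pi * dotp y z) + FT (pi / 2) v y * sin (2 * pi * dotp y z)).
    apply: goodD.
      by apply: eq_good (good_phase 0 z g0) => y; rewrite subr0 dotpC.
    by apply: eq_good (good_phase (pi / 2) z g1) => y; rewrite -cosBpihalf dotpC.
  by apply/funext => y; exact: shiftE.
have inv z : RI (FT 0 (fun zeta => v (zeta + z))) = v z.
  have [E gE] := good_shift z gv.
  by rewrite (FT_inversion0 gE (gsh z)) add0r.
have cosE : RI (fun y => FT 0 v y * cos (2 * pi * dotp y xi)) = v xi.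
  transitivity (RI (fun y => 2^-1 * (FT 0 (fun zeta => v (zeta + xi)) y + FT 0 (fun zeta => v (zeta - xi)) y))).
    apply: eq_RI => y; rewrite !shiftE dotpNr mulrN cosN sinN; by field.
  rewrite (RIZ _ (goodD (gsh xi) (gsh (- xi)))) (RID (gsh xi) (gsh (- xi))) !inv ev.
  by field.
rewrite -cosE -(RIZ _ gc).
transitivity (RI (fun y => cos b * (FT 0 v y * cos (2 * pi * dotp y xi)) +
                           sin b * (FT 0 v y * sin (2 * pi * dotp y xi)))).
  by apply: eq_RI => y; rewrite cosB; ring.
by rewrite (RID (goodZ _ gc) (goodZ _ gs)) (RIZ _ gs) odd mulr0 addr0.
Qed.

(** Convolution theorem: for an even symbol [v] the real transform [FT 0 v] is the full Fourier
    transform, so no cross terms appear. *)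
Lemma FT_mul C D a u v z : good C u -> good C v -> (forall y, v (- y) = v y) ->
  good D (FT 0 v) -> good D (FT (pi / 2) v) ->
  RI (fun w => FT 0 v w * FT a u (z - w)) = FT a (fun xi => u xi * v xi) z.
Proof.
move=> gu gv ev g0 g1.
have C0 := good_ge0 gu; have D0 := good_ge0 g0.
transitivity (RI (fun w => RI (fun xi => FT 0 v w * (u xi * cos (2 * pi * dotp (z - w) xi - a))))).
  by apply: eq_RI => w; rewrite -(RIZ _ (good_phase a (z - w) gu)).
rewrite (@RI_swap _ _ _ (D * C)); last 2 first.
- apply: continuous_mulf; first exact: (continuous_compf g0.1 (@continuous_fst _ _)).
  apply: continuous_mulf; first exact: (continuous_compf gu.1 (@continuous_snd _ _)).
  apply: continuous_phase; last exact: continuous_snd.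
  apply: eq_continuous (@continuous_rV_affine R ('rV[R]_n * 'rV[R]_n)%type n (-1) fst (fun _ => z)
    (@continuous_fst _ _) (@cst_continuous _ _ _)).
  by move=> p; rewrite scaleN1r addrC.
- move=> w xi; rewrite (_ : D * C * _ * _ = D * maj w * (C * maj xi)); last by ring.
  rewrite normrM ler_pM ?g0.2 //; exact: (good_phase a (z - w) gu).2.
apply: eq_RI => xi.
set b := 2 * pi * dotp z xi - a.
have E w : FT 0 v w * (u xi * cos (2 * pi * dotp (z - w) xi - a)) =
   u xi * (FT 0 v w * cos (2 * pi * dotp w xi - b)).
  rewrite dotpDl dotpNl mulrCA; congr (_ * (_ * _)); rewrite -cosN; congr cos.
  by rewrite /b; ring.
under eq_RI do rewrite E.
have gp : good D (fun w => FT 0 v w * cos (2 * pi * dotp w xi - b)).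
  by apply: eq_good (good_phase b xi g0) => y; rewrite dotpC.
by rewrite (RIZ _ gp) (RI_FT_phase xi b gv ev g0 g1) -mulrA [_ * v xi]mulrC.
Qed.

(* [conv K t g] is the convolution of g with the L^1-dilate [t^-n K (x / t)]. *)
Definition conv K (t : R) g x : R := RI (fun z => K z * g (x - t *: z)).

Lemma continuous_sub_scale (T : topologicalType) (t : R) (f h : T -> 'rV[R]_n) :
  continuous f -> continuous h -> continuous (fun p => f p - t *: h p).
Proof.
move=> cf ch; apply: eq_continuous (@continuous_rV_affine R T n (- t) h f ch cf).
by move=> p; rewrite scaleNr addrC.
Qed.

Lemma good_convM (C G : R) K t g x : good C K -> continuous g -> (forall y, `|g y| <= G) ->
  good (C * G) (fun z => K z * g (x - t *: z)).
Proof.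
move=> gK cg gG; apply: goodM gK _ _; last by move=> z; exact: gG.
apply: (continuous_compf cg); apply: continuous_sub_scale; first exact: cst_continuous.
exact: continuous_idf.
Qed.

Lemma conv_bound (C G : R) K t g x : good C K -> continuous g -> (forall y, `|g y| <= G) ->
  `|conv K t g x| <= G * RI (fun z => `|K z|).
Proof.
move=> gK cg gG; apply: (le_trans (RI_norm (good_convM t x gK cg gG))).
rewrite -(RIZ _ (good_norm gK)).
apply: (RI_le (good_norm (good_convM t x gK cg gG)) (goodZ G (good_norm gK))) => z.
by rewrite normrM mulrC ler_wpM2r.
Qed.

Lemma continuous_conv (C G : R) K t g : good C K -> continuous g -> (forall y, `|g y| <= G) ->
  continuous (conv K t g).
Proof.
move=> gK cg gG; apply: (RI_param_continuous (C := C * G)).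
  by move=> x; exact: good_convM.
move=> z; apply: continuous_mulf; first exact: continuous_cstf.
apply: (continuous_compf cg); apply: continuous_sub_scale; first exact: continuous_idf.
exact: cst_continuous.
Qed.

Lemma convD (C G G' : R) K t f g x : good C K -> continuous f -> continuous g ->
  (forall y, `|f y| <= G) -> (forall y, `|g y| <= G') ->
  conv K t (fun y => f y + g y) x = conv K t f x + conv K t g x.
Proof.
move=> gK cf cg fG gG; rewrite -(RID (good_convM t x gK cf fG) (good_convM t x gK cg gG)).
by apply: eq_RI => z; rewrite mulrDr.
Qed.

Lemma convB (C G G' : R) K t f g x : good C K -> continuous f -> continuous g ->
  (forall y, `|f y| <= G) -> (forall y, `|g y| <= G') ->
  conv K t (fun y => f y - g y) x = conv K t f x - conv K t g x.
Proof.
move=> gK cf cg fG gG; rewrite -(RIB (good_convM t x gK cf fG) (good_convM t x gK cg gG)).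
by apply: eq_RI => z; rewrite mulrBr.
Qed.

Lemma eq_conv K K' t g g' x : K =1 K' -> g =1 g' -> conv K t g x = conv K' t g' x.
Proof. by move=> /funext -> /funext ->. Qed.

Lemma conv_shift K t g x z : conv K t (fun y => g (y + z)) x = conv K t g (x + z).
Proof. by apply: eq_RI => w; rewrite addrAC. Qed.

Lemma conv_dct (C G : R) K t (g_ : nat -> 'rV[R]_n -> R) g x : good C K ->
  (forall k, continuous (g_ k)) -> continuous g -> (forall k y, `|g_ k y| <= G) ->
  (forall y, `|g y| <= G) -> (forall y, g_ k y @[k --> \oo] --> g y) ->
  conv K t (g_ k) x @[k --> \oo] --> conv K t g x.
Proof.
move=> gK cg_ cg g_G gG gl; apply: (@RI_dct _ _ (C * G)).
- by move=> k; exact: good_convM.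
- exact: good_convM.
- by move=> z; apply: cvgM; [exact: cvg_cst|exact: gl].
Qed.

Lemma majM_le x z : maj z * maj (x - z) <= 2 ^+ n * maj x.
Proof.
have -> : 2 ^+ n = \prod_(i < n) (2 : R) by rewrite prodr_const card_ord.
rewrite /maj -!big_split /=; apply: ler_prod => i _.
rewrite mulr_ge0 ?rho_ge0 //= !mxE /rho -invfM.
have h0 (a : R) : 0 < 1 + a ^+ 2 by rewrite ltr_pwDl // sqr_ge0.
rewrite ler_pdivlMr // mulrC ler_pdivrMr ?mulr_gt0 //.
have := sqr_ge0 (x 0 i - z 0 i - z 0 i); have := sqr_ge0 (z 0 i * (x 0 i - z 0 i)).
by rewrite !expr2; nra.
Qed.

(** [H] decays like [maj ^ 2]: after the substitution one factor is combined with [K] through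
    [majM_le], and the other keeps the integrand integrable in [z]. *)
Lemma conv_conv (C G : R) K H t g x : good C K -> continuous H ->
  (forall z, `|H z| <= C * maj z ^+ 2) -> continuous g -> (forall y, `|g y| <= G) ->
  conv K t (conv H t g) x = conv (fun z => RI (fun w => H w * K (z - w))) t g x.
Proof.
move=> gK cH HC cg gG; have [cK KC] := gK; have C0 := good_ge0 gK.
have gH : good C H.
  split => // z; rewrite (le_trans (HC z)) // ler_wpM2l // expr2.
  by rewrite ler_piMr ?maj_ge0 ?maj_le1.
have G0 : 0 <= G by exact: le_trans (gG 0).
transitivity (RI (fun w => RI (fun z => K w * (H z * g (x - t *: w - t *: z))))).
  by apply: eq_RI => w; rewrite -(RIZ _ (good_convM t _ gH cg gG)).
rewrite (@RI_swap _ _ _ (C * (C * G))); last 2 first.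
- apply: continuous_mulf; first exact: (continuous_compf cK (@continuous_fst _ _)).
  apply: continuous_mulf; first exact: (continuous_compf cH (@continuous_snd _ _)).
  apply: (continuous_compf cg); apply: continuous_sub_scale (@continuous_snd _ _).
  by apply: continuous_sub_scale (@continuous_fst _ _); exact: cst_continuous.
- move=> w z; rewrite (_ : C * (C * G) * _ * _ = C * maj w * (C * maj z * G)); last by ring.
  by rewrite !normrM ler_pM ?mulr_ge0 // ler_pM ?gH.2.
transitivity (RI (fun z => RI (fun w => H z * K (w - z) * g (x - t *: w)))).
  apply: eq_RI => z.
  have gM := good_convM t (x - t *: z) gK cg gG.
  transitivity (RI (fun w => (H z * (K w * g (x - t *: z - t *: w))))).
    by apply: eq_RI => w; rewrite mulrCA (addrAC x).
  rewrite -(RI_shift (- z) (goodZ (H z) gM)); apply: eq_RI => w.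
  by rewrite mulrA; congr (_ * g _); rewrite scalerBr opprB addrA subrK.
rewrite (@RI_swap _ _ _ (C * C * 2 ^+ n * G)); last 2 first.
- apply: continuous_mulf.
    apply: continuous_mulf; first exact: (continuous_compf cH (@continuous_fst _ _)).
    apply: (continuous_compf cK).
    by apply: eq_continuous (@continuous_sub_scale _ 1 _ _ (@continuous_snd 'rV[R]_n 'rV[R]_n) (@continuous_fst _ _)) => p; rewrite scale1r.
  apply: (continuous_compf cg); apply: continuous_sub_scale (@continuous_snd _ _).
  exact: cst_continuous.
- move=> z w; rewrite normrM (_ : C * C * _ * _ * _ * _ = C * C * 2 ^+ n * maj z * maj w * G); last by ring.
  rewrite ler_pM // normrM.
  apply: (@le_trans _ _ (C * maj z ^+ 2 * (C * maj (w - z)))); first by rewrite ler_pM.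
  rewrite (_ : _ * _ = C * C * maj z * (maj z * maj (w - z))); last by ring.
  rewrite (_ : C * C * 2 ^+ n * maj z * maj w = C * C * maj z * (2 ^+ n * maj w)); last by ring.
  by rewrite ler_wpM2l ?majM_le // !mulr_ge0 ?maj_ge0.
apply: eq_RI => w; rewrite mulrC.
have gk : good (C * (C * 1)) (fun z => H z * K (w - z)).
  rewrite mulr1; apply: goodM gH _ _.
    apply: (continuous_compf cK).
    by apply: eq_continuous (@continuous_sub_scale _ 1 _ _ (@cst_continuous _ _ w) (@continuous_idf 'rV[R]_n)) => p; rewrite scale1r.
  by move=> z; rewrite (le_trans (KC _)) // ler_piMr // maj_le1.
rewrite -(RIZ _ gk); apply: eq_RI => z; by rewrite mulrC.
Qed.

Lemma diff1_conv (C G : R) K t g h x : good C K -> continuous g -> (forall y, `|g y| <= G) ->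
  diff1 h (conv K t g) x = conv K t (diff1 h g) x.
Proof.
move=> gK cg gG; rewrite /diff1 -!conv_shift.
have cs z := @continuous_shiftv _ g z cg.
by rewrite -(convB t x gK (cs _) (cs _) (fun y => gG _) (fun y => gG _)).
Qed.

Lemma continuous_diff1 h g : continuous g -> continuous (diff1 h g).
Proof.
move=> cg.
have cs z := @continuous_shiftv _ g z cg.
by apply: continuous_addf; [exact: cs|exact/continuous_oppf/cs].
Qed.

Lemma diff1_bound h g (G : R) : (forall y, `|g y| <= G) -> forall y, `|diff1 h g y| <= 2 * G.
Proof.
by move=> gG y; rewrite (le_trans (ler_normB _ _)) // mulr2n mulrDl mul1r lerD.
Qed.

Lemma continuous_diffk k h g : continuous g -> continuous (diffk k h g).
Proof. by elim: k g => [//|k IH] g cg /=; apply: IH; exact: continuous_diff1. Qed.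

Lemma diffk_bound k h g (G : R) : (forall y, `|g y| <= G) -> forall y, `|diffk k h g y| <= 2 ^+ k * G.
Proof.
elim: k g G => [|k IH] g G gG y /=; first by rewrite expr0 mul1r.
by rewrite exprSr -mulrA; apply: IH; exact: diff1_bound.
Qed.

Lemma diffk_conv (C G : R) K t g h k x : good C K -> continuous g -> (forall y, `|g y| <= G) ->
  diffk k h (conv K t g) x = conv K t (diffk k h g) x.
Proof.
move=> gK; elim: k g G x => [//|k IH] g G x cg gG /=.
rewrite (_ : diff1 h (conv K t g) = conv K t (diff1 h g)); last first.
  by apply/funext => y; exact: diff1_conv gK cg gG.
exact: (IH _ (2 * G) x (@continuous_diff1 h g cg) (diff1_bound h gG)).
Qed.

Lemma good_diff1 C K h : good C K -> exists D, good D (diff1 h K).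
Proof.
move=> gK; have [D1 g1] := good_shift (2^-1 *: h) gK; have [D2 g2] := good_shift (- (2^-1 *: h)) gK.
by exists (D1 + D2); apply: goodD => //; exact: goodN.
Qed.

Lemma conv_diff1 (C G : R) K t g h x : good C K -> continuous g -> (forall y, `|g y| <= G) ->
  conv (diff1 h K) t g x = conv K t (diff1 (t *: h) g) x.
Proof.
move=> gK cg gG.
have sh z : RI (fun w => K (w + z) * g (x - t *: w)) = conv K t (fun y => g (y + t *: z)) x.
  have gM := good_convM t (x + t *: z) gK cg gG.
  rewrite conv_shift /conv -(RI_shift z gM); apply: eq_RI => w.
  by rewrite scalerDr opprD addrACA subrr addr0.
have cs z := @continuous_shiftv _ g z cg.
have gMs z : exists D, good D (fun w => K (w + z) * g (x - t *: w)).
  by have [D gD] := good_shift z gK; exists (D * G); exact: good_convM gD cg gG.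
have [D1 g1] := gMs (2^-1 *: h); have [D2 g2] := gMs (- (2^-1 *: h)).
transitivity (RI (fun w => K (w + 2^-1 *: h) * g (x - t *: w) - K (w - 2^-1 *: h) * g (x - t *: w))).
  by apply: eq_RI => w; rewrite /diff1 mulrBl.
rewrite (RIB g1 g2) !sh -(convB t x gK (cs _) (cs _) (fun y => gG _) (fun y => gG _)).
by apply: eq_conv => // y; rewrite /diff1 scalerN !scalerA mulrC.
Qed.

Lemma diff1_diffk k h g : diff1 h (diffk k h g) = diffk k h (diff1 h g).
Proof. by elim: k g => [//|k IH] g /=. Qed.

(** At scale [t] a difference of step [h] of the kernel becomes one of step [t h] of the function.
    With [diffk_conv], differences move freely between input, kernel and output. *)
Lemma conv_diffk (C G : R) K t g h k x : good C K -> continuous g -> (forall y, `|g y| <= G) ->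
  conv (diffk k h K) t g x = conv K t (diffk k (t *: h) g) x.
Proof.
elim: k C G K g => [//|k IH] C G K g gK cg gG /=.
have [D gD] := good_diff1 h gK.
rewrite (IH _ _ _ _ gD cg gG).
rewrite (conv_diff1 _ _ _ gK (@continuous_diffk k (t *: h) g cg) (diffk_bound k (t *: h) gG)).
by rewrite diff1_diffk.
Qed.

End Convolution.

(** * Smooth symbols, decay of their kernels and Bernstein's inequality *)

Section Multipliers.
Context {R : realType} {n : nat}.
Implicit Types (u v g : 'rV[R]_n -> R) (x h : 'rV[R]_n) (i : 'I_n).

Lemma enorm_ge0 x : 0 <= enorm x. Proof. exact: sqrtr_ge0. Qed.

Lemma enorm_sqr x : enorm x ^+ 2 = \sum_(i < n) x 0 i ^+ 2.
Proof. by rewrite sqr_sqrtr // sumr_ge0 // => k _; exact: sqr_ge0. Qed.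

Lemma coord_le_enorm x i : `|x 0 i| <= enorm x.
Proof.
rewrite -(@ler_pXn2r _ 2) ?nnegrE ?enorm_ge0 // enorm_sqr real_normK ?num_real //.
by rewrite (bigD1 i) //= lerDl sumr_ge0 // => k _; exact: sqr_ge0.
Qed.

Lemma enorm_le_sum x : enorm x <= \sum_(i < n) `|x 0 i|.
Proof.
rewrite -(@ler_pXn2r _ 2) ?nnegrE ?enorm_ge0 ?sumr_ge0 // enorm_sqr.
elim: (index_enum _) => [|k r IH]; first by rewrite !big_nil expr0n.
rewrite !big_cons; set A := \sum_(j <- r) `|x 0 j| in IH *.
have A0 : 0 <= A by apply: sumr_ge0.
rewrite -[x 0 k ^+ 2]real_normK ?num_real // sqrrD.
have := mulr_ge0 (normr_ge0 (x 0 k)) A0; lra.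
Qed.

Lemma enormZ c x : enorm (c *: x) = `|c| * enorm x.
Proof.
rewrite /enorm; under eq_bigr do rewrite mxE exprMn.
by rewrite -mulr_sumr sqrtrM ?sqr_ge0 // sqrtr_sqr.
Qed.

Lemma enormN x : enorm (- x) = enorm x.
Proof. by rewrite -scaleN1r enormZ normrN1 mul1r. Qed.

Lemma enorm_evec i : enorm (evec R i) = 1.
Proof.
apply/eqP; rewrite -(@eqrXn2 _ 2) ?enorm_ge0 // enorm_sqr expr1n (bigD1 i) //=.
rewrite evecE eqxx expr1n big1 ?addr0 // => k ki.
by rewrite evecE (negbTE ki) expr0n.
Qed.

Lemma enorm_inbox b x : inbox b x -> enorm x <= n%:R * b.
Proof.
move=> bx; rewrite (le_trans (enorm_le_sum x)) // -[n in n%:R](card_ord n) mulr_natl -sumr_const.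
by apply: ler_sum => k _.
Qed.

Lemma inbox_enorm x : inbox (enorm x) x.
Proof. by move=> k; exact: coord_le_enorm. Qed.

Lemma dotp_le h x b : inbox b x -> `|dotp h x| <= n%:R * b * enorm h.
Proof.
move=> bx; rewrite (le_trans (ler_norm_sum _ _ _)) //.
rewrite -mulrA -[n in n%:R](card_ord n) mulr_natl -sumr_const.
apply: ler_sum => k _; rewrite normrM mulrC ler_pM //; exact: coord_le_enorm.
Qed.

(** Bounded difference quotients of every order are what makes the transforms decay faster than any
    power of [maj]. *)
Definition multiplier u := [/\ continuous u, exists2 B, 0 <= B & csupp B u &
  forall i m b, exists C, dclass i m b C u].

Lemma dclass_all u m b : (forall i m b, exists C, dclass i m b C u) ->
  exists2 C, 0 < C & forall i, dclass i m b C u.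
Proof.
move=> du; pose c i := projT1 (cid (du i m b)).
have cP i : dclass i m b (c i) u by exact: projT2 (cid (du i m b)).
exists (1 + \sum_i `|c i|); first by rewrite ltr_pwDl // sumr_ge0.
move=> i; apply: dclass_mono (cP i) => //.
rewrite (bigD1 i) //= addrCA (le_trans (ler_norm _)) // lerDl.
by rewrite addr_ge0 // sumr_ge0.
Qed.

Lemma multiplier_good u : (0 < n)%N -> multiplier u -> exists C, good C u.
Proof.
move=> n0 [cu [B B0 sB] du]; have [C C0 dC] := dclass_all 0 B du.
exists (C * (1 + B ^+ 2) ^+ n); apply: csupp_good => // x.
case: (pselect (inbox B x)) => [bx|/sB ->]; last by rewrite normr0 ltW.
exact: (dC (Ordinal n0) x bx).
Qed.

Lemma FT_multiplier_decay u P : (0 < n)%N -> multiplier u ->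
  exists2 C, 0 < C & forall a x, `|FT a u x| <= C * maj x ^+ P.
Proof.
move=> n0 [cu [B B0 sB] du]; have [K K0 [m [b H]]] := @FT_decay R n B P n0 B0.
have [C C0 dC] := dclass_all m b du; exists (C * K); first exact: mulr_gt0.
by move=> a x; exact: H.
Qed.

Lemma FT_multiplier_good u : (0 < n)%N -> multiplier u ->
  exists2 C, 0 < C & forall a, good C (FT a u).
Proof.
move=> n0 mu; have [D gD] := multiplier_good n0 mu.
have [C C0 HC] := FT_multiplier_decay 1 n0 mu; exists C => // a.
split; first exact: continuous_FT gD.
by move=> x; have := HC a x; rewrite expr1.
Qed.

Lemma multiplierM u v : multiplier u -> continuous v ->
  (forall i m b, exists C, dclass i m b C v) -> multiplier (fun x => u x * v x).
Proof.
move=> [cu [B B0 sB] du] cv dv; split.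
- exact: continuous_mulf.
- by exists B => // x /sB ->; rewrite mul0r.
- move=> i m b; have [C1 h1] := du i m b; have [C2 h2] := dv i m b.
  by exists (2 ^+ m * C1 * C2); exact: dclassM.
Qed.

Lemma multiplierD u v : multiplier u -> multiplier v -> multiplier (fun x => u x + v x).
Proof.
move=> [cu [B B0 sB] du] [cv [B' B0' sB'] dv]; split.
- exact: continuous_addf.
- exists (B + B'); first exact: addr_ge0.
  move=> x nx; rewrite sB ?sB' ?addr0 // => bx; apply: nx; apply: inbox_le bx.
    by rewrite lerDr.
  by rewrite lerDl.
- move=> i m b; have [C1 h1] := du i m b; have [C2 h2] := dv i m b.
  by exists (C1 + C2); exact: dclassD.
Qed.

Lemma multiplierZ u c : multiplier u -> multiplier (fun x => c * u x).
Proof.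
move=> [cu [B B0 sB] du]; split.
- by apply: continuous_mulf cu; exact: continuous_cstf.
- by exists B => // x /sB ->; rewrite mulr0.
- move=> i m b; have [C1 h1] := du i m b.
  by exists (`|c| * C1); exact: dclassZ.
Qed.

Lemma multiplierB u v : multiplier u -> multiplier v -> multiplier (fun x => u x - v x).
Proof.
move=> mu mv; have := multiplierD mu (multiplierZ (-1) mv).
by congr multiplier; apply/funext => x; rewrite mulN1r.
Qed.

Lemma schwartz_multiplier u (c B : R) : schwartz u -> csupp B u -> 0 <= B -> c != 0 ->
  multiplier (fun x => u (c *: x)).
Proof.
move=> [su bu] sB B0 c0; split.
- apply: (continuous_compf ((su 0%N).2 [::] isT)).
  apply: rV_continuous => i; under eq_fun do rewrite mxE.
  by apply: continuous_mulf; [exact: continuous_cstf|exact: continuous_coord].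
- exists (B / `|c|); first by rewrite divr_ge0.
  move=> x nx; apply: sB => bx; apply: nx => i.
  by have := bx i; rewrite mxE normrM mulrC ler_pdivlMr // normr_gt0.
- move=> i m b.
  pose D k := dpow (nseq k i) u.
  have [M HM] : exists M : R, forall k x, (k <= m)%N -> `|D k x| <= M.
    elim: m => [|m [M HM]].
      have [M HM] := bu (fun _ => 0%N) [::]; exists M => k x; rewrite leqn0 => /eqP ->.
      by have := HM x; rewrite /monomial big1 ?mul1r.
    have [M' HM'] := bu (fun _ => 0%N) (nseq m.+1 i).
    exists (Num.max M M') => k x; rewrite leq_eqVlt ltnS => /orP[/eqP ->|km].
      rewrite le_max; have := HM' x; rewrite /monomial big1 ?mul1r // => ->.
      by rewrite orbT.
    by rewrite le_max HM.
  pose g k x := c ^+ k * D k (c *: x).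
  exists ((1 + `|c|) ^+ m * M).
  have := @dclass_deriv R n i m b ((1 + `|c|) ^+ m * M) g.
  rewrite (_ : g 0%N = fun x => u (c *: x)); last by apply/funext => x; rewrite /g expr0 mul1r.
  have M0 : 0 <= M by exact: le_trans (normr_ge0 _) (HM 0%N 0 (leq0n _)).
  apply => k x km; last first.
    rewrite /g normrM ler_pM ?HM // normrX.
    apply: (@le_trans _ _ ((1 + `|c|) ^+ k)); first by rewrite lerXn2r ?nnegrE ?addr_ge0 // lerDr.
    by apply: ler_weXn2l => //; rewrite lerDl.
  have dD : is_derive (c *: x) (evec R i) (D k) (D k.+1 (c *: x)).
    have := (su k.+1).1 (nseq k i); rewrite size_nseq => /(_ (leqnn _) i (c *: x)) h.
    exact: derivableP.
  have -> : g k.+1 x = c ^+ k *: (c *: D k.+1 (c *: x)).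
    by rewrite /g exprSr /GRing.scale /= mulrA.
  have -> : g k = c ^+ k \*: (fun x => D k (c *: x)) by [].
  have dS : is_derive x (evec R i) (fun x => D k (c *: x)) (c *: D k.+1 (c *: x)).
    have dl : is_derive (0 : R) 1 (fun s : R => D k (c *: x + s *: evec R i)) (D k.+1 (c *: x)).
      by apply: is_derive_line; rewrite scale0r addr0.
    have dl2 : is_derive (0 : R) 1 (fun s : R => D k (c *: x + (c * s) *: evec R i)) (c *: D k.+1 (c *: x)).
      have dm : is_derive (0 : R) 1 (fun s : R => c * s) c.
        by apply: is_derive_eq; rewrite /GRing.scale /= mulr1.
      have := @is_derive1_comp _ (fun s : R => D k (c *: x + s *: evec R i)) (fun s : R => c * s) 0 (D k.+1 (c *: x)) c.
      rewrite mulr0 => /(_ dl dm).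
      by rewrite /GRing.scale /= mulrC.
    case: dl2 => d2 e2.
    have E : (fun h : R => h^-1 *: (D k (c *: (h *: evec R i + x)) - D k (c *: x))) =
             (fun h : R => h^-1 *: (D k (c *: x + (c * (h *: (1 : R) + 0)) *: evec R i) - D k (c *: x + (c * 0) *: evec R i))).
      apply/funext => h; congr (_ *: (D k _ - D k _)).
        by rewrite scalerDr scalerA addrC addr0 /GRing.scale /= mulr1.
      by rewrite mulr0 scale0r addr0.
    by split; [rewrite /derivable /shift /= E|rewrite /derive /shift /= E].
  by apply: is_deriveZ.
Qed.

(** The symbol of a difference of step [h], divided by [|h|], stays bounded uniformly in [h]; this
    is how [diffk_FT_decay] extracts the factor [|h| ^ k]. *)
Lemma dclass_sinq i m b : exists2 C, 0 < C & forall h, 0 < enorm h <= 1 ->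
  dclass i m b C (fun x => -2 * sin (pi * dotp h x) / enorm h).
Proof.
pose C := 2 * pi * (n%:R * `|b|) + 2 * pi * (1 + 2 * pi * 1) ^+ m : R.
have P0 : 0 < 2 * pi :> R by rewrite mulr_gt0 // pi_gt0.
have P1 : 0 < 1 + 2 * pi * 1 :> R by rewrite mulr1 ltr_wpDr // ltW.
have C1 : 0 <= 2 * pi * (n%:R * `|b|) :> R by rewrite !mulr_ge0 // pi_ge0.
have C2 : 0 < 2 * pi * (1 + 2 * pi * 1) ^+ m :> R by rewrite mulr_gt0 // exprn_gt0.
exists C; first by rewrite ltr_wpDl.
move=> h /andP[h0 h1].
have bnd x : inbox b x -> `|-2 * sin (pi * dotp h x) / enorm h| <= C.
  move=> bx; rewrite !normrM normfV (ger0_norm (ltW h0)) normrN normr_nat ler_pdivrMr //.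
  apply: (@le_trans _ _ (2 * pi * (n%:R * `|b|) * enorm h)); last by rewrite ler_wpM2r ?(ltW h0) // /C lerDl (ltW C2).
  rewrite -!mulrA ler_wpM2l // (le_trans (ler_norm_sin _)) // normrM (ger0_norm (pi_ge0 _)).
  rewrite ler_wpM2l ?pi_ge0 // (le_trans (dotp_le _ bx)) // mulrA ler_wpM2r ?(ltW h0) // ler_wpM2l //.
  exact: ler_norm.
case: m @C C2 bnd => [|m] C C2 bnd //=; split => // t t0 t1.
set d := pi * h 0 i * t.
have hb : inbox 1 (2^-1 *: h).
  move=> k; rewrite mxE normrM ger0_norm ?invr_ge0 //.
  have := le_trans (coord_le_enorm h k) h1 => ?.
  by rewrite mulrC ler_pdivrMr //; lra.
have cb : `|4 * sin (d / 2) / (enorm h * t)| <= 2 * pi.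
  rewrite !normrM normfV normrM normr_nat (ger0_norm (ltW h0)).
  rewrite ler_pdivrMr ?mulr_gt0 ?normr_gt0 //.
  have := ler_norm_sin (d / 2); rewrite normrM [ `|2^-1| ]ger0_norm ?invr_ge0 // ler_pdivlMr // => hs.
  have : `|d| <= pi * enorm h * `|t|.
    rewrite /d !normrM (ger0_norm (pi_ge0 _)) ler_wpM2r // ler_wpM2l ?pi_ge0 //.
    exact: coord_le_enorm.
  move=> hd; rewrite [leRHS](_ : _ = 2 * (pi * enorm h * `|t|)); last by ring.
  by move: (`|sin (d / 2)|) hs hd => A; lra.
have := @dclass_cos R n i m (b - 1) (2 * pi) 1 _ (pi - d / 2) _ cb hb.
move=> D; apply: dclass_mono (eq_dclass _ D) => //.
  rewrite /C (@le_trans _ _ (2 * pi * (1 + 2 * pi * 1) ^+ m.+1)) //; last by rewrite lerDr.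
  by rewrite ler_wpM2l ?(ltW P0) // ler_weXn2l // mulr1 lerDl (ltW P0).
move=> x.
have -> : -2 * sin (pi * dotp h (x + t *: evec R i)) / enorm h - -2 * sin (pi * dotp h x) / enorm h =
   (-2 / enorm h) * (sin (pi * dotp h x + d) - sin (pi * dotp h x)).
  by rewrite dotpDr dotpZr dotp_evec /d mulrDr [pi * (t * _)](_ : _ = pi * h 0 i * t); [|ring]; field; rewrite gt_eqF.
rewrite !(sinE (pi * _ + _)) !(sinE (pi * _)) [_ + d - _]addrAC cosB_cos dotpZl.
have -> : 2 * pi * (2^-1 * dotp h x) - (pi - d / 2) = pi * dotp h x - pi / 2 + d / 2 - pi / 2 by field.
by field; rewrite t0 gt_eqF.
Qed.

Lemma diffk_FT_decay u k P : (0 < n)%N -> multiplier u ->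
  exists2 C, 0 < C & forall a h x, enorm h <= 1 ->
  `|diffk k h (FT a u) x| <= C * enorm h ^+ k * maj x ^+ P.
Proof.
move=> n0 mu; have [cu [B B0 sB] du] := mu.
have [D gu] := multiplier_good n0 mu.
have [K K0 [m [b H]]] := @FT_decay R n B P n0 B0.
have [C1 C10 d1] := dclass_all m b du.
pose c i := projT1 (cid2 (dclass_sinq i m b)).
have c0 i : 0 < c i by rewrite /c; case: cid2.
have cP i : forall h, 0 < enorm h <= 1 ->
    dclass i m b (c i) (fun x => -2 * sin (pi * dotp h x) / enorm h).
  by rewrite /c; case: cid2.
pose S := \sum_i c i.
have S0 : 0 < S.
  rewrite /S (bigD1 (Ordinal n0)) //= ltr_pwDl // sumr_ge0 // => i _; exact/ltW.
pose C := (2 ^+ m * S) ^+ k * C1.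
exists (C * K + C * K); first by rewrite addr_gt0 // !mulr_gt0 // exprn_gt0 // mulr_gt0.
have Ck0 : 0 < C * K by rewrite !mulr_gt0 // exprn_gt0 // mulr_gt0.
(* For [h = 0] the division by [|h|] is meaningless; the difference is then 0, except for [k = 0],
   where it is the transform itself. *)
move=> a h x h1; case: (ltP 0 (enorm h)) => [h0|hle]; last first.
  have h0 : enorm h = 0 by apply/eqP; rewrite eq_le hle enorm_ge0.
  have {h0} hz : h = 0.
    apply: rV_ext => i; rewrite mxE; apply/eqP; rewrite -normr_le0.
    by rewrite (le_trans (coord_le_enorm h i)) // h0.
  rewrite hz; case: k @C Ck0 => [|k] C Ck0; last first.
    have -> : diffk k.+1 0 (FT a u) x = 0.
      rewrite /= (_ : diff1 0 (FT a u) = fun _ => 0); last first.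
        by apply/funext => y; rewrite /diff1 scaler0 subr0 addr0 subrr.
      elim: k {Ck0 C} => [//|k IH] /=; rewrite (_ : diff1 0 (fun _ => 0) = fun _ : 'rV[R]_n => 0 : R) //.
      by apply/funext => y; rewrite /diff1 subrr.
    by rewrite normr0 !mulr_ge0 ?exprn_ge0 ?enorm_ge0 ?maj_ge0 // addr_ge0 ?ltW.
  rewrite /= expr0 mulr1; apply: (le_trans (H C1 a u cu sB d1 x)).
  rewrite ler_wpM2r ?exprn_ge0 ?maj_ge0 // /C expr0 mul1r lerDl.
  by rewrite ltW // mulr_gt0.
rewrite (diffk_FT _ _ _ _ gu).
have := H (C * enorm h ^+ k) (a + k%:R * (pi / 2)) (fun xi => (-2 * sin (pi * dotp h xi)) ^+ k * u xi).
move=> /(_ _ _ _ x) HH; apply: (le_trans (HH _ _ _)).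
- apply: continuous_mulf cu.
  have cs : continuous (fun xi : 'rV[R]_n => -2 * sin (pi * dotp h xi)).
    apply: continuous_mulf; first exact: continuous_cstf.
    apply: (continuous_compf (@continuous_sin R)); apply: continuous_mulf; first exact: continuous_cstf.
    by apply: continuous_dotp; [exact: cst_continuous|exact: continuous_idf].
  by apply: (continuous_compf (@exprn_continuous R k) cs).
- by move=> y /sB ->; rewrite mulr0.
- move=> i; have h01 : 0 < enorm h <= 1 by rewrite h0.
  have ciS : c i <= S by rewrite /S (bigD1 i) //= lerDl sumr_ge0 // => j _; exact/ltW.
  have dS := dclass_mono (lexx _) ciS (cP i h h01).
  have := dclassZ (enorm h ^+ k) (dclass_expM k dS (d1 i)).
  rewrite ger0_norm ?exprn_ge0 ?enorm_ge0 // mulrC.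
  apply: eq_dclass => y; rewrite mulrA -exprMn; congr (_ ^+ _ * _).
  by rewrite mulrC mulfVK // gt_eqF.
rewrite ler_wpM2r ?exprn_ge0 ?maj_ge0 // mulrAC ler_wpM2r ?exprn_ge0 ?enorm_ge0 //.
by rewrite lerDl ltW.
Qed.

Lemma Bernstein u k a : (0 < n)%N -> multiplier u ->
  exists2 C, 0 < C & forall G t h g x, 0 < t -> continuous g -> (forall y, `|g y| <= G) ->
  `|diffk k h (conv (FT a u) t g) x| <= C * (enorm h / t) ^+ k * G.
Proof.
move=> n0 mu; have [C C0 HC] := diffk_FT_decay k 1 n0 mu.
have [D D0 gD] := FT_multiplier_good n0 mu.
exists (C * pi ^+ n + 2 ^+ k * (D * pi ^+ n)).
  by rewrite addr_gt0 // !mulr_gt0 ?exprn_gt0 ?pi_gt0.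
move=> G t h g x t0 cg gG; have G0 : 0 <= G by exact: le_trans (gG 0).
have q0 : 0 <= enorm h / t by rewrite divr_ge0 ?enorm_ge0 // ltW.
have pn : 0 < pi ^+ n :> R by rewrite exprn_gt0 // pi_gt0.
(* If [|h| <= t] the differences fall on the kernel and gain [(|h| / t) ^ k]. Otherwise this factor
   is at least 1 and the trivial bound [2 ^ k] suffices. *)
case: (leP (enorm h / t) 1) => ht.
  have E : diffk k h (conv (FT a u) t g) x = conv (diffk k (t^-1 *: h) (FT a u)) t g x.
    by rewrite (conv_diffk _ _ _ _ (gD a) cg gG) scalerA mulfV ?gt_eqF // scale1r (diffk_conv _ _ _ _ (gD a) cg gG).
  have eh : enorm (t^-1 *: h) = enorm h / t by rewrite enormZ ger0_norm ?invr_ge0 ?ltW // mulrC.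
  have gK : good (C * (enorm h / t) ^+ k) (diffk k (t^-1 *: h) (FT a u)).
    split; first exact: continuous_diffk (gD a).1.
    by move=> y; have := HC a (t^-1 *: h) y; rewrite eh expr1; apply.
  rewrite E; apply: (le_trans (conv_bound t x gK cg gG)).
  have := RI_bound (good_norm gK); rewrite ger0_norm; last by apply: RI_ge0 => y.
  move=> hb; rewrite mulrC ler_wpM2r // (le_trans hb) // mulrAC ler_wpM2r ?exprn_ge0 //.
  by rewrite lerDl !mulr_ge0 ?exprn_ge0 ?pi_ge0 // ltW.
rewrite (diffk_conv _ _ _ _ (gD a) cg gG).
have cd := @continuous_diffk R n k h g cg.
apply: (le_trans (conv_bound t x (gD a) cd (diffk_bound k h gG))).
have := RI_bound (good_norm (gD a)); rewrite ger0_norm; last by apply: RI_ge0 => y.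
move=> hb; rewrite mulrAC ler_wpM2r //.
apply: (@le_trans _ _ (2 ^+ k * (D * pi ^+ n))); first by rewrite ler_wpM2l ?exprn_ge0.
rewrite mulrDl (@le_trans _ _ (2 ^+ k * (D * pi ^+ n) * (enorm h / t) ^+ k)) //.
  by rewrite ler_peMr ?exprn_ege1 ?(ltW ht) // !mulr_ge0 ?exprn_ge0 ?pi_ge0 // ltW.
by rewrite lerDr !mulr_ge0 ?exprn_ge0 ?pi_ge0 // ltW.
Qed.

End Multipliers.

(** * Littlewood-Paley pieces *)

Section LittlewoodPaley.
Context {R : realType} {n : nat} (n0 : (0 < n)%N).
Context (eta : 'rV[R]_n -> R) (eta_LP : LP_eta eta).
Implicit Types (u v g f : 'rV[R]_n -> R) (x h : 'rV[R]_n) (i : 'I_n).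

Local Notation theta := (LP_theta eta).

Lemma conv_FT_scale C G a u c t g x : good C u -> (forall b, good C (FT b u)) -> 0 < c ->
  continuous g -> (forall y, `|g y| <= G) ->
  conv (FT a (fun xi => u (c *: xi))) t g x = conv (FT a u) (c * t) g x.
Proof.
move=> gu gFu c0 cg gG.
have gM := good_convM (c * t) x (gFu a) cg gG.
have ci : 0 < c^-1 by rewrite invr_gt0.
have [D gD] := good_scale ci gM.
transitivity (RI (fun z => c ^- n * (FT a u (c^-1 *: z) * g (x - (c * t) *: (c^-1 *: z))))).
  apply: eq_RI => z; rewrite (FT_scale a z c0 gu) mulrA; congr (_ * g (x - _)).
  by rewrite scalerA mulrAC mulfV ?mul1r // gt_eqF.
rewrite (RIZ _ gD) (RI_scale ci gM) exprVn invrK mulKf // expf_neq0 // gt_eqF //.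
Qed.

Lemma conv_FT_mul G a u v t g x : multiplier u -> multiplier v -> (forall y, v (- y) = v y) ->
  continuous g -> (forall y, `|g y| <= G) ->
  conv (FT a u) t (conv (FT 0 v) t g) x = conv (FT a (fun xi => u xi * v xi)) t g x.
Proof.
move=> mu mv ev cg gG.
have [Cu gu] := multiplier_good n0 mu; have [Cv gv] := multiplier_good n0 mv.
have [D1 D10 g1] := FT_multiplier_good n0 mu; have [D2 D20 g2] := FT_multiplier_good n0 mv.
have [D3 D30 h3] := FT_multiplier_decay 2 n0 mv.
have D0 : 0 <= D1 + D3 by rewrite addr_ge0 // ltW.
rewrite (@conv_conv R n (D1 + D3) G); last 5 first.
- by apply: good_le (g1 a); rewrite lerDl ltW.
- by case: (g2 0).
- move=> z; rewrite (le_trans (h3 0 z)) // ler_wpM2r ?exprn_ge0 ?maj_ge0 //.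
  by rewrite lerDr ltW.
- exact: cg.
- exact: gG.
apply: eq_conv => // z.
have le1 : Cu <= Cu + Cv by rewrite lerDl (good_ge0 gv).
have le2 : Cv <= Cu + Cv by rewrite lerDr (good_ge0 gu).
exact: (FT_mul a z (good_le le1 gu) (good_le le2 gv) ev (g2 0) (g2 (pi / 2))).
Qed.

Lemma eta_csupp : csupp (3 / 2) eta.
Proof.
case: eta_LP => _ _ _ e0 x nx; apply: e0; rewrite leNgt; apply/negP => lt; apply: nx.
by apply: inbox_le (inbox_enorm x); exact: ltW.
Qed.

Lemma eta_multiplier (c : R) : c != 0 -> multiplier (fun x => eta (c *: x)).
Proof.
case: eta_LP => se _ _ _ c0; apply: schwartz_multiplier se eta_csupp _ c0.
by rewrite divr_ge0.
Qed.

Lemma eta_multiplier1 : multiplier eta.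
Proof.
have := eta_multiplier (oner_neq0 R).
by congr multiplier; apply/funext => x; rewrite scale1r.
Qed.

Lemma theta_multiplier : multiplier theta.
Proof. by apply: multiplierB; [exact: eta_multiplier1|apply: eta_multiplier; rewrite pnatr_eq0]. Qed.

(** Symmetrization of [eta]: the convolution theorem is stated for an even symbol. *)
Definition etae x : R := 2^-1 * (eta x + eta (- x)).

Lemma etae_multiplier (c : R) : c != 0 -> multiplier (fun x => etae (c *: x)).
Proof.
move=> c0; apply: multiplierZ; apply: multiplierD; first exact: eta_multiplier.
have c0' : - c != 0 by rewrite oppr_eq0.
have := eta_multiplier c0'.
by congr multiplier; apply/funext => x; rewrite scaleNr.
Qed.

Lemma etae_even x : etae (- x) = etae x.
Proof. by rewrite /etae opprK addrC. Qed.

Lemma etae1 x : enorm x <= 1 -> etae x = 1.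
Proof.
by case: eta_LP => _ _ e1 _ hx; rewrite /etae !e1 ?enormN //; field.
Qed.

Lemma etae0 x : 3 / 2 <= enorm x -> etae x = 0.
Proof.
by case: eta_LP => _ _ _ e0 hx; rewrite /etae !e0 ?enormN // addr0 mulr0.
Qed.

Lemma theta0_small x : enorm x <= 1 / 2 -> theta x = 0.
Proof.
case: eta_LP => _ _ e1 _ hx; rewrite /LP_theta !e1 ?subrr //.
  by rewrite enormZ normr_nat; lra.
by rewrite (le_trans hx) // ler_pdivrMr //; lra.
Qed.

Lemma theta0_large x : 3 / 2 <= enorm x -> theta x = 0.
Proof.
case: eta_LP => _ _ _ e0 hx; rewrite /LP_theta !e0 ?subrr //.
rewrite enormZ normr_nat (le_trans hx) // ler_peMl ?enorm_ge0 //.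
by rewrite ler1n.
Qed.

Definition lpb (j : nat) : 'rV[R]_n -> R := if j is 0 then eta else theta.
(** A wider even symbol, equal to 1 wherever [lpb j] is nonzero, so that its kernel reproduces the
    j-th piece. *)
Definition lpt (j : nat) : 'rV[R]_n -> R := fun x =>
  etae (2^-1 *: x) - (if j is 0 then 0 else etae (4 *: x)).

Lemma lpb_multiplier j : multiplier (lpb j).
Proof. by case: j => [|j]; [exact: eta_multiplier1|exact: theta_multiplier]. Qed.

Lemma lpb_scale_multiplier j (c : R) : c != 0 -> multiplier (fun x => lpb j (c *: x)).
Proof.
case: j => [|j] c0 /=; first exact: eta_multiplier.
apply: multiplierB; first exact: eta_multiplier.
have c2 : 2 * c != 0 by rewrite mulf_neq0 // pnatr_eq0.
have := eta_multiplier c2.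
by congr multiplier; apply/funext => x; rewrite scalerA.
Qed.

Lemma lpt_multiplier j : multiplier (lpt j).
Proof.
have h2 : 2^-1 != 0 :> R by rewrite invr_neq0 // pnatr_eq0.
case: j => [|j]; rewrite /lpt.
  have := etae_multiplier h2.
  by congr multiplier; apply/funext => x; rewrite subr0.
by apply: multiplierB; apply: etae_multiplier; rewrite // pnatr_eq0.
Qed.

Lemma lpt_even j x : lpt j (- x) = lpt j x.
Proof. by rewrite /lpt !scalerN !etae_even; case: j => //= j; rewrite etae_even. Qed.

Lemma lpb_lpt j x : lpb j x * lpt j x = lpb j x.
Proof.
case: (leP (3 / 2) (enorm x)) => hx.
  suff -> : lpb j x = 0 by rewrite mul0r.
  case: j => [|j] /=; last exact: theta0_large.
  by case: eta_LP => _ _ _ e0; exact: e0.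
have h1 : etae (2^-1 *: x) = 1.
  by apply: etae1; rewrite enormZ ger0_norm ?invr_ge0 // mulrC ler_pdivrMr //; lra.
case: j => [|j]; rewrite /lpt h1 /=; first by rewrite subr0 mulr1.
case: (leP (enorm x) (1 / 2)) => hx2; first by rewrite theta0_small // mul0r.
rewrite etae0 ?subr0 ?mulr1 // enormZ normr_nat.
by move: hx2; lra.
Qed.

(** Three levels apart, that is at a ratio 8 of the scales, the dyadic annuli no longer meet. *)
Lemma lpb_lpt_disjoint l j (c : R) x : ((l + 3 <= j)%N /\ 8 <= c) \/ ((j + 3 <= l)%N /\ 0 < c <= 1 / 8) ->
  lpb l (c *: x) * lpt j x = 0.
Proof.
move=> [[lj c8]|[jl /andP[c0 c8]]].
  have -> : lpt j x = lpt 1 x by case: j lj => [|j] //; rewrite addnS.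
  case: (leP (enorm x) (1 / 4)) => hx.
    rewrite /lpt !etae1 ?subrr ?mulr0 //.
      by rewrite enormZ normr_nat; lra.
    rewrite enormZ ger0_norm ?invr_ge0 // mulrC ler_pdivrMr //; lra.
  have cx : 3 / 2 <= enorm (c *: x).
    rewrite enormZ ger0_norm; last by lra.
    have : 8 * enorm x <= c * enorm x by rewrite ler_wpM2r ?enorm_ge0.
    by lra.
  suff -> : lpb l (c *: x) = 0 by rewrite mul0r.
  case: l lj => [|l] lj /=; last exact: theta0_large.
  by case: eta_LP => _ _ _ e0; exact: e0.
have -> : lpb l (c *: x) = theta (c *: x) by case: l jl => [|l] //; rewrite addnS.
case: (leP (enorm (c *: x)) (1 / 2)) => hx; first by rewrite theta0_small // mul0r.
have hx3 : 3 <= enorm x.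
  move: hx; rewrite enormZ (ger0_norm (ltW c0)) => hx.
  have : c * enorm x <= 1 / 8 * enorm x by rewrite ler_wpM2r ?enorm_ge0.
  by lra.
have z1 : etae (2^-1 *: x) = 0.
  apply: etae0; rewrite enormZ ger0_norm ?invr_ge0 //; lra.
have z2 : etae (4 *: x) = 0 by apply: etae0; rewrite enormZ normr_nat; lra.
by rewrite /lpt z1 z2; case: (j) => [|?]; rewrite subrr mulr0.
Qed.

Lemma invFT_FT C u x : good C u -> invFT u x = (FT 0 u x, FT (pi / 2) u x).
Proof.
move=> gu; rewrite /invFT /FT; congr pair.
  rewrite -(Rintn_RI (good_phase 0 x gu)); congr Rintn.
  by apply/funext => xi; rewrite subr0.
rewrite -(Rintn_RI (good_phase (pi / 2) x gu)); congr Rintn.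
by apply/funext => xi; rewrite cosBpihalf.
Qed.

Lemma LPphiE j x : LPphi eta j x = ((2 ^+ j) ^+ n * FT 0 (lpb j) ((2 ^+ j : R) *: x),
                                    (2 ^+ j) ^+ n * FT (pi / 2) (lpb j) ((2 ^+ j : R) *: x)).
Proof.
have [C gC] := multiplier_good n0 (lpb_multiplier j).
case: j C gC => [|j] C gC; first by rewrite /LPphi (invFT_FT _ gC) expr0 expr1n !mul1r scale1r.
by rewrite /LPphi -exprM (invFT_FT _ gC).
Qed.

Lemma Rintn_LPphi G a j g x : continuous g -> (forall y, `|g y| <= G) ->
  Rintn (fun y => (2 ^+ j) ^+ n * FT a (lpb j) ((2 ^+ j : R) *: (x - y)) * g y) =
  conv (FT a (lpb j)) (2 ^- j) g x.
Proof.
move=> cg gG; have [C C0 gF] := FT_multiplier_good n0 (lpb_multiplier j).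
set c : R := 2 ^+ j; have c0 : 0 < c by rewrite exprn_gt0.
have gM := good_convM (c^-1) x (gF a) cg gG.
have [D gD] := good_scale c0 (goodZ (c ^+ n) gM).
have gF' : good D (fun z => c ^+ n * FT a (lpb j) (c *: z) * g (x - z)).
  apply: eq_good gD => z; rewrite mulrA; congr (_ * g (x - _)).
  by rewrite scalerA mulVf ?scale1r // gt_eqF.
have gF2 : exists D', good D' (fun y => c ^+ n * FT a (lpb j) (c *: (x - y)) * g y).
  have [D' h'] := good_shift (- x) (good_opp gF').
  exists D'; apply: eq_good h' => y /=.
  by rewrite opprD opprK [- y + x]addrC opprB addrCA subrr addr0.
have [D' gD'] := gF2.
rewrite (Rintn_RI gD') -(RI_subl x gD').
transitivity (RI (fun z => c ^+ n * (FT a (lpb j) (c *: z) * g (x - c^-1 *: (c *: z))))).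
  apply: eq_RI => z; rewrite opprB addrCA subrr addr0 mulrA; congr (_ * g (x - _)).
  by rewrite scalerA mulVf ?scale1r // gt_eqF.
have [D2 gD2] := good_scale c0 gM.
by rewrite (RIZ _ gD2) (RI_scale c0 gM) mulVKf // expf_neq0 // gt_eqF.
Qed.

Lemma LPconv_absE G j g x : continuous g -> (forall y, `|g y| <= G) ->
  LPconv_abs eta j g x = Num.sqrt (conv (FT 0 (lpb j)) (2 ^- j) g x ^+ 2 +
                                   conv (FT (pi / 2) (lpb j)) (2 ^- j) g x ^+ 2).
Proof.
move=> cg gG; rewrite /LPconv_abs -!(Rintn_LPphi _ _ _ cg gG).
have E1 : (fun y => (LPphi eta j (x - y)).1 * g y) =
  (fun y => (2 ^+ j) ^+ n * FT 0 (lpb j) ((2 ^+ j : R) *: (x - y)) * g y).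
  by apply/funext => y; rewrite LPphiE.
have E2 : (fun y => (LPphi eta j (x - y)).2 * g y) =
  (fun y => (2 ^+ j) ^+ n * FT (pi / 2) (lpb j) ((2 ^+ j : R) *: (x - y)) * g y).
  by apply/funext => y; rewrite LPphiE.
by rewrite E1 E2.
Qed.

Lemma conv_theta G t g x : continuous g -> (forall y, `|g y| <= G) ->
  conv (FT 0 theta) t g x = conv (FT 0 eta) t g x - conv (FT 0 eta) (2 * t) g x.
Proof.
move=> cg gG.
have [C gC] := multiplier_good n0 eta_multiplier1.
have [D D0 gD] := FT_multiplier_good n0 eta_multiplier1.
have m2 : multiplier (fun x => eta (2 *: x)) by apply: eta_multiplier; rewrite pnatr_eq0.
have [C2 gC2] := multiplier_good n0 m2; have [D2 D20 gD2] := FT_multiplier_good n0 m2.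
have CD : 0 <= C + D by rewrite addr_ge0 ?(good_ge0 gC) // ltW.
rewrite -(@conv_FT_scale (C + D) G 0 eta 2 t g x) //; last 2 first.
- by apply: good_le gC; rewrite lerDl ltW.
- by move=> b; apply: good_le (gD b); rewrite lerDr (good_ge0 gC).
rewrite -(RIB (good_convM t x (gD 0) cg gG) (good_convM t x (gD2 0) cg gG)).
apply: eq_RI => z; rewrite -mulrBl; congr (_ * _).
by rewrite -(FTB 0 z gC gC2).
Qed.

Lemma LP_partial_sum G g x J : continuous g -> (forall y, `|g y| <= G) ->
  \sum_(j < J.+1) conv (FT 0 (lpb j)) (2 ^- j) g x = conv (FT 0 eta) (2 ^- J) g x.
Proof.
move=> cg gG; elim: J => [|J IH]; first by rewrite big_ord_recl big_ord0 addr0.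
rewrite big_ord_recr /= IH (conv_theta _ _ cg gG).
rewrite (_ : 2 * 2 ^- J.+1 = 2 ^- J); first by rewrite addrC subrK.
by rewrite exprS invfM mulVKf // pnatr_eq0.
Qed.

(** An approximate identity: by inversion the kernel has integral [eta 0 = 1]. *)
Lemma conv_eta_cvg G g x : continuous g -> (forall y, `|g y| <= G) ->
  conv (FT 0 eta) (2 ^- J) g x @[J --> \oo] --> g x.
Proof.
move=> cg gG.
have [C gC] := multiplier_good n0 eta_multiplier1.
have [D D0 gD] := FT_multiplier_good n0 eta_multiplier1.
have E : g x = RI (fun z => FT 0 eta z * g x).
  have -> : RI (fun z => FT 0 eta z * g x) = g x * RI (FT 0 eta).
    by rewrite -(RIZ _ (gD 0)); apply: eq_RI => z; rewrite mulrC.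
  rewrite (FT_inversion0 gC (gD 0)).
  case: eta_LP => _ _ e1 _; rewrite e1 ?mulr1 // /enorm big1 ?sqrtr0 // => i _.
  by rewrite mxE expr0n.
rewrite [X in _ --> X]E; apply: (@RI_dct _ _ (D * G)).
- by move=> k; exact: good_convM (gD 0) cg gG.
- apply: goodM (gD 0) _ _; first exact: cst_continuous.
  by move=> y; exact: gG.
- move=> z; apply: cvgM; first exact: cvg_cst.
  have sc : (x - 2 ^- k *: z : 'rV[R]_n) @[k --> \oo] --> x.
    rewrite -[X in _ --> X]subr0; apply: cvgB; first exact: cvg_cst.
    rewrite -(scale0r z); apply: cvgZr_tmp.
    by under eq_fun do rewrite -exprVn; apply: cvg_expr; rewrite ger0_norm ?invr_ge0 // invf_lt1 // ltr1n.
  by apply: cvg_comp sc _; exact: cg.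
Qed.

Lemma sin_ge_half (z : R) : `|z| <= 1 -> `|z| / 2 <= `|sin z|.
Proof.
have cosb (c : R) : `|c| <= 1 -> 1 / 2 <= cos c.
  move=> c1; have -> : cos c = 1 - 2 * sin (c / 2) ^+ 2.
    have -> : cos c = cos (c / 2 + c / 2) by congr cos; field.
    by rewrite cosD -!expr2; have := cos2Dsin2 (c / 2) => ?; lra.
  have h : `|sin (c / 2)| <= 1 / 2.
    rewrite (le_trans (ler_norm_sin _)) // normrM [ `|2^-1| ]ger0_norm ?invr_ge0 //; lra.
  have : `|sin (c / 2)| ^+ 2 <= (1 / 2) ^+ 2 by rewrite lerXn2r ?nnegrE.
  by rewrite real_normK ?num_real // expr2 => ?; lra.
have pos (w : R) : 0 < w -> w <= 1 -> w / 2 <= `|sin w|.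
  move=> w0 w1; have cs : {within `[0, w], continuous (@sin R)}.
    by apply: continuous_subspaceT; exact: continuous_sin.
  have [c] := @MVT R sin cos 0 w w0 (fun y _ => is_derive_sin y) cs.
  rewrite in_itv /= => /andP[c0 cw]; rewrite sin0 !subr0 => ->.
  rewrite normrM (gtr0_norm w0) mulrC ler_wpM2r ?(ltW w0) //.
  have c1 : `|c| <= 1 by rewrite ger0_norm ?(ltW c0) // (le_trans (ltW cw)).
  have := cosb c c1 => h; rewrite ger0_norm; lra.
move=> z1; case: (ltgtP z 0) => [z0|z0|->]; last by rewrite normr0 mul0r.
  rewrite (ltr0_norm z0) -normrN -sinN; apply: pos; first by rewrite oppr_gt0.
  by rewrite -(ltr0_norm z0).
by rewrite (gtr0_norm z0); apply: pos => //; rewrite -(gtr0_norm z0).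
Qed.

(* theta is divided by sum_i (2 sin (pi tau xi_i))^(2 r); the two cut-offs added to
   this sum vanish on the support of theta and make it bounded below. *)
Lemma theta_differences (r : nat) : exists2 tau : R, 0 < tau <= 1 &
  exists (a : R) (v : 'I_n -> 'rV[R]_n -> R), (forall i, multiplier (v i)) /\
  forall (G t : R) f x, continuous f -> (forall y, `|f y| <= G) ->
  conv (FT 0 theta) t f x =
    \sum_i conv (FT a (v i)) t (diffk r ((t * tau) *: evec R i) f) x.
Proof.
(* [pi * tau * 3 <= 1] keeps the argument of the sine within [[-1, 1]] for [|x| <= 3], where
   [|sin z| >= |z| / 2]. *)
pose tau : R := (1 + 3 * pi)^-1.
have P0 : 0 < pi :> R := pi_gt0 R.
have T0 : 0 < 1 + 3 * pi :> R by rewrite ltr_pwDl // mulr_ge0 // ltW.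
have t0 : 0 < tau by rewrite invr_gt0.
have t1 : tau <= 1 by rewrite invf_le1 // lerDl mulr_ge0 // ltW.
have t3 : pi * tau * 3 <= 1.
  by rewrite /tau mulrAC ler_pdivrMr // mul1r; lra.
exists tau; first by rewrite t0.
pose sn i x : R := -2 * sin (pi * dotp (tau *: evec R i) x).
have even2 (c : R) : 0 <= c ^+ (r + r) by rewrite exprD -expr2 sqr_ge0.
have etage0 y : 0 <= eta y by case: eta_LP => _ /(_ y) /andP[].
have etale1 y : eta y <= 1 by case: eta_LP => _ /(_ y) /andP[].
pose mum x : R := \sum_i sn i x ^+ (r + r) + eta (4 *: x) + (1 - eta (2^-1 *: x)).
have n1 : 0 < n%:R :> R by rewrite ltr0n.
(* For [1 / 4 < |x| < 3] some coordinate is at least [1 / (4 n)]; elsewhere one of the two cut-offs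
   contributes 1. *)
pose low : R := Num.min 1 ((pi * tau * (1 / (4 * n%:R))) ^+ (r + r)).
have low0 : 0 < low.
  by rewrite lt_min ltr01 exprn_gt0 // !mulr_gt0 ?invr_gt0 // mulr_gt0.
have sum0 x : 0 <= \sum_i sn i x ^+ (r + r) by apply: sumr_ge0 => i _; exact: even2.
have mlow x : low <= mum x.
  case: (leP (enorm x) (1 / 4)) => hx.
    have e1 : eta (4 *: x) = 1.
      by case: eta_LP => _ _ e1 _; apply: e1; rewrite enormZ normr_nat; lra.
    apply: (@le_trans _ _ 1); first by rewrite ge_min lexx.
    by rewrite /mum e1; move: (sum0 x) (etale1 (2^-1 *: x)); lra.
  case: (leP 3 (enorm x)) => hx3.
    have e1 : eta (2^-1 *: x) = 0.
      by case: eta_LP => _ _ _; apply; rewrite enormZ ger0_norm ?invr_ge0 //; lra.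
    apply: (@le_trans _ _ 1); first by rewrite ge_min lexx.
    by rewrite /mum e1; move: (sum0 x) (etage0 (4 *: x)); lra.
  have [i hi] : exists i, 1 / (4 * n%:R) <= `|x 0 i|.
    apply: contrapT => /forallNP hn.
    have : inbox (1 / (4 * n%:R)) x by move=> i; rewrite ltW // ltNge; apply/negP => ?; exact: (hn i).
    move/enorm_inbox; rewrite (_ : n%:R * _ = 1 / 4); first by lra.
    by field; rewrite gt_eqF.
  apply: (@le_trans _ _ (sn i x ^+ (r + r))); last first.
    rewrite /mum (bigD1 i) //=.
    have : 0 <= \sum_(k < n | k != i) sn k x ^+ (r + r) by apply: sumr_ge0 => k _; exact: even2.
    by move: (etage0 (4 *: x)) (etale1 (2^-1 *: x)); lra.
  apply: (@le_trans _ _ ((pi * tau * (1 / (4 * n%:R))) ^+ (r + r))).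
    by rewrite ge_min lexx orbT.
  rewrite -[leRHS]ger0_norm ?even2 // normrX lerXn2r ?nnegrE //.
    by rewrite ltW // !mulr_gt0 ?invr_gt0 // mulr_gt0.
  rewrite /sn normrM normrN normr_nat dotpZl dotpC dotp_evec.
  have z1 : `|pi * (tau * x 0 i)| <= 1.
    rewrite !normrM (ger0_norm (ltW P0)) (ger0_norm (ltW t0)) (le_trans _ t3) //.
    rewrite mulrA ler_wpM2l ?mulr_ge0 ?(ltW P0) ?(ltW t0) //.
    by rewrite (le_trans (coord_le_enorm _ _)) // ltW.
  have := sin_ge_half z1; rewrite ler_pdivrMr // [ `|sin _| * 2]mulrC; apply: le_trans.
  rewrite !normrM (ger0_norm (ltW P0)) (ger0_norm (ltW t0)) mulrA.
  by rewrite ler_wpM2l ?mulr_ge0 ?(ltW P0) ?(ltW t0).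
have csn i : continuous (sn i).
  apply: continuous_mulf; first exact: continuous_cstf.
  apply: (@continuous_compf _ _ _ (@sin R)); first exact: continuous_sin.
  apply: continuous_mulf; first exact: continuous_cstf.
  apply: (@continuous_dotp R n _ (fun=> tau *: evec R i) (fun x => x)).
    exact: cst_continuous.
  exact: continuous_idf.
have dsn i k m b : exists C, dclass k m b C (sn i).
  have hb : inbox `|2^-1 * tau| (2^-1 *: (tau *: evec R i)) by rewrite scalerA; exact: inbox_evec.
  have h := @dclass_cos R n k m b _ _ (-2) (pi / 2) _ (lexx _) hb.
  eexists; apply: eq_dclass h => x; rewrite /sn sinE; congr (_ * cos (_ - _)).
  by rewrite [in LHS]dotpZl; field.
have cpow i k : continuous (fun x => sn i x ^+ k).
  elim: k => [|k IH]; first by under eq_fun do rewrite expr0; exact: continuous_cstf.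
  by under eq_fun do rewrite exprS; apply: continuous_mulf => //; exact: csn.
have dpow i k m b p : exists C, dclass k m b C (fun x => sn i x ^+ p).
  have [C dC] := dsn i k m b; have d1 := @dclass_cst R n k m b 1.
  by eexists; apply: eq_dclass (dclass_expM p dC d1) => x; rewrite mulr1.
have m4 : multiplier (fun x => eta (4 *: x)) by apply: eta_multiplier; rewrite pnatr_eq0.
have m2 : multiplier (fun x => eta (2^-1 *: x)) by apply: eta_multiplier; rewrite invr_eq0 pnatr_eq0.
have cmum : continuous mum.
  have [c4 _ _] := m4; have [c2 _ _] := m2.
  apply: continuous_addf; last first.
    apply: continuous_addf; first exact: continuous_cstf.
    by move=> x; apply: continuousN; exact: c2.
  apply: continuous_addf => //.
  by apply: continuous_sumf => i _; exact: cpow.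
have dmum k m b : exists C, dclass k m b C mum.
  have [_ _ d4] := m4; have [_ _ d2] := m2.
  have [C4 h4] := d4 k m b; have [C2 h2] := d2 k m b.
  have ds : exists C, dclass k m b C (fun x => \sum_i sn i x ^+ (r + r)).
    elim: (index_enum _) => [|i l [C IH]].
      by eexists; apply: eq_dclass (@dclass_cst R n k m b 0) => x; rewrite big_nil.
    have [D hD] := dpow i k m b (r + r)%N.
    by eexists; apply: eq_dclass (dclassD hD IH) => x; rewrite big_cons.
  have [C hC] := ds.
  eexists; apply: eq_dclass (dclassD (dclassD hC h4) (dclassD (@dclass_cst R n k m b 1) (dclassZ (-1) h2))) => x.
  by rewrite mulN1r.
have mpos x : mum x != 0 by rewrite gt_eqF // (lt_le_trans low0).
pose w x := theta x * (mum x)^-1.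
have mw : multiplier w.
  apply: multiplierM theta_multiplier _ _.
    by move=> x; apply: continuousV; [exact: mpos|exact: cmum].
  move=> k m b; have [C hC] := dmum k m b.
  have [C' _ hC'] := @dclass_inv R n k m C low low0.
  by exists C'; apply: hC' hC => x _; exact: mlow.
pose v i x := w x * sn i x ^+ r.
have mv i : multiplier (v i).
  by apply: multiplierM mw (cpow _ _) _ => k m b; exact: dpow.
(* This phase cancels the [r] quarter turns of [diffk_FT]. *)
pose a : R := - (r%:R * (pi / 2)).
exists a, v; split => // G t f x cf fG.
have gF i := FT_multiplier_good n0 (mv i).
have gK i : exists D, good D (diffk r (tau *: evec R i) (FT a (v i))).
  have [D _ gD] := gF i; elim: (r) (FT a (v i)) (D) (gD a) => [|k IH] F E gE /=; first by exists E.
  by have [E' gE'] := good_diff1 (tau *: evec R i) gE; exact: IH gE'.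
have E z : FT 0 theta z = \sum_i diffk r (tau *: evec R i) (FT a (v i)) z.
  have gv i := multiplier_good n0 (mv i).
  have gs i : exists D, good D (fun xi => sn i xi ^+ r * v i xi).
    have [D gD] := gv i.
    have sb y : `|sn i y ^+ r| <= 2 ^+ r.
      rewrite normrX lerXn2r ?nnegrE // /sn normrM normrN normr_nat.
      by rewrite -[leRHS]mulr1 ler_wpM2l // ler_norml sin_geN1 sin_le1.
    exists (D * 2 ^+ r); apply: eq_good (goodM gD (cpow i r) sb) => y.
    by rewrite mulrC.
  transitivity (FT 0 (fun xi => \sum_i sn i xi ^+ r * v i xi) z).
    apply: eq_RI => xi; congr (_ * _).
    have -> : \sum_i sn i xi ^+ r * v i xi = w xi * \sum_i sn i xi ^+ (r + r).
      by rewrite mulr_sumr; apply: eq_bigr => i _; rewrite /v exprD; ring.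
    case: (eqVneq (theta xi) 0) => [th0|thn].
      by rewrite /w th0 !mul0r.
    have h1 : eta (4 *: xi) = 0.
      case: eta_LP => _ _ _; apply; rewrite enormZ normr_nat leNgt; apply/negP => hx.
      by move: thn; rewrite theta0_small ?eqxx //; lra.
    have h2 : eta (2^-1 *: xi) = 1.
      case: eta_LP => _ _ e1 _; apply: e1; rewrite enormZ ger0_norm ?invr_ge0 // leNgt.
      apply/negP => hx; move: thn; rewrite theta0_large ?eqxx //; lra.
    rewrite /w -mulrA (_ : \sum_i _ = mum xi); last by rewrite /mum h1 h2 subrr !addr0.
    by rewrite mulVf // mulr1.
  pose D i := projT1 (cid (gs i)).
  have gD i : good (D i) (fun xi => sn i xi ^+ r * v i xi) by rewrite /D; case: cid.
  transitivity (\sum_i FT 0 (fun xi => sn i xi ^+ r * v i xi) z).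
    rewrite /FT -(@RI_sum _ _ _ _ _ D); last by move=> i _; exact: good_phase.
    by apply: eq_RI => xi; rewrite mulr_suml.
  apply: eq_bigr => i _; have [Di gDi] := gv i.
  by rewrite (diffk_FT _ _ _ _ gDi) /a addNr.
transitivity (\sum_i conv (diffk r (tau *: evec R i) (FT a (v i))) t f x).
  pose D i := projT1 (cid (gK i)).
  have gD i : good (D i) (diffk r (tau *: evec R i) (FT a (v i))) by rewrite /D; case: cid.
  rewrite /conv -(@RI_sum _ _ _ _ _ (fun i => D i * G)); last by move=> i _; exact: good_convM.
  by apply: eq_RI => z; rewrite E mulr_suml.
apply: eq_bigr => i _; have [D _ gD] := gF i.
by rewrite (conv_diffk _ _ _ _ (gD a) cf fG) scalerA.
Qed.

End LittlewoodPaley.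

(** * The spaces Lambda_s and differences *)

Section Lambda.
Context {R : realType} {n : nat} (n0 : (0 < n)%N) (s : R).
Implicit Types (f g : 'rV[R]_n -> R) (x h : 'rV[R]_n).

(** One real bound for size and differences, which keeps the analysis out of the extended reals; it
    matches [Lam_norm] up to a factor 2. *)
Definition LamB (A : R) f := [/\ continuous f, (forall x, `|f x| <= A) &
  forall x h, 0 < enorm h <= 1 -> `|diffk (Num.truncn s).+1 h f x| <= A * powR (enorm h) s].

Lemma LamB_ge0 A f : LamB A f -> 0 <= A.
Proof. by case=> _ fA _; exact: le_trans (fA 0). Qed.

Lemma LamB_mono (A B : R) f : A <= B -> LamB A f -> LamB B f.
Proof.
move=> AB [cf fA dA]; split => // [x|x h hh]; first exact: le_trans AB.
by rewrite (le_trans (dA _ _ hh)) // ler_wpM2r ?powR_ge0.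
Qed.

Lemma Dr_le r f x (y B : R) : (forall h, enorm h = y -> `|diffk r h f x| <= B) ->
  (Dr r f x y <= B%:E)%E.
Proof. by move=> H; apply: ge_ereal_sup => _ [h hy <-]; rewrite lee_fin; exact: H. Qed.

Lemma Dr_ge r f x h : (`|diffk r h f x|%:E <= Dr r f x (enorm h))%E.
Proof. by apply: ereal_sup_ubound; exists h. Qed.

Lemma LamB_norm_le (A : R) f : LamB A f -> (Lam_norm s f <= (2 * A)%:E)%E.
Proof.
move=> [cf fA dA]; rewrite mulr_natl mulr2n EFinD; apply: leeD.
  by apply: ge_ereal_sup => _ [x _ <-]; rewrite lee_fin.
apply: ge_ereal_sup => _ [[x y] /= /andP[y0 y1] <-].
have ys : 0 < powR y s by rewrite powR_gt0.
rewrite lee_pdivrMr // -EFinM; apply: Dr_le => h hy; rewrite -hy; apply: dA.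
by rewrite hy y0.
Qed.

Lemma Lam_norm_LamB (A : R) f : continuous f -> (Lam_norm s f <= A%:E)%E -> LamB A f.
Proof.
move=> cf; rewrite /Lam_norm.
set S1 := sup_norm f; set S2 := ereal_sup _ => LA.
have S10 : (0 <= S1)%E.
  by apply: (@le_trans _ _ (`|f 0|%:E)); [rewrite lee_fin|apply: ereal_sup_ubound; exists 0].
(* A unit vector exists because [n > 0], so the supremum is nonnegative and each summand is bounded
   by the sum. *)
have S20 : (0 <= S2)%E.
  apply: (@le_trans _ _ (Dr (Num.truncn s).+1 f 0 1 * ((powR 1 s)^-1)%:E)%E).
    rewrite powR1 invr1 mule1 /Dr.
    have h1 := @enorm_evec R n (Ordinal n0); set h := evec R _ in h1.
    apply: (@le_trans _ _ (`|diffk (Num.truncn s).+1 h f 0|%:E)); first by rewrite lee_fin.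
    by rewrite -h1; exact: Dr_ge.
  by apply: ereal_sup_ubound; exists (0, 1) => //=; rewrite ltr01 lexx.
split => //.
  move=> x; rewrite -lee_fin; apply: le_trans LA; apply: (@le_trans _ _ S1); last exact: leeDl.
  by apply: ereal_sup_ubound; exists x.
move=> x h /andP[h0 h1].
have hs : 0 < powR (enorm h) s by rewrite powR_gt0.
rewrite -lee_fin EFinM -lee_pdivrMr //; apply: le_trans LA; apply: (@le_trans _ _ S2); last exact: leeDr.
apply: (@le_trans _ _ (Dr (Num.truncn s).+1 f x (enorm h) * ((powR (enorm h) s)^-1)%:E)%E).
  by rewrite lee_pmul2r ?lte_fin ?invr_gt0 //; exact: Dr_ge.
by apply: ereal_sup_ubound; exists (x, enorm h) => //=; rewrite h0.
Qed.

Lemma SsetP r f (e : R) x y : Sset r s f e (x, y) <->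
  0 < y /\ exists2 h, enorm h = y & e * powR y s < `|diffk r h f x|.
Proof.
split.
  case=> /= y0 H; split => //.
  have ys : 0 < powR y s by rewrite powR_gt0.
  have : ((e * powR y s)%:E < Dr r f x y)%E by rewrite EFinM -lte_pdivlMr.
  by move/ereal_sup_gt => [_ [h hy <-]]; rewrite lte_fin => lt; exists h.
case=> y0 [h hy lt]; split => //=.
have ys : 0 < powR y s by rewrite powR_gt0.
rewrite lte_pdivlMr // -EFinM; apply: (@lt_le_trans _ _ (`|diffk r h f x|%:E)).
  by rewrite lte_fin.
by rewrite -hy; exact: Dr_ge.
Qed.

Lemma diffkD k m h f : diffk (k + m) h f = diffk k h (diffk m h f).
Proof. by elim: m f => [|m IH] f; rewrite ?addn0 // addnS /= IH. Qed.

(** [r] is at least [floor s + 1], and each surplus difference costs a factor 2. *)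
Lemma LamB_diffk r A f : 0 < s -> s < r%:R -> LamB A f ->
  forall x h, 0 < enorm h <= 1 -> `|diffk r h f x| <= 2 ^+ r * A * powR (enorm h) s.
Proof.
move=> s0 sr lf x h hh; have A0 := LamB_ge0 lf; case: lf => _ _ dA.
have tr : ((Num.truncn s).+1 <= r)%N.
  rewrite -(ltr_nat R); apply: le_lt_trans sr; rewrite truncn_le; exact: ltW.
rewrite -(subnK tr) diffkD.
have := @diffk_bound R n (r - (Num.truncn s).+1) h _ _ (fun x => dA x h hh) x.
move/le_trans; apply; rewrite mulrA ler_wpM2r ?powR_ge0 // ler_wpM2r //.
by rewrite ler_weXn2l ?ler1n // leq_addr.
Qed.

Lemma eq_diffk k h f g : f =1 g -> diffk k h f =1 diffk k h g.
Proof. by move=> /funext ->. Qed.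

Lemma diffkDf k h f g x : diffk k h (fun y => f y + g y) x = diffk k h f x + diffk k h g x.
Proof.
elim: k f g => [//|k IH] f g /=; rewrite -IH; apply: eq_diffk => y.
by rewrite /diff1; ring.
Qed.

Lemma diffkBf k h f g x : diffk k h (fun y => f y - g y) x = diffk k h f x - diffk k h g x.
Proof.
elim: k f g => [//|k IH] f g /=; rewrite -IH; apply: eq_diffk => y.
by rewrite /diff1; ring.
Qed.

Lemma diffk0f k h x : diffk k h (fun _ : 'rV[R]_n => 0 : R) x = 0.
Proof.
elim: k => [//|k IH] /=; rewrite -[RHS]IH; apply: eq_diffk => y.
by rewrite /diff1 subrr.
Qed.

Lemma diffk_sumf k h (J : nat) (P : nat -> 'rV[R]_n -> R) x :
  diffk k h (fun y => \sum_(j < J) P j y) x = \sum_(j < J) diffk k h (P j) x.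
Proof.
elim: J => [|J IH].
  rewrite big_ord0 -[RHS](diffk0f k h x); apply: eq_diffk => y; by rewrite big_ord0.
rewrite big_ord_recr /= -IH -diffkDf; apply: eq_diffk => y; by rewrite big_ord_recr.
Qed.

Lemma enormD x h : enorm (x + h) <= enorm x + enorm h.
Proof.
have sq0 := @enorm_ge0 R n.
rewrite -[leRHS]ger0_norm ?addr_ge0 // -[leLHS]ger0_norm // -ler_sqr ?nnegrE // !real_normK ?num_real //.
have dotE (y z : 'rV[R]_n) : enorm (y + z) ^+ 2 = enorm y ^+ 2 + enorm z ^+ 2 + 2 * dotp y z.
  rewrite !enorm_sqr /dotp mulr_sumr -!big_split /=; apply: eq_bigr => i _.
  by rewrite mxE; ring.
have CS (y z : 'rV[R]_n) : dotp y z <= enorm y * enorm z.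
  have key (a b : R) : 0 <= a ^+ 2 * enorm y ^+ 2 + b ^+ 2 * enorm z ^+ 2 - 2 * (a * b * dotp y z).
    have := sqr_ge0 (enorm (a *: y + (- b) *: z)); rewrite dotE !enormZ !exprMn.
    by rewrite !real_normK ?num_real // sqrrN dotpZl dotpZr => /le_trans; apply; rewrite le_eqVlt; apply/orP; left; apply/eqP; ring.
  have := key (enorm z) (enorm y); set a := enorm y; set b := enorm z.
  have a0 : 0 <= a := sq0 y; have b0 : 0 <= b := sq0 z.
  move=> k1; case: (eqVneq a 0) => [az|an].
    have y0 : y = 0.
      apply: rV_ext => i; rewrite mxE; apply/eqP; rewrite -normr_le0.
      by rewrite (le_trans (coord_le_enorm y i)) // -/a az.
    by rewrite y0 /dotp big1 ?mulr_ge0 // => i _; rewrite mxE mul0r.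
  case: (eqVneq b 0) => [bz|bn].
    have z0 : z = 0.
      apply: rV_ext => i; rewrite mxE; apply/eqP; rewrite -normr_le0.
      by rewrite (le_trans (coord_le_enorm z i)) // -/b bz.
    by rewrite z0 /dotp big1 ?mulr_ge0 // => i _; rewrite mxE mulr0.
  have a1 : 0 < a by rewrite lt_neqAle eq_sym an.
  have b1 : 0 < b by rewrite lt_neqAle eq_sym bn.
  have ab : 0 < 2 * (b * a) by rewrite !mulr_gt0.
  rewrite -(ler_pM2l ab); move: k1; rewrite -subr_ge0 => /le_trans; apply.
  by rewrite le_eqVlt; apply/orP; left; apply/eqP; ring.
rewrite dotE sqrrD; have := CS x h; rewrite -mulr_natl; lra.
Qed.

Lemma diffk_local k h f x (G : R) :
  (forall y, enorm (y - x) <= k%:R * enorm h -> `|f y| <= G) -> `|diffk k h f x| <= 2 ^+ k * G.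
Proof.
elim: k f G => [|k IH] f G H /=.
  by rewrite expr0 mul1r; apply: H; rewrite subrr mul0r /enorm big1 ?sqrtr0 // => i _; rewrite mxE expr0n.
rewrite exprSr -mulrA; apply: IH => y hy; rewrite /diff1.
have hb : enorm (2^-1 *: h) <= enorm h.
  by rewrite enormZ ger0_norm ?invr_ge0 // ler_piMl ?enorm_ge0 // invf_le1 // ler1n.
have h0 := @enorm_ge0 R n h.
rewrite mulr_natl mulr2n (le_trans (ler_normB _ _)) // lerD // H //.
  rewrite addrAC (le_trans (enormD _ _)) // -natr1 mulrDl mul1r lerD //.
rewrite addrAC (le_trans (enormD _ _)) // enormN -natr1 mulrDl mul1r lerD //.
Qed.

End Lambda.

(** * Dyadic scales and geometric sums *)

Section Scales.
Context {R : realType}.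

Lemma dyadic_scale (y : R) : 0 < y <= 1 -> exists m : nat, 2 ^- m.+1 < y <= 2 ^- m.
Proof.
move=> /andP[y0 y1].
have [N hN] : exists N : nat, 2 ^- N < y.
  have /cvgrPdist_lt /(_ y y0) [N _ HN] : ((2^-1 : R) ^+ k) @[k --> \oo] --> (0 : R).
    by apply: cvg_expr; rewrite ger0_norm ?invr_ge0 // invf_lt1 // ltr1n.
  exists N; have := HN N (leqnn N); rewrite /= sub0r normrN exprVn ger0_norm //.
case: (ex_minnP (ex_intro (fun N : nat => 2 ^- N < y) N hN)) => m.
case: m => [|m] hm min; first by exfalso; move: hm; rewrite expr0 invr1 ltNge y1.
exists m; rewrite hm /= leNgt; apply/negP => lt; have := min m lt.
by rewrite ltnn.
Qed.

Context (s : R) (s0 : 0 < s).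

(** With [ka = 2 ^ (- s)] the natural size [2 ^ (- j s)] of the j-th piece is [ka ^ j]. *)
Definition ka : R := powR 2^-1 s.

Lemma ka_gt0 : 0 < ka. Proof. by rewrite powR_gt0 // invr_gt0. Qed.

Lemma ka_ge0 : 0 <= ka. Proof. exact/ltW/ka_gt0. Qed.

Lemma ka_lt1 : ka < 1.
Proof.
have -> : 1 = powR 1 s :> R by rewrite powR1.
rewrite /ka gt0_ltr_powR // ?nnegrE ?invr_ge0 //.
by rewrite invf_lt1 // ltr1n.
Qed.

Lemma kaE j : powR (2 ^- j) s = ka ^+ j.
Proof.
rewrite -exprVn; elim: j => [|j IH]; first by rewrite !expr0 powR1.
by rewrite !exprS powRM ?exprn_ge0 ?invr_ge0 // IH.
Qed.

Lemma kaVE j : powR 2 (j%:R * s) = ka ^- j.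
Proof.
by rewrite -kaE -powR_inv1 ?powR_ge0 // -powRrM -(powR_mulrn _ (ler0n _ 2)) -powRN -powRrM mulrN1 mulrN mulNr opprK.
Qed.

Lemma ka_le_exp j : ka ^+ j <= 1.
Proof. by rewrite exprn_ile1 ?ka_ge0 // ltW ?ka_lt1. Qed.

Lemma powR_dyadic_le (y : R) m : 2 ^- m.+1 < y -> ka ^+ m <= ka^-1 * powR y s.
Proof.
move=> h; rewrite ler_pdivlMl ?ka_gt0 // -exprS -kaE ge0_ler_powR ?nnegrE ?(ltW s0) ?(ltW h) //.
by rewrite (le_trans _ (ltW h)).
Qed.

Lemma powR_dyadic_ge (y : R) m : 0 <= y -> y <= 2 ^- m -> powR y s <= ka ^+ m.
Proof.
by move=> y0 h; rewrite -kaE ge0_ler_powR ?nnegrE ?(ltW s0) // invr_ge0 exprn_ge0.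
Qed.

(** This is where [r > s] enters: sums of low-frequency bounds have ratio above 1 and are dominated
    by their last term. *)
Lemma ka_exp_gt1 (r : nat) : s < r%:R -> 1 < 2 ^+ r * ka.
Proof.
move=> sr; rewrite -ltr_pdivrMl ?exprn_gt0 // mulr1 /ka -exprVn -powR_mulrn ?invr_ge0 //.
rewrite /powR invr_eq0 pnatr_eq0 /= ltr_expR lnV ?posrE // !mulrN ltrN2.
by rewrite ltr_pM2r // ln_gt0 // ltr1n.
Qed.

Lemma geo_sum_le (q : R) (N : nat) : 1 < q -> \sum_(j < N) q ^+ j <= q ^+ N / (q - 1).
Proof.
move=> q1; have q10 : 0 < q - 1 by rewrite subr_gt0.
rewrite ler_pdivlMr // mulrC -subrX1 lerBlDr lerDl //.
Qed.

Lemma geo_small (q e : R) : 0 <= q < 1 -> 0 < e -> exists N : nat, forall k, (N <= k)%N -> q ^+ k < e.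
Proof.
move=> /andP[q0 q1] e0; have qn : `|q| < 1 by rewrite ger0_norm.
have /cvgrPdist_lt /(_ e e0) [N _ HN] := cvg_expr qn.
exists N => k Nk; have := HN k Nk; rewrite /= sub0r normrN ger0_norm //.
by rewrite exprn_ge0.
Qed.

End Scales.

(** * Localization of convolutions *)

Section ConvTail.
Context {R : realType} {n : nat}.
Implicit Types (K H f g u : 'rV[R]_n -> R) (x h : 'rV[R]_n).

Lemma conv_comm (C G : R) K H t g x : continuous K -> continuous H ->
  (forall z, `|K z| <= C * maj z ^+ 2) -> (forall z, `|H z| <= C * maj z ^+ 2) ->
  continuous g -> (forall y, `|g y| <= G) ->
  conv K t (conv H t g) x = conv H t (conv K t g) x.
Proof.
move=> cK cH hK hH cg gG.
have C0 : 0 <= C.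
  have := le_trans (normr_ge0 _) (hK 0).
  by rewrite pmulr_lge0 // exprn_gt0 // maj_gt0.
have lem (F : 'rV[R]_n -> R) : continuous F -> (forall z, `|F z| <= C * maj z ^+ 2) -> good C F.
  move=> cF hF; split => // z; rewrite (le_trans (hF z)) // ler_wpM2l // expr2.
  by rewrite ler_piMr ?maj_ge0 ?maj_le1.
have gK := lem _ cK hK; have gH := lem _ cH hH.
rewrite (conv_conv _ _ gK cH hH cg gG) (conv_conv _ _ gH cK hK cg gG).
apply: eq_conv => // z.
have gM : good (C * C) (fun w => H w * K (z - w)).
  apply: goodM gH _ _.
    apply: (@continuous_compf _ _ _ K) => //.
    have := @continuous_sub_scale R n _ 1 (fun=> z) (fun w => w) (@cst_continuous _ _ z) (@continuous_idf _).
    by apply: eq_continuous => w; rewrite scale1r.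
  by move=> w; have [_ h] := gK; rewrite (le_trans (h _)) // ler_piMr ?maj_le1.
rewrite -(RI_subl z gM); apply: eq_RI => w.
by rewrite opprB addrCA subrr addr0 mulrC.
Qed.

Lemma maj_out (Z : R) x : 0 <= Z -> ~ inbox Z x -> maj x <= (1 + Z ^+ 2)^-1.
Proof.
move=> Z0 nb; have [i hi] : exists i, Z < `|x 0 i|.
  by apply: contrapT => /forallNP H; apply: nb => i; rewrite leNgt; apply/negP; exact: H.
rewrite /maj (bigD1 i) //=; apply: (@le_trans _ _ (rho (x 0 i))).
  rewrite ler_piMr ?rho_ge0 //.
  have : 0 <= \prod_(k < n | k != i) rho (x 0 k) <= 1.
    apply: (big_ind (fun y => 0 <= y <= 1)) => [|a b /andP[a0 a1] /andP[b0 b1]|k _].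
    - by rewrite ler01 lexx.
    - by rewrite mulr_ge0 //= mulr_ile1.
    - by rewrite rho_ge0 rho_le1.
  by case/andP.
rewrite /rho lef_pV2 ?posrE ?ltr_pwDl ?sqr_ge0 // lerD2l.
by rewrite -[leRHS]real_normK ?num_real // lerXn2r ?nnegrE // ltW.
Qed.

(** One power of [maj] is kept for integrability; the other [P] give the decay outside the box,
    where only the global bound [A] is known. *)
Lemma conv_tail (C A a Z : R) K (P : nat) t u x : continuous K ->
  (forall z, `|K z| <= C * maj z ^+ P.+1) -> continuous u -> (forall y, `|u y| <= A) ->
  0 <= a -> 0 <= Z -> (forall z, inbox Z z -> `|u (x - t *: z)| <= a) ->
  `|conv K t u x| <= C * pi ^+ n * (a + A * (1 + Z ^+ 2) ^- P).
Proof.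
move=> cK hK cu uA a0 Z0 H.
have C0 : 0 <= C.
  have := le_trans (normr_ge0 _) (hK 0).
  by rewrite pmulr_lge0 // exprn_gt0 // maj_gt0.
have A0 : 0 <= A := le_trans (normr_ge0 _) (uA 0).
have mP z : maj z ^+ P <= 1 :> R by rewrite exprn_ile1 ?maj_ge0 ?maj_le1.
have gK : good C K.
  split => // z; rewrite (le_trans (hK z)) // ler_wpM2l // exprS.
  by rewrite ler_piMr ?maj_ge0.
have gM := good_convM t x gK cu uA.
have D0 : 0 <= A * (1 + Z ^+ 2) ^- P by rewrite mulr_ge0 // invr_ge0 exprn_ge0 // addr_ge0 // sqr_ge0.
apply: (le_trans (RI_norm gM)).
have gB := goodZ (C * (a + A * (1 + Z ^+ 2) ^- P)) (@good_maj R n).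
apply: (le_trans (RI_le (good_norm gM) gB _)); last first.
  by rewrite (RIZ _ (@good_maj R n)) RI_maj mulrAC.
move=> z; rewrite normrM -mulrA.
have Kz : `|K z| <= C * (maj z * maj z ^+ P) by rewrite -exprS.
case: (pselect (inbox Z z)) => iz.
  apply: (@le_trans _ _ (C * maj z * a)).
    rewrite ler_pM // ?H //.
    by rewrite (le_trans Kz) // ler_wpM2l // ler_piMr ?maj_ge0.
  by rewrite -mulrA ler_wpM2l // mulrC ler_wpM2r ?maj_ge0 // lerDl.
apply: (@le_trans _ _ (C * (maj z * maj z ^+ P) * A)); first by rewrite ler_pM.
rewrite -mulrA ler_wpM2l // -mulrA mulrC ler_wpM2r ?maj_ge0 //.
apply: (@le_trans _ _ (A * (1 + Z ^+ 2) ^- P)); last by rewrite lerDr.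
rewrite mulrC ler_wpM2l // -exprVn lerXn2r ?nnegrE ?maj_ge0 ?maj_out //.
by rewrite invr_ge0 addr_ge0 // sqr_ge0.
Qed.

Lemma geo_tail (u : nat -> R) (l B q : R) (J : nat) : 0 <= q < 1 ->
  (forall j, `|u j| <= B * q ^+ j) -> \sum_(j < N) u j @[N --> \oo] --> l ->
  `|l - \sum_(j < J) u j| <= B * q ^+ J / (1 - q).
Proof.
move=> /andP[q0 q1] ub cl.
have B0 : 0 <= B by have := ub 0%N; rewrite expr0 mulr1; apply: le_trans.
have q1' : 0 < 1 - q by rewrite subr_gt0.
have key k : `|\sum_(j < J + k) u j - \sum_(j < J) u j| <= B * q ^+ J * (1 - q ^+ k) / (1 - q).
  elim: k => [|k IH]; first by rewrite addn0 subrr normr0 expr0 subrr mulr0 mul0r.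
  rewrite addnS big_ord_recr /= addrAC (le_trans (ler_normD _ _)) //.
  rewrite (le_trans (lerD IH (ub _))) // ler_pdivlMr // mulrDl mulfVK ?gt_eqF //.
  by rewrite exprD exprS le_eqVlt; apply/orP; left; apply/eqP; ring.
rewrite leNgt; apply/negP => lt.
have e0 : 0 < `|l - \sum_(j < J) u j| - B * q ^+ J / (1 - q) by rewrite subr_gt0.
move/cvgrPdist_lt : cl => /(_ _ e0) [N _ HN].
have := HN (J + N)%N (leq_addl _ _) => /=.
have := key N.
have : B * q ^+ J * (1 - q ^+ N) / (1 - q) <= B * q ^+ J / (1 - q).
  rewrite ler_wpM2r ?invr_ge0 ?(ltW q1') // ler_piMr ?mulr_ge0 ?exprn_ge0 //.
  by rewrite lerBlDr lerDl exprn_ge0.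
have := ler_normD (l - \sum_(j < J + N) u j) (\sum_(j < J + N) u j - \sum_(j < J) u j).
rewrite addrA subrK; lra.
Qed.

End ConvTail.

(** * Band-limited functions *)

Section BandLimited.
Context {R : realType} {n : nat} (n0 : (0 < n)%N).
Context (eta : 'rV[R]_n -> R) (eta_LP : LP_eta eta).
Implicit Types (K P f g u : 'rV[R]_n -> R) (x h : 'rV[R]_n).

Local Notation Kt := (FT 0 (lpt eta 0)).

(* Band limitation at scale t is expressed through a reproducing kernel. *)
Definition blim (t G : R) P := [/\ continuous P, forall x, `|P x| <= G &
  forall x, conv Kt t P x = P x].

Lemma blim_shift t G P z : blim t G P -> blim t G (fun x => P (x + z)).
Proof.
by case=> cP PG eP; split => // [|x]; [exact: continuous_shiftv|rewrite conv_shift eP].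
Qed.

Lemma Kt_good : exists2 C : R, 0 < C & good C Kt.
Proof. by have [C C0 gC] := FT_multiplier_good n0 (lpt_multiplier eta_LP 0); exists C. Qed.

Lemma blimD t G G' P Q : blim t G P -> blim t G' Q -> blim t (G + G') (fun x => P x + Q x).
Proof.
have [C C0 gC] := Kt_good.
move=> [cP PG eP] [cQ QG eQ]; split; first exact: continuous_addf.
  by move=> x; rewrite (le_trans (ler_normD _ _)) // lerD.
by move=> x; rewrite (convD t x gC cP cQ PG QG) eP eQ.
Qed.

Lemma blim_diff1 : exists2 C : R, 1 <= C & forall t G P h, 0 < t -> blim t G P ->
  blim t (C * (enorm h / t) * G) (diff1 h P).
Proof.
have [C C0 gC] := Kt_good.
have [D D0 hD] := Bernstein 1 0 n0 (lpt_multiplier eta_LP 0).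
exists (1 + D); first by rewrite lerDl ltW.
move=> t G P h t0 [cP PG eP]; split; first exact: (@continuous_diff1 _ _ h P cP).
  move=> x; have -> : diff1 h P x = diffk 1 h (conv Kt t P) x.
    by congr (diff1 h _ x); apply/funext => y; rewrite eP.
  have G0 : 0 <= G := le_trans (normr_ge0 _) (PG 0).
  rewrite (le_trans (hD G t h P x t0 cP PG)) // expr1.
  by rewrite ler_wpM2r // ler_wpM2r ?divr_ge0 ?enorm_ge0 ?(ltW t0) // lerDr.
move=> x; rewrite -(diff1_conv _ _ _ gC cP PG) /diff1 !eP //.
Qed.

Definition CB : R := projT1 (cid2 blim_diff1).

Lemma CB_ge1 : 1 <= CB. Proof. by rewrite /CB; case: cid2. Qed.

Lemma CB_ge0 : 0 <= CB. Proof. exact: le_trans CB_ge1. Qed.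

Lemma blim_diff1P t G P h : 0 < t -> blim t G P -> blim t (CB * (enorm h / t) * G) (diff1 h P).
Proof. by rewrite /CB; case: cid2 => //= C _; apply. Qed.

Lemma blim_diffk t G P h k : 0 < t -> blim t G P ->
  blim t ((CB * (enorm h / t)) ^+ k * G) (diffk k h P).
Proof.
move=> t0; elim: k G P => [|k IH] G P bP /=; first by rewrite expr0 mul1r.
by rewrite exprSr -mulrA; apply: IH; exact: blim_diff1P.
Qed.

Lemma blim_ge0 t G P : blim t G P -> 0 <= G.
Proof. by case=> _ PG _; exact: le_trans (PG 0). Qed.

Lemma blim_lip t G P x y : 0 < t -> blim t G P -> `|P y - P x| <= CB * (enorm (y - x) / t) * G.
Proof.
move=> t0 bP; have [_ h _] := blim_diff1P (y - x) t0 bP.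
have := h (x + 2^-1 *: (y - x)); rewrite /diff1 addrK -addrA -scalerDl.
rewrite (_ : 2^-1 + 2^-1 = 1); last by field.
by rewrite scale1r addrC subrK.
Qed.

Lemma blim_dilate t G P h x (l : R) k : 0 < t -> `|l - 1| <= 1 -> blim t G P ->
  `|diffk k (l *: h) P x - diffk k h P x| <= k%:R * `|l - 1| * (2 * (CB * (enorm h / t))) ^+ k * G.
Proof.
move=> t0 l1; have l2 : `|l| <= 2.
  by have := ler_normD (l - 1) 1; rewrite subrK normr1; lra.
have [b Eb] : exists b, b = CB * (enorm h / t) by eexists.
rewrite -Eb.
have b0 : 0 <= b by rewrite Eb mulr_ge0 ?CB_ge0 // divr_ge0 ?enorm_ge0 // ltW.
have bl : CB * (enorm (l *: h) / t) <= 2 * b.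
  by rewrite enormZ -mulrA mulrCA -Eb ler_wpM2r.
elim: k G P => [|k IH] G P bP /=; first by rewrite subrr normr0 mul0r !mul0r.
have G0 := blim_ge0 bP.
have bQ : blim t (2 * b * G) (diff1 (l *: h) P).
  have [c1 c2 c3] := blim_diff1P (l *: h) t0 bP; split => // y.
  by rewrite (le_trans (c2 y)) // ler_wpM2r.
(* The end points [l h / 2] and [h / 2] differ by [w] and have midpoint [(l + 1) h / 4]. Changing
   the step thus adds one short difference of step [w] on each side, small by Bernstein. *)
pose w := (l - 1) / 2 *: h.
pose Q y := diff1 w P (y + (l + 1) / 4 *: h) + diff1 w P (y + - ((l + 1) / 4 *: h)).
have bQ2 : blim t (`|l - 1| * b * G) Q.
  have bw := blim_diff1P w t0 bP.
  have := blimD (blim_shift ((l + 1) / 4 *: h) bw) (blim_shift (- ((l + 1) / 4 *: h)) bw).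
  rewrite (_ : _ + _ = `|l - 1| * b * G) // /w enormZ normrM [ `|2^-1| ]ger0_norm ?invr_ge0 //.
  by rewrite Eb; field; rewrite gt_eqF.
have EQ y : diff1 (l *: h) P y - diff1 h P y = Q y.
  rewrite /Q /diff1 /w.
  have c1 : y + (l + 1) / 4 *: h + 2^-1 *: ((l - 1) / 2 *: h) = y + 2^-1 *: (l *: h).
    by apply: rV_ext => i; rewrite !mxE; field.
  have c2 : y + (l + 1) / 4 *: h - 2^-1 *: ((l - 1) / 2 *: h) = y + 2^-1 *: h.
    by apply: rV_ext => i; rewrite !mxE; field.
  have c3 : y - (l + 1) / 4 *: h + 2^-1 *: ((l - 1) / 2 *: h) = y - 2^-1 *: h.
    by apply: rV_ext => i; rewrite !mxE; field.
  have c4 : y - (l + 1) / 4 *: h - 2^-1 *: ((l - 1) / 2 *: h) = y - 2^-1 *: (l *: h).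
    by apply: rV_ext => i; rewrite !mxE; field.
  by rewrite c1 c2 c3 c4; ring.
have -> : diffk k (l *: h) (diff1 (l *: h) P) x - diffk k h (diff1 h P) x =
   (diffk k (l *: h) (diff1 (l *: h) P) x - diffk k h (diff1 (l *: h) P) x) + diffk k h Q x.
  have -> : diffk k h Q x = diffk k h (diff1 (l *: h) P) x - diffk k h (diff1 h P) x.
    by rewrite -diffkBf; apply: eq_diffk => y; rewrite EQ.
  by rewrite addrA subrK.
rewrite (le_trans (ler_normD _ _)) // (le_trans (lerD (IH _ _ bQ) (lexx _))) //.
have [_ h3 _] := blim_diffk h k t0 bQ2.
rewrite (le_trans (lerD (lexx _) (h3 x))) // -Eb.
have bb : b ^+ k <= (2 * b) ^+ k.
  by apply: lerXn2r; rewrite ?nnegrE ?mulr_ge0 //; lra.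
have -> : k.+1%:R * `|l - 1| * (2 * b) ^+ k.+1 * G =
    k%:R * `|l - 1| * (2 * b) ^+ k * (2 * b * G) + 2 * ((2 * b) ^+ k * (`|l - 1| * b * G)).
  by rewrite -natr1 exprSr; ring.
rewrite lerD2l.
have : b ^+ k * (`|l - 1| * b * G) <= (2 * b) ^+ k * (`|l - 1| * b * G).
  by rewrite ler_wpM2r // !mulr_ge0.
move/le_trans; apply.
have : 0 <= (2 * b) ^+ k * (`|l - 1| * b * G) by rewrite !mulr_ge0 // exprn_ge0 // mulr_ge0.
lra.
Qed.

End BandLimited.

(** * Large pieces versus large differences *)

Section Detection.
Context {R : realType} {n : nat} (n0 : (0 < n)%N).
Context (eta : 'rV[R]_n -> R) (eta_LP : LP_eta eta).
Context (s : R) (s0 : 0 < s) (r : nat) (sr : s < r%:R).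
Implicit Types (K P f g u : 'rV[R]_n -> R) (x h : 'rV[R]_n) (A G e d q T : R).

Lemma le_of_eq (x y : R) : x = y -> x <= y. Proof. by move=> ->. Qed.

(** The real part of the j-th piece; the real parts alone already sum to [f] ([LPR_cvg]). *)
Definition LPR (j : nat) f : 'rV[R]_n -> R := conv (FT 0 (lpb eta j)) (2 ^- j) f.

Local Notation ka := (ka s).
Local Notation CB := (CB n0 eta_LP).
Local Notation rh := (2 ^+ r * ka).

Lemma lpb_lpt0 j x : lpb eta j x * lpt eta 0 x = lpb eta j x.
Proof.
case: (leP (3 / 2) (enorm x)) => hx.
  suff -> : lpb eta j x = 0 by rewrite mul0r.
  case: j => [|j] /=; last exact: theta0_large.
  by case: eta_LP => _ _ _ e0; exact: e0.
rewrite /lpt (etae1 eta_LP) ?subr0 ?mulr1 //.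
by rewrite enormZ ger0_norm ?invr_ge0 // mulrC ler_pdivrMr //; lra.
Qed.

Lemma pow2V_gt0 j : 0 < 2 ^- j :> R. Proof. by rewrite invr_gt0 exprn_gt0. Qed.
Lemma pow2V_ge0 j : 0 <= 2 ^- j :> R. Proof. exact/ltW/pow2V_gt0. Qed.

Lemma LPR_blim (A G : R) j f : continuous f -> (forall x, `|f x| <= A) ->
  (forall x, `|LPR j f x| <= G) -> blim eta (2 ^- j) G (LPR j f).
Proof.
move=> cf fA fG; have mb := lpb_multiplier eta_LP j; have mt := lpt_multiplier eta_LP 0.
have [C1 C10 g1] := FT_multiplier_good n0 mb; have [C2 C20 g2] := FT_multiplier_good n0 mt.
have [D1 D10 h1] := FT_multiplier_decay 2 n0 mb; have [D2 D20 h2] := FT_multiplier_decay 2 n0 mt.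
split => //; first exact: continuous_conv (g1 0) cf fA.
move=> x; rewrite /LPR (@conv_comm R n (D1 + D2) A) //.
- rewrite (conv_FT_mul n0 0 (2 ^- j) x mb mt (lpt_even _ _) cf fA).
  by apply: eq_conv => // z; congr FT; apply/funext => xi; rewrite lpb_lpt0.
- by case: (g2 0).
- by case: (g1 0).
- move=> z; rewrite (le_trans (h2 0 z)) // ler_wpM2r ?exprn_ge0 ?maj_ge0 //.
  by rewrite lerDr ltW.
- move=> z; rewrite (le_trans (h1 0 z)) // ler_wpM2r ?exprn_ge0 ?maj_ge0 //.
  by rewrite lerDl ltW.
Qed.

Lemma RI_norm_ge0 K : 0 <= RI (fun z => `|K z|).
Proof. by apply: RI_ge0 => z; exact: normr_ge0. Qed.

(** For [j > 0] the piece is a sum of averages of differences of order [floor s + 1] with steps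
    comparable to [2 ^- j]; for [j = 0] the sup norm is enough. *)
Lemma LPR_bound : exists2 C : R, 0 < C & forall A f, LamB s A f ->
  forall j x, `|LPR j f x| <= C * A * ka ^+ j.
Proof.
have [tau /andP[t0 t1] [a [v [mv H]]]] := theta_differences n0 eta_LP (Num.truncn s).+1.
pose I0 := RI (fun z => `|FT 0 eta z|); pose I1 := \sum_i RI (fun z => `|FT a (v i) z|).
have I00 : 0 <= I0 := RI_norm_ge0 _.
have I10 : 0 <= I1 by apply: sumr_ge0 => i _; exact: RI_norm_ge0.
exists (1 + I0 + I1); first by rewrite -addrA ltr_pwDl // addr_ge0.
move=> A f lf j x; have A0 := LamB_ge0 lf; have [cf fA dA] := lf.
have kj : 0 <= ka ^+ j by rewrite exprn_ge0 // ka_ge0.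
case: j kj => [|j] kj.
  rewrite expr0 mulr1 /LPR /=.
  have [C1 C10 g1] := FT_multiplier_good n0 (eta_multiplier1 eta_LP).
  rewrite (le_trans (conv_bound _ _ (g1 0) cf fA)) // mulrC ler_wpM2r // -/I0.
  by lra.
have -> : LPR j.+1 f x = conv (FT 0 (LP_theta eta)) (2 ^- j.+1) f x by [].
rewrite (H A) //; set t : R := 2 ^- j.+1.
have tt0 : 0 < t := pow2V_gt0 _.
have tt1 : t <= 1 by rewrite /t invf_le1 ?exprn_gt0 // exprn_ege1 // ler1n.
have tb i y : `|diffk (Num.truncn s).+1 ((t * tau) *: evec R i) f y| <= A * ka ^+ j.+1.
  have he : enorm ((t * tau) *: evec R i) = t * tau.
    by rewrite enormZ enorm_evec mulr1 ger0_norm // mulr_ge0 // ltW.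
  have tt : 0 < t * tau by rewrite mulr_gt0.
  rewrite (le_trans (dA _ _ _)) ?he ?tt ?mulr_ile1 ?(ltW t0) ?(ltW tt0) //.
  rewrite ler_wpM2l // powR_dyadic_ge ?(ltW tt) // -/t.
  by rewrite ler_piMr // ltW.
rewrite (le_trans (ler_norm_sum _ _ _)) //.
apply: (@le_trans _ _ (\sum_i A * ka ^+ j.+1 * RI (fun z => `|FT a (v i) z|))).
  apply: ler_sum => i _; have [C1 C10 g1] := FT_multiplier_good n0 (mv i).
  by apply: conv_bound (g1 a) (@continuous_diffk _ _ _ _ _ cf) (tb i).
rewrite -mulr_sumr -/I1 [in leRHS]mulrAC -mulrA mulrC ler_wpM2r ?mulr_ge0 //.
by rewrite mulrC ler_wpM2r // lerDr addr_ge0.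
Qed.

Definition CL : R := projT1 (cid2 LPR_bound).

Lemma CL_gt0 : 0 < CL. Proof. by rewrite /CL; case: cid2. Qed.

Lemma LPR_le A f : LamB s A f -> forall j x, `|LPR j f x| <= CL * A * ka ^+ j.
Proof. by rewrite /CL; case: cid2 => //= C _; apply. Qed.

Lemma LamB_blim A f j : LamB s A f -> blim eta (2 ^- j) (CL * A * ka ^+ j) (LPR j f).
Proof. by move=> lf; have [cf fA _] := lf; apply: LPR_blim cf fA _; exact: LPR_le. Qed.

Lemma LPR_cvg (A : R) f x : continuous f -> (forall y, `|f y| <= A) ->
  \sum_(j < N) LPR j f x @[N --> \oo] --> f x.
Proof.
move=> cf fA; have H := @conv_eta_cvg R n n0 eta eta_LP A f x cf fA.
have H2 : \sum_(j < N.+1) LPR j f x @[N --> \oo] --> f x.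
  by under eq_fun do rewrite /LPR (LP_partial_sum n0 eta_LP _ _ cf fA).
by rewrite -cvg_shiftS; exact: H2.
Qed.

Lemma ka1 : 0 <= ka < 1. Proof. by rewrite ka_ge0 ka_lt1. Qed.

Lemma diffk_tail A f k h x J : LamB s A f ->
  `|diffk k h f x - \sum_(j < J) diffk k h (LPR j f) x| <= 2 ^+ k * (CL * A * ka ^+ J / (1 - ka)).
Proof.
move=> lf; have [cf fA _] := lf.
rewrite -(diffk_sumf k h J (fun j => LPR j f) x) -diffkBf; apply: diffk_bound => y.
by apply: (geo_tail J ka1 (fun j => LPR_le lf j y)); exact: LPR_cvg.
Qed.

Lemma rh1 : 0 < rh - 1. Proof. by rewrite subr_gt0 ka_exp_gt1. Qed.

(** The summands grow geometrically with ratio [2 ^ r ka > 1], so the top level decides. *)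
Lemma low_sum h m N : enorm h <= 2 ^- m ->
  \sum_(j < N) (CB * (enorm h / 2 ^- j)) ^+ r * ka ^+ j <=
  CB ^+ r * (2 ^- m) ^+ r * (rh ^+ N / (rh - 1)).
Proof.
move=> hm; have CB0 := CB_ge0 n0 eta_LP; have h0 := enorm_ge0 h.
apply: (@le_trans _ _ (\sum_(j < N) CB ^+ r * (2 ^- m) ^+ r * rh ^+ j)); last first.
  rewrite -mulr_sumr ler_wpM2l ?mulr_ge0 ?exprn_ge0 ?pow2V_ge0 // geo_sum_le //.
  exact: ka_exp_gt1.
apply: ler_sum => j _.
have -> : CB ^+ r * (2 ^- m) ^+ r * rh ^+ j = CB ^+ r * (2 ^- m) ^+ r * (2 ^+ r) ^+ j * ka ^+ j.
  by rewrite [rh ^+ j]exprMn !mulrA.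
rewrite ler_wpM2r ?exprn_ge0 ?ka_ge0 // exprAC -!exprMn invrK lerXn2r ?nnegrE ?mulr_ge0 ?exprn_ge0 ?pow2V_ge0 //.
by rewrite -mulrA ler_wpM2l // ler_wpM2r // exprn_ge0.
Qed.

Lemma rhE m : (2 ^- m) ^+ r * rh ^+ m = ka ^+ m.
Proof. by rewrite exprMn mulrA exprAC -exprMn mulVf ?expf_neq0 ?pnatr_eq0 // expr1n mul1r. Qed.

Lemma geo_choose (q T e : R) : 0 <= q < 1 -> 0 <= T -> 0 < e ->
  exists N : nat, forall k, (N <= k)%N -> T * q ^+ k <= e.
Proof.
move=> q01 T0 e0; have T1 : 0 < T + 1 by rewrite ltr_wpDl.
have [N hN] := @geo_small R q (e / (T + 1)) q01 (divr_gt0 e0 T1).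
exists N => k /hN; rewrite ltr_pdivlMr // => /ltW; apply: le_trans.
case/andP: q01 => q0 _; rewrite mulrC ler_wpM2l ?exprn_ge0 //.
by rewrite lerDl.
Qed.

(** Levels beyond [m + J] are negligible. Below, each piece is band limited and reacts little to a
    shift or dilation by a small multiple of [|h|]. [J] is fixed first, then [d], both independently
    of [h]. *)
Lemma diffk_rel_cont A f e : LamB s A f -> 0 < e -> exists2 d : R, 0 < d <= 1 &
  forall h x x' (l : R), 0 < enorm h <= 1 -> enorm (x' - x) <= d * enorm h -> `|l - 1| <= d ->
  `|diffk r (l *: h) f x' - diffk r h f x| <= e * powR (enorm h) s.
Proof.
move=> lf e0; have A0 := LamB_ge0 lf; have CB0 := CB_ge0 n0 eta_LP; have CL0 := CL_gt0.
have k0 := @ka_gt0 R s; have k1 : 0 < 1 - ka by rewrite subr_gt0 ka_lt1.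
pose T := 2 ^+ r * (CL * A / (1 - ka)).
have T0 : 0 <= T by rewrite !mulr_ge0 ?exprn_ge0 ?invr_ge0 ?(ltW CL0) ?(ltW k1).
have T20 : 0 <= 2 * T by rewrite mulr_ge0.
have e20 : 0 < e * ka / 2 by rewrite divr_gt0 // mulr_gt0.
have [J hJ] := geo_choose ka1 T20 e20.
pose D := (CB * 2 ^+ J + r%:R) * 2 ^+ r * CB ^+ r * (CL * A) * (rh ^+ J / (rh - 1)).
have rh0 : 0 <= rh by rewrite mulr_ge0 ?exprn_ge0 ?ka_ge0.
have D0 : 0 <= D.
  by rewrite !mulr_ge0 ?addr_ge0 ?exprn_ge0 ?mulr_ge0 ?exprn_ge0 ?invr_ge0 ?(ltW rh1) ?(ltW CL0) ?ka_ge0.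
have D1 : 0 < D + 1 by rewrite ltr_wpDl.
pose d := Num.min 1 (e * ka / 2 / (D + 1)).
have d0 : 0 < d by rewrite lt_min ltr01 !divr_gt0 // mulr_gt0.
have d1 : d <= 1 by rewrite ge_min lexx.
have dD : d * D <= e * ka / 2.
  have : d * (D + 1) <= e * ka / 2 by rewrite -ler_pdivlMr // ge_min lexx orbT.
  by apply: le_trans; rewrite ler_wpM2l ?(ltW d0) // lerDl.
exists d; first by rewrite d0.
move=> h x x' l h01 xx ll; have [h0 h1] := andP h01.
have [m /andP[m1 m2]] := dyadic_scale h01.
pose F j y k := diffk r (k *: h) (LPR j f) y.
have t1 := diffk_tail r (l *: h) x' (m + J) lf.
have t2 := diffk_tail r h x (m + J) lf.
have tr j : (j < m + J)%N -> `|diffk r (l *: h) (LPR j f) x' - diffk r h (LPR j f) x| <=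
    d * ((CB * 2 ^+ J + r%:R) * 2 ^+ r * (CL * A)) * ((CB * (enorm h / 2 ^- j)) ^+ r * ka ^+ j).
  move=> jm; have bP := LamB_blim j lf; set t : R := 2 ^- j in bP *.
  have t0 : 0 < t := pow2V_gt0 _.
  set b := CB * (enorm h / t).
  have b0 : 0 <= b by rewrite mulr_ge0 ?divr_ge0 ?(ltW t0) ?(ltW h0).
  set G := CL * A * ka ^+ j in bP *.
  have G0 : 0 <= G := blim_ge0 bP.
  have l1 : `|l - 1| <= 1 by apply: le_trans d1.
  have l2 : `|l| <= 2 by have := ler_normD (l - 1) 1; rewrite subrK normr1; lra.
  have e1 := blim_lip n0 eta_LP x x' t0 (blim_diffk n0 eta_LP (l *: h) r t0 bP).
  have e2 := blim_dilate n0 eta_LP h x r t0 l1 bP; rewrite -/b in e2.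
  have bl : CB * (enorm (l *: h) / t) <= 2 * b.
    by rewrite enormZ -mulrA mulrCA -/b ler_wpM2r.
  have bl0 : 0 <= CB * (enorm (l *: h) / t).
    by apply: mulr_ge0 => //; apply: divr_ge0; [exact: enorm_ge0|exact: ltW].
  have b2 : (CB * (enorm (l *: h) / t)) ^+ r <= (2 * b) ^+ r.
    by apply: lerXn2r; rewrite ?nnegrE //; rewrite mulr_ge0.
  have xt : CB * (enorm (x' - x) / t) <= CB * (d * 2 ^+ J).
    rewrite ler_wpM2l // ler_pdivrMr // (le_trans xx) // -mulrA ler_wpM2l ?(ltW d0) //.
    rewrite (le_trans m2) // /t -ler_pdivrMr ?pow2V_gt0 // invrK mulrC ler_pdivrMr ?exprn_gt0 //.
    by rewrite -exprD ler_weXn2l ?ler1n // addnC ltnW.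
  have B0 : 0 <= (2 * b) ^+ r * G by rewrite mulr_ge0 // exprn_ge0 // mulr_ge0.
  have e1' : `|diffk r (l *: h) (LPR j f) x' - diffk r (l *: h) (LPR j f) x| <= CB * (d * 2 ^+ J) * ((2 * b) ^+ r * G).
    apply: (le_trans e1); apply: ler_pM => //.
    - by rewrite mulr_ge0 ?divr_ge0 ?enorm_ge0 ?(ltW t0).
    - by apply: mulr_ge0 => //; exact: exprn_ge0.
    - exact: ler_wpM2r.
  have e2' : `|diffk r (l *: h) (LPR j f) x - diffk r h (LPR j f) x| <= r%:R * d * ((2 * b) ^+ r * G).
    apply: (le_trans e2); rewrite -[leLHS]mulrA; apply: ler_wpM2r => //.
    exact: ler_wpM2l.
  rewrite (_ : diffk r (l *: h) (LPR j f) x' - diffk r h (LPR j f) x =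
    (diffk r (l *: h) (LPR j f) x' - diffk r (l *: h) (LPR j f) x) +
    (diffk r (l *: h) (LPR j f) x - diffk r h (LPR j f) x)); last by ring.
  rewrite (le_trans (ler_normD _ _)) // (le_trans (lerD e1' e2')) //.
  by apply: le_of_eq; rewrite /G exprMn; ring.
have t3 : `|\sum_(j < m + J) diffk r (l *: h) (LPR j f) x' - \sum_(j < m + J) diffk r h (LPR j f) x| <= d * D * ka ^+ m.
  rewrite -sumrB (le_trans (ler_norm_sum _ _ _)) //.
  apply: (le_trans (ler_sum _ (fun (j : 'I_(m + J)) _ => tr j (ltn_ord j)))).
  rewrite -mulr_sumr.
  have H0 : 0 <= d * ((CB * 2 ^+ J + r%:R) * 2 ^+ r * (CL * A)).
    by rewrite !mulr_ge0 ?addr_ge0 ?mulr_ge0 ?exprn_ge0 ?(ltW d0) ?(ltW CL0).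
  rewrite (le_trans (ler_wpM2l H0 (low_sum (m + J) m2))) // exprD.
  apply: le_of_eq; rewrite -rhE /D; ring.
have hs : e * ka * ka ^+ m <= e * powR (enorm h) s.
  by rewrite -mulrA ler_wpM2l ?(ltW e0) // -ler_pdivlMl // powR_dyadic_le.
apply: le_trans hs.
have kJ : 2 * T * ka ^+ (m + J) <= e * ka / 2 * ka ^+ m.
  by rewrite exprD mulrCA mulrC ler_wpM2r ?exprn_ge0 ?ka_ge0 // hJ.
have dDk : d * D * ka ^+ m <= e * ka / 2 * ka ^+ m by rewrite ler_wpM2r ?exprn_ge0 ?ka_ge0.
have TE : 2 ^+ r * (CL * A * ka ^+ (m + J) / (1 - ka)) = T * ka ^+ (m + J) by rewrite /T; ring.
rewrite TE in t1 t2.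
move: t1 t2 t3; set a1 := diffk r (l *: h) f x'; set a2 := \sum_(j < m + J) _.
set b1 := diffk r h f x; set b2 := \sum_(j < m + J) _ => t1 t2 t3.
have -> : a1 - b1 = (a1 - a2) + (a2 - b2) - (b1 - b2) by ring.
rewrite (le_trans (ler_normB _ _)) // (le_trans (lerD (ler_normD _ _) (lexx _))) //.
move: kJ dDk t1 t2 t3; rewrite -mulrA; lra.
Qed.

(** [h] is shortened to length [y] in its own direction; the change costs at most [e |h| ^ s], which
    is what the [2 * e] provides for. *)
Lemma Sset_thick A f e : LamB s A f -> 0 < e -> exists2 d : R, 0 < d <= 1 / 2 &
  forall h x, 0 < enorm h <= 1 -> 2 * e * powR (enorm h) s < `|diffk r h f x| ->
  forall x' y, enorm (x' - x) <= d * enorm h -> (1 - d) * enorm h <= y <= enorm h ->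
  Sset r s f e (x', y).
Proof.
move=> lf e0; have [d /andP[d0 d1] H] := diffk_rel_cont lf e0.
exists (d / 2); first by rewrite divr_gt0 // ler_wpM2r ?invr_ge0.
move=> h x h01 big x' y xx /andP[y1 y2]; have [h0 h1] := andP h01.
have y0 : 0 < y by apply: lt_le_trans y1; rewrite mulr_gt0 //; lra.
apply/SsetP; split => //.
have hn : enorm h != 0 by rewrite gt_eqF.
exists ((y / enorm h) *: h).
  by rewrite enormZ ger0_norm ?divr_ge0 ?(ltW y0) ?(ltW h0) // mulfVK.
have xx' : enorm (x' - x) <= d * enorm h.
  rewrite (le_trans xx) // ler_wpM2r ?(ltW h0) //; lra.
have ll : `|y / enorm h - 1| <= d.
  have : (1 - d / 2) <= y / enorm h by rewrite ler_pdivlMr.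
  have : y / enorm h <= 1 by rewrite ler_pdivrMr // mul1r.
  rewrite ler_norml; lra.
have := H h x x' (y / enorm h) h01 xx' ll.
have ys : powR y s <= powR (enorm h) s by rewrite ge0_ler_powR ?nnegrE ?(ltW s0) ?(ltW y0) ?(ltW h0).
have : e * powR y s <= e * powR (enorm h) s by rewrite ler_wpM2l // ltW.
have := ler_normD (diffk r ((y / enorm h) *: h) f x') (diffk r h f x - diffk r ((y / enorm h) *: h) f x').
rewrite addrC subrK distrC; lra.
Qed.

(** By contraposition: if all differences in a box around [x] were small, [conv_tail] applied to
    [theta_differences] would make the piece small. *)
Lemma large_piece_diff : exists2 C0 : R, 0 < C0 & exists2 tau : R, 0 < tau <= 1 &
  forall A f e, LamB s A f -> 0 < e -> exists2 Z : R, 0 <= Z & exists2 d : R, 0 < d <= 1 / 2 &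
  forall j x, (0 < j)%N -> C0 * e * ka ^+ j < `|LPR j f x| ->
  exists2 x1, inbox (Z * 2 ^- j) (x1 - x) &
  forall x' y, enorm (x' - x1) <= d * 2 ^- j -> (1 - d) * (tau * 2 ^- j) <= y <= tau * 2 ^- j ->
  Sset r s f e (x', y).
Proof.
have [tau /andP[t0 t1] [a [v [mv H]]]] := theta_differences n0 eta_LP r.
pose Ci i := projT1 (cid2 (FT_multiplier_decay 2 n0 (mv i))).
have Ci0 i : 0 < Ci i by rewrite /Ci; case: cid2.
have CiP i b x : `|FT b (v i) x| <= Ci i * maj x ^+ 2 by rewrite /Ci; case: cid2.
pose CK := \sum_i Ci i.
have CK0 : 0 <= CK by apply: sumr_ge0 => i _; exact/ltW.
have pin : 0 <= pi ^+ n :> R by rewrite exprn_ge0 // pi_ge0.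
exists (CK * pi ^+ n * 3 + 1); first by rewrite ltr_wpDl // !mulr_ge0.
exists tau; first by rewrite t0.
move=> A f e lf e0; have A0 := LamB_ge0 lf.
have [cf fA _] := lf.
(* For this [Z] the tail [2 ^ r A / (1 + Z ^ 2)] is at most [e]; with [2 e] inside the box this
   gives the factor 3 in [C0]. *)
pose Z := 2 ^+ r * A / e.
have Z0 : 0 <= Z by rewrite !mulr_ge0 ?exprn_ge0 ?invr_ge0 ?(ltW e0).
have [d /andP[d0 d1] hd] := Sset_thick lf e0.
exists Z => //; exists (d * tau).
  rewrite mulr_gt0 //= (le_trans _ d1) // ler_piMr // ltW //.
move=> [//|j] x _ big.
set t : R := 2 ^- j.+1 in big *.
have tt0 : 0 < t := pow2V_gt0 _.
have tt1 : t <= 1 by rewrite /t invf_le1 ?exprn_gt0 // exprn_ege1 // ler1n.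
have ta : 0 < t * tau by rewrite mulr_gt0.
have ta1 : t * tau <= 1 by rewrite mulr_ile1 ?(ltW t0) ?(ltW tt0).
have he (i : 'I_n) : enorm ((t * tau) *: evec R i) = t * tau.
  by rewrite enormZ enorm_evec mulr1 ger0_norm // ltW.
pose y0 := powR (t * tau) s.
have y00 : 0 <= y0 by rewrite powR_ge0.
have y0k : y0 <= ka ^+ j.+1.
  by rewrite powR_dyadic_ge ?(ltW ta) // -/t ler_piMr // ltW.
have [i [z [iz bz]]] : exists i z, inbox Z z /\
    2 * e * y0 < `|diffk r ((t * tau) *: evec R i) f (x - t *: z)|.
  apply: contrapT => /forallNP Hn.
  have Hb i z : inbox Z z -> `|diffk r ((t * tau) *: evec R i) f (x - t *: z)| <= 2 * e * y0.
    by move=> iz; rewrite leNgt; apply/negP => lt; apply: (Hn i); exists z.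
  have : `|LPR j.+1 f x| <= CK * pi ^+ n * 3 * e * ka ^+ j.+1.
    have -> : LPR j.+1 f x = conv (FT 0 (LP_theta eta)) t f x by [].
    rewrite (H A) // (le_trans (ler_norm_sum _ _ _)) //.
    apply: (@le_trans _ _ (\sum_i Ci i * (pi ^+ n * (3 * e * ka ^+ j.+1)))); last first.
      by rewrite -mulr_suml -/CK !mulrA.
    apply: ler_sum => i _.
    have db y : `|diffk r ((t * tau) *: evec R i) f y| <= 2 ^+ r * A * y0.
      by rewrite /y0 -{2}(he i); apply: LamB_diffk => //; rewrite he ta ta1.
    have [C1 C10 g1] := FT_multiplier_good n0 (mv i).
    have ey0 : 0 <= 2 * e * y0 by rewrite !mulr_ge0 // ltW.
    have := @conv_tail R n (Ci i) (2 ^+ r * A * y0) (2 * e * y0) Z (FT a (v i)) 1 t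
      (diffk r ((t * tau) *: evec R i) f) x (g1 a).1 (CiP i a) (@continuous_diffk _ _ _ _ _ cf) db
      ey0 Z0 (Hb i).
    move/le_trans; apply; rewrite -mulrA ler_wpM2l ?(ltW (Ci0 i)) // ler_wpM2l // expr1.
    apply: (@le_trans _ _ (3 * e * y0)); last by rewrite ler_wpM2l // mulr_ge0 // ltW.
    have : 2 ^+ r * A * y0 / (1 + Z ^+ 2) <= e * y0.
      have Ze : 2 ^+ r * A <= e * (1 + Z ^+ 2).
        have <- : Z * e = 2 ^+ r * A by rewrite /Z divfK // gt_eqF.
        rewrite mulrC ler_wpM2l ?(ltW e0) //.
        have := sqr_ge0 (Z - 1); rewrite (_ : (Z - 1) ^+ 2 = Z ^+ 2 - 2 * Z + 1); last by ring.
        by move: Z0; lra.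
      have Zp : 0 < 1 + Z ^+ 2 by rewrite ltr_pwDl // sqr_ge0.
      by rewrite ler_pdivrMr // [leRHS]mulrAC ler_wpM2r.
    lra.
  move/(lt_le_trans big); rewrite !mulrDl mul1r ltNge lerDl mulr_ge0 ?exprn_ge0 ?ka_ge0 //.
  exact: ltW.
exists (x - t *: z).
  move=> k; rewrite !mxE addrAC subrr add0r normrN normrM (ger0_norm (ltW tt0)) mulrC.
  by rewrite ler_wpM2r // ltW.
have yl : (1 - d) * (t * tau) <= (1 - d * tau) * (tau * t).
  rewrite [t * tau]mulrC; apply: ler_wpM2r; first by apply: mulr_ge0; exact: ltW.
  by rewrite lerD2l lerN2 ler_piMr // ltW.
move=> x' y xx /andP[y1 y2]; apply: (hd ((t * tau) *: evec R i) (x - t *: z)).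
- by rewrite he ta ta1.
- by rewrite he.
- by rewrite he mulrCA mulrC.
- by rewrite he (le_trans yl y1) /= [t * tau]mulrC.
Qed.

(** Levels below [m - J] and from [m + J] on cannot carry the whole difference, so one of the levels
    in between is large at a point that the difference sees. *)
Lemma large_diff_piece A g (del : R) : LamB s A g -> 0 < del ->
  exists J : nat, exists2 c : R, 0 < c &
  forall x h m, 2 ^- m.+1 < enorm h <= 2 ^- m -> del * powR (enorm h) s < `|diffk r h g x| ->
  exists (j : nat) x', [/\ (m <= j + J)%N, (j < m + J)%N, enorm (x' - x) <= r%:R * enorm h &
    c * ka ^+ j < `|LPR j g x'|].
Proof.
move=> lg d0; have A0 := LamB_ge0 lg; have CB0 := CB_ge0 n0 eta_LP; have CL0 := CL_gt0.
have k0 := @ka_gt0 R s; have k1 : 0 < 1 - ka by rewrite subr_gt0 ka_lt1.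
have r1 := rh1; have rg : 0 < rh by have := rh1; lra.
pose T1 := CB ^+ r * (CL * A) / (rh - 1).
pose T2 := 2 ^+ r * (CL * A / (1 - ka)).
have T10 : 0 <= T1 by rewrite !mulr_ge0 ?exprn_ge0 ?invr_ge0 ?(ltW CL0) ?(ltW r1).
have T20 : 0 <= T2 by rewrite !mulr_ge0 ?exprn_ge0 ?invr_ge0 ?(ltW CL0) ?(ltW k1).
have e0 : 0 < del * ka / 4 by rewrite divr_gt0 // mulr_gt0.
have rV : 0 <= rh^-1 < 1 by rewrite invr_ge0 (ltW rg) invf_lt1 // -subr_gt0.
have [J1 hJ1] := geo_choose rV T10 e0.
have [J2 hJ2] := geo_choose ka1 T20 e0.
have [J [hA hB]] : exists J : nat, T1 * rh^-1 ^+ J <= del * ka / 4 /\ T2 * ka ^+ J <= del * ka / 4.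
  by exists (J1 + J2)%N; rewrite hJ1 ?leq_addr // hJ2 ?leq_addl.
(* Low, high and middle levels get a quarter of the difference each; the middle quarter is shared
   among at most [2 J + 1] levels. *)
pose c := del * ka / 4 * ka ^+ J / (2 ^+ r * (2 * J + 1)%:R).
have c0 : 0 < c by rewrite !divr_gt0 // ?mulr_gt0 ?exprn_gt0 // ltr0n addn1.
exists J, c => // x h m /andP[m1 m2] big.
have h0 : 0 < enorm h by rewrite (lt_trans _ m1) // pow2V_gt0.
apply: contrapT => Hn.
have Hb j x' : (m <= j + J)%N -> (j < m + J)%N -> enorm (x' - x) <= r%:R * enorm h ->
    `|LPR j g x'| <= c * ka ^+ j.
  by move=> a1 a2 a3; rewrite leNgt; apply/negP => lt; apply: Hn; exists j, x'.
have tl := diffk_tail r h x (m + J) lg.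
have TE : 2 ^+ r * (CL * A * ka ^+ (m + J) / (1 - ka)) = T2 * ka ^+ J * ka ^+ m.
  by rewrite exprD /T2; ring.
rewrite TE in tl.
have S1 : `|\sum_(0 <= j < m - J) diffk r h (LPR j g) x| <= T1 * rh^-1 ^+ J * ka ^+ m.
  rewrite big_mkord; case: (leqP J m) => Jm; last first.
    have -> : (m - J = 0)%N by apply/eqP; rewrite subn_eq0 ltnW.
    by rewrite big_ord0 normr0 mulr_ge0 ?exprn_ge0 ?ka_ge0 // mulr_ge0 // exprn_ge0 // invr_ge0 ltW.
  rewrite (le_trans (ler_norm_sum _ _ _)) //.
  apply: (@le_trans _ _ (\sum_(j < m - J) CL * A * ((CB * (enorm h / 2 ^- j)) ^+ r * ka ^+ j))).
    apply: ler_sum => j _.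
    have [_ hb _] := blim_diffk n0 eta_LP h r (pow2V_gt0 j) (LamB_blim j lg).
    by rewrite (le_trans (hb x)) // mulrCA.
  rewrite -mulr_sumr (le_trans (ler_wpM2l _ (low_sum (m - J) m2))) ?mulr_ge0 ?(ltW CL0) //.
  have rhm : rh ^+ m = rh ^+ (m - J) * rh ^+ J by rewrite -exprD subnK.
  have YV : rh ^- J * rh ^+ J = 1 by rewrite mulVf // expf_neq0 // gt_eqF.
  rewrite -(rhE m) rhm [rh^-1 ^+ J]exprVn; apply: le_of_eq.
  have -> : T1 * rh ^- J * ((2 ^- m) ^+ r * (rh ^+ (m - J) * rh ^+ J)) =
    CL * A * (CB ^+ r * (2 ^- m) ^+ r * (rh ^+ (m - J) / (rh - 1))) * (rh ^- J * rh ^+ J).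
    by rewrite /T1; ring.
  by rewrite YV mulr1.
have S2 : `|\sum_(m - J <= j < m + J) diffk r h (LPR j g) x| <= del * ka / 4 * ka ^+ m.
  apply: (@le_trans _ _ (\sum_(m - J <= j < m + J) 2 ^+ r * (c * (ka ^+ m / ka ^+ J)))).
    rewrite (le_trans (ler_norm_sum _ _ _)) // big_nat [leRHS]big_nat; apply: ler_sum => j /andP[j1 j2].
    have mj : (m <= j + J)%N by move: j1; clear; lia.
    apply: (le_trans (diffk_local (fun y hy => Hb j y mj j2 hy))).
    rewrite ler_wpM2l ?exprn_ge0 // ler_wpM2l ?(ltW c0) // ler_pdivlMr ?exprn_gt0 // -exprD.
    by rewrite ler_wiXn2l ?ka_ge0 // ltW // ka_lt1.
  rewrite sumr_const_nat -[leLHS]mulr_natr.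
  have cnt : (m + J - (m - J) <= 2 * J + 1)%N by clear; lia.
  have c1 : 0 <= 2 ^+ r * (c * (ka ^+ m / ka ^+ J)).
    by rewrite mulr_ge0 ?exprn_ge0 // mulr_ge0 ?(ltW c0) // divr_ge0 ?exprn_ge0 ?ka_ge0.
  apply: (@le_trans _ _ (2 ^+ r * (c * (ka ^+ m / ka ^+ J)) * (2 * J + 1)%:R)).
    by rewrite ler_wpM2l // ler_nat.
  have cE : c * (2 ^+ r * (2 * J + 1)%:R) = del * ka / 4 * ka ^+ J.
    by rewrite /c divfK // mulf_neq0 ?expf_neq0 // pnatr_eq0 addn1.
  have kE : ka ^+ J * (ka ^+ m / ka ^+ J) = ka ^+ m by rewrite mulrC divfK // expf_neq0 // gt_eqF.
  have -> : del * ka / 4 * ka ^+ m = c * (2 ^+ r * (2 * J + 1)%:R) * (ka ^+ m / ka ^+ J).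
    by rewrite cE -[RHS]mulrA kE.
  by apply: le_of_eq; generalize (ka ^+ m / ka ^+ J) ((2 * J + 1)%:R : R) => a b; ring.
have hs : del * ka * ka ^+ m <= del * powR (enorm h) s.
  by rewrite -mulrA ler_wpM2l ?(ltW d0) // -ler_pdivlMl // powR_dyadic_le.
have kk : 0 <= ka ^+ m by rewrite exprn_ge0 // ka_ge0.
have hA' := ler_wpM2r kk hA; have hB' := ler_wpM2r kk hB.
move: tl; rewrite -(big_mkord xpredT (fun j => diffk r h (LPR j g) x)).
rewrite (@big_cat_nat _ _ _ (m - J)) //=; last by clear; lia.
move: S1 S2 big; set a1 := \sum_(_ <= _ < _) _; set a2 := \sum_(_ <= _ < _) _ => S1 S2 big tl.
have := ler_normD (diffk r h g x - (a1 + a2)) (a1 + a2); rewrite subrK.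
have := ler_normD a1 a2.
have kp : 0 < ka ^+ m by rewrite exprn_gt0.
have : 0 < del * ka * ka ^+ m by rewrite !mulr_gt0.
lra.
Qed.

End Detection.

(** * Counting marked dyadic cubes *)

Section IntnStep.
Context {R : realType}.
Local Notation mu := (@lebesgue_measure R).
Local Open Scope ereal_scope.

(** The integral of a nonnegative function is a supremum over the simple functions below it, so
    monotonicity holds for arbitrary functions. *)
Lemma ge0_le_integralT (f g : R -> \bar R) : (forall x, 0 <= f x) -> (forall x, f x <= g x) ->
  \int[mu]_x f x <= \int[mu]_x g x.
Proof.
move=> f0 fg; have g0 x : 0 <= g x by exact: le_trans (fg x).
rewrite !ge0_integralE // !patch_setT.
apply: ge_ereal_sup => _ [h hf <-]; apply: ereal_sup_ubound; exists h => // x.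
exact: le_trans (fg x).
Qed.

Lemma intn_ge0 n (F : 'rV[R]_n -> \bar R) : (forall x, 0 <= F x) -> 0 <= intn F.
Proof.
elim: n F => [|n IH] F F0 /=; first exact: F0.
by apply: integral_ge0 => t _; apply: IH => v.
Qed.

Lemma intn_le n (F G : 'rV[R]_n -> \bar R) : (forall x, 0 <= F x) -> (forall x, F x <= G x) ->
  intn F <= intn G.
Proof.
elim: n F G => [|n IH] F G F0 FG /=; first exact: FG.
apply: ge0_le_integralT => t; first by apply: intn_ge0.
exact: IH.
Qed.

(** An enumeration of the integers, so that the line becomes a union of cells indexed by the
    naturals. *)
Definition zen (k : nat) : int := if odd k then Negz k./2 else Posz k./2.

Lemma zen_bij : set_bij [set: nat] [set: int] zen.
Proof.
split => //.
  move=> i j _ _; rewrite /zen => E.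
  rewrite -(odd_double_half i) -(odd_double_half j); move: E.
  by case: (odd i); case: (odd j) => // -[->].
move=> z _; case: z => k.
  by exists k.*2 => //; rewrite /zen odd_double doubleK.
by exists k.*2.+1 => //; rewrite /zen /= odd_double /= uphalf_double.
Qed.

Definition fstep (M : nat) (k : int) : set R := [set t : R | Num.floor (2 ^+ M * t)%R = k].

Lemma fstepE M k : fstep M k = [set` `[(k%:~R / 2 ^+ M)%R, ((k + 1)%:~R / 2 ^+ M)%R[].
Proof.
have p0 : (0 < 2 ^+ M :> R)%R by rewrite exprn_gt0.
apply/seteqP; split => t; rewrite /fstep /= in_itv /= ler_pdivrMr // ltr_pdivlMr // [(t * _)%R]mulrC.
  by move=> <-; exact: floor_itv.
exact: floor_def.
Qed.

Lemma measurable_fstep M k : measurable (fstep M k).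
Proof. by rewrite fstepE; exact: measurable_itv. Qed.

Lemma mu_fstep M k : mu (fstep M k) = (2 ^- M)%:E.
Proof.
have p0 : (0 < 2 ^+ M :> R)%R by rewrite exprn_gt0.
rewrite fstepE lebesgue_measure_itv /= lte_fin ltr_pM2r ?invr_gt0 // ltr_int ltrDl /=.
by rewrite -EFinB -mulrBl intrD addrAC subrr add0r mul1r.
Qed.

Lemma measurable_step M (w : int -> \bar R) :
  measurable_fun setT (fun t : R => w (Num.floor (2 ^+ M * t)%R)).
Proof.
move=> _ Y mY; rewrite setTI.
have -> : (fun t : R => w (Num.floor (2 ^+ M * t)%R)) @^-1` Y =
    \bigcup_(i in [set i | Y (w (zen i))]) fstep M (zen i).
  have [_ _ zs] := zen_bij.
  apply/seteqP; split => t /=.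
    move=> Yt; have [i _ Hi] := zs (Num.floor (2 ^+ M * t)%R) I.
    by exists i; rewrite /= /fstep /= ?Hi.
  by move=> [i /= Yi]; rewrite /fstep /= => ->.
by apply: bigcup_measurable => i _; exact: measurable_fstep.
Qed.

Lemma esumZl (T : choiceType) (c : R) (w : T -> \bar R) : (0 <= c)%R -> (forall k, 0 <= w k) ->
  \esum_(k in [set: T]) (c%:E * w k) = c%:E * \esum_(k in [set: T]) w k.
Proof.
have half (d : R) (v : T -> \bar R) : (0 <= d)%R -> (forall k, 0 <= v k) ->
    \esum_(k in [set: T]) (d%:E * v k) <= d%:E * \esum_(k in [set: T]) v k.
  move=> d0 v0; apply: ge_ereal_sup => _ [X fX <-].
  rewrite -ge0_mule_fsumr // lee_wpmul2l ?lee_fin //.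
  by apply: ereal_sup_ubound; exists X.
rewrite le_eqVlt => /orP[/eqP <-|c0] w0.
  by rewrite mul0e esum1 // => k _; rewrite mul0e.
apply/eqP; rewrite eq_le half ?(ltW c0) //=.
have ci : (0 <= c^-1)%R by rewrite invr_ge0 ltW.
have cw k : 0 <= c%:E * w k by rewrite mule_ge0 // lee_fin ltW.
have := half _ _ ci cw.
have E : \esum_(k in [set: T]) (c^-1%:E * (c%:E * w k)) = \esum_(k in [set: T]) w k.
  by apply: eq_esum => k _; rewrite muleA -EFinM mulVf ?gt_eqF // mul1e.
rewrite E => /(lee_wpmul2l (_ : 0 <= c%:E)); rewrite lee_fin => /(_ (ltW c0)).
by rewrite muleA -EFinM mulfV ?gt_eqF // mul1e.
Qed.

Lemma integral_step M (w : int -> \bar R) : (forall k, 0 <= w k) ->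
  \int[mu]_t w (Num.floor (2 ^+ M * t)%R) = (2 ^- M)%:E * \esum_(k in [set: int]) w k.
Proof.
move=> w0; have [_ zi zs] := zen_bij.
have cov : [set: R] = \bigcup_i fstep M (zen i).
  apply/seteqP; split => // t _; have [i _ Hi] := zs (Num.floor (2 ^+ M * t)%R) I.
  by exists i => //; rewrite /fstep /= Hi.
rewrite [X in integral _ X](_ : _ = \bigcup_i fstep M (zen i)) //.
rewrite ge0_integral_bigcup //.
- transitivity (\sum_(i <oo) (2 ^- M)%:E * w (zen i)).
    apply: eq_eseriesr => i _.
    rewrite (eq_integral (cst (w (zen i)))); last first.
      by move=> t; rewrite inE /fstep /= => ->.
    transitivity (w (zen i) * mu (fstep M (zen i))); last by rewrite mu_fstep muleC.
    by apply: integral_cst; exact: measurable_fstep.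
  have p0 : (0 <= 2 ^- M :> R)%R by rewrite invr_ge0 exprn_ge0.
  rewrite nneseries_esumT; last by move=> i; rewrite mule_ge0 // lee_fin.
  by rewrite esumZl // (@reindex_esum R _ _ setT setT zen w zen_bij).
- by move=> i; exact: measurable_fstep.
- by rewrite -cov; exact: measurable_step.
- by move=> i j _ _ [t []]; rewrite /fstep /= => Ei Ej; apply: zi; rewrite ?inE // -Ei -Ej.
Qed.

Definition cnz n (k : int) (v : 'rV[int]_n) : 'rV[int]_n.+1 := row_mx (\row_(_ < 1) k) v.

Lemma cnz0 n k (v : 'rV[int]_n) : cnz k v 0%R ord0 = k.
Proof.
rewrite /cnz (_ : ord0 = lshift n (0%R : 'I_1)); last exact/val_inj.
exact: (etrans (row_mxEl _ _ _ _) (mxE _ _ _ _)).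
Qed.

Lemma cnzS n k (v : 'rV[int]_n) i : cnz k v 0%R (lift ord0 i) = v 0%R i.
Proof.
rewrite /cnz mxE; case: splitP => [j|j]; first by rewrite [j]ord1.
by rewrite /= /bump add1n => -[/ord_inj ->].
Qed.

Lemma esum_cnz n (w : 'rV[int]_n.+1 -> \bar R) : (forall k, 0 <= w k) ->
  \esum_(k in [set: 'rV[int]_n.+1]) w k =
  \esum_(k in [set: int]) \esum_(v in [set: 'rV[int]_n]) w (cnz k v).
Proof.
move=> w0; rewrite esum_esum //.
rewrite (@reindex_esum _ _ _ ([set: int] `*`` (fun=> [set: 'rV[int]_n])) [set: 'rV[int]_n.+1]
  (fun p => cnz p.1 p.2)) //; split => //.
  move=> [k v] [k' v'] _ _ /= E; congr pair.
    by rewrite -(cnz0 k v) E cnz0.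
  by apply/rowP => i; rewrite -(cnzS k v) E cnzS.
move=> z _; exists (z 0%R ord0, \row_i z 0%R (lift ord0 i)) => //=.
apply/rowP => i; case: (unliftP ord0 i) => [j ->|->]; first by rewrite cnzS mxE.
by rewrite cnz0.
Qed.

(** The index of the dyadic cube of side [2 ^- M] that contains [x]. *)
Definition flr n (M : nat) (x : 'rV[R]_n) : 'rV[int]_n := \row_i Num.floor (2 ^+ M * x 0%R i)%R.

Lemma flr_cns n M t (v : 'rV[R]_n) : flr M (cns t v) = cnz (Num.floor (2 ^+ M * t)%R) (flr M v).
Proof.
apply/rowP => i; case: (unliftP ord0 i) => [j ->|->].
  by rewrite cnzS mxE [in RHS]mxE cnsS.
by rewrite cnz0 mxE cns0.
Qed.

(** The integral of the function with value [w k] on the cube of level [M] and index [k], as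
    [intn_step] confirms. *)
Definition lat n (M : nat) (w : 'rV[int]_n -> \bar R) : \bar R :=
  ((2 ^- M) ^+ n)%:E * \esum_(k in [set: 'rV[int]_n]) w k.

Lemma pow2Vn_ge0 n M : (0 <= (2 ^- M) ^+ n :> R)%R.
Proof. by rewrite exprn_ge0 // invr_ge0 exprn_ge0. Qed.

Lemma lat_ge0 n M (w : 'rV[int]_n -> \bar R) : (forall k, 0 <= w k) -> 0 <= lat M w.
Proof.
by move=> w0; rewrite mule_ge0 // ?lee_fin ?pow2Vn_ge0 // esum_ge0.
Qed.

Lemma esum_rV0 (w : 'rV[int]_0 -> \bar R) : (forall k, 0 <= w k) ->
  \esum_(k in [set: 'rV[int]_0]) w k = w 0%R.
Proof.
move=> w0; have -> : [set: 'rV[int]_0] = [set 0%R].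
  by apply/seteqP; split => // k _ /=; apply/rowP => -[].
by rewrite esum_set1.
Qed.

Lemma intn_step n M (w : 'rV[int]_n -> \bar R) : (forall k, 0 <= w k) ->
  intn (fun x => w (flr M x)) = lat M w.
Proof.
elim: n w => [|n IH] w w0 /=.
  rewrite /lat expr0 mul1e esum_rV0 //; congr (w _); by apply/rowP => -[].
transitivity (\int[mu]_t (lat M (fun v => w (cnz (Num.floor (2 ^+ M * t)%R) v)))).
  apply: eq_integral => t _; rewrite -IH //; congr intn; apply/funext => v.
  by rewrite -/(cns t v) flr_cns.
rewrite (@integral_step M (fun k => lat M (fun v => w (cnz k v)))); last by move=> k; exact: lat_ge0.
rewrite /lat esumZl ?pow2Vn_ge0 //; last by move=> k; exact: esum_ge0.
by rewrite muleA -EFinM -exprS -esum_cnz.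
Qed.

Lemma intn_ge_lat n M (w : 'rV[int]_n -> \bar R) (G : 'rV[R]_n -> \bar R) :
  (forall k, 0 <= w k) -> (forall x, w (flr M x) <= G x) -> lat M w <= intn G.
Proof. by move=> w0 wG; rewrite -intn_step //; exact: intn_le. Qed.

(** Monotone convergence is applied to the step functions only, one coordinate at a time, so [G]
    itself may fail to be measurable. *)
Lemma intn_le_sup n (W : nat -> 'rV[int]_n -> \bar R) (G : 'rV[R]_n -> \bar R) :
  (forall M k, 0 <= W M k) -> (forall M x, W M (flr M x) <= W M.+1 (flr M.+1 x)) ->
  (forall x, 0 <= G x) -> (forall x, G x <= ereal_sup (range (fun M => W M (flr M x)))) ->
  intn G <= ereal_sup (range (fun M => lat M (W M))).
Proof.
elim: n W G => [|n IH] W G W0 mW G0 GW /=.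
  apply: (le_trans (GW 0%R)); apply: ge_ereal_sup => _ [M _ <-].
  apply: ereal_sup_ubound; exists M => //=; rewrite /lat expr0 mul1e esum_rV0 //.
  by congr (W M _); apply/rowP => -[].
pose Phi M (t : R) := lat M (fun v => W M (cnz (Num.floor (2 ^+ M * t)%R) v)).
have Phi0 M t : 0 <= Phi M t by apply: lat_ge0 => v; exact: W0.
have mPhi M : measurable_fun setT (Phi M).
  exact: (@measurable_step M (fun k => lat M (fun v => W M (cnz k v)))).
have ndPhi t : nondecreasing_seq (Phi ^~ t).
  apply/nondecreasing_seqP => M; rewrite /Phi -!intn_step //.
  by apply: intn_le => // v; rewrite -!flr_cns.
have h1 : intn G <= \int[mu]_t ereal_sup (range (Phi ^~ t)).
  apply: ge0_le_integralT => t; first by apply: intn_ge0 => v; exact: G0.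
  apply: (IH (fun M v => W M (cnz (Num.floor (2 ^+ M * t)%R) v))) => //.
  - by move=> M v; rewrite -!flr_cns.
  - move=> v; have := GW (cns t v).
    by under eq_fun do rewrite flr_cns.
apply: (le_trans h1).
have -> : \int[mu]_t ereal_sup (range (Phi ^~ t)) = \int[mu]_t limn (Phi ^~ t).
  apply: eq_integral => t _; apply/esym/cvg_lim => //.
  exact: ereal_nondecreasing_cvgn.
rewrite monotone_convergence //.
have E M : \int[mu]_t Phi M t = lat M (W M).
  rewrite (@integral_step M (fun k => lat M (fun v => W M (cnz k v)))); last by move=> k; exact: lat_ge0.
  rewrite /lat esumZl ?pow2Vn_ge0 //; last by move=> k; exact: esum_ge0.
  by rewrite muleA -EFinM -exprS -esum_cnz.
under eq_fun do rewrite E.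
have -> : limn (fun M => lat M (W M)) = ereal_sup (range (fun M => lat M (W M))) => //.
apply: cvg_lim => //; apply: ereal_nondecreasing_cvgn; apply/nondecreasing_seqP => M.
by rewrite -!intn_step //; exact: intn_le.
Qed.

End IntnStep.

(** * Powers of counts as sums over ranks *)

Section RankSums.
Context {R : realType}.
Implicit Types (a c u x y : R) (b : nat -> bool).

(** Young's inequality for the product [u * 1] with exponent [a]. *)
Lemma bernoulli_ge a u : 1 <= a -> 0 <= u -> 1 + a * (u - 1) <= powR u a.
Proof.
move=> a1 u0; have a0 : 0 < a by apply: lt_le_trans a1.
move: a1; rewrite le_eqVlt => /orP[/eqP <-|a1]; first by rewrite powRr1 // mul1r; lra.
have d0 : 0 < a - 1 by rewrite subr_gt0.
have q0 : 0 < a / (a - 1) by rewrite divr_gt0.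
have pq : a^-1 + (a / (a - 1))^-1 = 1 by field; rewrite !gt_eqF.
have := conjugate_powR u0 ler01 a0 q0 pq; rewrite mulr1 powR1 => h.
have : a * u <= a * (powR u a / a + 1 / (a / (a - 1))) by rewrite ler_pM2l.
have -> : a * (powR u a / a + 1 / (a / (a - 1))) = powR u a + a - 1 by field; rewrite !gt_eqF.
lra.
Qed.

(** This is [bernoulli_ge] with exponent [1 / a] at the point [u ^ a]. *)
Lemma bernoulli_le a u : 0 < a <= 1 -> 0 <= u -> powR u a <= 1 + a * (u - 1).
Proof.
move=> /andP[a0 a1] u0; have b1 : 1 <= a^-1 by rewrite invf_ge1.
have := bernoulli_ge b1 (powR_ge0 u a).
rewrite -powRrM mulfV ?gt_eqF // powRr1 // => h.
have := h; rewrite -(ler_pM2l a0) mulrDr mulrA mulfV ?gt_eqF // mul1r; lra.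
Qed.

Lemma powR_pred a x : 0 < x -> powR x a = x * powR x (a - 1).
Proof.
by move=> x0; rewrite -{2}(powRr1 (ltW x0)) -powRD ?(gt_eqF x0) ?implybT // addrCA subrr addr0.
Qed.

Lemma powR_predE a x : 1 <= x -> powR (x - 1) a = powR x a * powR ((x - 1) / x) a.
Proof.
move=> x1; have x0 : 0 < x by apply: lt_le_trans x1.
rewrite -powRM ?divr_ge0 ?subr_ge0 ?(ltW x0) // mulrC divfK // gt_eqF //.
Qed.

Lemma powR_step_ge a x : 0 < a <= 1 -> 1 <= x -> a * powR x (a - 1) <= powR x a - powR (x - 1) a.
Proof.
move=> a01 x1; have x0 : 0 < x by apply: lt_le_trans x1.
have u0 : 0 <= (x - 1) / x by rewrite divr_ge0 ?subr_ge0 ?(ltW x0).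
have := bernoulli_le a01 u0; rewrite powR_predE //.
have -> : (x - 1) / x - 1 = - x^-1 by field; rewrite gt_eqF.
have p0 := powR_ge0 x (a - 1); rewrite (powR_pred a x0) => h.
have hx : 0 <= x * powR x (a - 1) by rewrite mulr_ge0 // ltW.
have := ler_wpM2l hx h.
have -> : x * powR x (a - 1) * (1 + a * - x^-1) = x * powR x (a - 1) - a * powR x (a - 1).
  by field; rewrite gt_eqF.
lra.
Qed.

Lemma powR_step_le a x : 1 <= a -> 1 <= x -> powR x a - powR (x - 1) a <= a * powR x (a - 1).
Proof.
move=> a01 x1; have x0 : 0 < x by apply: lt_le_trans x1.
have u0 : 0 <= (x - 1) / x by rewrite divr_ge0 ?subr_ge0 ?(ltW x0).
have := bernoulli_ge a01 u0; rewrite powR_predE //.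
have -> : (x - 1) / x - 1 = - x^-1 by field; rewrite gt_eqF.
have p0 := powR_ge0 x (a - 1); rewrite (powR_pred a x0) => h.
have hx : 0 <= x * powR x (a - 1) by rewrite mulr_ge0 // ltW.
have := ler_wpM2l hx h.
have -> : x * powR x (a - 1) * (1 + a * - x^-1) = x * powR x (a - 1) - a * powR x (a - 1).
  by field; rewrite gt_eqF.
lra.
Qed.

Lemma powR_antitone c x y : c <= 0 -> 0 < x -> x <= y -> powR y c <= powR x c.
Proof.
move=> c0 x0 xy; have y0 : 0 < y := lt_le_trans x0 xy.
have E z : powR z c = (powR z (- c))^-1 by rewrite -powRN opprK.
rewrite !E lef_pV2 ?posrE ?powR_gt0 //.
by rewrite ge0_ler_powR ?nnegrE ?oppr_ge0 ?(ltW x0) ?(ltW y0).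
Qed.

Lemma rank_le b a M : 0 < a <= 1 -> powR (\sum_(m < M) b m)%:R a <=
  \sum_(m < M) (b m)%:R * powR (\sum_(m' < m.+1) b m')%:R (a - 1).
Proof.
move=> /andP[a0 a1]; set T := (\sum_(m < M) b m)%N.
have r0 (m : nat) : 0 <= (b m)%:R * powR (\sum_(m' < m.+1) b m')%:R (a - 1).
  by rewrite mulr_ge0 // powR_ge0.
case: (posnP T) => [->|T0]; first by rewrite powR0 ?gt_eqF // sumr_ge0.
have T1 : 0 < T%:R :> R by rewrite ltr0n.
rewrite (powR_pred a T1) {1}/T natr_sum mulr_suml; apply: ler_sum => m _.
case bm: (b m); last by rewrite !mul0r.
rewrite !mul1r; apply: powR_antitone; first by rewrite subr_le0.
  by rewrite ltr0n big_ord_recr /= bm addn1.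
rewrite -natr_sum ler_nat -!(big_mkord xpredT (fun m => nat_of_bool (b m))).
by rewrite [X in (_ <= X)%N](@big_cat_nat _ _ _ m.+1) //= leq_addr.
Qed.

(** Telescoping: a mark of rank [x] raises the a-th power of the count by at least
    [a x ^ (a - 1)]. *)
Lemma rank_sum_le b a M : 0 < a <= 1 ->
  \sum_(m < M) (b m)%:R * powR (\sum_(m' < m.+1) b m')%:R (a - 1) <=
  powR (\sum_(m < M) b m)%:R a / a.
Proof.
move=> a01; have [a0 a1] := andP a01; elim: M => [|M IH].
  by rewrite !big_ord0 powR0 ?gt_eqF // mul0r.
rewrite big_ord_recr /= [X in (X)%:R `^ a / _]big_ord_recr /=.
case bM: (b M); last by rewrite mul0r addr0 addn0.
rewrite [X in _ + _ * powR X%:R _]big_ord_recr /= bM mul1r.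
set T := (\sum_(m < M) b m)%N in IH *.
have x1 : 1 <= (T + 1)%:R :> R by rewrite addn1 ler1n.
have := powR_step_ge a01 x1.
rewrite [(T + 1)%:R - 1](_ : _ = T%:R); last by rewrite natrD addrK.
move: IH; rewrite !ler_pdivlMr // mulrDl [_ * a in X in _ -> _ -> X <= _]mulrC; lra.
Qed.

(** The same telescoping; for [a >= 1] a mark of rank [x] raises the power by at most
    [a x ^ (a - 1)]. *)
Lemma rank_ge b a M : 1 <= a -> powR (\sum_(m < M) b m)%:R a <=
  a * \sum_(m < M) (b m)%:R * powR (\sum_(m' < m.+1) b m')%:R (a - 1).
Proof.
move=> a1; have a0 : 0 < a by apply: lt_le_trans a1.
elim: M => [|M IH]; first by rewrite !big_ord0 powR0 ?gt_eqF // mulr0.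
rewrite [X in (X)%:R `^ a]big_ord_recr /=.
rewrite [X in a * X]big_ord_recr /=.
case bM: (b M); last by rewrite mul0r addr0 addn0.
rewrite [X in _ + _ * powR X%:R _]big_ord_recr /= bM mul1r.
set T := (\sum_(m < M) b m)%N in IH *.
have x1 : 1 <= (T + 1)%:R :> R by rewrite addn1 ler1n.
have := powR_step_le a1 x1.
rewrite [(T + 1)%:R - 1](_ : _ = T%:R); last by rewrite natrD addrK.
by move: IH; rewrite mulrDr; lra.
Qed.

(** Split at [c x = e y]: on one side the term is absorbed by [e y ^ a], on the other [y] is at most
    a multiple of [x]. The free parameter [e] is what makes absorption possible later. *)
Lemma young_threshold a c e x y : 1 <= a -> 0 < c -> 0 < e -> 0 <= x -> 0 <= y ->
  c * (x * powR y (a - 1)) <= e * powR y a + powR c a * powR e (1 - a) * powR x a.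
Proof.
move=> a1 c0 e0 x0 y0; have a0 : 0 < a by apply: lt_le_trans a1.
have p1 : 0 <= powR c a * powR e (1 - a) * powR x a by rewrite !mulr_ge0 ?powR_ge0.
have p2 : 0 <= e * powR y a by rewrite mulr_ge0 ?powR_ge0 ?(ltW e0).
case: (leP (c * x) (e * y)) => h.
  apply: (@le_trans _ _ (e * powR y a)); last by rewrite lerDl.
  move: y0; rewrite le_eqVlt => /orP[/eqP y0|y0].
    have x00 : x = 0.
      apply/eqP; rewrite eq_le x0 andbT; move: h; rewrite -y0 mulr0.
      by rewrite pmulr_rle0.
    by rewrite x00 mul0r mulr0 mulr_ge0 ?powR_ge0 ?(ltW e0).
  by rewrite (powR_pred a y0) !mulrA ler_wpM2r ?powR_ge0.
apply: (@le_trans _ _ (powR c a * powR e (1 - a) * powR x a)); last by rewrite lerDr.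
have cx : 0 < c * x by apply: le_lt_trans h; rewrite mulr_ge0 // ltW.
have xp : 0 < x by move: cx; rewrite pmulr_rgt0.
have yb : powR y (a - 1) <= powR (c * x / e) (a - 1).
  rewrite ge0_ler_powR ?nnegrE ?subr_ge0 ?divr_ge0 ?(ltW cx) ?(ltW e0) //.
  by rewrite ler_pdivlMr // mulrC ltW.
apply: (@le_trans _ _ (c * x * powR (c * x / e) (a - 1))).
  by rewrite mulrA ler_wpM2l // ltW.
rewrite powRM ?invr_ge0 ?(ltW cx) ?(ltW e0) // mulrA -(powR_pred a cx) powRM ?(ltW c0) //.
rewrite -powR_inv1 ?(ltW e0) // -powRrM mulN1r opprB.
by apply: le_of_eq; ring.
Qed.

End RankSums.

(** * Dyadic ancestors, neighbours and counts *)

Section Lattice.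
Context {n : nat}.
Local Notation Z := 'rV[int]_n.
Implicit Types (k v : Z) (E : nat -> pred Z).

(* The index of the dyadic cube d generations above the cube with index k. *)
Definition anc (d : nat) k : Z := \row_i (k 0%R i %/ (2 ^ d)%N%:Z)%Z.

Lemma anc0 k : anc 0 k = k.
Proof. by apply/rowP => i; rewrite mxE expn0 divz1. Qed.

Lemma anc_anc d e k : anc e (anc d k) = anc (d + e) k.
Proof. by apply/rowP => i; rewrite !mxE expnD PoszM divzMA_ge0. Qed.

(** A translation by whole cubes of generation [d]: it moves that ancestor by exactly [- v] and
    permutes the lattice, so it preserves lattice sums. *)
Definition shf (d : nat) v k : Z := \row_i (k 0%R i - v 0%R i * (2 ^ d)%N%:Z).

Lemma anc_shf d v k : anc d (shf d v k) = anc d k - v.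
Proof.
apply/rowP => i; rewrite !mxE.
rewrite (_ : k 0 i - _ = - v 0 i * (2 ^ d)%N%:Z + k 0 i); last by rewrite mulNr addrC.
rewrite divzMDl; first by rewrite addrC.
by rewrite eqz_nat expn_eq0.
Qed.

Lemma shf_bij d v : set_bij [set: Z] [set: Z] (shf d v).
Proof.
split => //.
  move=> k k' _ _ /rowP H; apply/rowP => i; have := H i; rewrite !mxE; exact: addIr.
move=> k _; exists (shf d (- v) k) => //; apply/rowP => i.
by rewrite !mxE mulNr opprK addrK.
Qed.

Definition near (N : nat) k k' := forall i, `|k 0%R i - k' 0%R i| <= N%:Z.

Lemma near_sym N k k' : near N k k' -> near N k' k.
Proof. by move=> H i; rewrite distrC. Qed.

Lemma near_trans N N' k k' k'' : near N k k' -> near N' k' k'' -> near (N + N') k k''.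
Proof.
move=> H H' i; rewrite -(subrK (k' 0%R i) (k 0%R i)) -addrA PoszD.
by rewrite (le_trans (ler_normD _ _)) // lerD.
Qed.

(** Floor division is monotone, and an offset [N] of fine cubes is at most [N] coarse ones; hence
    [N] does not grow. *)
Lemma near_anc N d k k' : near N k k' -> near N (anc d k) (anc d k').
Proof.
have D0 : (2 ^ d)%N%:Z != 0 by rewrite eqz_nat expn_eq0.
have key (x y : int) : x <= y + N%:Z -> (x %/ (2 ^ d)%N%:Z)%Z <= (y %/ (2 ^ d)%N%:Z)%Z + N%:Z.
  move=> xy; rewrite addrC -divzMDl //; apply: lez_pdiv2r => //.
  rewrite (le_trans xy) // addrC lerD2r // ler_peMr // lez_nat expn_gt0 //.
move=> H i; have := H i; rewrite !mxE !ler_norml => /andP[h1 h2].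
have k1 := key _ _ (_ : k' 0%R i <= k 0%R i + N%:Z); have k2 := key _ _ (_ : k 0%R i <= k' 0%R i + N%:Z).
apply/andP; split.
  by rewrite lerBrDr addrC lerBlDr; apply: k1; rewrite -lerBlDl -opprB lerNl.
by rewrite lerBlDr addrC; apply: k2; rewrite -lerBlDl.
Qed.

Definition boxseq (N : nat) : seq Z :=
  [seq \row_i ((f i : nat)%:Z - N%:Z) | f : {ffun 'I_n -> 'I_(2 * N).+1}].

Lemma size_boxseq N : size (boxseq N) = ((2 * N).+1 ^ n)%N.
Proof. by rewrite size_map -cardE card_ffun !card_ord. Qed.

Lemma mem_boxseq N v : near N v 0 -> v \in boxseq N.
Proof.
move=> H; have H' i : 0 <= v 0%R i + N%:Z <= (2 * N)%N%:Z.
  have := H i; rewrite mxE subr0 ler_norml => /andP[h1 h2].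
  by rewrite -lerBlDr sub0r h1 mul2n -addnn PoszD lerD2r.
apply/mapP; exists [ffun i => inord (absz (v 0%R i + N%:Z))]; first by rewrite mem_enum.
apply/rowP => i; rewrite mxE ffunE inordK; last first.
  by have := H' i => /andP[h1 h2]; rewrite ltnS -lez_nat gez0_abs.
by have := H' i => /andP[h1 h2]; rewrite gez0_abs // addrK.
Qed.

Definition nb (N : nat) E : nat -> pred Z :=
  fun m k => `[< exists2 k', E m k' & near N k k' >].

(** The number of marked ancestors of the cube [k] of level [M]. The companion [rk] stops at level
    [m], which gives ranks counted from the coarse end. *)
Definition cnt E (M : nat) k : nat := \sum_(m < M.+1) E m (anc (M - m) k).
Definition rk E (M m : nat) k : nat := \sum_(m' < m.+1) E m' (anc (M - m') k).

(** A cube below a neighbour of a mark is moved below the mark itself. The translation is by at most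
    [N] cubes of level [m], so all coarser ancestors stay within [N] as well. *)
Lemma nb_witness N E M m k : (m <= M)%N -> nb N E m (anc (M - m) k) ->
  exists2 v, v \in boxseq N & E m (anc (M - m) (shf (M - m) v k)) /\
   forall m', (m' <= m)%N -> near N (anc (M - m') k) (anc (M - m') (shf (M - m) v k)).
Proof.
move=> mM /asboolP[k' Ek' nk']; pose v := anc (M - m) k - k'.
have va : anc (M - m) (shf (M - m) v k) = k' by rewrite anc_shf /v opprB addrC subrK.
exists v.
  by apply: mem_boxseq => i; have := nk' i; rewrite !mxE subr0.
split; first by rewrite va.
move=> m' m'm; have -> : (M - m' = (M - m) + (m - m'))%N by lia.
by rewrite -!anc_anc va; exact: near_anc.
Qed.

Lemma rk_le_cnt E M m k : (m <= M)%N -> (rk E M m k <= cnt E M k)%N.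
Proof.
move=> mM; rewrite /rk /cnt -!(big_mkord xpredT (fun m => nat_of_bool (E m (anc (M - m) k)))).
by rewrite [X in (_ <= X)%N](@big_cat_nat _ _ _ m.+1) //= leq_addr.
Qed.

End Lattice.

(** * Cost of enlarging the marks *)

Section LatticeSums.
Context {R : realType} {n : nat}.
Local Notation Z := 'rV[int]_n.
Implicit Types (k v : Z) (E : nat -> pred Z) (a : R).

Lemma anc_flr d M (x : 'rV[R]_n) : anc d (flr (M + d) x) = flr M x.
Proof.
apply/rowP => i; rewrite !mxE; set y := x 0 i; symmetry; apply: floor_def.
set f := Num.floor (2 ^+ (M + d) * y); set D := (2 ^ d)%N%:Z.
have D0 : 0 < D by rewrite ltz_nat expn_gt0.
have DR : D%:~R = 2 ^+ d :> R by rewrite /D -pmulrn natrX.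
have p0 : 0 < 2 ^+ d :> R by rewrite exprn_gt0.
have /andP[f1 f2] := floor_itv (2 ^+ (M + d) * y).
have fE : 2 ^+ (M + d) * y = 2 ^+ M * y * 2 ^+ d by rewrite exprD mulrAC.
apply/andP; split.
  rewrite -(ler_pM2r p0) -fE -DR -intrM; apply: le_trans f1.
  by rewrite ler_int; apply: lez_floor; rewrite gt_eqF.
rewrite -(ltr_pM2r p0) -fE -DR -intrM; apply: (lt_le_trans f2).
by rewrite ler_int -/f lezD1; exact: ltz_ceil.
Qed.

Lemma lat_le (M : nat) (w w' : Z -> \bar R) : (forall k, w k <= w' k)%E -> (lat M w <= lat M w')%E.
Proof. by move=> h; rewrite lee_wpmul2l ?lee_fin ?pow2Vn_ge0 //; apply: le_esum. Qed.

Lemma latZ (M : nat) (c : R) (w : Z -> \bar R) : 0 <= c -> (forall k, 0 <= w k)%E ->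
  lat M (fun k => c%:E * w k)%E = (c%:E * lat M w)%E.
Proof. by move=> c0 w0; rewrite /lat esumZl // muleCA. Qed.

Lemma latD (M : nat) (w w' : Z -> \bar R) : (forall k, 0 <= w k)%E -> (forall k, 0 <= w' k)%E ->
  lat M (fun k => w k + w' k)%E = (lat M w + lat M w')%E.
Proof.
move=> w0 w0'; rewrite /lat esumD // ge0_muleDr //; exact: esum_ge0.
Qed.

Lemma lat_sum (T : choiceType) (l : seq T) (M : nat) (w : T -> Z -> R) : (forall i k, 0 <= w i k) ->
  lat M (fun k => (\sum_(i <- l) w i k)%:E) = (\sum_(i <- l) lat M (fun k => (w i k)%:E))%E.
Proof.
move=> w0; rewrite /lat -ge0_sume_distrr; last by move=> i _; apply: esum_ge0 => k _; rewrite lee_fin.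
congr (_ * _)%E; rewrite -esum_sum; last by move=> *; rewrite lee_fin.
by apply: eq_esum => k _; rewrite sumEFin.
Qed.

Lemma lat_shf (M d : nat) v (w : Z -> \bar R) : lat M (fun k => w (shf d v k)) = lat M w.
Proof. by rewrite /lat -(@reindex_esum R _ _ setT setT (shf d v) w (shf_bij d v)). Qed.

Lemma sume_const_seq (T : Type) (l : seq T) (c : \bar R) : (0 <= c)%E ->
  (\sum_(v <- l) c = (size l)%:R%:E * c)%E.
Proof.
move=> c0; elim: l => [|x l IH]; first by rewrite big_nil mul0e.
by rewrite big_cons IH /= -nat1r EFinD ge0_muleDl ?mul1e ?lee_fin.
Qed.

(** Every translation permutes the lattice, so each of the [(2 N + 1) ^ n] offsets contributes the
    same sum. *)
Lemma lat_transfer (N M : nat) (h : nat -> Z -> R) : (forall m k, 0 <= h m k) ->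
  lat M (fun k => (\sum_(m < M.+1) \sum_(v <- boxseq N) h m (shf (M - m) v k))%:E) =
  ((((2 * N).+1 ^ n)%N%:R : R)%:E * lat M (fun k => (\sum_(m < M.+1) h m k)%:E))%E.
Proof.
move=> h0; rewrite lat_sum; last by move=> m k; apply: sumr_ge0.
rewrite lat_sum // ge0_sume_distrr; last by move=> m _; apply: lat_ge0 => k; rewrite lee_fin.
apply: eq_bigr => m _; rewrite lat_sum //.
under eq_bigr => v _ do rewrite (lat_shf M (M - m) v (fun k => (h m k)%:E)).
by rewrite sume_const_seq ?size_boxseq //; apply: lat_ge0 => k; rewrite lee_fin.
Qed.

Definition latcnt a E M : \bar R := lat M (fun k => (powR (cnt E M k)%:R a)%:E).

Lemma box_le (i : nat) : ((2 * 2 ^ i).+1 ^ n)%N%:R <= (3 ^+ n * (2 ^+ n) ^+ i : R).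
Proof.
rewrite exprAC -exprMn natrX lerXn2r ?nnegrE // ?mulr_ge0 ?exprn_ge0 //.
rewrite -natr1 natrM natrX; have : 1 <= (2 ^+ i : R) by rewrite exprn_ege1 // ler1n.
lra.
Qed.

(** Each enlarged mark is charged to the mark it comes from. The translated cube sees at most as
    many original marks as the given one sees enlarged marks, and for [a <= 1] a smaller rank gives
    a larger charge. *)
Lemma latcnt_nb_le1 a N E M : 0 < a <= 1 ->
  (latcnt a (nb N E) M <= ((((2 * N).+1 ^ n)%N%:R / a) : R)%:E * latcnt a E M)%E.
Proof.
move=> a01; have [a0 a1] := andP a01.
pose h m k : R := (E m (anc (M - m) k))%:R * powR (rk E M m k)%:R (a - 1).
have h0 m k : 0 <= h m k by rewrite mulr_ge0 ?powR_ge0.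
have pt k : powR (cnt (nb N E) M k)%:R a <= \sum_(m < M.+1) \sum_(v <- boxseq N) h m (shf (M - m) v k).
  have := rank_le (fun m => nb N E m (anc (M - m) k)) M.+1 a01.
  move/le_trans; apply; apply: ler_sum => m _.
  have s0 : 0 <= \sum_(v <- boxseq N) h m (shf (M - m) v k) by apply: sumr_ge0.
  case nm: (nb N E m _); last by rewrite mul0r.
  rewrite mul1r; have mM : (m <= M)%N by rewrite -ltnS.
  have [v vb [Ev near_v]] := nb_witness mM nm.
  apply: (@le_trans _ _ (h m (shf (M - m) v k))); last first.
    by rewrite (big_rem v) //= lerDl sumr_ge0.
  rewrite /h Ev mul1r; apply: powR_antitone; first by rewrite subr_le0.
    by rewrite ltr0n /rk big_ord_recr /= Ev addn1.
  rewrite ler_nat /rk; apply: leq_sum => m' _.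
  case Em': (E m' _) => //=; rewrite lt0b; apply/asboolP; eexists; first exact: Em'.
  by apply: near_v; rewrite -ltnS.
apply: (@le_trans _ _ (lat M (fun k => (\sum_(m < M.+1) \sum_(v <- boxseq N) h m (shf (M - m) v k))%:E))).
  by apply: lat_le => k; rewrite lee_fin.
rewrite lat_transfer // EFinM -muleA lee_wpmul2l ?lee_fin //.
rewrite -latZ ?invr_ge0 ?(ltW a0) //.
apply: lat_le => k; rewrite -EFinM lee_fin mulrC.
exact: (rank_sum_le (fun m => E m (anc (M - m) k)) M.+1 a01).
Qed.

Lemma latcnt_ge0 a E M : (0 <= latcnt a E M)%E.
Proof. by apply: lat_ge0 => k; rewrite lee_fin powR_ge0. Qed.

Lemma cnt_le E M k : (cnt E M k <= M.+1)%N.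
Proof.
by rewrite /cnt -[leqRHS]card_ord -sum1_card; apply: leq_sum => m _; exact: leq_b1.
Qed.

Lemma cnt_nb_le N E M k : ((cnt (nb N E) M k)%:R : R) <=
  \sum_(m < M.+1) \sum_(v <- boxseq N) (E m (anc (M - m) (shf (M - m) v k)))%:R.
Proof.
rewrite /cnt natr_sum; apply: ler_sum => m _.
have s0 : 0 <= \sum_(v <- boxseq N) (E m (anc (M - m) (shf (M - m) v k)))%:R :> R.
  by apply: sumr_ge0.
case nm: (nb N E m _) => //; have mM : (m <= M)%N by rewrite -ltnS.
have [v vb [Ev _]] := nb_witness mM nm.
by rewrite (big_rem v) //= Ev lerDl sumr_ge0.
Qed.

(** A bound that grows with [M]; it starts the iteration of [latcnt_nb], where each step halves its
    contribution. *)
Lemma latcnt_nb_crude a N E M : 1 <= a ->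
  (latcnt a (nb N E) M <= (((2 * N).+1 ^ n)%N%:R * powR M.+1%:R a)%:E * latcnt a E M)%E.
Proof.
move=> a1; have a0 : 0 < a by apply: lt_le_trans a1.
have pt k : powR (cnt (nb N E) M k)%:R a <= powR M.+1%:R a *
    \sum_(m < M.+1) \sum_(v <- boxseq N) (E m (anc (M - m) (shf (M - m) v k)))%:R.
  have := cnt_nb_le N E M k; have := cnt_le (nb N E) M k.
  case: (cnt _ _ _) => [_ h|c cM h].
    by rewrite powR0 ?gt_eqF // mulr_ge0 ?powR_ge0.
  apply: (@le_trans _ _ (powR M.+1%:R a * 1)).
    by rewrite mulr1 ge0_ler_powR ?nnegrE ?(ltW a0) ?ler_nat.
  by rewrite ler_wpM2l ?powR_ge0 // (le_trans _ h) // ler1n.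
apply: (@le_trans _ _ (lat M (fun k => (powR M.+1%:R a)%:E *
    (\sum_(m < M.+1) \sum_(v <- boxseq N) (E m (anc (M - m) (shf (M - m) v k)))%:R)%:E)%E)).
  by apply: lat_le => k; rewrite -EFinM lee_fin.
rewrite latZ ?powR_ge0 //; last first.
  by move=> k; rewrite lee_fin; apply: sumr_ge0 => m _; apply: sumr_ge0.
have T0 m k : 0 <= (E m (anc (M - m) k))%:R :> R by [].
have -> := @lat_transfer N M (fun m k => (E m (anc (M - m) k))%:R) T0.
rewrite muleA -EFinM [(powR _ _ * _)%R]mulrC lee_wpmul2l ?lee_fin ?mulr_ge0 ?powR_ge0 //.
apply: lat_le => k; rewrite lee_fin -natr_sum -/(cnt E M k).
case: (cnt E M k) => [|c]; first by rewrite powR_ge0.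
by rewrite -[leLHS]powRr1 // ler_powR // ler1n.
Qed.

(** For [a >= 1] the charge contains the rank among marks enlarged by the doubled radius.
    [young_threshold] separates it from the count of original marks. *)
Lemma latcnt_nb_rec a i E M : 1 <= a ->
  (latcnt a (nb (2 ^ i) E) M <= ((powR (2 ^+ n) a)^-1 / 2)%:E * latcnt a (nb (2 ^ i.+1) E) M +
     (powR (a * 3 ^+ n) a * powR ((powR (2 ^+ n) a)^-1 / 2) (1 - a) * powR (2 ^+ n) a ^+ i)%:E * latcnt a E M)%E.
Proof.
move=> a1; have a0 : 0 < a by apply: lt_le_trans a1.
(* With this [e] the doubled radius enters with a factor that beats its expected growth [be] by one
   half. *)
set be := powR (2 ^+ n) a; set e := be^-1 / 2.
have be0 : 0 < be by rewrite powR_gt0 // exprn_gt0.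
have e0 : 0 < e by rewrite divr_gt0 // invr_gt0.
pose B := cnt (nb (2 ^ i.+1) E) M.
pose h m k : R := (E m (anc (M - m) k))%:R * powR (B k)%:R (a - 1).
have h0 m k : 0 <= h m k by rewrite mulr_ge0 ?powR_ge0.
have pt k : powR (cnt (nb (2 ^ i) E) M k)%:R a <=
    a * \sum_(m < M.+1) \sum_(v <- boxseq (2 ^ i)) h m (shf (M - m) v k).
  have := rank_ge (fun m => nb (2 ^ i) E m (anc (M - m) k)) M.+1 a1.
  move/le_trans; apply; rewrite ler_wpM2l ?(ltW a0) //; apply: ler_sum => m _.
  have s0 : 0 <= \sum_(v <- boxseq (2 ^ i)) h m (shf (M - m) v k) by apply: sumr_ge0.
  case nm: (nb _ E m _); last by rewrite mul0r.
  rewrite mul1r; have mM : (m <= M)%N by rewrite -ltnS.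
  have [v vb [Ev near_v]] := nb_witness mM nm.
  apply: (@le_trans _ _ (h m (shf (M - m) v k))); last first.
    by rewrite (big_rem v) //= lerDl sumr_ge0.
  rewrite /h Ev mul1r ge0_ler_powR ?nnegrE ?subr_ge0 // ler_nat.
  apply: leq_trans (rk_le_cnt _ _ mM); apply: leq_sum => m' _.
  case Em': (nb _ E m' _) => //=; rewrite lt0b; apply/asboolP.
  move/asboolP: Em' => [k' Ek' nk']; exists k' => //.
  rewrite expnS mul2n -addnn; apply: near_trans nk'.
  by apply/near_sym/near_v; rewrite -ltnS.
have s0 k : (0 <= (\sum_(m < M.+1) \sum_(v <- boxseq (2 ^ i)) h m (shf (M - m) v k))%:E)%E.
  by rewrite lee_fin; apply: sumr_ge0 => m _; apply: sumr_ge0.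
apply: (@le_trans _ _ (lat M (fun k => a%:E * (\sum_(m < M.+1) \sum_(v <- boxseq (2 ^ i)) h m (shf (M - m) v k))%:E)%E)).
  by apply: lat_le => k; rewrite -EFinM lee_fin.
rewrite (latZ M (ltW a0) s0) lat_transfer // muleA -EFinM.
have s1 k : (0 <= (\sum_(m < M.+1) h m k)%:E)%E by rewrite lee_fin sumr_ge0.
have c0 : 0 < a * (3 ^+ n * (2 ^+ n) ^+ i) by rewrite !mulr_gt0 ?exprn_gt0.
apply: (@le_trans _ _ ((a * (3 ^+ n * (2 ^+ n) ^+ i))%:E * lat M (fun k => (\sum_(m < M.+1) h m k)%:E))%E).
  by rewrite lee_wpmul2r ?lat_ge0 // lee_fin ler_wpM2l ?(ltW a0) // box_le.
rewrite -(latZ M (ltW c0) s1).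
have D0 : 0 <= powR (a * 3 ^+ n) a * powR e (1 - a) * be ^+ i.
  by rewrite !mulr_ge0 ?powR_ge0 // exprn_ge0 // ltW.
have p1 E' k : (0 <= (powR (cnt E' M k)%:R a)%:E)%E by rewrite lee_fin powR_ge0.
rewrite /latcnt -(latZ M (ltW e0) (p1 _)) -(latZ M D0 (p1 _)) -latD; last 2 first.
- by move=> k; rewrite mule_ge0 // lee_fin ltW.
- by move=> k; rewrite mule_ge0 // lee_fin.
apply: lat_le => k; rewrite -!EFinM -EFinD lee_fin.
have -> : \sum_(m < M.+1) h m k = (cnt E M k)%:R * powR (B k)%:R (a - 1).
  by rewrite /h -mulr_suml; congr (_ * _); rewrite /cnt natr_sum.
apply: (le_trans (young_threshold a1 c0 e0 (ler0n _ _) (ler0n _ _))).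
rewrite lerD2l; apply: le_of_eq; congr (_ * _).
rewrite mulrA (powRM _ (ltW (mulr_gt0 a0 _))) ?exprn_ge0 ?exprn_gt0 // mulrAC; congr (_ * _).
rewrite /be -[in RHS]powR_mulrn ?powR_ge0 // -powRrM mulrC powRrM powR_mulrn ?exprn_ge0 //.
Qed.

Lemma latcnt_rec_eq (be D N2 CM b2 x : R) : be != 0 ->
  be^-1 / 2 * ((2 * D + N2 * CM) * (be * b2) * x) + D * b2 * x = (2 * D + 2^-1 * N2 * CM) * b2 * x.
Proof. by move=> be0; field. Qed.

Lemma latcnt_nb a : 0 < a -> exists2 C : R, 0 < C & exists2 be : R, 1 <= be &
  forall i E M, (latcnt a (nb (2 ^ i) E) M <= (C * be ^+ i)%:E * latcnt a E M)%E.
Proof.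
move=> a0; case: (leP a 1) => a1.
  exists (3 ^+ n / a); first by rewrite divr_gt0 // exprn_gt0.
  exists (2 ^+ n); first by rewrite exprn_ege1 // ler1n.
  move=> i E M; have a01 : 0 < a <= 1 by rewrite a0.
  apply: (le_trans (latcnt_nb_le1 _ _ _ a01)); rewrite lee_wpmul2r ?latcnt_ge0 // lee_fin.
  by rewrite mulrAC ler_wpM2r ?invr_ge0 ?(ltW a0) // box_le.
have {}a1 := ltW a1.
set be := powR (2 ^+ n) a; pose e := be^-1 / 2.
have two1 : 1 <= 2 ^+ n :> R by rewrite exprn_ege1 // ler1n.
have be1 : 2 ^+ n <= be.
  by rewrite -[leLHS]powRr1 ?exprn_ge0 // ler_powR.
have be11 : 1 <= be by apply: le_trans be1.
have be0 : 0 < be by apply: lt_le_trans be11.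
pose D := powR (a * 3 ^+ n) a * powR e (1 - a).
have D0 : 0 < D by rewrite mulr_gt0 // powR_gt0 ?mulr_gt0 ?exprn_gt0 ?divr_gt0 ?invr_gt0.
exists (2 * D); first by rewrite mulr_gt0.
exists be => // i E M.
have [->|xfin] := eqVneq (latcnt a E M) +oo%E.
  have p : 0 < 2 * D * be ^+ i by apply: mulr_gt0; [exact: mulr_gt0|exact: exprn_gt0].
  by rewrite gt0_muley ?leey // lte_fin.
have [x Ex] : exists x : R, latcnt a E M = x%:E.
  have := latcnt_ge0 a E M; case: (latcnt a E M) xfin => [x _ _|//|//]; by exists x.
have x0 : 0 <= x by have := latcnt_ge0 a E M; rewrite Ex lee_fin.
pose CM := 3 ^+ n * powR M.+1%:R a.
have CM0 : 0 <= CM by rewrite mulr_ge0 ?exprn_ge0 ?powR_ge0.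
(* [N] applications of the recursion leave only [2 ^- N] of the crude bound [CM]; letting [N] grow
   removes the dependence on [M]. *)
have key N : forall j, (latcnt a (nb (2 ^ j) E) M <= ((2 * D + 2 ^- N * CM) * be ^+ j * x)%:E)%E.
  elim: N => [|N IH] j.
    apply: (le_trans (latcnt_nb_crude (2 ^ j) E M a1)); rewrite Ex -EFinM lee_fin ler_wpM2r //.
    apply: (@le_trans _ _ (CM * be ^+ j)).
      rewrite /CM mulrAC ler_wpM2r ?powR_ge0 // (le_trans (box_le j)) // ler_wpM2l ?exprn_ge0 //.
      by rewrite lerXn2r ?nnegrE ?exprn_ge0 ?(ltW be0).
    rewrite ler_wpM2r ?exprn_ge0 ?(ltW be0) // expr0 invr1 mul1r lerDr.
    by apply: mulr_ge0 => //; exact: ltW.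
  apply: (le_trans (latcnt_nb_rec j E M a1)); rewrite -/be -/e -/D Ex.
  have e0 : 0 <= e by rewrite divr_ge0 // invr_ge0 ltW.
  apply: (@le_trans _ _ (e%:E * ((2 * D + 2 ^- N * CM) * be ^+ j.+1 * x)%:E + (D * be ^+ j)%:E * x%:E)%E).
    by rewrite leeD2r // lee_wpmul2l ?lee_fin // IH.
  rewrite -!EFinM -EFinD lee_fin; apply: le_of_eq.
  rewrite /e exprS exprS invfM.
  by apply: latcnt_rec_eq; rewrite gt_eqF.
apply/lee_addgt0Pr => del del0; rewrite Ex -EFinM -EFinD.
have half01 : 0 <= (2^-1 : R) < 1 by rewrite invr_ge0 ler0n /= invf_lt1 ?ltr1n.
have T0 : 0 <= CM * be ^+ i * x by rewrite !mulr_ge0 ?exprn_ge0 ?(ltW be0).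
have [N hN] := geo_choose half01 T0 del0.
apply: (le_trans (key N i)); rewrite lee_fin.
have := hN N (leqnn _); rewrite exprVn !mulrDl => h.
rewrite lerD2l; apply: le_trans h; apply: le_of_eq; ring.
Qed.

Definition cntl E (l M : nat) k : nat := \sum_(m < M.+1 | (l <= m)%N) E m (anc (M - m) k).

(** The discrete Carleson quantity: marks of level [l] to [M], integrated over the cube [k0] of
    level [l]. *)
Definition latcar E (l M : nat) (k0 : Z) : \bar R :=
  lat M (fun k => ((anc (M - l) k == k0)%:R * (cntl E l M k)%:R)%:E).

(** One factor [(2 N + 1) ^ n] pays for the translations of the marks, the other for the neighbours
    of [k0] into which the translated cubes may fall. *)
Lemma latcar_nb E (La : R) N : 0 <= La -> (forall l M k0, (l <= M)%N -> latcar E l M k0 <= (La * (2 ^- l) ^+ n)%:E)%E ->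
  forall l M k0, (l <= M)%N ->
  (latcar (nb N E) l M k0 <= (((2 * N).+1 ^ n)%N%:R * ((2 * N).+1 ^ n)%N%:R * La * (2 ^- l) ^+ n)%:E)%E.
Proof.
move=> La0 HE l M k0 lM.
pose h m k : R := \sum_(u <- boxseq N) ((anc (M - l) k == k0 - u) && (l <= m)%N && E m (anc (M - m) k))%:R.
have h0 m k : 0 <= h m k by apply: sumr_ge0.
apply: (@le_trans _ _ (lat M (fun k => (\sum_(m < M.+1) \sum_(v <- boxseq N) h m (shf (M - m) v k))%:E))).
  apply: lat_le => k; rewrite lee_fin.
  case: eqP => [ek|_]; last by rewrite mul0r; apply: sumr_ge0 => m _; apply: sumr_ge0.
  rewrite mul1r /cntl natr_sum big_mkcond /=; apply: ler_sum => m _.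
  have s0 : 0 <= \sum_(v <- boxseq N) h m (shf (M - m) v k) by apply: sumr_ge0.
  case: ifPn => // lm; case nm: (nb N E m _) => //.
  have mM : (m <= M)%N by rewrite -ltnS.
  have [v vb [Ev near_v]] := nb_witness mM nm.
  apply: (@le_trans _ _ (h m (shf (M - m) v k))); last by rewrite (big_rem v) //= lerDl sumr_ge0.
  have ub : (k0 - anc (M - l) (shf (M - m) v k)) \in boxseq N.
    by apply: mem_boxseq => i; have := near_v l lm i; rewrite ek !mxE subr0.
  rewrite /h (big_rem _ ub) /= subKr eqxx lm Ev /= lerDl.
  exact: sumr_ge0.
rewrite lat_transfer // -!mulrA EFinM lee_wpmul2l ?lee_fin //.
apply: (@le_trans _ _ (lat M (fun k => (\sum_(u <- boxseq N) ((anc (M - l) k == k0 - u)%:R * (cntl E l M k)%:R))%:E))).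
  apply: lat_le => k; rewrite lee_fin /h exchange_big /=; apply: ler_sum => u _.
  rewrite /cntl natr_sum mulr_sumr [leRHS]big_mkcond /=; apply: ler_sum => m _.
  by case: eqP; case: (leqP l m); case: (E m _); rewrite /= ?mulr1 ?mulr0 ?mul1r ?mul0r.
rewrite lat_sum; last by move=> *; rewrite mulr_ge0.
apply: (@le_trans _ _ (\sum_(u <- boxseq N) (La * (2 ^- l) ^+ n)%:E)%E).
  by apply: lee_sum => u _; exact: HE.
by rewrite sume_const_seq ?size_boxseq ?lee_fin ?mulr_ge0 ?pow2Vn_ge0 // -EFinM lee_fin.
Qed.

End LatticeSums.

(** * Large differences of functions in F *)

Section LargeDifferences.
Context {R : realType} {n : nat} (n0 : (0 < n)%N).
Context (eta : 'rV[R]_n -> R) (eta_LP : LP_eta eta).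
Context (s : R) (s0 : 0 < s) (r : nat) (sr : s < r%:R) (q : R) (q0 : 0 < q).
Implicit Types (f g : 'rV[R]_n -> R) (x : 'rV[R]_n) (A c d : R) (k : 'rV[int]_n).

Local Notation mu := (@lebesgue_measure R).
Local Notation ka := (ka s).
Local Notation LPR := (LPR eta).

Lemma dcubeP j k x : dcube R j k x <-> flr j x = k.
Proof.
have p0 : 0 < 2 ^+ j :> R by rewrite exprn_gt0.
split.
  move=> H; apply/rowP => i; rewrite mxE; apply: floor_def.
  have := H i; rewrite ler_pdivrMr // ltr_pdivlMr // [x 0 i * _]mulrC.
  by rewrite intrD.
move=> <- i; rewrite mxE ler_pdivrMr // ltr_pdivlMr // [x 0 i * _]mulrC.
by have := floor_itv (2 ^+ j * x 0 i); rewrite intrD.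
Qed.

(** The extra 1 is the rounding of the floor. *)
Lemma flr_near M x x' (b : R) (N : nat) : inbox b (x - x') -> 2 ^+ M * b <= N%:R ->
  near N.+1 (flr M x) (flr M x').
Proof.
have p0 : 0 < 2 ^+ M :> R by rewrite exprn_gt0.
have key (u v : R) : u <= v + N%:R -> Num.floor u <= Num.floor v + N.+1%:Z.
  move=> uv; rewrite -ltzD1 -(ltr_int R); have /andP[f1 _] := floor_itv u.
  apply: (le_lt_trans f1); apply: (le_lt_trans uv); have /andP[_ f2] := floor_itv v.
  have -> : (Num.floor v + N.+1%:Z + 1)%:~R = (Num.floor v)%:~R + N%:R + 2 :> R.
    by rewrite !intrD -[(N.+1%:Z)%:~R]pmulrn -natr1 mulr1z; ring.
  by move: f2; rewrite intrD mulr1z; lra.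
move=> H bN i; rewrite !mxE.
have h : `|2 ^+ M * x 0 i - 2 ^+ M * x' 0 i| <= N%:R.
  rewrite -mulrBr normrM (gtr0_norm p0) (le_trans _ bN) // ler_pM2l //.
  by have := H i; rewrite !mxE.
move: h; rewrite !ler_norml => /andP[h1 h2]; apply/andP; split.
  by rewrite lerBrDr addrC lerBlDr; apply: key; lra.
by rewrite lerBlDr addrC; apply: key; lra.
Qed.

Lemma flr_same M x x' : flr M x = flr M x' -> enorm (x - x') <= n%:R * 2 ^- M.
Proof.
have p0 : 0 < 2 ^+ M :> R by rewrite exprn_gt0.
move=> /rowP H; apply: enorm_inbox => i; have := H i; rewrite !mxE => E.
have /andP[a1 a2] := floor_itv (2 ^+ M * x 0 i).
have /andP[b1 b2] := floor_itv (2 ^+ M * x' 0 i).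
rewrite E in a1 a2; move: a2 b2; rewrite intrD => a2 b2.
rewrite -(ler_pM2l p0) -{1}(gtr0_norm p0) -normrM mulfV ?gt_eqF // mulrBr ler_norml.
lra.
Qed.

Lemma flr_anc m M x : (m <= M)%N -> anc (M - m) (flr M x) = flr m x.
Proof. by move=> mM; rewrite -{2}(subnKC mM) anc_flr. Qed.

Lemma cntl_nat (E : nat -> pred 'rV[int]_n) l M k :
  cntl E l M k = (\sum_(l <= m < M.+1) E m (anc (M - m) k))%N.
Proof. by rewrite /cntl big_geq_mkord. Qed.

Lemma cntl_flr (E : nat -> pred 'rV[int]_n) l M x :
  cntl E l M (flr M x) = (\sum_(l <= m < M.+1) E m (flr m x))%N.
Proof.
rewrite cntl_nat big_nat [RHS]big_nat; apply: eq_bigr => m /andP[_ mM].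
by rewrite flr_anc.
Qed.

Lemma cntl0 (E : nat -> pred 'rV[int]_n) M k : cntl E 0 M k = cnt E M k.
Proof. by rewrite /cntl /cnt; apply: eq_bigl => m. Qed.

Lemma cntl_mono (E : nat -> pred 'rV[int]_n) l M x :
  (cntl E l M (flr M x) <= cntl E l M.+1 (flr M.+1 x))%N.
Proof.
rewrite !cntl_flr; case: (leqP l M.+1) => lM; first by rewrite [leqRHS]big_nat_recr //= leq_addr.
by rewrite !big_geq // ltnW.
Qed.

Lemma poweR_le_sup (a : R) (c : nat -> R) (y : \bar R) : 0 < a -> (forall M, 0 <= c M) -> (0 <= y)%E ->
  (y <= ereal_sup (range (fun M => (c M)%:E)))%E ->
  (poweR y a <= ereal_sup (range (fun M => (powR (c M) a)%:E)))%E.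
Proof.
move=> a0 c0 y0 yc; set S := ereal_sup _.
have S0 : (0 <= S)%E.
  apply: (@le_trans _ _ (powR (c 0%N) a)%:E); first by rewrite lee_fin powR_ge0.
  by apply: ereal_sup_ubound; exists 0%N.
have cS : (ereal_sup (range (fun M => (c M)%:E)) <= poweR S a^-1)%E.
  apply: ge_ereal_sup => _ [M _ <-].
  have -> : (c M)%:E = poweR (powR (c M) a)%:E a^-1.
    by rewrite poweR_EFin -powRrM mulfV ?gt_eqF // powRr1.
  apply: gt0_ler_poweR; rewrite ?invr_ge0 ?(ltW a0) ?in_itv /= ?leey ?andbT ?lee_fin ?powR_ge0 //.
  by apply: ereal_sup_ubound; exists M.
have : (poweR y a <= poweR (poweR S a^-1) a)%E.
  apply: gt0_ler_poweR; rewrite ?(ltW a0) ?in_itv /= ?leey ?andbT ?poweR_ge0 //.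
  exact: le_trans cS.
by rewrite -poweRrM mulVf ?gt_eqF // poweRe1.
Qed.

Lemma nneseries_le (u : nat -> \bar R) (B : \bar R) : (forall m, 0 <= u m)%E ->
  (forall K, \sum_(0 <= m < K) u m <= B)%E -> (\sum_(m <oo) u m <= B)%E.
Proof.
move=> u0 H; apply: lime_le; first by apply: is_cvg_nneseries => m _ _; exact: u0.
by apply: nearW => K; exact: H.
Qed.

Lemma nneseries_ge_term (u : nat -> \bar R) m : (forall m, 0 <= u m)%E -> (u m <= \sum_(i <oo) u i)%E.
Proof.
move=> u0; apply: (@le_trans _ _ (\sum_(0 <= i < m.+1) u i)%E).
  by rewrite big_nat_recr //= leeDr // sume_ge0.
exact: nneseries_lim_ge.
Qed.

(** The interval from [2 ^- (m + 1)] to [2 ^- m] has [dy / y]-mass at most 1, seen by replacing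
    [1 / y] by its value at the left end. *)
Lemma yint_le (S : set ('rV[R]_n * R)) x l (F : nat -> bool) :
  (forall y m, S (x, y) -> 2 ^- m.+1 < y <= 2 ^- m -> F m) ->
  (yint S x (2 ^- l) <= \sum_(m <oo) (((l <= m)%N && F m)%:R)%:E)%E.
Proof.
move=> H.
pose I m : set R := [set` `](2 ^- m.+1 : R), (2 ^- m : R)]].
have mI m : measurable (I m) by exact: measurable_itv.
pose b m : R := ((l <= m)%N && F m)%:R.
pose f m (y : R) : \bar R := ((b m * 2 ^+ m.+1)%:E * (\1_(I m) y)%:E)%E.
have f0 m y : (0 <= f m y)%E by rewrite mule_ge0 // lee_fin // mulr_ge0 // exprn_ge0.
have muI m : mu (I m) = (2 ^- m.+1)%:E.
  have lt : 2 ^- m.+1 < 2 ^- m :> R.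
    by rewrite ltf_pV2 ?posrE ?exprn_gt0 // ltr_eXn2l ?ltr1n.
  rewrite lebesgue_measure_itv /= lte_fin lt -EFinB exprS invfM.
  by congr EFin; field; rewrite expf_neq0.
have mf m : measurable_fun setT (fun y : R => (\1_(I m) y : R)%:E).
  by apply/measurable_EFinP; exact: measurable_indic.
have E m : (\int[mu]_y f m y = (b m)%:E)%E.
  have Ei : (\int[mu]_y (\1_(I m) y : R)%:E = (2 ^- m.+1)%:E)%E.
    transitivity (mu (I m `&` setT)); last by rewrite setIT muI.
    by apply: integral_indic; [exact: measurableT|exact: mI].
  rewrite ge0_integralZl_EFin //.
  - by rewrite Ei -EFinM -mulrA mulfV ?mulr1 // expf_neq0.
  - exact: mf.
  - by rewrite mulr_ge0 // exprn_ge0.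
rewrite /yint integral_mkcond.
apply: (@le_trans _ _ (\int[mu]_y (\sum_(m <oo) f m y))%E); last first.
  rewrite integral_nneseries //; first by under eq_eseriesr do rewrite E.
  by move=> m; apply: measurable_funeM; exact: mf.
apply: ge0_le_integralT => y.
  apply: erestrict_ge0 => z /= /andP[z0 _]; rewrite lee_fin divr_ge0 ?(ltW z0) //.
rewrite /patch; case: ifPn => [|_]; last by apply: nneseries_ge0.
rewrite inE /= => /andP[y0 yl].
rewrite indicE; case: (boolP ((x, y) \in S)) => yS; last first.
  by rewrite mul0r; apply: nneseries_ge0.
rewrite inE in yS; rewrite mul1r.
have y1 : y <= 1 by rewrite (le_trans yl) // invf_le1 ?exprn_gt0 // exprn_ege1 // ler1n.
have [|m my] := @dyadic_scale R y; first by rewrite y0.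
have [m1 m2] := andP my.
have lm : (l <= m)%N.
  have : 2 ^- m.+1 < 2 ^- l :> R by apply: lt_le_trans yl.
  by rewrite ltf_pV2 ?posrE ?exprn_gt0 // ltr_eXn2l ?ltr1n // ltnS.
apply: (@le_trans _ _ (f m y)); last exact: nneseries_ge_term.
rewrite /f /b lm (H y m yS my) mul1r indicE mem_set; last by rewrite /I /= in_itv /= my.
by rewrite mule1 lee_fin invf_ple ?posrE ?exprn_gt0 // ltW.
Qed.

(* Cubes of level m carry information on the frequency level m - J0. *)
Definition bigpiece g c (J0 m : nat) : pred 'rV[int]_n := fun k =>
  `[< (J0 <= m)%N /\ forall x, flr m x = k -> c * ka ^+ (m - J0) < `|LPR (m - J0) g x| >].

(** By band limitation the piece varies by at most [c ka ^ j] on a cube of level [j + J0] once [J0]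
    is large, so half of its size survives on the whole cube. *)
Lemma bigpiece_thick A g c : LamB s A g -> 0 < c -> exists J00, forall J0, (J00 <= J0)%N ->
  forall j x, 2 * c * ka ^+ j < `|LPR j g x| -> bigpiece g c J0 (j + J0) (flr (j + J0) x).
Proof.
move=> lg c0; have A0 := LamB_ge0 lg; have CB0 := CB_ge0 n0 eta_LP; have CL0 := CL_gt0 n0 eta_LP s0.
have T0 : 0 <= CB n0 eta_LP * n%:R * (CL n0 eta_LP s0 * A) by rewrite !mulr_ge0 // ltW.
have half01 : 0 <= (2^-1 : R) < 1 by rewrite invr_ge0 ler0n /= invf_lt1 ?ltr1n.
have [J00 hJ] := geo_choose half01 T0 c0.
exists J00 => J0 J0J j x big; apply/asboolP; split; first exact: leq_addl.
move=> x' xx; rewrite addnK.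
have bP := LamB_blim n0 eta_LP s0 j lg.
have := blim_lip n0 eta_LP x' x (pow2V_gt0 j) bP.
have := flr_same (esym xx).
set e := enorm (x - x') => ex lip.
have kj : 0 < ka ^+ j by rewrite exprn_gt0 // ka_gt0.
have lip2 : `|LPR j g x - LPR j g x'| <= c * ka ^+ j.
  apply: (le_trans lip); rewrite !mulrA ler_wpM2r ?(ltW kj) //.
  apply: le_trans (hJ J0 J0J); rewrite exprVn.
  have : e / 2 ^- j <= n%:R * 2 ^- J0.
    rewrite ler_pdivrMr ?pow2V_gt0 // -mulrA -invfM -exprD addnC; exact: ex.
  move=> ee; have CC : 0 <= CB n0 eta_LP * (CL n0 eta_LP s0 * A) by rewrite !mulr_ge0 // ltW.
  have := ler_wpM2l CC ee; move=> h; apply: le_trans (le_trans h _); apply: le_of_eq; ring.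
have := ler_normD (LPR j g x - LPR j g x') (LPR j g x'); rewrite subrK.
move: big lip2; have -> : 2 * c * ka ^+ j = c * ka ^+ j + c * ka ^+ j :> R by ring.
lra.
Qed.

Lemma LPterm_ge0 j g x : (0 <= LPterm eta s q j g x)%E.
Proof. by rewrite lee_fin powR_ge0. Qed.

Lemma LPR_le_abs A j g x : continuous g -> (forall y, `|g y| <= A) ->
  `|LPR j g x| <= LPconv_abs eta j g x.
Proof.
move=> cg gA; rewrite (LPconv_absE n0 eta_LP j x cg gA) -sqrtr_sqr ler_wsqrtr //.
by rewrite lerDl sqr_ge0.
Qed.

Lemma LPterm_ge A c j g x : continuous g -> (forall y, `|g y| <= A) -> 0 <= c ->
  c * ka ^+ j < `|LPR j g x| -> ((powR c q)%:E <= LPterm eta s q j g x)%E.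
Proof.
move=> cg gA c0 big; rewrite lee_fin (kaVE s).
have kj : 0 < ka ^+ j by rewrite exprn_gt0 // ka_gt0.
have h : c <= ka ^- j * LPconv_abs eta j g x.
  by rewrite ler_pdivlMl // mulrC (le_trans (ltW big)) // (LPR_le_abs j x cg gA).
by rewrite ge0_ler_powR ?nnegrE ?(ltW q0) ?(le_trans c0 h).
Qed.

Lemma bigpiece_series A c J0 g l M x : continuous g -> (forall y, `|g y| <= A) -> 0 <= c ->
  ((powR c q * (cntl (bigpiece g c J0) (l + J0) M (flr M x))%:R)%:E <=
    \sum_(j <oo) LPterm eta s q (j + l)%N g x)%E.
Proof.
move=> cg gA c0; rewrite cntl_flr -[(l + J0)%N]add0n big_addn.
apply: (@le_trans _ _ (\sum_(0 <= j < M.+1 - (l + J0)) LPterm eta s q (j + l)%N g x)%E); last first.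
  by apply: nneseries_lim_ge => *; exact: LPterm_ge0.
rewrite natr_sum mulr_sumr -sumEFin; apply: lee_sum => j _.
case Ej: (bigpiece _ _ _ _ _); last by rewrite mulr0; exact: LPterm_ge0.
rewrite mulr1; move/asboolP: Ej => [_ /(_ x erefl)].
have -> : (j + (l + J0) - J0 = j + l)%N by rewrite addnA addnK.
exact: LPterm_ge cg gA c0.
Qed.

Lemma latcnt_bigpiece p A c J0 g : 0 < p -> LamB s A g -> 0 < c -> inF eta s p q g ->
  exists2 La : R, 0 <= La & forall M, (latcnt (p / q) (bigpiece g c J0) M <= La%:E)%E.
Proof.
move=> p0 [cg gA _] c0; rewrite /inF; set I := intn _ => Ioo.
have a0 : 0 < p / q by rewrite divr_gt0.
have I0 : (0 <= I)%E by apply: intn_ge0 => x; exact: poweR_ge0.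
have If : I \is a fin_num by rewrite ge0_fin_numE.
pose C := powR (powR c q) (p / q).
have C0 : 0 < C by rewrite !powR_gt0.
exists (fine I / C); first by rewrite divr_ge0 ?fine_ge0 // ltW.
move=> M; rewrite EFinM fineK // lee_pdivlMr // muleC -latZ ?(ltW C0) //.
apply: (@le_trans _ _ (lat M (fun k => (powR (powR c q * (cntl (bigpiece g c J0) (0 + J0) M k)%:R) (p / q))%:E))).
  apply: lat_le => k; rewrite -EFinM lee_fin -powRM ?powR_ge0 //.
  rewrite ge0_ler_powR ?nnegrE ?(ltW a0) ?mulr_ge0 ?powR_ge0 // ler_wpM2l ?powR_ge0 // ler_nat.
  rewrite /cnt /cntl [leqRHS]big_mkcond; apply: leq_sum => m _.
  case Em: (bigpiece _ _ _ _ _) => //; move/asboolP: Em => [Jm _].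
  by rewrite add0n Jm.
apply: intn_ge_lat => [k|x]; first by rewrite lee_fin powR_ge0.
rewrite -poweR_EFin; apply: gt0_ler_poweR; rewrite ?(ltW a0) ?in_itv /= ?leey ?andbT //.
- by rewrite lee_fin mulr_ge0 ?powR_ge0.
- by apply: nneseries_ge0 => *; exact: LPterm_ge0.
apply: (le_trans (bigpiece_series J0 0 M x cg gA (ltW c0))).
by under eq_eseriesr do rewrite addn0.
Qed.

Lemma lat_anc l M (k0 : 'rV[int]_n) : (l <= M)%N ->
  lat M (fun k => ((anc (M - l) k == k0)%:R : R)%:E) = ((2 ^- l) ^+ n)%:E.
Proof.
move=> lM; rewrite -intn_step; last by move=> k; rewrite lee_fin.
transitivity (intn (fun x : 'rV[R]_n => ((flr l x == k0)%:R : R)%:E)).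
  by congr intn; apply/funext => x; rewrite flr_anc.
rewrite (@intn_step _ _ l (fun k => ((k == k0)%:R : R)%:E)); last by move=> k; rewrite lee_fin.
rewrite /lat (_ : esum _ _ = 1%E) ?mule1 //.
have -> : \esum_(k in [set: 'rV[int]_n]) ((k == k0)%:R : R)%:E = \esum_(k in [set k0]) (1 : R)%:E.
  rewrite [RHS]esum_mkcond; apply: eq_esum => k _.
  have -> : (k \in [set k0]) = (k == k0) by apply/idP/eqP => [|->]; rewrite inE.
  by case: eqP.
by rewrite esum_set1.
Qed.

(** The levels [l] to [l + J0 - 1] are estimated by their number; finer marks are read off the
    series of pieces that starts at index [l]. *)
Lemma latcar_bigpiece A c J0 g : LamB s A g -> 0 < c -> inFinf eta s q g ->
  exists2 La : R, 0 <= La & forall l M k0, (l <= M)%N ->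
  (latcar (bigpiece g c J0) l M k0 <= (La * (2 ^- l) ^+ n)%:E)%E.
Proof.
move=> [cg gA _] c0; rewrite /inFinf; set S := ereal_sup _ => Soo.
have t0 l x : (0 <= \sum_(j <oo) LPterm eta s q (j + l)%N g x)%E.
  by apply: nneseries_ge0 => *; exact: LPterm_ge0.
have S0 : (0 <= S)%E.
  apply: (@le_trans _ _ ((2 ^+ (0 * n) : R)%:E *
     intn (fun x => (\1_(dcube R 0 0) x : R)%:E * \sum_(j <oo) LPterm eta s q (j + 0)%N g x))%E).
    rewrite mule_ge0 // ?lee_fin ?exprn_ge0 //; apply: intn_ge0 => x.
    by rewrite mule_ge0 // lee_fin.
  by apply: ereal_sup_ubound; exists (0%N, 0).
have Sf : S \is a fin_num by rewrite ge0_fin_numE.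
pose C := powR c q; have C0 : 0 < C by rewrite powR_gt0.
exists (J0%:R + fine S / C); first by rewrite addr_ge0 // divr_ge0 ?fine_ge0 // ltW.
move=> l M k0 lM.
pose w1 k : \bar R := (J0%:R%:E * ((anc (M - l) k == k0)%:R : R)%:E)%E.
pose w2 k : \bar R := (C^-1%:E * ((anc (M - l) k == k0)%:R * (C * (cntl (bigpiece g c J0) (l + J0) M k)%:R) : R)%:E)%E.
have w20 k : (0 <= ((anc (M - l) k == k0)%:R * (C * (cntl (bigpiece g c J0) (l + J0) M k)%:R) : R)%:E)%E.
  by rewrite lee_fin !mulr_ge0 // ltW.
apply: (@le_trans _ _ (lat M (fun k => w1 k + w2 k)%E)).
  apply: lat_le => k; rewrite /w1 /w2 -!EFinM -EFinD lee_fin.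
  case: eqP => _; last by rewrite !mul0r !mulr0 addr0.
  rewrite !mul1r mulr1 mulKf ?gt_eqF // -natrD ler_nat !cntl_nat.
  case: (leqP (l + J0) M.+1) => h.
    rewrite (@big_cat_nat _ _ _ (l + J0)) ?leq_addr //= leq_add2r.
    rewrite -[leqRHS](addKn l) -[X in (_ <= X)%N]muln1 -sum_nat_const_nat.
    by apply: leq_sum => m _; exact: leq_b1.
  rewrite [X in (_ + X)%N]big_geq ?(ltnW h) // addn0.
  apply: (@leq_trans (\sum_(l <= m < M.+1) 1)%N); first by apply: leq_sum => m _; exact: leq_b1.
  by rewrite sum_nat_const_nat muln1 leq_subLR ltnW.
rewrite latD; last 2 first.
- by move=> k; rewrite mule_ge0 // lee_fin.
- by move=> k; rewrite mule_ge0 // lee_fin invr_ge0 ltW.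
rewrite (latZ M (ler0n _ _)); last by move=> k; rewrite lee_fin.
rewrite (latZ M _ w20) ?invr_ge0 ?(ltW C0) // lat_anc // mulrDl EFinD EFinM leeD2l //.
rewrite mulrAC mulrC EFinM lee_wpmul2l ?lee_fin ?invr_ge0 ?(ltW C0) //.
apply: (@le_trans _ _ (intn (fun x => (\1_(dcube R l k0) x : R)%:E * \sum_(j <oo) LPterm eta s q (j + l)%N g x)%E)).
  apply: intn_ge_lat => // x; rewrite flr_anc // indicE.
  case: (boolP (x \in _)) => xk.
    rewrite inE in xk; move/dcubeP: xk => ->; rewrite eqxx mul1r mul1e.
    exact: bigpiece_series cg gA (ltW c0).
  rewrite (negbTE (_ : flr l x != k0)) ?mul0r ?mul0e //.
  by apply: contraNN xk => /eqP h; rewrite inE; apply/dcubeP.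
have : ((2 ^+ (l * n) : R)%:E * intn (fun x => (\1_(dcube R l k0) x : R)%:E * \sum_(j <oo) LPterm eta s q (j + l)%N g x) <= S)%E.
  by apply: ereal_sup_ubound; exists (l, k0).
rewrite -(fineK Sf) -lee_pdivlMl ?exprn_gt0 // => h; apply: (le_trans h).
by rewrite -EFinM lee_fin exprM exprVn mulrC.
Qed.

Lemma sum_shift_le (b : nat -> bool) (l K a T : nat) : (K + a <= T)%N ->
  (\sum_(0 <= m < K) ((l <= m)%N && b (m + a)%N) <= \sum_(l <= m < T) b m)%N.
Proof.
move=> h; rewrite [leqRHS](@big_nat_widenl _ _ _ l 0) // [leqRHS]big_mkcond /=.
apply: (@leq_trans (\sum_(a <= m < K + a) (if (l <= m)%N then b m : nat else 0%N))%N).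
  rewrite -[X in (_ <= \sum_(X <= _ < _) _)%N]add0n [leqRHS]big_addn addnK; apply: leq_sum => m _.
  by case: (leqP l m) => //= lm; rewrite (leq_trans lm (leq_addr _ _)).
rewrite [leqRHS](@big_cat_nat _ _ _ a) //=; last by move: h; clear; lia.
rewrite [X in (_ <= _ + X)%N](@big_cat_nat _ _ _ (K + a)) //=; last by move: h; clear; lia.
by rewrite addnCA leq_addr.
Qed.

(* The dyadic level of a large difference is only known up to J, whence the factor 2 J. *)
Lemma yint_Sset A g d : LamB s A g -> 0 < d -> exists J J0 i : nat, exists2 c, 0 < c &
  forall l x, (yint (Sset r s g d) x (2 ^- l) <=
    ereal_sup (range (fun M => ((2 * J)%N%:R * (cntl (nb (2 ^ i) (bigpiece g c J0)) l M (flr M x))%:R : R)%:E)))%E.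
Proof.
move=> lg d0; have [J [c c0 det]] := large_diff_piece n0 eta_LP s0 sr lg d0.
have c20 : 0 < c / 2 by rewrite divr_gt0.
have [J00 th] := bigpiece_thick lg c20.
(* The level [j + J0] is written as [m + t + K0] with [t = j + J - m]; the extra [J] keeps [t]
   nonnegative. *)
pose J0 := (J00 + J)%N; pose K0 := J00.
have [i hi] : exists i : nat, (r%:R * 2 ^+ (J + J0) : R) + 1 <= (2 ^ i)%N%:R.
  exists (r * 2 ^ (J + J0)).+1; apply: (@le_trans _ _ ((r * 2 ^ (J + J0)).+1%:R)).
    by rewrite -[leRHS]natr1 natrM natrX.
  by rewrite ler_nat ltnW // ltn_expl.
exists J, J0, i, (c / 2) => // l x.
pose B m := nb (2 ^ i) (bigpiece g (c / 2) J0) m (flr m x).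
pose F m := `[< exists2 t, (t < 2 * J)%N & B (m + t + K0)%N >].
have HF y m : Sset r s g d (x, y) -> 2 ^- m.+1 < y <= 2 ^- m -> F m.
  move=> /SsetP [y0 [h hy big]] my; rewrite -hy in my big.
  have [j [x' [mj jm xx bj]]] := det x h m my big.
  apply/asboolP; exists (j + J - m)%N; first by move: mj jm; clear; lia.
  have -> : (m + (j + J - m) + K0 = j + J0)%N by move: mj; rewrite /K0 /J0; clear; lia.
  apply/asboolP; exists (flr (j + J0) x').
    apply: th; first exact: leq_addr.
    by move: bj; rewrite [2 * _]mulrC divfK.
  have rh : enorm (x' - x) <= r%:R * 2 ^- m.
    by rewrite (le_trans xx) // ler_wpM2l //; case/andP: my.
  have ib : inbox (r%:R * 2 ^- m) (x - x').
    by apply: inbox_le (_ : inbox (enorm (x - x')) _); [rewrite -enormN opprB|exact: inbox_enorm].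
  have hN : 2 ^+ (j + J0) * (r%:R * 2 ^- m) <= (r * 2 ^ (J + J0))%N%:R :> R.
    rewrite mulrCA natrM natrX ler_wpM2l // ler_pdivrMr ?exprn_gt0 // -exprD.
    by rewrite ler_weXn2l ?ler1n //; move: jm; clear; lia.
  have := flr_near ib hN; move=> nr z; apply: le_trans (nr z) _.
  by rewrite lez_nat -(ler_nat R) -natr1 natrM natrX.
apply: (le_trans (yint_le l HF)); apply: nneseries_le => [m|K]; first by rewrite lee_fin.
apply: (@le_trans _ _ (((2 * J)%N%:R * (cntl (nb (2 ^ i) (bigpiece g (c / 2) J0)) l (K + 2 * J + K0) (flr (K + 2 * J + K0) x))%:R : R)%:E)); last first.
  by apply: ereal_sup_ubound; exists (K + 2 * J + K0)%N.
rewrite sumEFin lee_fin -natr_sum -natrM ler_nat cntl_flr.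
apply: (@leq_trans (\sum_(0 <= m < K) \sum_(t < 2 * J) ((l <= m)%N && B (m + t + K0)%N))%N).
  apply: leq_sum => m _; case: (leqP l m) => //= lm.
  case Fm: (F m) => //; move/asboolP: Fm => [t tJ Bt].
  by rewrite (bigD1 (Ordinal tJ)) //= Bt.
rewrite exchange_big /= -[X in (_ <= X * _)%N]card_ord -sum_nat_const; apply: leq_sum => t _.
under eq_bigr do rewrite -addnA.
by apply: sum_shift_le; have := ltn_ord t; lia.
Qed.

Lemma yint_ge0 (S : set ('rV[R]_n * R)) x (b : R) : (0 <= yint S x b)%E.
Proof.
apply: integral_ge0 => y /= /andP[y0 _]; rewrite lee_fin divr_ge0 ?(ltW y0) //.
Qed.

Lemma Sset_inF p A g d : 0 < p -> LamB s A g -> inF eta s p q g -> 0 < d ->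
  (intn (fun x => poweR (yint (Sset r s g d) x 1) (p / q)) < +oo)%E.
Proof.
move=> p0 lg gF d0; have a0 : 0 < p / q by rewrite divr_gt0.
have [J [J0 [i [c c0 yb]]]] := yint_Sset lg d0.
have [La La0 HLa] := latcnt_bigpiece J0 p0 lg c0 gF.
have [C C0 [be be1 Hnb]] := @latcnt_nb R n _ a0.
pose E := nb (2 ^ i) (bigpiece g c J0).
pose W M k : \bar R := (powR ((2 * J)%N%:R * (cntl E 0 M k)%:R) (p / q))%:E.
have W0 M k : (0 <= W M k)%E by rewrite lee_fin powR_ge0.
apply: (@le_lt_trans _ _ (powR (2 * J)%N%:R (p / q) * (C * be ^+ i * La))%:E); last exact: ltry.
apply: (@le_trans _ _ (ereal_sup (range (fun M => lat M (W M))))).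
  apply: intn_le_sup => //.
  - move=> M x; rewrite lee_fin ge0_ler_powR ?nnegrE ?(ltW a0) ?mulr_ge0 //.
    by rewrite ler_wpM2l // ler_nat cntl_mono.
  - by move=> x; exact: poweR_ge0.
  - move=> x; apply: poweR_le_sup => //; first exact: yint_ge0.
    by have := yb 0%N x; rewrite expr0 invr1.
apply: ge_ereal_sup => _ [M _ <-].
have -> : lat M (W M) = ((powR (2 * J)%N%:R (p / q))%:E * latcnt (p / q) E M)%E.
  rewrite /latcnt -latZ ?powR_ge0 //; congr lat; apply/funext => k.
  by rewrite /W cntl0 powRM.
rewrite EFinM lee_wpmul2l ?lee_fin ?powR_ge0 // (le_trans (Hnb _ _ _)) //.
have P0 : 0 <= C * be ^+ i by rewrite mulr_ge0 ?(ltW C0) // exprn_ge0 // (le_trans _ be1).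
by rewrite (EFinM (C * be ^+ i) La) lee_wpmul2l // lee_fin.
Qed.

Lemma Sset_inFinf A g d : LamB s A g -> inFinf eta s q g -> 0 < d -> (Mcar (Sset r s g d) < +oo)%E.
Proof.
move=> lg gF d0.
have [J [J0 [i [c c0 yb]]]] := yint_Sset lg d0.
have [La La0 HLa] := latcar_bigpiece J0 lg c0 gF.
pose E := nb (2 ^ i) (bigpiece g c J0).
pose B : R := ((2 * 2 ^ i).+1 ^ n)%N%:R * ((2 * 2 ^ i).+1 ^ n)%N%:R * La.
have B0 : 0 <= B by rewrite !mulr_ge0.
apply: (@le_lt_trans _ _ ((2 * J)%N%:R * B)%:E); last exact: ltry.
apply: ge_ereal_sup => _ [[l k0] _ <-] /=.
pose W M k : \bar R := ((2 * J)%N%:R%:E * (((l <= M)%N && (anc (M - l) k == k0))%:R * (cntl E l M k)%:R : R)%:E)%E.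
have w0 M k : (0 <= (((l <= M)%N && (anc (M - l) k == k0))%:R * (cntl E l M k)%:R : R)%:E)%E.
  by rewrite lee_fin mulr_ge0.
have W0 M k : (0 <= W M k)%E by rewrite mule_ge0 // lee_fin.
rewrite muleC -lee_pdivlMr ?exprn_gt0 //.
apply: (@le_trans _ _ (ereal_sup (range (fun M => lat M (W M))))).
  apply: intn_le_sup => //.
  - move=> M x; case: (leqP l M) => lM; last by rewrite {1}/W leqNgt lM /= mul0r mule0.
    rewrite /W lM (leq_trans lM (leqnSn _)) !flr_anc // ?(leq_trans lM (leqnSn _)) //=.
    by rewrite lee_wpmul2l ?lee_fin // ler_wpM2l // ler_nat cntl_mono.
  - by move=> x; rewrite mule_ge0 // ?lee_fin // yint_ge0.
  - move=> x; rewrite indicE; case: (boolP (x \in _)) => xk; last first.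
      rewrite mul0e; apply: (@le_trans _ _ (W 0%N (flr 0 x))) => //.
      by apply: ereal_sup_ubound; exists 0%N.
    rewrite inE in xk; move/dcubeP: xk => xk; rewrite mul1e (le_trans (yb l x)) //.
    apply: ge_ereal_sup => _ [M _ <-].
    apply: (@le_trans _ _ (W M (flr M x))); last by apply: ereal_sup_ubound; exists M.
    rewrite /W -EFinM lee_fin; case: (leqP l M) => lM.
      by rewrite flr_anc // xk eqxx mul1r.
    by rewrite cntl_nat big_geq // mulr0 mul0r mulr0.
apply: ge_ereal_sup => _ [M _ <-].
rewrite (latZ M (ler0n _ _) (w0 M)) EFinM -muleA lee_wpmul2l ?lee_fin // -EFinM.
case: (leqP l M) => lM; last first.
  rewrite /lat esum1 ?mule0 //; first by rewrite lee_fin mulr_ge0 // invr_ge0 exprn_ge0.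
  by move=> k _; rewrite mul0r.
apply: (le_trans (latcar_nb (2 ^ i) La0 HLa k0 lM)).
by rewrite lee_fin -/B exprM exprVn.
Qed.

(** A marked cube of level [m] contributes at least its own volume, so a finite total leaves room
    for finitely many. *)
Lemma latcnt_bounded (a La : R) (E : nat -> pred 'rV[int]_n) m : 0 < a ->
  (latcnt a E m <= La%:E)%E -> exists N, forall k, E m k -> near N k 0.
Proof.
move=> a0 HLa; have p0 : 0 < (2 ^- m) ^+ n :> R by rewrite exprn_gt0 // invr_gt0 exprn_gt0.
have fin : finite_set [set k | E m k].
  (* [K] exceeds [La] divided by the volume of one cube of level [m]. *)
  apply: contrapT => inf; pose K := (Num.truncn (`|La| / (2 ^- m) ^+ n)).+1.
  have [B BE KB] := infinite_set_fset K inf.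
  have : ((K%:R : R)%:E <= \esum_(k in [set: 'rV[int]_n]) (powR (cnt E m k)%:R a)%:E)%E.
    apply: esum_ge; exists [set` B]; first by split.
    rewrite fsbig_finite //= set_fsetK.
    apply: (@le_trans _ _ (\sum_(k <- B) (1 : R)%:E)%E).
      by rewrite sume_const_seq // mule1 lee_fin ler_nat.
    rewrite big_seq [leRHS]big_seq; apply: lee_sum => k kB; rewrite lee_fin.
    have Ek : E m k by apply: BE.
    have c1 : 1 <= (cnt E m k)%:R :> R.
      by rewrite ler1n /cnt big_ord_recr /= subnn anc0 Ek addn1.
    apply: (@le_trans _ _ (powR 1 a)); first by rewrite powR1.
    by rewrite ge0_ler_powR ?nnegrE ?(ltW a0).
  move=> h; move: HLa; rewrite /latcnt /lat => HLa.
  have : (((2 ^- m) ^+ n)%:E * (K%:R : R)%:E <= La%:E)%E.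
    by apply: le_trans HLa; rewrite lee_wpmul2l // lee_fin ltW.
  rewrite -EFinM lee_fin mulrC -ler_pdivlMr // leNgt => /negP; apply.
  apply: le_lt_trans (truncnS_gt _); rewrite ler_wpM2r ?invr_ge0 ?(ltW p0) //.
  exact: ler_norm.
have /finite_seqP [sq Hs] := fin.
exists (\sum_(k <- sq) \sum_i absz (k 0%R i))%N => k Ek i.
have ks : k \in sq by have : [set` sq] k by rewrite -Hs.
rewrite mxE subr0 -abszE lez_nat (big_rem k) //= (bigD1 i) //= -!addnA.
exact: leq_addr.
Qed.

Lemma near_flr_enorm N m x : near N (flr m x) 0 -> enorm x <= n%:R * N.+1%:R.
Proof.
move=> H; apply: enorm_inbox => i; have := H i; rewrite !mxE subr0 => h.
have p1 : 1 <= 2 ^+ m :> R by rewrite exprn_ege1 // ler1n.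
have /andP[f1 f2] := floor_itv (2 ^+ m * x 0 i).
have h' : `|(Num.floor (2 ^+ m * x 0 i))%:~R| <= N%:R :> R.
  by rewrite -intr_norm -[N%:R]/(N%:Z%:~R) ler_int.
apply: (@le_trans _ _ `|2 ^+ m * x 0 i|).
  by rewrite normrM ger0_norm ?(le_trans _ p1) // ler_peMl.
move: f2 h'; rewrite intrD mulr1z -natr1 !ler_norml => f2 /andP[h1 h2].
by apply/andP; split; lra.
Qed.

(** Each of the first [J] pieces is large on finitely many cubes only, and the remaining ones are
    uniformly small. *)
Lemma inF_vanish p A g e : 0 < p -> LamB s A g -> inF eta s p q g -> 0 < e ->
  exists rho : R, forall x, rho < enorm x -> `|g x| <= e.
Proof.
move=> p0 lg gF e0; have a0 : 0 < p / q by rewrite divr_gt0.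
have [cg gA _] := lg; have A0 := LamB_ge0 lg; have CL0 := CL_gt0 n0 eta_LP s0.
have k1 : 0 < 1 - ka by rewrite subr_gt0 ka_lt1.
have T0 : 0 <= CL n0 eta_LP s0 * A / (1 - ka) by rewrite !mulr_ge0 ?invr_ge0 ?(ltW CL0) ?(ltW k1).
have e20 : 0 < e / 2 by rewrite divr_gt0.
have [J hJ] := geo_choose (ka1 s0) T0 e20.
pose c : R := e / (4 * J.+1%:R).
have c0 : 0 < c by rewrite divr_gt0 // mulr_gt0.
have [J0 th] := bigpiece_thick lg c0.
have [La La0 HLa] := latcnt_bigpiece J0 p0 lg c0 gF.
have /choice [rho Hrho] : forall j, exists rho : R, forall x, rho < enorm x -> `|LPR j g x| <= 2 * c.
  move=> j; have [N HN] := latcnt_bounded a0 (HLa (j + J0)%N).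
  exists (n%:R * N.+1%:R) => x; apply: contraTT; rewrite -ltNge -leNgt => big.
  apply: (@near_flr_enorm N (j + J0)); apply: HN; apply: th => //.
  by rewrite (le_lt_trans _ big) // ler_piMr ?ka_le_exp // mulr_ge0 // ltW.
exists (\sum_(j < J) `|rho j|) => x xr.
have tl := geo_tail J (ka1 s0) (fun j => LPR_le n0 eta_LP s0 lg j x) (@LPR_cvg R n n0 eta eta_LP A g x cg gA).
have t2 := hJ J (leqnn _).
have sm : `|\sum_(j < J) LPR j g x| <= e / 2.
  rewrite (le_trans (ler_norm_sum _ _ _)) //.
  apply: (@le_trans _ _ (\sum_(j < J) 2 * c)).
    apply: ler_sum => j _; apply: Hrho; apply: le_lt_trans xr.
    by rewrite (bigD1 j) //= (le_trans (ler_norm _)) // lerDl sumr_ge0.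
  rewrite sumr_const card_ord -[leLHS]mulr_natr /c.
  have J1 : 0 < J.+1%:R :> R by [].
  have -> : 2 * (e / (4 * J.+1%:R)) * J%:R = e / 2 * (J%:R / J.+1%:R) by field; rewrite gt_eqF.
  by rewrite ler_piMr ?(ltW e20) // ler_pdivrMr // mul1r ler_nat.
have := ler_normD (g x - \sum_(j < J) LPR j g x) (\sum_(j < J) LPR j g x); rewrite subrK.
have E : CL n0 eta_LP s0 * A * ka ^+ J / (1 - ka) = CL n0 eta_LP s0 * A / (1 - ka) * ka ^+ J by ring.
rewrite E in tl; move: tl t2 sm; lra.
Qed.

End LargeDifferences.

(** * Clipping the pieces and resynthesis *)

Section Synthesis.
Context {R : realType} {n : nat} (n0 : (0 < n)%N).
Context (eta : 'rV[R]_n -> R) (eta_LP : LP_eta eta).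
Context (s : R) (s0 : 0 < s).
Implicit Types (K P f g u : 'rV[R]_n -> R) (x h : 'rV[R]_n) (A D G e : R).

Local Notation ka := (ka s).
Local Notation LPR := (LPR eta).

(** The synthesis operator of level [j]; it is the identity on j-th pieces ([LPT_LPR]), hence
    resynthesis without clipping returns [f]. *)
Definition LPT (j : nat) u : 'rV[R]_n -> R := conv (FT 0 (lpt eta j)) (2 ^- j) u.

Lemma LPT_good : exists2 C : R, 0 < C & forall j, good C (FT 0 (lpt eta j)).
Proof.
have [C C0 g0] := FT_multiplier_good n0 (lpt_multiplier eta_LP 0).
have [D D0 g1] := FT_multiplier_good n0 (lpt_multiplier eta_LP 1).
exists (C + D); first by rewrite addr_gt0.
case=> [|j]; first by apply: good_le (g0 0); rewrite lerDl ltW.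
by apply: good_le (g1 0); rewrite lerDr ltW.
Qed.

Lemma LPT_diffk k : exists2 C : R, 0 < C & forall j G u h x, continuous u -> (forall y, `|u y| <= G) ->
  `|diffk k h (LPT j u) x| <= C * (enorm h / 2 ^- j) ^+ k * G.
Proof.
have [C C0 H0] := Bernstein k 0 n0 (lpt_multiplier eta_LP 0).
have [D D0 H1] := Bernstein k 0 n0 (lpt_multiplier eta_LP 1).
exists (C + D); first by rewrite addr_gt0.
move=> j G u h x cu uG; have G0 : 0 <= G := le_trans (normr_ge0 _) (uG 0).
have e0 : 0 <= (enorm h / 2 ^- j) ^+ k by rewrite exprn_ge0 // divr_ge0 ?enorm_ge0 ?pow2V_ge0.
have h0 := H0 G (2 ^- j) h u x (pow2V_gt0 j) cu uG.
have h1 := H1 G (2 ^- j) h u x (pow2V_gt0 j) cu uG.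
rewrite !mulrDl; have p0 : 0 <= C * (enorm h / 2 ^- j) ^+ k * G by rewrite !mulr_ge0 // ltW.
have p1 : 0 <= D * (enorm h / 2 ^- j) ^+ k * G by rewrite !mulr_ge0 // ltW.
case: j e0 h0 h1 p0 p1 => [|j] e0 h0 h1 p0 p1.
  by apply: (le_trans h0); rewrite lerDl.
by apply: (le_trans h1); rewrite lerDr.
Qed.

Definition CT : R := projT1 (cid2 (LPT_diffk 0)).
Lemma CT_gt0 : 0 < CT. Proof. by rewrite /CT; case: cid2. Qed.

Lemma LPT_le j G u x : continuous u -> (forall y, `|u y| <= G) -> `|LPT j u x| <= CT * G.
Proof.
move=> cu uG; rewrite /CT; case: cid2 => //= C _ H.
by have := H j G u 0 x cu uG; rewrite expr0 mulr1.
Qed.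

Lemma continuous_LPT j G u : continuous u -> (forall y, `|u y| <= G) -> continuous (LPT j u).
Proof. by move=> cu uG; have [C C0 gC] := LPT_good; exact: continuous_conv (gC j) cu uG. Qed.

Lemma LPT_LPR A j f x : continuous f -> (forall y, `|f y| <= A) -> LPT j (LPR j f) x = LPR j f x.
Proof.
move=> cf fA; have mb := lpb_multiplier eta_LP j; have mt := lpt_multiplier eta_LP j.
have [C1 C10 g1] := FT_multiplier_good n0 mb; have [C2 C20 g2] := FT_multiplier_good n0 mt.
have [D1 D10 h1] := FT_multiplier_decay 2 n0 mb; have [D2 D20 h2] := FT_multiplier_decay 2 n0 mt.
rewrite /LPT /LPR (@conv_comm R n (D1 + D2) A) //.
- rewrite (conv_FT_mul n0 0 (2 ^- j) x mb mt (lpt_even _ _) cf fA).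
  by apply: eq_conv => // z; congr FT; apply/funext => xi; rewrite (lpb_lpt eta_LP).
- by case: (g2 0).
- by case: (g1 0).
- move=> z; rewrite (le_trans (h2 0 z)) // ler_wpM2r ?exprn_ge0 ?maj_ge0 //.
  by rewrite lerDr ltW.
- move=> z; rewrite (le_trans (h1 0 z)) // ler_wpM2r ?exprn_ge0 ?maj_ge0 //.
  by rewrite lerDl ltW.
Qed.

Lemma LPTB G G' j u v x : continuous u -> (forall y, `|u y| <= G) -> continuous v -> (forall y, `|v y| <= G') ->
  LPT j (fun y => u y - v y) x = LPT j u x - LPT j v x.
Proof. by move=> cu uG cv vG; have [C C0 gC] := LPT_good; exact: convB (gC j) cu cv uG vG. Qed.

Lemma geo_series_cvg (u : nat -> R) B q : 0 <= q < 1 -> (forall j, `|u j| <= B * q ^+ j) ->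
  cvgn (fun N => \sum_(j < N) u j).
Proof.
move=> /andP[q0 q1] uB.
have c : cvgn [normed series u].
  apply: (@series_le_cvg _ _ (geometric B q)) => [j|j|j|] /=.
  - exact: normr_ge0.
  - exact: le_trans (uB j).
  - exact: uB.
  - by apply: is_cvg_geometric_series; rewrite ger0_norm.
have := normed_cvg c; rewrite (_ : [series u j]_j = fun N => \sum_(j < N) u j) //.
by apply/funext => N; rewrite /series /= big_mkord.
Qed.

(** For a step of length about [2 ^- m], terms with [j < m] are estimated by Bernstein's inequality
    and the others by their size; both sums are geometric and of order [D ka ^ m]. *)
Lemma synthesis : exists2 C : R, 0 < C & forall D (Q : nat -> 'rV[R]_n -> R),
  (forall j, continuous (Q j)) -> (forall j y, `|Q j y| <= D * ka ^+ j) ->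
  exists2 G, LamB s (C * D) G & forall x, \sum_(j < N) LPT j (Q j) x @[N --> \oo] --> G x.
Proof.
pose r0 := (Num.truncn s).+1.
have sr0 : s < r0%:R by exact: truncnS_gt.
have [CB CB0 HB] := LPT_diffk r0.
have CT0 := CT_gt0; have k1 : 0 < 1 - ka by rewrite subr_gt0 ka_lt1.
have rh := rh1 sr0; set rh0 := 2 ^+ r0 * ka in rh.
have k0 := @ka_gt0 R s.
pose C := CT / (1 - ka) + (CB / (rh0 - 1) + 2 ^+ r0 * (CT / (1 - ka))) / ka.
have T0 : 0 < CT / (1 - ka) by rewrite divr_gt0.
have C1 : 0 <= (CB / (rh0 - 1) + 2 ^+ r0 * (CT / (1 - ka))) / ka.
  by rewrite divr_ge0 ?addr_ge0 ?mulr_ge0 ?exprn_ge0 ?invr_ge0 ?(ltW CB0) ?(ltW rh) ?(ltW CT0) ?(ltW k1) ?(ltW k0).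
exists C; first by rewrite ltr_pwDl.
move=> D Q cQ QD.
have D0 : 0 <= D by have := QD 0%N 0; rewrite expr0 mulr1; apply: le_trans.
have tb j x : `|LPT j (Q j) x| <= CT * D * ka ^+ j by rewrite -mulrA; apply: LPT_le (cQ j) (QD j).
pose S N x := \sum_(j < N) LPT j (Q j) x.
have /choice [G cG] : forall x, exists y : R, S N x @[N --> \oo] --> y.
  move=> x; exists (limn (S ^~ x)); exact: (geo_series_cvg (ka1 s0) (tb ^~ x)).
have tl J x : `|G x - S J x| <= CT * D * ka ^+ J / (1 - ka).
  exact: (geo_tail J (ka1 s0) (tb ^~ x) (cG x)).
have cS J : continuous (S J).
  by apply: continuous_sumf => j _; exact: continuous_LPT (cQ j) (QD j).
have contG : continuous G.
  move=> x; apply/(@cvgrPdist_lt R R _ _ (nbhs_filter x)) => e e0.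
  have e30 : 0 < e / 4 by rewrite divr_gt0.
  have TD : 0 <= CT * D / (1 - ka) by rewrite !mulr_ge0 ?invr_ge0 ?(ltW CT0) ?(ltW k1).
  have [J /(_ J (leqnn J)) hJ] := geo_choose (ka1 s0) TD e30.
  have /(@cvgrPdist_lt R R _ _ (nbhs_filter x)) /(_ _ e30) := cS J x.
  apply: filterS => y hy; have := tl J x; have := tl J y.
  have -> : CT * D * ka ^+ J / (1 - ka) = CT * D / (1 - ka) * ka ^+ J by ring.
  have -> : G x - G y = (G x - S J x) + (S J x - S J y) - (G y - S J y) by ring.
  have := ler_normB ((G x - S J x) + (S J x - S J y)) (G y - S J y).
  have := ler_normD (G x - S J x) (S J x - S J y).
  move: hy hJ; lra.
exists G => //; split => //.
  move=> x; have := tl 0%N x; rewrite /S big_ord0 subr0 expr0 mulr1 => h.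
  by rewrite (le_trans h) // /C mulrDl mulrAC lerDl mulr_ge0.
move=> x h h01; have [h0 h1] := andP h01.
have [m /andP[m1 m2]] := dyadic_scale h01.
have e1 : `|diffk r0 h G x - diffk r0 h (S m) x| <= 2 ^+ r0 * (CT * D * ka ^+ m / (1 - ka)).
  by rewrite -diffkBf; apply: diffk_bound => y; exact: tl.
have e2 : `|diffk r0 h (S m) x| <= CB * D * (ka ^+ m / (rh0 - 1)).
  have -> : diffk r0 h (S m) x = \sum_(j < m) diffk r0 h (LPT j (Q j)) x.
    exact: (diffk_sumf r0 h m (fun j => LPT j (Q j)) x).
  rewrite (le_trans (ler_norm_sum _ _ _)) //.
  apply: (@le_trans _ _ (\sum_(j < m) CB * D * ((2 ^- m) ^+ r0 * rh0 ^+ j))).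
    apply: ler_sum => j _; apply: (le_trans (HB j _ _ h x (cQ j) (QD j))).
    have -> : CB * (enorm h / 2 ^- j) ^+ r0 * (D * ka ^+ j) = CB * D * ((enorm h / 2 ^- j) ^+ r0 * ka ^+ j) by ring.
    rewrite ler_wpM2l ?mulr_ge0 ?(ltW CB0) // /rh0 [(_ * ka) ^+ _]exprMn mulrA ler_wpM2r ?exprn_ge0 ?(ltW k0) //.
    rewrite exprAC -exprMn invrK; apply: lerXn2r; rewrite ?nnegrE ?mulr_ge0 ?exprn_ge0 ?invr_ge0 ?exprn_ge0 ?enorm_ge0 //.
    by rewrite ler_wpM2r // exprn_ge0.
  rewrite -mulr_sumr -mulr_sumr ler_wpM2l ?mulr_ge0 ?(ltW CB0) //.
  have := geo_sum_le m (ka_exp_gt1 sr0); rewrite -/rh0 => gs.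
  have p0 : 0 <= (2 ^- m) ^+ r0 :> R by rewrite exprn_ge0 // pow2V_ge0.
  apply: (le_trans (ler_wpM2l p0 gs)); rewrite mulrA.
  by have -> := rhE s r0 m.
have hs : ka ^+ m <= ka^-1 * powR (enorm h) s by exact: powR_dyadic_le.
have := ler_normD (diffk r0 h G x - diffk r0 h (S m) x) (diffk r0 h (S m) x); rewrite subrK => e3.
apply: (le_trans e3); apply: (le_trans (lerD e1 e2)).
have -> : 2 ^+ r0 * (CT * D * ka ^+ m / (1 - ka)) + CB * D * (ka ^+ m / (rh0 - 1)) =
   (CB / (rh0 - 1) + 2 ^+ r0 * (CT / (1 - ka))) * D * ka ^+ m by ring.
have H0 : 0 <= (CB / (rh0 - 1) + 2 ^+ r0 * (CT / (1 - ka))) * D.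
  by rewrite mulr_ge0 ?addr_ge0 ?mulr_ge0 ?exprn_ge0 ?invr_ge0 ?(ltW CB0) ?(ltW rh) ?(ltW CT0) ?(ltW k1).
apply: (le_trans (ler_wpM2l H0 hs)); rewrite [leLHS]mulrA ler_wpM2r ?powR_ge0 //.
by rewrite /C [leLHS]mulrAC [leRHS]mulrDl lerDr mulr_ge0 // ltW.
Qed.

(* The kernel of the l-th piece after the j-th synthesis kernel, seen at scale 2^-j. *)
Definition mixk (a : R) (l j : nat) : 'rV[R]_n -> R :=
  FT a (fun x => lpb eta l ((2 ^+ j / 2 ^+ l) *: x) * lpt eta j x).

Lemma mix_multiplier l j : multiplier (fun x => lpb eta l ((2 ^+ j / 2 ^+ l) *: x) * lpt eta j x).
Proof.
have [c _ d] := lpt_multiplier eta_LP j.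
apply: multiplierM c d; apply: lpb_scale_multiplier => //.
Qed.

Lemma mixk_far a l j z : (l + 3 <= j)%N || (j + 3 <= l)%N -> mixk a l j z = 0.
Proof.
move=> lj; rewrite /mixk -[RHS](@RI0 R n); apply: eq_RI => xi.
have p0 (k : nat) : 0 < 2 ^+ k :> R by rewrite exprn_gt0.
rewrite (lpb_lpt_disjoint eta_LP) ?mul0r //.
case/orP: lj => lj; [left|right]; split => //.
  rewrite ler_pdivlMr // (_ : 8 = 2 ^+ 3); last by rewrite -natrX.
  by rewrite -exprD ler_weXn2l ?ler1n // addnC.
rewrite divr_gt0 //= ler_pdivrMr // mulrC mulrA mulr1 ler_pdivlMr //.
rewrite (_ : 8 = 2 ^+ 3); last by rewrite -natrX.
by rewrite -exprD ler_weXn2l ?ler1n // .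
Qed.

(** Only finitely many symbols occur: they depend on [j - l], one of five values, and on whether [l]
    and [j] vanish. Their constants are simply added. *)
Lemma mixk_decay (P : nat) : exists2 C : R, 0 < C & forall a l j z, (l <= j + 2)%N -> (j <= l + 2)%N ->
  `|mixk a l j z| <= C * maj z ^+ P.
Proof.
pose u (p : bool * bool * 'I_5) x := lpb eta p.1.1 ((2 ^+ p.2 / 4) *: x) * lpt eta p.1.2 x.
have mu p : multiplier (u p).
  have [c _ d] := lpt_multiplier eta_LP p.1.2.
  by apply: multiplierM c d; apply: lpb_scale_multiplier.
pose C p := projT1 (cid2 (FT_multiplier_decay P n0 (mu p))).
have C0 p : 0 < C p by rewrite /C; case: cid2.
have CP p a z : `|FT a (u p) z| <= C p * maj z ^+ P by rewrite /C; case: cid2.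
exists (1 + \sum_p C p); first by rewrite ltr_pwDl // sumr_ge0 // => p _; exact: ltW.
move=> a l j z lj jl.
have t5 : (j + 2 - l < 5)%N by lia.
pose p := ((0 < l)%N, (0 < j)%N, Ordinal t5).
have -> : mixk a l j z = FT a (u p) z.
  congr (FT a _ z); apply/funext => x; rewrite /u /=.
  have -> : 2 ^+ (j + 2 - l) / 4 = 2 ^+ j / 2 ^+ l :> R.
    have p0 (k : nat) : 2 ^+ k != 0 :> R by rewrite expf_neq0 // pnatr_eq0.
    have : 2 ^+ (j + 2 - l) * 2 ^+ l = 2 ^+ j * 4 :> R.
      by rewrite -exprD subnK // exprD; congr (_ * _); rewrite expr2; ring.
    by move=> E; apply/eqP; rewrite eqr_div ?pnatr_eq0 // E.
  congr (_ * _); first by case: (l).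
  by case: (j).
rewrite (le_trans (CP p a z)) // ler_wpM2r ?exprn_ge0 ?maj_ge0 //.
rewrite (bigD1 p) //= addrCA lerDl addr_ge0 // sumr_ge0 // => k _; exact: ltW.
Qed.

Lemma lpb_LPT G a l j u x : continuous u -> (forall y, `|u y| <= G) ->
  conv (FT a (lpb eta l)) (2 ^- l) (LPT j u) x = conv (mixk a l j) (2 ^- j) u x.
Proof.
move=> cu uG; have mb := lpb_multiplier eta_LP l; have mt := lpt_multiplier eta_LP j.
have [C0 g0] := multiplier_good n0 mb; have [C1 C10 g1] := FT_multiplier_good n0 mb.
have p0 (k : nat) : 0 < 2 ^+ k :> R by rewrite exprn_gt0.
set c : R := 2 ^+ j / 2 ^+ l; have cp : 0 < c by rewrite divr_gt0.
have E : 2 ^- l = c * 2 ^- j :> R by rewrite /c mulrAC mulfV ?gt_eqF // mul1r.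
have C00 := good_ge0 g0.
rewrite E -(@conv_FT_scale R n (C0 + C1) (CT * G) a (lpb eta l) c) //.
- have mbc : multiplier (fun x => lpb eta l (c *: x)) by apply: lpb_scale_multiplier => //; rewrite gt_eqF.
  exact: (conv_FT_mul n0 a (2 ^- j) x mbc mt (lpt_even _ _) cu uG).
- by apply: good_le g0; rewrite lerDl ltW.
- by move=> b; apply: good_le (g1 b); rewrite lerDr.
- exact: continuous_LPT cu uG.
- by move=> y; exact: LPT_le cu uG.
Qed.

End Synthesis.

(** * The clipped approximant and the pieces of the remainder *)

Section Approximant.
Context {R : realType} {n : nat} (n0 : (0 < n)%N).
Context (eta : 'rV[R]_n -> R) (eta_LP : LP_eta eta).
Context (s : R) (s0 : 0 < s).
Implicit Types (K f g : 'rV[R]_n -> R) (x h : 'rV[R]_n) (A D e : R).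

Local Notation ka := (ka s).
Local Notation LPR := (LPR eta).
Local Notation LPT := (LPT eta).
Local Notation CL := (CL n0 eta_LP s0).
Local Notation CT := (CT n0 eta_LP).

(** Truncation to [[-L, L]], in a form whose continuity is immediate. *)
Definition clip (L u : R) : R := 2^-1 * (`|u + L| - `|u - L|).

Lemma clip_le (L u : R) : 0 <= L -> `|clip L u| <= L.
Proof.
move=> L0; rewrite normrM ger0_norm ?invr_ge0 // mulrC ler_pdivrMr //.
have := ler_dist_dist (u + L) (u - L).
have -> : u + L - (u - L) = L * 2 by ring.
by rewrite (ger0_norm (mulr_ge0 L0 _)).
Qed.

Lemma clip_id (L u : R) : `|u| <= L -> clip L u = u.
Proof.
rewrite ler_norml => /andP[h1 h2]; rewrite /clip ger0_norm; last by lra.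
by rewrite ler0_norm; last (by lra); field.
Qed.

Lemma clip_sub_le (L u : R) : 0 <= L -> `|u - clip L u| <= `|u|.
Proof.
move=> L0; case: (leP `|u| L) => uL; first by rewrite clip_id // subrr normr0.
case: (leP 0 u) => u0.
  rewrite ger0_norm // in uL; have -> : clip L u = L.
    by rewrite /clip !ger0_norm; [field|lra|lra].
  by rewrite !ger0_norm; lra.
rewrite ltr0_norm // in uL; have -> : clip L u = - L.
  by rewrite /clip !ler0_norm; [field|lra|lra].
by rewrite !ler0_norm; lra.
Qed.

Lemma continuous_clip (T : topologicalType) (u : T -> R) (L : R) :
  continuous u -> continuous (fun x : T => clip L (u x)).
Proof.
move=> cu; apply: continuous_mulf; first exact: continuous_cstf.
apply: continuous_addf; last apply: continuous_oppf.
  by apply: continuous_normf; apply: continuous_addf => //; exact: continuous_cstf.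
by apply: continuous_normf; apply: continuous_addf => //; exact: continuous_cstf.
Qed.

Definition exc (L : nat -> R) f (j : nat) : 'rV[R]_n -> R :=
  fun x => LPR j f x - clip (L j) (LPR j f x).

Lemma conv_sum C K t x (u : nat -> 'rV[R]_n -> R) (B : nat -> R) N : good C K ->
  (forall j, continuous (u j)) -> (forall j y, `|u j y| <= B j) ->
  conv K t (fun y => \sum_(j < N) u j y) x = \sum_(j < N) conv K t (u j) x.
Proof.
move=> gK cu uB; elim: N => [|N IH].
  rewrite big_ord0 -[RHS](@RI0 R n); apply: eq_RI => z; by rewrite big_ord0 mulr0.
rewrite big_ord_recr /= -IH -(convD (G := \sum_(j < N) B j) (G' := B N) t x gK) //.
- by apply: eq_conv => // y; rewrite big_ord_recr.
- by apply: continuous_sumf => j _; exact: cu.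
- by move=> y; rewrite (le_trans (ler_norm_sum _ _ _)) //; apply: ler_sum => j _.
Qed.

(** [G] is synthesized from the clipped pieces, hence [f - G] from the excesses. The l-th piece of
    [f - G] sees only the levels within 2 of [l], by disjointness of the symbols. *)
Lemma approximant : exists2 CS : R, 0 < CS & forall A f D (L : nat -> R), LamB s A f ->
  (forall j, 0 <= L j <= D * ka ^+ j) -> exists2 G : 'rV[R]_n -> R, LamB s (CS * D) G & forall a l x,
  conv (FT a (lpb eta l)) (2 ^- l) (fun y => f y - G y) x =
  \sum_(l - 2 <= j < l + 3) conv (mixk eta a l j) (2 ^- j) (exc L f j) x.
Proof.
have [CS CS0 syn] := synthesis n0 eta_LP s0; exists CS => // A f D L lf LD.
have [cf fA _] := lf; have A0 := LamB_ge0 lf; have CL0 := CL_gt0 n0 eta_LP s0.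
have CT0 := CT_gt0 n0 eta_LP.
have k1 : 0 < 1 - ka by rewrite subr_gt0 ka_lt1.
have L0 j : 0 <= L j by case/andP: (LD j).
have cR j : continuous (LPR j f) by case: (LamB_blim n0 eta_LP s0 j lf).
have RB j y : `|LPR j f y| <= CL * A * ka ^+ j := LPR_le n0 eta_LP s0 lf j y.
pose Q j x := clip (L j) (LPR j f x).
have cQ j : continuous (Q j) by exact: continuous_clip.
have QD j y : `|Q j y| <= D * ka ^+ j.
  by apply: (le_trans (clip_le _ (L0 j))); case/andP: (LD j).
have [G lG cG] := syn D Q cQ QD; exists G => // a l x.
have ce j : continuous (exc L f j).
  by apply: continuous_addf => //; apply: continuous_oppf; exact: cQ.
have eB j y : `|exc L f j y| <= CL * A * ka ^+ j.
  by apply: le_trans (RB j y); exact: clip_sub_le.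
have [cGc GB _] := lG.
pose S N y := \sum_(j < N) LPT j (exc L f j) y.
have SE j y : LPT j (exc L f j) y = LPR j f y - LPT j (Q j) y.
  rewrite /exc (LPTB n0 eta_LP j y (cR j) (RB j) (cQ j) (QD j)).
  by rewrite (LPT_LPR n0 eta_LP j y cf fA).
have Sc y : S N y @[N --> \oo] --> f y - G y.
  have h : \sum_(j < N) LPR j f y - \sum_(j < N) LPT j (Q j) y @[N --> \oo] --> f y - G y.
    by apply: cvgB; [exact: (@LPR_cvg R n n0 eta eta_LP A f y cf fA)|exact: cG].
  apply: cvg_trans h; apply: near_eq_cvg; near=> N.
  by rewrite /S -sumrB; apply: eq_bigr => j _; rewrite SE.
have TB j y : `|LPT j (exc L f j) y| <= CT * (CL * A) * ka ^+ j.
  by rewrite -mulrA; exact: LPT_le (ce j) (eB j).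
have SB N y : `|S N y| <= CT * (CL * A) / (1 - ka).
  rewrite (le_trans (ler_norm_sum _ _ _)) //.
  apply: (@le_trans _ _ (\sum_(j < N) CT * (CL * A) * ka ^+ j)); first by apply: ler_sum => j _.
  rewrite -mulr_sumr ler_wpM2l ?mulr_ge0 ?(ltW CT0) ?(ltW CL0) //.
  rewrite -[leRHS]mul1r ler_pdivlMr // mulrC -opprB mulNr -subrX1 opprB.
  by rewrite lerBlDr lerDl exprn_ge0 // ka_ge0.
have cSN N : continuous (S N).
  by apply: continuous_sumf => j _; exact: continuous_LPT (ce j) (eB j).
have [C C0 gK] := FT_multiplier_good n0 (lpb_multiplier eta_LP l).
have cfG : continuous (fun y => f y - G y).
  by apply: continuous_addf => //; exact: continuous_oppf.
pose B := CT * (CL * A) / (1 - ka) + (A + CS * D).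
have CSD0 : 0 <= CS * D := LamB_ge0 lG.
have B1 : 0 <= CT * (CL * A) / (1 - ka).
  by rewrite !mulr_ge0 ?invr_ge0 ?(ltW CT0) ?(ltW CL0) ?(ltW k1).
have dct : conv (FT a (lpb eta l)) (2 ^- l) (S N) x @[N --> \oo] -->
    conv (FT a (lpb eta l)) (2 ^- l) (fun y => f y - G y) x.
  apply: (@conv_dct R n C B) => //.
  - by move=> N y; apply: (le_trans (SB N y)); rewrite lerDl addr_ge0.
  - move=> y; rewrite (le_trans (ler_normB _ _)) // (le_trans (lerD (fA y) (GB y))) //.
    by rewrite lerDr.
have TE j : conv (FT a (lpb eta l)) (2 ^- l) (LPT j (exc L f j)) x =
    conv (mixk eta a l j) (2 ^- j) (exc L f j) x by exact: lpb_LPT (ce j) (eB j).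
have far j : (l + 3 <= j)%N || (j + 3 <= l)%N -> conv (mixk eta a l j) (2 ^- j) (exc L f j) x = 0.
  move=> lj; rewrite -[RHS](@RI0 R n); apply: eq_RI => z.
  by rewrite (mixk_far eta_LP) // mul0r.
have ev N : (l + 3 <= N)%N -> conv (FT a (lpb eta l)) (2 ^- l) (S N) x =
    \sum_(l - 2 <= j < l + 3) conv (mixk eta a l j) (2 ^- j) (exc L f j) x.
  move=> lN.
  rewrite (@conv_sum C _ _ _ (fun j => LPT j (exc L f j)) (fun j => CT * (CL * A) * ka ^+ j)) //; last first.
    by move=> j; exact: continuous_LPT (ce j) (eB j).
  under eq_bigr do rewrite TE.
  rewrite -(big_mkord xpredT (fun j => conv (mixk eta a l j) (2 ^- j) (exc L f j) x)).
  rewrite (@big_cat_nat _ _ _ (l - 2)) //=; last by move: lN; clear; lia.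
  rewrite big_nat big1 ?add0r; last by move=> j hj; apply: far; move: hj; clear; lia.
  rewrite (@big_cat_nat _ _ _ (l + 3)) //=; last by clear; lia.
  by rewrite [X in _ + X]big_nat [X in _ + X]big1 ?addr0 // => j hj; apply: far; move: hj; clear; lia.
have [V EV] : exists V : R, V = \sum_(l - 2 <= j < l + 3) conv (mixk eta a l j) (2 ^- j) (exc L f j) x.
  by eexists.
have H2 : conv (FT a (lpb eta l)) (2 ^- l) (S N) x @[N --> \oo] --> V.
  have h : (fun _ : nat => V) N @[N --> \oo] --> V by exact: cvg_cst.
  apply: cvg_trans h; apply: near_eq_cvg; near=> N.
  by rewrite EV ev //; near: N; exact: nbhs_infty_ge.
by rewrite -EV; exact: (norm_cvg_unique dct H2).
Unshelve. all: by end_near. Qed.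

Lemma sqrt_sum_le (u v : R) : Num.sqrt (u ^+ 2 + v ^+ 2) <= `|u| + `|v|.
Proof.
have h : 0 <= `|u| + `|v| by rewrite addr_ge0.
rewrite -[leRHS]ger0_norm // -sqrtr_sqr ler_wsqrtr // sqrrD !real_normK ?num_real //.
have : 0 <= `|u| * `|v| by rewrite mulr_ge0.
by rewrite -mulr_natl; lra.
Qed.

(** The excess vanishes where a piece stays below its threshold, so away from large values only the
    tail of the kernel contributes. *)
Lemma approximant_decay (P : nat) : exists2 C : R, 0 < C & forall A f (L : nat -> R)
  (G : 'rV[R]_n -> R), LamB s A f ->
  (forall j, 0 <= L j) -> continuous G -> (exists B : R, forall y, `|G y| <= B) ->
  (forall a l x, conv (FT a (lpb eta l)) (2 ^- l) (fun y => f y - G y) x =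
    \sum_(l - 2 <= j < l + 3) conv (mixk eta a l j) (2 ^- j) (exc L f j) x) ->
  forall l x, LPconv_abs eta l (fun y => f y - G y) x <= C * A * ka ^+ l /\
  forall Z : R, 0 <= Z -> (forall j z, (l <= j + 2)%N -> (j <= l + 2)%N -> inbox Z z ->
     `|LPR j f (x - 2 ^- j *: z)| <= L j) ->
   LPconv_abs eta l (fun y => f y - G y) x <= C * A * ka ^+ l * (1 + Z ^+ 2) ^- P.
Proof.
have [Cm Cm0 dec] := mixk_decay n0 eta_LP s0 P.+1.
have CL0 := CL_gt0 n0 eta_LP s0; have k0 := @ka_gt0 R s.
have pin : 0 < pi ^+ n :> R by rewrite exprn_gt0 // pi_gt0.
have [C1 EC1] : exists C1 : R, C1 = Cm * pi ^+ n * (CL / ka ^+ 2) by eexists.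
have C10 : 0 < C1 by rewrite EC1 !mulr_gt0 // invr_gt0 exprn_gt0.
(* Five levels and two components give 10; the case [a0 = 1], [Z = 0] doubles it. *)
exists (20 * C1); first by rewrite mulr_gt0.
move=> A f L G lf L0 cG [BG GB] HG l x.
have [cf fA _] := lf; have A0 := LamB_ge0 lf.
have cR j : continuous (LPR j f) by case: (LamB_blim n0 eta_LP s0 j lf).
have RB j y : `|LPR j f y| <= CL * A * ka ^+ j := LPR_le n0 eta_LP s0 lf j y.
have ce j : continuous (exc L f j).
  by apply: continuous_addf => //; apply: continuous_oppf; exact: continuous_clip.
have eB j y : `|exc L f j y| <= CL * A * ka ^+ j.
  by apply: le_trans (RB j y); exact: clip_sub_le.
have cfG : continuous (fun y => f y - G y).
  by apply: continuous_addf => //; exact: continuous_oppf.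
have fGB y : `|f y - G y| <= A + BG by rewrite (le_trans (ler_normB _ _)) // lerD.
have kl j : (l <= j + 2)%N -> CL * A * ka ^+ j <= CL / ka ^+ 2 * A * ka ^+ l.
  move=> lj; have : ka ^+ j * ka ^+ 2 <= ka ^+ l.
    by rewrite -exprD ler_wiXn2l ?(ltW k0) // ltW // ka_lt1.
  rewrite -ler_pdivlMr ?exprn_gt0 // => h.
  have p0 : 0 <= CL * A by rewrite mulr_ge0 // ltW.
  by apply: (le_trans (ler_wpM2l p0 h)); apply: le_of_eq; ring.
have mcont a j : continuous (mixk eta a l j).
  have [D D0 gD] := FT_multiplier_good n0 (mix_multiplier eta_LP l j).
  by case: (gD a).
have main (a0 : R) (Z : R) : 0 <= Z -> 0 <= a0 ->
    (forall j z, (l <= j + 2)%N -> (j <= l + 2)%N -> inbox Z z -> `|exc L f j (x - 2 ^- j *: z)| <= a0 * (CL / ka ^+ 2 * A * ka ^+ l)) ->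
    LPconv_abs eta l (fun y => f y - G y) x <= 10 * C1 * A * ka ^+ l * (a0 + (1 + Z ^+ 2) ^- P).
  move=> Z0 a00 Hz.
  have key a : `|conv (FT a (lpb eta l)) (2 ^- l) (fun y => f y - G y) x| <=
      5 * (C1 * A * ka ^+ l * (a0 + (1 + Z ^+ 2) ^- P)).
    rewrite HG (le_trans (ler_norm_sum _ _ _)) //.
    have p0 : 0 <= C1 * A * ka ^+ l * (a0 + (1 + Z ^+ 2) ^- P).
      rewrite !mulr_ge0 ?addr_ge0 ?invr_ge0 ?exprn_ge0 ?(ltW C10) ?(ltW k0) //.
      by rewrite addr_ge0 // sqr_ge0.
    apply: (@le_trans _ _ (\sum_(l - 2 <= j < l + 3) C1 * A * ka ^+ l * (a0 + (1 + Z ^+ 2) ^- P))).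
      rewrite big_nat [leRHS]big_nat; apply: ler_sum => j hj.
      have lj : (l <= j + 2)%N by move: hj; clear; lia.
      have jl : (j <= l + 2)%N by move: hj; clear; lia.
      have aa : 0 <= a0 * (CL / ka ^+ 2 * A * ka ^+ l).
        by rewrite !mulr_ge0 ?invr_ge0 ?exprn_ge0 ?(ltW CL0) ?(ltW k0).
      have eB' y : `|exc L f j y| <= CL / ka ^+ 2 * A * ka ^+ l by apply: le_trans (eB j y) (kl j lj).
      have := @conv_tail R n Cm _ _ Z (mixk eta a l j) P (2 ^- j) (exc L f j) x (mcont a j)
        (fun z => dec a l j z lj jl) (ce j) eB' aa Z0 (fun z => Hz j z lj jl).
      by move/le_trans; apply; apply: le_of_eq; rewrite EC1; ring.
    rewrite sumr_const_nat -[leLHS]mulr_natl ler_wpM2r // ler_nat; clear; lia.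
  rewrite (LPconv_absE n0 eta_LP l x cfG fGB) (le_trans (sqrt_sum_le _ _)) //.
  apply: (le_trans (lerD (key 0) (key (pi / 2)))); apply: le_of_eq; ring.
split.
  have := main 1 0 (lexx _) ler01; rewrite expr0n addr0 expr1n invr1 => m1.
  apply: (le_trans (m1 _)); last by apply: le_of_eq; ring.
  move=> j z lj jl _; rewrite mul1r; apply: le_trans (eB _ _) (kl j lj).
move=> Z Z0 Hz; have := main 0 Z Z0 (lexx _); rewrite add0r => m1.
apply: (le_trans (m1 _)).
  by move=> j z lj jl iz; rewrite mul0r /exc clip_id ?subrr ?normr0 // Hz.
have ZP : 0 <= (1 + Z ^+ 2) ^- P by rewrite invr_ge0 exprn_ge0 // addr_ge0 // sqr_ge0.
rewrite ler_wpM2r // ler_wpM2r ?exprn_ge0 ?(ltW k0) // ler_wpM2r // ler_wpM2r ?(ltW C10) //.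
by rewrite ler_nat.
Qed.

End Approximant.

(** * Summing the tails around the marks *)

Section TailSeries.
Context {R : realType} {n : nat}.
Implicit Types (E : nat -> pred 'rV[int]_n) (x : 'rV[R]_n) (k : 'rV[int]_n).

Lemma latZR (M : nat) (c : R) (w : 'rV[int]_n -> R) : 0 <= c -> (forall k, 0 <= w k) ->
  lat M (fun k => (c * w k)%:E) = (c%:E * lat M (fun k => (w k)%:E))%E.
Proof. by move=> c0 w0; rewrite -latZ // => k; rewrite lee_fin. Qed.

Lemma geo_sum_le1 (z : R) (N : nat) : 0 <= z < 1 -> \sum_(i < N) z ^+ i <= (1 - z)^-1.
Proof.
move=> /andP[z0 z1]; rewrite -[leRHS]mul1r ler_pdivlMr ?subr_gt0 //.
by rewrite mulrC -opprB mulNr -subrX1 opprB lerBlDr lerDl exprn_ge0.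
Qed.

(** Counts of marks enlarged by [2 ^ (i + i0)], weighted by [om ^ i]: the discrete form of fast
    decaying tails around the marks. *)
Definition tsum E (om : R) (i0 l M : nat) k : R :=
  \sum_(i < M) om ^+ i * (cntl (nb (2 ^ (i + i0)) E) l M k)%:R.

Lemma tsum_ge0 E om i0 l M k : 0 <= om -> 0 <= tsum E om i0 l M k.
Proof. by move=> om0; apply: sumr_ge0 => i _; rewrite mulr_ge0 // exprn_ge0. Qed.

Lemma tsum_mono E om i0 l M x : 0 <= om ->
  tsum E om i0 l M (flr M x) <= tsum E om i0 l M.+1 (flr M.+1 x).
Proof.
move=> om0; rewrite /tsum big_ord_recr /= -[leLHS]addr0 lerD //; last by rewrite mulr_ge0 // exprn_ge0.
by apply: ler_sum => i _; rewrite ler_wpM2l ?exprn_ge0 // ler_nat cntl_mono.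
Qed.

(** An enlarged mark is met at one of the five levels that interact with the l-th piece; [e] shifts
    from frequency level to cube level. *)
Definition tbad E (i0 e i l : nat) x : bool :=
  `[< exists2 t, (t < 5)%N & nb (2 ^ (i + i0)) E (l + t + e)%N (flr (l + t + e) x) >].

(** Each enlarged mark is counted for at most five values of the level. The leftover [om ^ N],
    summed over [K] levels, is made smaller than any [d]. *)
Lemma tail_series E (u : nat -> 'rV[R]_n -> R) (C1 om : R) (i0 e : nat) : 0 <= C1 -> 0 <= om < 1 ->
  (forall l x, 0 <= u l x) ->
  (forall l x I, u l x <= C1 * (om ^+ I + \sum_(i < I) om ^+ i * (tbad E i0 e i l x)%:R)) ->
  forall l x, (\sum_(j <oo) (u (j + l)%N x)%:E <=
    ereal_sup (range (fun M => (5 * C1 * tsum E om i0 l M (flr M x))%:E)))%E.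
Proof.
move=> C10 om01 u0 H l x; have [om0 om1] := andP om01.
apply: nneseries_le => [j|K]; first by rewrite lee_fin.
apply/lee_addgt0Pr => d d0.
have KC0 : 0 <= C1 * K%:R by rewrite mulr_ge0.
have [N hN] := geo_choose om01 KC0 d0.
pose M := (N + K + l + 5 + e)%N.
apply: (@le_trans _ _ ((5 * C1 * tsum E om i0 l M (flr M x))%:E + d%:E)%E); last first.
  by rewrite leeD2r //; apply: ereal_sup_ubound; exists M.
rewrite sumEFin -EFinD lee_fin.
apply: (@le_trans _ _ (\sum_(0 <= j < K) C1 * (om ^+ N + \sum_(i < N) om ^+ i * (tbad E i0 e i (j + l) x)%:R))).
  by apply: ler_sum => j _; exact: H.
rewrite -mulr_sumr big_split /= sumr_const_nat subn0 mulrDr addrC lerD //; last first.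
  by apply: le_trans (hN N (leqnn _)); rewrite -mulr_natr; apply: le_of_eq; ring.
rewrite [5 * C1]mulrC -mulrA ler_wpM2l // exchange_big /= /tsum mulr_sumr.
have [T ET] : exists T, M = (N + T)%N by exists (K + l + 5 + e)%N; rewrite /M; clear; lia.
have TK : (K + l + 5 + e <= N + T)%N by rewrite -ET /M; clear; lia.
rewrite ET big_split_ord /=.
rewrite -[leLHS]addr0 lerD //; last first.
  by apply: sumr_ge0 => i _; rewrite !mulr_ge0 // exprn_ge0.
apply: ler_sum => i _; rewrite -mulr_sumr [leRHS]mulrCA ler_wpM2l ?exprn_ge0 //.
rewrite -natr_sum -natrM ler_nat cntl_flr.
pose B m := nb (2 ^ (i + i0)) E m (flr m x).
apply: (@leq_trans (\sum_(0 <= j < K + l) \sum_(t < 5) ((l <= j)%N && B (j + (t + e))%N))%N); last first.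
  rewrite exchange_big /= -[X in (_ <= X * _)%N]card_ord -sum_nat_const; apply: leq_sum => t _.
  have h : (K + l + (t + e) <= (N + T).+1)%N by move: (ltn_ord t); move: TK; clear; lia.
  exact: (sum_shift_le B l h).
rewrite (@big_cat_nat _ _ _ l 0 (K + l)) ?leq_addl //= -[leqLHS]add0n leq_add //.
rewrite -[X in (_ <= \sum_(X <= _ < _) _)%N]add0n [leqRHS]big_addn addnK; apply: leq_sum => j _.
case Fm: (tbad _ _ _ _ _ _) => //; move/asboolP: Fm => [t tJ Bt].
by rewrite leq_addl (bigD1 (Ordinal tJ)) //= /B addnA Bt.
Qed.

Lemma powR_expn (z a : R) (k : nat) : 0 <= z -> powR (z ^+ k) a = powR z a ^+ k.
Proof. by move=> z0; rewrite -(powR_mulrn k z0) -(powR_mulrn k (powR_ge0 z a)) -!powRrM [_%:R * _]mulrC. Qed.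

(** The weight is split as [sg ^ i * sg ^ i]: one factor is summed geometrically, the other stays
    with the largest term. This treats [a < 1] and [a >= 1] alike. *)
Lemma powR_sum_le (a sg : R) (c : nat -> R) N : 0 < a -> 0 <= sg < 1 -> (forall i, 0 <= c i) ->
  powR (\sum_(i < N) (sg ^+ 2) ^+ i * c i) a <=
  powR (1 - sg)^-1 a * \sum_(i < N) powR sg a ^+ i * powR (c i) a.
Proof.
move=> a0 sg01 c0; have [sg0 sg1] := andP sg01.
have s1 : 0 < 1 - sg by rewrite subr_gt0.
case: N => [|N]; first by rewrite !big_ord0 powR0 ?gt_eqF // mulr0.
have [i0 _ hm] := @arg_maxP _ _ _ ord0 xpredT (fun i : 'I_N.+1 => sg ^+ i * c i) isT.
pose m := sg ^+ i0 * c i0; have m0 : 0 <= m by rewrite mulr_ge0 // exprn_ge0.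
apply: (@le_trans _ _ (powR ((1 - sg)^-1 * m) a)).
  apply: ge0_ler_powR; rewrite ?nnegrE ?(ltW a0) //.
  - by apply: sumr_ge0 => i _; rewrite mulr_ge0 // exprn_ge0 // exprn_ge0.
  - by rewrite mulr_ge0 // invr_ge0 ltW.
  apply: (@le_trans _ _ (\sum_(i < N.+1) sg ^+ i * m)).
    apply: ler_sum => i _; rewrite -exprM mulnC exprM expr2 -mulrA ler_wpM2l ?exprn_ge0 //.
    by have := hm i isT.
  by rewrite -mulr_suml ler_wpM2r // geo_sum_le1.
rewrite powRM ?invr_ge0 ?(ltW s1) // ler_wpM2l ?powR_ge0 //.
rewrite (bigD1 i0) //= /m powRM ?exprn_ge0 // powR_expn // lerDl.
by apply: sumr_ge0 => i _; rewrite mulr_ge0 ?exprn_ge0 ?powR_ge0.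
Qed.

(** The weights must beat the geometric cost [be ^ i] of the enlargement, which is the condition
    [sg ^ a * be <= 1 / 2]. *)
Lemma tail_intn (a : R) : 0 < a -> exists2 be : R, 1 <= be & forall E (La sg C1 : R) (i0 : nat),
  0 <= La -> (forall M, latcnt a E M <= La%:E)%E -> 0 <= sg < 1 -> powR sg a * be <= 1 / 2 -> 0 <= C1 ->
  exists B : R, forall F : 'rV[R]_n -> \bar R, (forall x, 0 <= F x)%E ->
  (forall x, F x <= ereal_sup (range (fun M => (C1 * tsum E (sg ^+ 2) i0 0 M (flr M x))%:E)))%E ->
  (intn (fun x => poweR (F x) a) <= B%:E)%E.
Proof.
move=> a0; have [C C0 [be be1 Hnb]] := @latcnt_nb R n _ a0; exists be => //.
move=> E La sg C1 i0 La0 HLa sg01 sgbe C10; have [sg0 sg1] := andP sg01.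
have be0 : 0 <= be by apply: le_trans be1.
have om0 : 0 <= sg ^+ 2 by exact: sqr_ge0.
pose D := powR C1 a * powR (1 - sg)^-1 a.
have D0 : 0 <= D by rewrite mulr_ge0 ?powR_ge0.
have CL0 : 0 <= C * be ^+ i0 * La by rewrite !mulr_ge0 ?exprn_ge0 ?(ltW C0).
exists (D * (C * be ^+ i0 * La * 2)) => F F0 HF.
pose W M k : \bar R := (powR (C1 * tsum E (sg ^+ 2) i0 0 M k) a)%:E.
have W0 M k : (0 <= W M k)%E by rewrite lee_fin powR_ge0.
apply: (@le_trans _ _ (ereal_sup (range (fun M => lat M (W M))))).
  apply: intn_le_sup => //.
  - move=> M x; rewrite lee_fin ge0_ler_powR ?nnegrE ?(ltW a0) ?mulr_ge0 ?tsum_ge0 //.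
    by rewrite ler_wpM2l // tsum_mono.
  - by move=> x; exact: poweR_ge0.
  - by move=> x; apply: poweR_le_sup => // M; rewrite mulr_ge0 // tsum_ge0.
apply: ge_ereal_sup => _ [M _ <-].
pose v (i : 'I_M) k : R := powR sg a ^+ i * powR (cnt (nb (2 ^ (i + i0)) E) M k)%:R a.
have v0 i k : 0 <= v i k by rewrite mulr_ge0 ?exprn_ge0 ?powR_ge0.
apply: (@le_trans _ _ (lat M (fun k => (D%:E * (\sum_(i < M) v i k)%:E)%E))).
  apply: lat_le => k; rewrite lee_fin powRM ?tsum_ge0 // /D -mulrA ler_wpM2l ?powR_ge0 //.
  have := @powR_sum_le a sg (fun i => (cnt (nb (2 ^ (i + i0)) E) M k)%:R) M a0 sg01 (fun _ => ler0n _ _).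
  by apply: le_trans; rewrite /tsum; under eq_bigr do rewrite cntl0.
rewrite latZ //; last by move=> k; rewrite lee_fin sumr_ge0.
rewrite [leRHS]EFinM lee_wpmul2l ?lee_fin // lat_sum //.
apply: (@le_trans _ _ (\sum_(i < M) (C * be ^+ i0 * La * (1 / 2) ^+ i)%:E)%E).
  apply: lee_sum => i _; rewrite latZR ?exprn_ge0 ?powR_ge0 //.
  have h : (latcnt a (nb (2 ^ (i + i0)) E) M <= (C * be ^+ (i + i0) * La)%:E)%E.
    apply: (le_trans (Hnb _ _ _)); rewrite (EFinM (C * be ^+ (i + i0))) lee_wpmul2l // lee_fin.
    by rewrite mulr_ge0 ?exprn_ge0 ?(ltW C0).
  apply: (@le_trans _ _ ((powR sg a ^+ i)%:E * (C * be ^+ (i + i0) * La)%:E)%E).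
    by rewrite lee_wpmul2l // lee_fin exprn_ge0 ?powR_ge0.
  rewrite -EFinM lee_fin exprD.
  rewrite [leLHS](_ : _ = C * be ^+ i0 * La * (powR sg a * be) ^+ i); last by rewrite exprMn; ring.
  by rewrite ler_wpM2l // lerXn2r ?nnegrE ?mulr_ge0 ?powR_ge0.
rewrite sumEFin lee_fin -mulr_sumr ler_wpM2l //.
have h2 : 0 <= (1 / 2 : R) < 1 by rewrite divr_ge0 //= ltr_pdivrMr // mul1r ltr1n.
by apply: (le_trans (geo_sum_le1 M h2)); apply: le_of_eq; field.
Qed.

(** In [latcar_nb] the enlargement by [2 ^ i] costs the bound of [box_le] twice, whence the [4 ^ n]
    to be beaten by [om] and the [9 ^ n] in [D]. *)
Lemma tail_car E (La om C1 : R) (i0 : nat) : 0 <= La ->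
  (forall l M k0, (l <= M)%N -> latcar E l M k0 <= (La * (2 ^- l) ^+ n)%:E)%E ->
  0 <= om -> om * 4 ^+ n <= 1 / 2 -> 0 <= C1 ->
  exists B : R, forall l k0 (F : 'rV[R]_n -> \bar R), (forall x, 0 <= F x)%E ->
  (forall x, F x <= ereal_sup (range (fun M => (C1 * tsum E om i0 l M (flr M x))%:E)))%E ->
  ((2 ^+ (l * n) : R)%:E * intn (fun x => (\1_(dcube R l k0) x : R)%:E * F x) <= B%:E)%E.
Proof.
move=> La0 HLa om0 om4 C10.
pose D := (9 ^+ n * (4 ^+ n) ^+ i0 : R); have D0 : 0 <= D by rewrite mulr_ge0 ?exprn_ge0.
exists (C1 * (D * La * 2)) => l k0 F F0 HF.
pose w M k : R := ((l <= M)%N && (anc (M - l) k == k0))%:R * tsum E om i0 l M k.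
pose W M k : \bar R := (C1%:E * (w M k)%:E)%E.
have w0 M k : 0 <= w M k by rewrite mulr_ge0 ?tsum_ge0.
have W0 M k : (0 <= W M k)%E by rewrite mule_ge0 // lee_fin.
rewrite muleC -lee_pdivlMr ?exprn_gt0 //.
apply: (@le_trans _ _ (ereal_sup (range (fun M => lat M (W M))))).
  apply: intn_le_sup => //.
  - move=> M x; case: (leqP l M) => lM; last by rewrite {1}/W /w leqNgt lM /= mul0r mule0.
    rewrite /W /w lM (leq_trans lM (leqnSn _)) !flr_anc // ?(leq_trans lM (leqnSn _)) //=.
    by rewrite lee_wpmul2l ?lee_fin // ler_wpM2l // tsum_mono.
  - by move=> x; rewrite mule_ge0 // lee_fin.
  - move=> x; rewrite indicE; case: (boolP (x \in _)) => xk; last first.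
      rewrite mul0e; apply: (@le_trans _ _ (W 0%N (flr 0 x))) => //.
      by apply: ereal_sup_ubound; exists 0%N.
    rewrite inE in xk; move/dcubeP: xk => xk; rewrite mul1e (le_trans (HF x)) //.
    apply: ge_ereal_sup => _ [M _ <-].
    apply: (@le_trans _ _ (W M (flr M x))); last by apply: ereal_sup_ubound; exists M.
    rewrite /W /w -EFinM lee_fin; case: (leqP l M) => lM.
      by rewrite flr_anc // xk eqxx mul1r.
    rewrite /tsum big1 ?mulr0 ?mul0r ?mulr0 // => i _.
    by rewrite cntl_nat big_geq // mulr0.
apply: ge_ereal_sup => _ [M _ <-].
have w0' k : (0 <= (w M k)%:E)%E by rewrite lee_fin.
rewrite (latZ M C10 w0') EFinM -muleA lee_wpmul2l ?lee_fin // -EFinM.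
case: (leqP l M) => lM; last first.
  rewrite /lat esum1 ?mule0 //; first by rewrite lee_fin !mulr_ge0 // invr_ge0 exprn_ge0.
  by move=> k _; rewrite /w leqNgt lM mul0r.
pose v (i : 'I_M) k : R := om ^+ i * ((anc (M - l) k == k0)%:R * (cntl (nb (2 ^ (i + i0)) E) l M k)%:R).
have v0 i k : 0 <= v i k by rewrite !mulr_ge0 ?exprn_ge0.
have -> : lat M (fun k => (w M k)%:E) = lat M (fun k => (\sum_(i < M) v i k)%:E).
  congr lat; apply/funext => k; congr EFin; rewrite /w lM /tsum mulr_sumr.
  by apply: eq_bigr => i _; rewrite /v mulrCA.
rewrite lat_sum //.
apply: (@le_trans _ _ (\sum_(i < M) (D * La * (2 ^- l) ^+ n * (1 / 2) ^+ i)%:E)%E).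
  apply: lee_sum => i _; rewrite latZR ?exprn_ge0 //.
  apply: (@le_trans _ _ ((om ^+ i)%:E * (((2 * 2 ^ (i + i0)).+1 ^ n)%N%:R * ((2 * 2 ^ (i + i0)).+1 ^ n)%N%:R * La * (2 ^- l) ^+ n)%:E)%E).
    by rewrite lee_wpmul2l ?lee_fin ?exprn_ge0 //; exact: latcar_nb.
  rewrite -EFinM lee_fin.
  apply: (@le_trans _ _ (om ^+ i * ((3 ^+ n * (2 ^+ n) ^+ (i + i0)) * (3 ^+ n * (2 ^+ n) ^+ (i + i0)) * La * (2 ^- l) ^+ n))).
    rewrite ler_wpM2l ?exprn_ge0 // ler_wpM2r ?pow2Vn_ge0 // ler_wpM2r // ler_pM ?box_le //.
  rewrite (_ : _ * _ = D * La * (2 ^- l) ^+ n * (om * 4 ^+ n) ^+ i).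
    by rewrite ler_wpM2l ?lerXn2r ?nnegrE ?mulr_ge0 ?exprn_ge0 ?invr_ge0.
  have e9 : 9 ^+ n = 3 ^+ n * 3 ^+ n :> R by rewrite -exprMn; congr (_ ^+ _); ring.
  have e4 : 4 ^+ n = 2 ^+ n * 2 ^+ n :> R by rewrite -exprMn; congr (_ ^+ _); ring.
  by rewrite /D e9 e4 !exprMn exprD; ring.
rewrite sumEFin lee_fin -mulr_sumr.
have h2 : 0 <= (1 / 2 : R) < 1 by rewrite divr_ge0 //= ltr_pdivrMr // mul1r ltr1n.
have -> : D * La * 2 / 2 ^+ (l * n) = D * La * (2 ^- l) ^+ n * 2.
  by rewrite exprM exprVn; ring.
rewrite ler_wpM2l ?mulr_ge0 ?pow2Vn_ge0 //.
by apply: (le_trans (geo_sum_le1 M h2)); apply: le_of_eq; field.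
Qed.

End TailSeries.

(** * Marks from large differences and the clipping estimates *)

Section Clipping.
Context {R : realType} {n : nat} (n0 : (0 < n)%N).
Context (eta : 'rV[R]_n -> R) (eta_LP : LP_eta eta).
Context (s : R) (s0 : 0 < s) (r : nat) (sr : s < r%:R) (q : R) (q0 : 0 < q).
Implicit Types (f g : 'rV[R]_n -> R) (x : 'rV[R]_n) (A d tau e : R) (k : 'rV[int]_n).

Local Notation mu := (@lebesgue_measure R).
Local Notation ka := (ka s).
Local Notation LPR := (LPR eta).

(* The intervals ](1 - d) tau 2^-j, tau 2^-j] are disjoint because d <= 1/2, and each has dy/y-mass at least d. *)
Lemma yint_ge (S : set ('rV[R]_n * R)) x d tau (b : nat -> bool) (l l' N : nat) :
  0 < d <= 1 / 2 -> 0 < tau <= 1 -> (l <= l')%N ->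
  (forall j y, b j -> (1 - d) * (tau * 2 ^- j) <= y <= tau * 2 ^- j -> S (x, y)) ->
  ((d * (\sum_(l' <= j < N) b j)%N%:R)%:E <= yint S x (2 ^- l))%E.
Proof.
move=> /andP[d0 d1] /andP[t0 t1] ll H.
have p0 j : 0 < tau * 2 ^- j by rewrite mulr_gt0 // pow2V_gt0.
have lt j : (1 - d) * (tau * 2 ^- j) < tau * 2 ^- j by rewrite gtr_pMl //; lra.
pose I j : set R := [set` `]((1 - d) * (tau * 2 ^- j) : R), (tau * 2 ^- j : R)]].
have mI j : measurable (I j) by exact: measurable_itv.
pose f j (y : R) : \bar R := (((b j)%:R / (tau * 2 ^- j))%:E * (\1_(I j) y)%:E)%E.
have f0 j y : (0 <= f j y)%E by rewrite mule_ge0 // lee_fin // divr_ge0 // ltW.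
have muI j : mu (I j) = (d * (tau * 2 ^- j))%:E.
  by rewrite lebesgue_measure_itv /= lte_fin lt -EFinB; congr EFin; ring.
have mf j : measurable_fun setT (fun y : R => (\1_(I j) y : R)%:E).
  by apply/measurable_EFinP; exact: measurable_indic.
have E j : (\int[mu]_y f j y = (d * (b j)%:R)%:E)%E.
  have Ei : (\int[mu]_y (\1_(I j) y : R)%:E = (d * (tau * 2 ^- j))%:E)%E.
    transitivity (mu (I j `&` setT)); last by rewrite setIT muI.
    by apply: integral_indic; [exact: measurableT|exact: mI].
  rewrite ge0_integralZl_EFin //.
  - by rewrite Ei -EFinM mulrCA mulfVK // gt_eqF.
  - exact: mf.
  - by rewrite divr_ge0 // ltW.
have dis i j y : (i < j)%N -> I i y -> I j y -> False.
  move=> ij; rewrite /I /= !in_itv /= => /andP[a1 _] /andP[_ a2].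
  have h : 2 ^- j <= 2 ^- i / 2 :> R.
    rewrite -invfM lef_pV2 ?posrE ?mulr_gt0 ?exprn_gt0 // -exprSr.
    by rewrite ler_weXn2l ?ler1n.
  have h2 := ler_wpM2l (ltW t0) h; have h3 := lt_le_trans a1 a2.
  have p := p0 i.
  have : (1 - d) * (tau * 2 ^- i) >= 2^-1 * (tau * 2 ^- i) by rewrite ler_wpM2r ?(ltW p) //; lra.
  lra.
rewrite /yint integral_mkcond.
apply: (@le_trans _ _ (\int[mu]_y (\sum_(l' <= j < N) f j y))%E).
  rewrite ge0_integral_sum //.
    rewrite natr_sum mulr_sumr -sumEFin; apply: lee_sum => j _; by rewrite E.
  by move=> j; apply: measurable_funeM; exact: mf.
apply: ge0_le_integralT => y; first exact: sume_ge0.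
have F0 : (0 <= ((fun y0 : R => (\1_S (x, y0) / y0)%:E) \_ [set y0 : R | (0 < y0 <= 2 ^- l)%R]) y)%E.
  apply: erestrict_ge0 => z /= /andP[z0 _]; rewrite lee_fin divr_ge0 ?(ltW z0) //.
have [[j [lj [bj Ij]]]|no] := pselect (exists j, (l' <= j)%N /\ b j /\ I j y); last first.
  rewrite big_nat big1 // => j /andP[lj _]; rewrite /f indicE.
  case: (boolP (y \in I j)) => yI; last by rewrite mule0.
  case bj : (b j); last by rewrite mul0r mul0e.
  by exfalso; apply: no; exists j; rewrite inE in yI.
have yi := Ij; rewrite /I /= in_itv /= in yi; have [y1 y2] := andP yi.
have y0 : 0 < y by apply: le_lt_trans y1; rewrite mulr_ge0 ?(ltW (p0 j)) //; lra.
apply: (@le_trans _ _ (f j y)).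
  have z i : i != j -> f i y = 0%E.
    move=> ij; rewrite /f indicE; case: (boolP (y \in I i)) => yI; last by rewrite mule0.
    rewrite inE in yI; move: ij; rewrite neq_ltn => /orP[] ij.
      by case: (dis _ _ _ ij yI Ij).
    by case: (dis _ _ _ ij Ij yI).
  have [jN|Nj] := ltnP j N; last first.
    by rewrite big_nat big1 // => i /andP[_ iN]; rewrite z // neq_ltn (leq_trans iN Nj).
  rewrite (bigD1_seq j) /= ?iota_uniq ?mem_index_iota ?lj //.
  by rewrite big1 ?adde0 // => i; exact: z.
have yl : y <= 2 ^- l.
  apply: (le_trans y2); apply: (@le_trans _ _ (2 ^- j)); first by rewrite ler_piMl // ltW // pow2V_gt0.
  by rewrite lef_pV2 ?posrE ?exprn_gt0 // ler_weXn2l ?ler1n // (leq_trans ll).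
rewrite /patch mem_set /=; last by rewrite y0 yl.
rewrite /f bj mul1r indicE (mem_set Ij) mule1 indicE mem_set; last by apply: (H j) => //; rewrite (ltW y1).
by rewrite lee_fin mul1r lef_pV2 ?posrE.
Qed.

(** Level [J0] records where the low-frequency piece exceeds [b0]. A finer level [m] records cubes
    over which a whole box, of heights about [2 ^- (m - J0)], lies in the set of large
    differences. *)
Definition bigdiff f e d tau (b0 : R) (J0 m : nat) : pred 'rV[int]_n := fun k =>
  `[< (m = J0 /\ exists2 w, flr J0 w = k & b0 < `|LPR 0 f w|) \/
      ((J0 < m)%N /\ forall x y, flr m x = k ->
        (1 - d) * (tau * 2 ^- (m - J0)) <= y <= tau * 2 ^- (m - J0) -> Sset r s f e (x, y)) >].

Lemma bigdiff_yint f e d tau (b0 : R) J0 l l' M x : 0 < d <= 1 / 2 -> 0 < tau <= 1 -> (l <= l')%N -> (0 < l')%N ->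
  ((d * (\sum_(l' <= j < M.+1 - J0) bigdiff f e d tau b0 J0 (j + J0) (flr (j + J0) x))%N%:R)%:E <=
    yint (Sset r s f e) x (2 ^- l))%E.
Proof.
move=> d01 t01 ll l0.
have -> : (\sum_(l' <= j < M.+1 - J0) bigdiff f e d tau b0 J0 (j + J0) (flr (j + J0) x) =
    \sum_(l' <= j < M.+1 - J0) ((0 < j)%N && bigdiff f e d tau b0 J0 (j + J0) (flr (j + J0) x)))%N.
  by rewrite big_nat [RHS]big_nat; apply: eq_bigr => j /andP[lj _]; rewrite (leq_trans l0 lj).
apply: (@yint_ge _ x d tau (fun j => (0 < j)%N && bigdiff f e d tau b0 J0 (j + J0) (flr (j + J0) x))) => //.
move=> j y /andP[j0 /asboolP[[Ej _]|[_ H]]] yy.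
  by move: j0 Ej; clear; lia.
by apply: (H x y erefl); rewrite addnK.
Qed.

Lemma powR_add_le (a u v : R) : 0 <= a -> 0 <= u -> 0 <= v -> powR (u + v) a <= powR 2 a * (powR u a + powR v a).
Proof.
move=> a0 u0 v0; wlog uv : u v u0 v0 / u <= v.
  move=> H; case: (leP u v) => uv; first exact: H.
  by rewrite addrC [powR u a + _]addrC; apply: H => //; exact: ltW.
apply: (@le_trans _ _ (powR (2 * v) a)).
  by rewrite ge0_ler_powR ?nnegrE ?addr_ge0 ?mulr_ge0 //; lra.
by rewrite powRM // ler_wpM2l ?powR_ge0 // lerDr powR_ge0.
Qed.

(** Marks finer than [J0] are counted by the integral condition; those of level [J0] lie in a
    bounded region because the low-frequency piece is small at infinity. *)
Lemma latcnt_bigdiff p f e d tau (b0 : R) J0 : 0 < p -> 0 < d <= 1 / 2 -> 0 < tau <= 1 ->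
  (intn (fun x => poweR (yint (Sset r s f e) x 1) (p / q)) < +oo)%E ->
  (exists rho : R, forall x, rho < enorm x -> `|LPR 0 f x| <= b0) ->
  exists2 La : R, 0 <= La & forall M, (latcnt (p / q) (bigdiff f e d tau b0 J0) M <= La%:E)%E.
Proof.
move=> p0 d01 t01; set I := intn _ => Ioo [rho hrho].
have [d0 _] := andP d01.
have a0 : 0 < p / q by rewrite divr_gt0.
set a := p / q in I Ioo a0 *.
have I0 : (0 <= I)%E by apply: intn_ge0 => x; exact: poweR_ge0.
have If : I \is a fin_num by rewrite ge0_fin_numE.
set E := bigdiff f e d tau b0 J0.
pose N := Num.bound (2 ^+ J0 * `|rho|).
have EN k : E J0 k -> near N.+1 k 0.
  move=> /asboolP[[_ [w wk hw]]|[]]; last by rewrite ltnn.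
  have wr : enorm w <= `|rho|.
    rewrite leNgt; apply/negP => h; move: hw; rewrite ltNge hrho //.
    by apply: le_lt_trans h; exact: ler_norm.
  have ib : inbox `|rho| (w - 0) by rewrite subr0; apply: inbox_le wr _; exact: inbox_enorm.
  have bd : 2 ^+ J0 * `|rho| <= N%:R.
    by rewrite /N; apply: le_trans (ltW (archi_boundP _)); rewrite ?mulr_ge0 ?exprn_ge0.
  have := flr_near ib bd; rewrite wk (_ : flr J0 0 = 0) //.
  by apply/rowP => i; rewrite !mxE mulr0 floor0.
pose c1 M k := (\sum_(1 <= j < M.+1 - J0) E (j + J0)%N (anc (M - (j + J0)) k))%N.
pose e0 M (k : 'rV[int]_n) : R := \sum_(v <- boxseq N.+1) (anc (M - J0) k == v)%:R.
have e00 M k : 0 <= e0 M k by apply: sumr_ge0.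
have lt0 m k : (m < J0)%N -> E m k = false.
  move=> mJ; apply/asboolP => -[[mE _]|[Jm _]]; first by rewrite mE ltnn in mJ.
  by have := ltn_trans mJ Jm; rewrite ltnn.
have cntE M k : (J0 <= M)%N -> powR (cnt E M k)%:R a <= powR 2 a * (e0 M k + powR (c1 M k)%:R a).
  move=> JM.
  have -> : cnt E M k = (E J0 (anc (M - J0) k) + c1 M k)%N.
    rewrite -cntl0 cntl_nat (@big_cat_nat _ _ _ J0) //=; last by rewrite (leq_trans JM).
    rewrite big_nat big1 ?add0n; last by move=> m /andP[_ mJ]; rewrite lt0.
    rewrite -[X in (\sum_(X <= _ < _) _)%N]add0n big_addn big_ltn ?subn_gt0 //.
  rewrite natrD (le_trans (powR_add_le _ _ _)) ?(ltW a0) // ler_wpM2l ?powR_ge0 // lerD2r.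
  case EJ : (E J0 _); last by rewrite powR0 ?gt_eqF.
  rewrite powR1; have := mem_boxseq (EN _ EJ) => mb.
  by rewrite /e0 (big_rem _ mb) /= eqxx lerDl sumr_ge0.
have lc1 M : (lat M (fun k => (powR (c1 M k)%:R a)%:E) <= ((powR d a)^-1 * fine I)%:E)%E.
  have da : 0 < powR d a by rewrite powR_gt0.
  have h : ((powR d a)%:E * lat M (fun k => (powR (c1 M k)%:R a)%:E) <= I)%E.
    rewrite -latZ ?(ltW da) //.
    apply: intn_ge_lat => [k|x]; first by rewrite mule_ge0 // lee_fin powR_ge0.
    rewrite -EFinM -powRM ?(ltW d0) // -poweR_EFin.
    apply: gt0_ler_poweR; rewrite ?(ltW a0) ?in_itv /= ?leey ?andbT ?yint_ge0 ?lee_fin ?mulr_ge0 ?(ltW d0) //.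
    have := @bigdiff_yint f e d tau b0 J0 0 1 M x d01 t01 isT isT; rewrite expr0 invr1; apply: le_trans.
    rewrite lee_fin ler_wpM2l ?(ltW d0) // ler_nat /c1 big_nat [leqRHS]big_nat; apply: leq_sum => j hj.
    by rewrite flr_anc //; move: hj; clear; lia.
  by rewrite EFinM fineK // muleC lee_pdivlMr // muleC.
exists (powR 2 a * ((size (boxseq (n := n) N.+1))%:R + (powR d a)^-1 * fine I)).
  by rewrite mulr_ge0 ?powR_ge0 // addr_ge0 // mulr_ge0 ?invr_ge0 ?powR_ge0 // fine_ge0.
move=> M; have [JM|MJ] := leqP J0 M; last first.
  rewrite /latcnt /lat esum1 ?mule0.
    rewrite lee_fin mulr_ge0 ?powR_ge0 // addr_ge0 // mulr_ge0 ?invr_ge0 ?powR_ge0 // fine_ge0 //.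
  move=> k _; rewrite -cntl0 cntl_nat big_nat big1 ?powR0 ?gt_eqF // => m /andP[_ mM].
  by rewrite lt0 // (leq_trans mM MJ).
apply: (@le_trans _ _ (lat M (fun k => (powR 2 a)%:E * (e0 M k + powR (c1 M k)%:R a)%:E)%E)).
  by apply: lat_le => k; rewrite -EFinM lee_fin cntE.
rewrite latZ ?powR_ge0 //; last by move=> k; rewrite lee_fin addr_ge0 ?powR_ge0.
rewrite EFinM lee_wpmul2l ?lee_fin ?powR_ge0 //.
have -> : lat M (fun k => (e0 M k + powR (c1 M k)%:R a)%:E) =
    (lat M (fun k => (e0 M k)%:E) + lat M (fun k => (powR (c1 M k)%:R a)%:E))%E.
  by rewrite -latD // => k; rewrite lee_fin // powR_ge0.
rewrite EFinD leeD // lat_sum //.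
apply: (@le_trans _ _ (\sum_(v <- boxseq (n := n) N.+1) 1)%E); last first.
  by rewrite sume_const_seq ?mule1 ?lee_fin.
apply: lee_sum => v _; rewrite lat_anc // lee_fin exprn_ile1 ?invr_ge0 ?exprn_ge0 //.
by rewrite invf_le1 ?exprn_gt0 // exprn_ege1 // ler1n.
Qed.

(** The levels [l] to [l + J0] are estimated by their number, which covers the marks of level [J0]
    for any [b0]; finer ones are counted by the Carleson condition. *)
Lemma latcar_bigdiff f e d tau (b0 : R) J0 : 0 < d <= 1 / 2 -> 0 < tau <= 1 ->
  (Mcar (Sset r s f e) < +oo)%E ->
  exists2 La : R, 0 <= La & forall l M k0, (l <= M)%N ->
    (latcar (bigdiff f e d tau b0 J0) l M k0 <= (La * (2 ^- l) ^+ n)%:E)%E.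
Proof.
move=> d01 t01; rewrite /Mcar; set I := ereal_sup _ => Ioo; have [d0 _] := andP d01.
have i0 l k0 : (0 <= intn (fun x => (\1_(dcube R l k0) x : R)%:E * yint (Sset r s f e) x (2 ^- l)))%E.
  by apply: intn_ge0 => x; rewrite mule_ge0 ?lee_fin ?yint_ge0.
have Ile l k0 : ((2 ^+ (l * n) : R)%:E * intn (fun x => (\1_(dcube R l k0) x : R)%:E * yint (Sset r s f e) x (2 ^- l)) <= I)%E.
  by apply: ereal_sup_ubound; exists (l, k0).
have I0 : (0 <= I)%E.
  by apply: le_trans (Ile 0%N 0); rewrite mule_ge0 // lee_fin exprn_ge0.
have If : I \is a fin_num by rewrite ge0_fin_numE.
set E := bigdiff f e d tau b0 J0.
exists (J0.+1%:R + d^-1 * fine I).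
  by rewrite addr_ge0 // mulr_ge0 ?invr_ge0 ?(ltW d0) // fine_ge0.
move=> l M k0 lM.
pose c1 k := (\sum_(l.+1 <= j < M.+1 - J0) E (j + J0)%N (anc (M - (j + J0)) k))%N.
have cE k : (cntl E l M k <= J0.+1 + c1 k)%N.
  rewrite cntl_nat; have [h|h] := leqP (l.+1 + J0) M.+1.
    rewrite (@big_cat_nat _ _ _ (l.+1 + J0)) //=; last by clear; lia.
    rewrite leq_add //.
      apply: (@leq_trans (\sum_(l <= m < l.+1 + J0) 1)%N); first by apply: leq_sum => m _; exact: leq_b1.
      by rewrite sum_nat_const_nat muln1; clear; lia.
    by rewrite big_addn.
  apply: (@leq_trans (\sum_(l <= m < M.+1) 1)%N); first by apply: leq_sum => m _; exact: leq_b1.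
  by rewrite sum_nat_const_nat muln1; move: h; clear; lia.
pose w k : R := (anc (M - l) k == k0)%:R.
have w0 k : 0 <= w k by [].
have h1 : (lat M (fun k => (w k * (c1 k)%:R)%:E) <= (d^-1 * fine I * (2 ^- l) ^+ n)%:E)%E.
  have h : (d%:E * lat M (fun k => (w k * (c1 k)%:R)%:E) <= intn (fun x => (\1_(dcube R l k0) x : R)%:E * yint (Sset r s f e) x (2 ^- l)))%E.
    rewrite -latZ ?(ltW d0) //; last by move=> k; rewrite lee_fin mulr_ge0.
    apply: intn_ge_lat => [k|x]; first by rewrite mule_ge0 // lee_fin ?mulr_ge0 // ltW.
    rewrite /w flr_anc //; case: eqP => xk; last by rewrite mul0r mule0 mule_ge0 ?lee_fin ?yint_ge0.
    rewrite indicE mem_set; last exact/dcubeP.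
    rewrite mul1e mul1r -EFinM.
    apply: le_trans (@bigdiff_yint f e d tau b0 J0 l l.+1 M x d01 t01 (leqnSn _) isT).
    rewrite lee_fin ler_wpM2l ?(ltW d0) // ler_nat /c1 big_nat [leqRHS]big_nat; apply: leq_sum => j hj.
    by rewrite flr_anc //; move: hj; clear; lia.
  have p0 : 0 < 2 ^+ (l * n) :> R by rewrite exprn_gt0.
  have := Ile l k0; rewrite muleC -lee_pdivlMr // => h'.
  have := le_trans h h'; rewrite muleC -lee_pdivlMr // => /le_trans; apply.
  rewrite -{1}(fineK If) -!EFinM lee_fin; apply: le_of_eq.
  by rewrite exprM exprVn; ring.
apply: (@le_trans _ _ (lat M (fun k => J0.+1%:R%:E * (w k)%:E + (w k * (c1 k)%:R)%:E)%E)).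
  apply: lat_le => k; rewrite -EFinM -EFinD lee_fin [J0.+1%:R * _]mulrC -mulrDr ler_wpM2l //.
  by rewrite -natrD ler_nat.
rewrite latD; [|by move=> k; rewrite -EFinM lee_fin mulr_ge0|by move=> k; rewrite lee_fin mulr_ge0].
rewrite mulrDl EFinD leeD // latZ // /w lat_anc // -EFinM lee_fin.
Qed.

Lemma powR_half_lt1 (a : R) : 0 < a -> powR (1 / 2) a < 1.
Proof.
move=> a0; have h0 : 0 <= 1 / 2 :> R by rewrite divr_ge0.
apply: (@lt_le_trans _ _ (powR 1 a)); last by rewrite powR1.
by rewrite gt0_ltr_powR ?nnegrE // ltr_pdivrMr // mul1r ltr1n.
Qed.

(** A large value within [2 ^ i 2 ^- j] of [x] produces a box within a further [Z0 2 ^- j]. Measured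
    in cubes of level [j + J0], these distances grow by [2 ^ J0], and [i0] absorbs this factor. *)
Lemma bigdiff_nb A f e d tau (b0 : R) C0 Z0 J0 i0 : LamB s A f -> 0 <= Z0 -> n%:R * 2 ^- J0 <= d ->
  2 ^+ J0 * (Z0 + 1) + 1 <= 2 ^+ i0 ->
  (forall j x, (0 < j)%N -> C0 * e * ka ^+ j < `|LPR j f x| ->
    exists2 x1, inbox (Z0 * 2 ^- j) (x1 - x) &
    forall x' y, enorm (x' - x1) <= d * 2 ^- j -> (1 - d) * (tau * 2 ^- j) <= y <= tau * 2 ^- j ->
    Sset r s f e (x', y)) ->
  forall j x i z, inbox (2 ^+ i) z ->
  (if j == 0%N then b0 else C0 * e * ka ^+ j) < `|LPR j f (x - 2 ^- j *: z)| ->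
  nb (2 ^ (i + i0)) (bigdiff f e d tau b0 J0) (j + J0) (flr (j + J0) x).
Proof.
move=> lf Z00 nd hi det j x i z iz big.
have t0 : 0 < 2 ^- j :> R := pow2V_gt0 _.
have [w Ew iw] : exists2 w, bigdiff f e d tau b0 J0 (j + J0) (flr (j + J0) w) &
    inbox ((Z0 + 2 ^+ i) * 2 ^- j) (x - w).
  have iz' : inbox (2 ^+ i * 2 ^- j) (2 ^- j *: z).
    by move=> a; rewrite mxE normrM gtr0_norm // mulrC ler_wpM2r ?(ltW t0).
  move: big; case: eqP => [j0|/eqP j0] big.
    rewrite j0 in big iz' *; exists (x - 2 ^- 0 *: z).
      by apply/asboolP; left; split=> //; exists (x - 2 ^- 0 *: z); rewrite ?add0n.
    rewrite opprB addrCA subrr addr0; apply: inbox_le iz'.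
    by rewrite ler_wpM2r ?pow2V_ge0 // lerDr.
  have jp : (0 < j)%N by rewrite lt0n.
  have [x1 ix1 Hx1] := det j _ jp big; exists x1.
    apply/asboolP; right; split; first by move: jp; clear; lia.
    rewrite addnK => x' y xx yy; apply: Hx1 => //.
    apply: (le_trans (flr_same xx)); rewrite exprD invfM mulrCA mulrC ler_wpM2r ?(ltW t0) //.
  have -> : x - x1 = - (x1 - (x - 2 ^- j *: z)) + 2 ^- j *: z by rewrite opprB addrAC subrK.
  rewrite mulrDl; apply: inboxD => // a; rewrite mxE normrN; exact: ix1.
apply/asboolP; exists (flr (j + J0) w) => //.
have i1 : 1 <= 2 ^+ i :> R by rewrite exprn_ege1 // ler1n.
have pJ : 0 < 2 ^+ J0 :> R by rewrite exprn_gt0.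
have key : 2 ^+ (j + J0) * ((Z0 + 2 ^+ i) * 2 ^- j) <= (2 ^ (i + i0) - 1)%N%:R :> R.
  rewrite natrB ?expn_gt0 // natrX lerBrDr exprD.
  have -> : 2 ^+ j * 2 ^+ J0 * ((Z0 + 2 ^+ i) * 2 ^- j) = 2 ^+ J0 * (Z0 + 2 ^+ i) :> R.
    by field; rewrite expf_neq0.
  rewrite exprD; apply: (@le_trans _ _ (2 ^+ i * (2 ^+ J0 * (Z0 + 1) + 1))); last first.
    by rewrite ler_wpM2l // exprn_ge0.
  have p1 : 0 <= (2 ^+ i - 1) * (2 ^+ J0 * Z0) by rewrite !mulr_ge0 ?subr_ge0 ?(ltW pJ).
  rewrite -subr_ge0; have -> : 2 ^+ i * (2 ^+ J0 * (Z0 + 1) + 1) - (2 ^+ J0 * (Z0 + 2 ^+ i) + 1) =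
    (2 ^+ i - 1) * (2 ^+ J0 * Z0) + (2 ^+ i - 1) :> R by ring.
  by rewrite addr_ge0 // subr_ge0.
have := flr_near iw key; rewrite subn1 prednK ?expn_gt0 //.
Qed.

(** For given [l] and [x], take the first radius [2 ^ i] at which a mark appears: all smaller radii
    are free of large values, so the piece of [f - G] has already decayed like [om ^ i]. *)
Lemma clipping_series : exists2 C : R, 0 < C & forall A f e (b0 : R), LamB s A f -> 0 < e -> 0 <= b0 ->
  exists2 G : 'rV[R]_n -> R, LamB s (C * (e + b0)) G &
  exists2 d : R, 0 < d <= 1 / 2 & exists2 tau : R, 0 < tau <= 1 & exists J0 : nat,
  forall P, exists i0 : nat, exists2 C1 : R, 0 <= C1 & forall l x, (0 < P)%N ->
  (\sum_(j <oo) LPterm eta s q (j + l)%N (fun y => (f y - G y)%R) x <=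
    ereal_sup (range (fun M => (C1 * tsum (bigdiff f e d tau b0 J0) ((powR (1 / 2) q ^+ P) ^+ 2) i0 l M (flr M x))%:E)))%E.
Proof.
have [C0 C00 [tau t01 det]] := large_piece_diff n0 eta_LP s0 sr.
have [CS CS0 appr] := approximant n0 eta_LP s0.
have k0 := @ka_gt0 R s.
exists (CS * (C0 + 1)); first by rewrite mulr_gt0 // ltr_wpDl // ltW.
move=> A f e b0 lf e0 b00.
have [Z0 Z00 [d d01 hdet]] := det A f e lf e0.
have [d0 d1] := andP d01.
pose L j : R := if j == 0%N then b0 else C0 * e * ka ^+ j.
have Ce0 : 0 < C0 * e by rewrite mulr_gt0.
have L0 j : 0 <= L j.
  by rewrite /L; case: ifP => // _; rewrite mulr_ge0 ?exprn_ge0 // ltW.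
have LD j : 0 <= L j <= (C0 * e + b0) * ka ^+ j.
  rewrite L0 /L; case: eqP => [->|_]; first by rewrite expr0 mulr1 lerDr ltW.
  by rewrite ler_wpM2r ?exprn_ge0 ?(ltW k0) // lerDl.
have [G lG HG] := appr A f _ L lf LD.
exists G.
  apply: LamB_mono lG; rewrite -mulrA ler_wpM2l ?(ltW CS0) // mulrDl mul1r mulrDr.
  have : 0 <= C0 * b0 by rewrite mulr_ge0 // ltW.
  lra.
exists d => //; exists tau => //.
have half01 : 0 <= (2^-1 : R) < 1 by rewrite invr_ge0 ler0n /= invf_lt1 ?ltr1n.
have [J1 hJ1] := geo_choose half01 (ler0n R n) d0.
(* The shift by 2 lets [t = j + 2 - l] start at 0 for the levels [j] that interact with [l]. *)
pose J0 := (J1 + 2)%N.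
have nd : n%:R * 2 ^- J0 <= d by rewrite -exprVn; apply: hJ1; exact: leq_addr.
exists J0 => P.
pose T := 2 ^+ J0 * (Z0 + 1) + 1.
have T0 : 0 <= T by rewrite addr_ge0 // mulr_ge0 ?exprn_ge0 // addr_ge0.
have [i0 hi] : exists i0 : nat, T <= 2 ^+ i0.
  exists (Num.bound T); apply: (le_trans (ltW (archi_boundP T0))).
  by rewrite -natrX ler_nat ltnW // ltn_expl.
have bad := @bigdiff_nb A f e d tau b0 C0 Z0 J0 i0 lf Z00 nd hi hdet.
have [C C0' dec] := approximant_decay n0 eta_LP s0 P.
have [cG GB _] := lG.
have {}dec := dec A f L G lf L0 cG (ex_intro _ _ GB) HG.
have A0 := LamB_ge0 lf.
(* At radius [2 ^ i] the tail factor [(1 + 4 ^ i) ^ (- P)], raised to the power [q], is at most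
   [om ^ i]. *)
pose sg : R := powR (1 / 2) q ^+ P; pose om := sg ^+ 2.
have h0 : 0 < 1 / 2 :> R by rewrite divr_gt0.
have sg00 : 0 < powR (1 / 2) q by rewrite powR_gt0.
have sg01 : powR (1 / 2) q < 1.
  by rewrite powR_half_lt1.
have om0 : 0 < om by rewrite !exprn_gt0.
pose u l x := powR (powR 2 (l%:R * s) * LPconv_abs eta l (fun y => f y - G y) x) q.
have u0 l x : 0 <= u l x by rewrite powR_ge0.
pose Cu := powR (C * A) q; have Cu0 : 0 <= Cu by rewrite powR_ge0.
have CA0 : 0 <= C * A by rewrite mulr_ge0 // ltW.
have uE (D : R) l x : 0 <= D -> LPconv_abs eta l (fun y => f y - G y) x <= C * A * ka ^+ l * D -> u l x <= Cu * powR D q.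
  move=> D0 h; rewrite /u /Cu -powRM //; apply: ge0_ler_powR; rewrite ?nnegrE ?(ltW q0) //.
  - by rewrite mulr_ge0 ?powR_ge0 ?sqrtr_ge0.
  - by rewrite mulr_ge0.
  rewrite (kaVE s) ler_pdivrMl ?exprn_gt0 // (le_trans h) //; apply: le_of_eq; ring.
have u1 l x : u l x <= Cu.
  by have := uE 1 l x ler01; rewrite powR1 !mulr1; apply; case: (dec l x).
have u2 l x i : ~~ tbad (bigdiff f e d tau b0 J0) i0 J1 i l x -> u l x <= Cu * om ^+ i.
  move=> nt; have i2 : 0 <= 2 ^+ i :> R by rewrite exprn_ge0.
  have [_ /(_ (2 ^+ i) i2) dd] := dec l x.
  have D0 : 0 <= (1 + (2 ^+ i) ^+ 2) ^- P :> R.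
    by rewrite invr_ge0 exprn_ge0 // addr_ge0 // sqr_ge0.
  apply: (le_trans (uE _ l x D0 (dd _))).
    move=> j z lj jl iz; rewrite leNgt; apply/negP => big; move/negP: nt; apply.
    apply/asboolP; exists (j + 2 - l)%N; first by move: lj jl; clear; lia.
    have -> : (l + (j + 2 - l) + J1 = j + J0)%N by move: lj; rewrite /J0; clear; lia.
    exact: bad iz big.
  have -> : om ^+ i = powR ((1 / 2) ^+ (2 * i * P)) q.
    rewrite powR_expn ?(ltW h0) // /om /sg -!exprM; congr (_ ^+ _); clear; lia.
  rewrite ler_wpM2l // ge0_ler_powR ?nnegrE ?(ltW q0) ?exprn_ge0 ?(ltW h0) //.
  rewrite exprM -exprVn lerXn2r ?nnegrE ?invr_ge0 ?exprn_ge0 ?(ltW h0) ?addr_ge0 ?sqr_ge0 //.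
  rewrite mul1r exprVn lef_pV2 ?posrE ?exprn_gt0 ?ltr_wpDr ?sqr_ge0 //.
  by rewrite mulnC exprM lerDr.
exists i0, (5 * (Cu / om)); first by rewrite !mulr_ge0 // invr_ge0 ltW.
move=> l x P0.
have om01 : 0 <= om < 1.
  rewrite (ltW om0) /om /sg !exprn_ilt1 ?exprn_ge0 ?(ltW sg00) // -?lt0n ?muln_gt0 //.
have Co0 : 0 <= Cu / om by rewrite divr_ge0 // ltW.
apply: (@tail_series R n (bigdiff f e d tau b0 J0) u (Cu / om) om i0 J1) => // {l x} l x I.
have u3 i : (forall i', (i' < i)%N -> ~~ tbad (bigdiff f e d tau b0 J0) i0 J1 i' l x) -> u l x <= Cu / om * om ^+ i.
  case: i => [|i] h.
    rewrite expr0 mulr1 (le_trans (u1 l x)) // ler_pdivlMr // ler_piMr // ltW //.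
    by case/andP: om01.
  by rewrite exprS mulrA divfK ?gt_eqF // u2 // h.
have ex : exists i, (i == I) || tbad (bigdiff f e d tau b0 J0) i0 J1 i l x by exists I; rewrite eqxx.
have s0' : 0 <= \sum_(i < I) om ^+ i * (tbad (bigdiff f e d tau b0 J0) i0 J1 i l x)%:R.
  by apply: sumr_ge0 => i _; rewrite mulr_ge0 ?exprn_ge0 // ltW.
case: (ex_minnP ex) => i Hi mi.
apply: (le_trans (u3 i _)).
  move=> i' ii; apply/negP => ti; have := mi i'; rewrite ti orbT => /(_ isT).
  by rewrite leqNgt ii.
rewrite ler_wpM2l //; move/orP: Hi => [/eqP ->|ti]; first by rewrite lerDl.
have [iI|Ii] := ltnP i I; last first.
  have -> : i = I by apply/eqP; rewrite eqn_leq Ii andbT; apply: mi; rewrite eqxx.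
  by rewrite lerDl.
rewrite (bigD1 (Ordinal iI)) //= ti mulr1 addrCA lerDl addr_ge0 ?exprn_ge0 ?(ltW om0) //.
by apply: sumr_ge0 => j _; rewrite mulr_ge0 ?exprn_ge0 // ltW.
Qed.

Lemma sg_choose (a be : R) : 0 < a -> 1 <= be -> exists2 P : nat, (0 < P)%N & powR (powR (1 / 2) q ^+ P) a * be <= 1 / 2.
Proof.
move=> a0 be1; have h0 : 0 < 1 / 2 :> R by rewrite divr_gt0.
have be0 : 0 <= be by apply: le_trans be1.
have sg00 : 0 <= powR (1 / 2) q by rewrite powR_ge0.
have z1 : powR (powR (1 / 2) q) a < 1.
  by rewrite -powRrM powR_half_lt1 // mulr_gt0.
have z01 : 0 <= powR (powR (1 / 2) q) a < 1 by rewrite powR_ge0.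
have [P hP] := geo_choose z01 be0 h0.
by exists P.+1 => //; rewrite powR_expn // mulrC hP.
Qed.

Lemma sg_lt1 P : (0 < P)%N -> 0 <= powR (1 / 2 : R) q ^+ P < 1.
Proof.
move=> P0; have h0 : 0 < 1 / 2 :> R by rewrite divr_gt0.
rewrite exprn_ge0 ?powR_ge0 //= exprn_ilt1 ?powR_ge0 -?lt0n //.
exact: powR_half_lt1.
Qed.

Lemma clipping_inF p : 0 < p -> exists2 C : R, 0 < C & forall A f e (b0 : R), LamB s A f -> 0 < e -> 0 <= b0 ->
  (intn (fun x => poweR (yint (Sset r s f e) x 1) (p / q)) < +oo)%E ->
  (exists rho : R, forall x, rho < enorm x -> `|LPR 0 f x| <= b0) ->
  exists2 G : 'rV[R]_n -> R, LamB s (C * (e + b0)) G & inF eta s p q (fun y => f y - G y).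
Proof.
move=> p0; have a0 : 0 < p / q by rewrite divr_gt0.
have [C C0 H] := clipping_series; exists C => // A f e b0 lf e0 b00 Ioo far.
have [G lG [d d01 [tau t01 [J0 HP]]]] := H A f e b0 lf e0 b00; exists G => //.
have [La La0 HLa] := latcnt_bigdiff J0 p0 d01 t01 Ioo far.
have [be be1 HT] := @tail_intn R n _ a0.
have [P P0 hP] := sg_choose a0 be1.
have [i0 [C1 C10 Hs]] := HP P.
have [B HB] := HT _ La _ C1 i0 La0 HLa (sg_lt1 P0) hP C10.
rewrite /inF; apply: le_lt_trans (ltry B); apply: HB => x.
  by apply: nneseries_ge0 => *; exact: LPterm_ge0.
have E0 : (\sum_(j <oo) LPterm eta s q j (fun y => (f y - G y)%R) x =
    \sum_(j <oo) LPterm eta s q (j + 0)%N (fun y => (f y - G y)%R) x)%E.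
  by apply: eq_eseriesr => j _; rewrite addn0.
by rewrite E0; exact: Hs.
Qed.

Lemma clipping_inFinf : exists2 C : R, 0 < C & forall A f e, LamB s A f -> 0 < e ->
  (Mcar (Sset r s f e) < +oo)%E ->
  exists2 G : 'rV[R]_n -> R, LamB s (C * e) G & inFinf eta s q (fun y => f y - G y).
Proof.
have [C C0 H] := clipping_series; exists C => // A f e lf e0 Ioo.
(* Threshold 0 at the lowest level: the low-frequency piece is left entirely to [f - G]. *)
have [G lG [d d01 [tau t01 [J0 HP]]]] := H A f e 0 lf e0 (lexx _).
exists G; first by rewrite addr0 in lG.
have [La La0 HLa] := latcar_bigdiff 0 J0 d01 t01 Ioo.
have n4 : 1 <= 4 ^+ n :> R by rewrite exprn_ege1 // ler1n.
(* Exponent 2, since the weight in the series is [om = sg ^ 2]. *)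
have [P P0 hP] := sg_choose (ltr0Sn R 1) n4.
have [i0 [C1 C10 Hs]] := HP P.
have om0 : 0 <= (powR (1 / 2 : R) q ^+ P) ^+ 2 by rewrite sqr_ge0.
rewrite powR_mulrn ?exprn_ge0 ?powR_ge0 // in hP.
have [B HB] := @tail_car R n _ La _ C1 i0 La0 HLa om0 hP C10.
rewrite /inFinf; apply: le_lt_trans (ltry B); apply: ge_ereal_sup => _ [[l k0] _ <-] /=.
apply: HB => x; first by apply: nneseries_ge0 => *; exact: LPterm_ge0.
exact: Hs.
Qed.

End Clipping.

(** * Behaviour at infinity *)

Section Far.
Context {R : realType} {n : nat} (n0 : (0 < n)%N).
Implicit Types (f g u v K : 'rV[R]_n -> R) (x y h z : 'rV[R]_n) (A a b c e B t : R).

Definition far a u := exists rho : R, forall x, rho < enorm x -> `|u x| <= a.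

Lemma far_le a b u : a <= b -> far a u -> far b u.
Proof. by move=> ab [rho H]; exists rho => x /H /le_trans; apply. Qed.

Lemma eq_far a u v : u =1 v -> far a u -> far a v.
Proof. by move=> uv [rho H]; exists rho => x /H; rewrite uv. Qed.

Lemma farD a b u v : far a u -> far b v -> far (a + b) (fun x => u x + v x).
Proof.
move=> [r1 H1] [r2 H2]; exists (Num.max r1 r2) => x; rewrite gt_max => /andP[h1 h2].
by rewrite (le_trans (ler_normD _ _)) // lerD ?H1 ?H2.
Qed.

Lemma far_shift a u z : far a u -> far a (fun x => u (x + z)).
Proof.
move=> [rho H]; exists (rho + enorm z) => x hx; apply: H.
have := enormD (x + z) (- z); rewrite addrK enormN; lra.
Qed.

Lemma far0 : far 0 (fun _ : 'rV[R]_n => 0 : R).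
Proof. by exists 0 => x _; rewrite normr0. Qed.

Lemma far_bigsum (I : Type) (rr : seq I) (b : I -> R) (u : I -> 'rV[R]_n -> R) :
  (forall i, far (b i) (u i)) -> far (\sum_(i <- rr) b i) (fun x => \sum_(i <- rr) u i x).
Proof.
move=> H; elim: rr => [|i rr IH].
  by rewrite big_nil; apply: eq_far far0 => x; rewrite big_nil.
rewrite big_cons; apply: (@eq_far _ (fun x => u i x + \sum_(i <- rr) u i x)).
  by move=> x; rewrite big_cons.
exact: farD.
Qed.

Lemma far_scale a u c : 0 < c -> far a u -> far a (fun x => u (c *: x)).
Proof.
move=> c0 [rho H]; exists (rho / c) => x; rewrite ltr_pdivrMr // => hx; apply: H.
by rewrite enormZ gtr0_norm // mulrC.
Qed.

Lemma sqr_tail A e : 0 <= A -> 0 < e -> exists2 Z : R, 0 <= Z & A * (1 + Z ^+ 2) ^- 1 <= e.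
Proof.
move=> A0 e0; exists (A / e + 1); first by rewrite addr_ge0 // divr_ge0 // ltW.
have q0 : 0 <= A / e by rewrite divr_ge0 // ltW.
rewrite expr1 ler_pdivrMr; last by rewrite ltr_wpDr // sqr_ge0.
have h : A / e <= 1 + (A / e + 1) ^+ 2 by rewrite -subr_ge0 (_ : _ - _ = (A / e) ^+ 2 + A / e + 2); [rewrite !addr_ge0 // sqr_ge0|ring].
by have := h; rewrite ler_pdivrMr // mulrC.
Qed.

Lemma conv_far C K t A a e u : continuous K -> (forall z, `|K z| <= C * maj z ^+ 2) ->
  continuous u -> (forall y, `|u y| <= A) -> 0 <= a -> 0 < e -> far a u ->
  far (C * pi ^+ n * (a + e)) (conv K t u).
Proof.
move=> cK hK cu uA a0 e0 [rho H].
have A0 : 0 <= A by apply: le_trans (uA 0).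
have [Z Z0 hZ] := sqr_tail A0 e0.
have C0 : 0 <= C.
  by have := le_trans (normr_ge0 _) (hK 0); rewrite pmulr_lge0 // exprn_gt0 // maj_gt0.
exists (rho + `|t| * (n%:R * Z)) => x hx.
apply: (le_trans (@conv_tail R n C A a Z K 1 t u x cK hK cu uA a0 Z0 _)); last first.
  by rewrite ler_wpM2l ?mulr_ge0 ?exprn_ge0 ?pi_ge0 // lerD2l.
move=> z iz; apply: H.
have h := ler_wpM2l (normr_ge0 t) (enorm_inbox iz).
have := enormD (x - t *: z) (t *: z); rewrite subrK enormZ; lra.
Qed.

(** A difference of step [2 h] is the sum of two shifted differences of step [h]; iteration controls
    steps [2 ^ T h] by steps [h]. *)
Definition sum1 h u : 'rV[R]_n -> R := fun x => u (x + 2^-1 *: h) + u (x - 2^-1 *: h).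

Lemma sum1_diff1 h u : sum1 h (diff1 h u) =1 diff1 (2 *: h) u.
Proof.
move=> x; rewrite /sum1 /diff1 scalerA mulVf // scale1r subrK addrK.
rewrite -!addrA -scalerDl -opprD -scalerDl (_ : 2^-1 + 2^-1 = 1 :> R) ?scale1r; last by field.
by rewrite addKr.
Qed.

Lemma diffk_sum1 k h u : diffk k h (sum1 h u) =1 sum1 h (diffk k h u).
Proof.
elim: k u => [//|k IH] u x /=; rewrite -IH; apply: eq_diffk => y.
by rewrite /sum1 /diff1 addrK subrK; ring.
Qed.

Lemma diffk_double k h u : diffk k (2 *: h) u =1 iter k (sum1 h) (diffk k h u).
Proof.
elim: k u => [//|k IH] u x; rewrite iterSr /=.
rewrite (@eq_diffk _ _ _ _ _ (sum1 h (diff1 h u))) ?IH; last by move=> y; rewrite sum1_diff1.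
by congr (iter k _ _ x); apply/funext => y; rewrite diffk_sum1.
Qed.

Lemma far_sum1 a h u k : far a u -> far (2 ^+ k * a) (iter k (sum1 h) u).
Proof.
move=> fu; elim: k => [|k IH]; first by rewrite expr0 mul1r.
have := farD (far_shift (2^-1 *: h) IH) (far_shift (- (2^-1 *: h)) IH).
by apply: far_le; rewrite exprS; lra.
Qed.

Lemma bound_sum1 a h u k : (forall x, `|u x| <= a) -> forall x, `|iter k (sum1 h) u x| <= 2 ^+ k * a.
Proof.
move=> fu; elim: k => [|k IH] x; first by rewrite expr0 mul1r.
rewrite /= /sum1 (le_trans (ler_normD _ _)) // exprS -mulrA mulr2n mulrDl mul1r.
by rewrite lerD.
Qed.

Lemma diffk_pow2_far k a h u T : far a (diffk k h u) -> far (2 ^+ (k * T) * a) (diffk k (2 ^+ T *: h) u).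
Proof.
elim: T => [|T IH] fu; first by rewrite muln0 expr0 mul1r scale1r.
rewrite mulnS exprD -mulrA exprS -scalerA.
by apply: eq_far (fun x => esym (diffk_double k _ u x)) _; apply: far_sum1; exact: IH.
Qed.

Lemma diffk_pow2_bound k a h u T : (forall x, `|diffk k h u x| <= a) ->
  forall x, `|diffk k (2 ^+ T *: h) u x| <= 2 ^+ (k * T) * a.
Proof.
move=> H; elim: T => [|T IH] x; first by rewrite muln0 expr0 mul1r scale1r.
rewrite mulnS exprD -mulrA exprS -scalerA diffk_double; exact: bound_sum1.
Qed.

Lemma diffk_scale k h u c x : diffk k h (fun y => u (c *: y)) x = diffk k (c *: h) u (c *: x).
Proof.
elim: k u => [//|k IH] u /=; rewrite -IH; apply: eq_diffk => y.
by rewrite /diff1 scalerDr scalerBr !scalerA [c * _]mulrC.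
Qed.

Lemma csupp_continuous_bounded u B : continuous u -> csupp B u -> exists M : R, forall x, `|u x| <= M.
Proof.
case: n n0 u B => [//|m] _ u B cu su.
pose D : set 'rV[R]_m.+1 := [set x | inbox `|B| x].
have cD : compact D.
  apply: bounded_closed_compact.
    exists `|B|; split; first exact: num_real.
    move=> M BM x Dx; change (mx_norm x <= M); rewrite mx_normrE; apply/bigmax_leP; split; first by rewrite (le_trans _ (ltW BM)).
    by move=> [i j] _ /=; rewrite [i]ord1; apply: le_trans (ltW BM); exact: Dx.
  have -> : D = \bigcap_(i in [set: 'I_m.+1]) [set x | `|x 0 i| <= `|B|].
    by apply/seteqP; split => [x Dx i _|x Dx i]; [exact: Dx|exact: (Dx i I)].
  apply: closed_bigI => i _.
  apply: (@preimage_closed _ _ (fun x : 'rV[R]_m.+1 => `|x 0 i|) [set y | y <= `|B|]); last exact: closed_le.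
  by move=> x _; apply: continuous_normf; exact: continuous_coord.
have cI := continuous_compact (continuous_subspaceT cu) cD.
have [M [_ HM]] := compact_bounded cI.
exists (Num.max (M + 1) 0) => x; rewrite le_max; case: (pselect (inbox `|B| x)) => [bx|nb].
  by rewrite (HM (M + 1)) ?ltrDl //; exists x.
rewrite su ?normr0 ?lexx ?orbT // => bx; apply: nb; apply: inbox_le bx; exact: ler_norm.
Qed.

End Far.

(** * Low frequencies at infinity *)

Section FarLow.
Context {R : realType} {n : nat} (n0 : (0 < n)%N).
Context (eta : 'rV[R]_n -> R) (eta_LP : LP_eta eta).
Context (s : R) (s0 : 0 < s) (r : nat) (sr : s < r%:R) (q : R) (q0 : 0 < q).
Context (p : R) (p0 : 0 < p).
Implicit Types (f g : 'rV[R]_n -> R) (x h : 'rV[R]_n) (A a c e : R) (k : 'rV[int]_n).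

Local Notation ka := (ka s).
Local Notation LPR := (LPR eta).
Local Notation small f e := (intn (fun x => poweR (yint (Sset r s f e) x 1) (p / q)) < +oo)%E.
(** After this dilation the low-frequency piece [LPR 0] is an average of [f] at scale [2 ^ T]. *)
Definition dil (T : nat) f : 'rV[R]_n -> R := fun y => f ((2 ^+ T : R) *: y).

(** A large difference of step [h] spreads to a box of fixed size, and the finite integral leaves
    room for finitely many such boxes. *)
Lemma diffk_far A f e h : LamB s A f -> 0 < e -> small f e -> 0 < enorm h <= 1 ->
  far (2 * e * powR (enorm h) s) (diffk r h f).
Proof.
move=> lf e0; set I := intn _ => Ioo h01; have [h0 h1] := andP h01.
have a0 : 0 < p / q by rewrite divr_gt0.
have I0 : (0 <= I)%E by apply: intn_ge0 => x; exact: poweR_ge0.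
have If : I \is a fin_num by rewrite ge0_fin_numE.
have [d d01 thick] := Sset_thick n0 eta_LP s0 sr lf e0; have [d0 d1] := andP d01.
have half01 : 0 <= (2^-1 : R) < 1 by rewrite invr_ge0 ler0n /= invf_lt1 ?ltr1n.
have dh0 : 0 < d * enorm h by rewrite mulr_gt0.
have [M hM] := geo_choose half01 (ler0n R n) dh0.
pose E (m : nat) k : bool := `[< m = M /\ forall x y, flr M x = k -> (1 - d) * enorm h <= y <= enorm h -> Sset r s f e (x, y) >].
have da : 0 < powR d (p / q) by rewrite powR_gt0.
have HL : (latcnt (p / q) E M <= ((powR d (p / q))^-1 * fine I)%:E)%E.
  have hh : ((powR d (p / q))%:E * latcnt (p / q) E M <= I)%E.
    rewrite -latZ ?(ltW da) //.
    apply: intn_ge_lat => [k|x]; first by rewrite mule_ge0 // lee_fin powR_ge0.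
    rewrite -EFinM -powRM ?(ltW d0) // -poweR_EFin.
    apply: gt0_ler_poweR; rewrite ?(ltW a0) ?in_itv /= ?leey ?andbT ?yint_ge0 ?lee_fin ?mulr_ge0 ?(ltW d0) //.
    (* [yint_ge] is used with the single index [j = 0] and [tau = |h|]. *)
    have := @yint_ge R n (Sset r s f e) x d (enorm h) (fun j => (j == 0%N) && E M (flr M x)) 0 0 1 d01 h01 (leqnn _).
    rewrite expr0 invr1 big_nat1 /= => H; apply: le_trans (H _); last first.
      by move=> j y /andP[/eqP -> /asboolP[_ Ex]]; rewrite expr0 invr1 mulr1; exact: Ex.
    rewrite lee_fin ler_wpM2l ?(ltW d0) // ler_nat -cntl0 cntl_flr big_nat_recr //= big_nat big1 ?add0n //.
    move=> m /andP[_ mM]; case Em : (E m _) => //; move/asboolP: Em => [mE _].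
    by rewrite mE ltnn in mM.
  by rewrite EFinM fineK // muleC lee_pdivlMr // muleC.
have [N HN] := latcnt_bounded a0 HL.
exists (n%:R * N.+1%:R) => x; apply: contraTT; rewrite -ltNge -leNgt => big.
apply: (@near_flr_enorm R n N M); apply: HN; apply/asboolP; split => // x' y xx yy.
apply: (thick h x h01 big x' y) => //; apply: (le_trans (flr_same xx)).
by rewrite -exprVn; exact: hM.
Qed.

Lemma continuous_dil T f : continuous f -> continuous (dil T f).
Proof.
move=> cf; rewrite /dil; apply: (@continuous_compf _ _ _ f (fun y : 'rV[R]_n => (2 ^+ T : R) *: y)) => //.
apply: rV_continuous => i; apply: (@eq_continuous _ _ (fun x : 'rV[R]_n => 2 ^+ T * x 0 i)).
  by move=> x; rewrite mxE.
by apply: continuous_mulf; [exact: continuous_cstf|exact: continuous_coord].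
Qed.

Lemma LamB_dil T A f : LamB s A f -> LamB s (2 ^+ ((Num.truncn s).+1 * T) * A) (dil T f).
Proof.
move=> lf; have A0 := LamB_ge0 lf; have [cf fA dA] := lf; split; first exact: continuous_dil.
  by move=> x; rewrite (le_trans (fA _)) // ler_peMl // exprn_ege1 // ler1n.
move=> x h hh; rewrite diffk_scale -mulrA; apply: diffk_pow2_bound => y.
exact: dA.
Qed.

(** Differences of the dilate are differences of [f] with steps [2 ^ T] times longer, reached by
    doubling at the cost [2 ^ (r T)]; hence [C] depends on [T]. *)
Lemma LPR_far T : exists2 C : R, 0 < C & forall A f e, LamB s A f -> 0 < e -> small f e ->
  forall j, far (C * e * ka ^+ j.+1) (LPR j.+1 (dil T f)).
Proof.
have [tau /andP[t0 t1] [a [v [mv H]]]] := theta_differences n0 eta_LP r.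
pose Ci i := projT1 (cid2 (FT_multiplier_decay 2 n0 (mv i))).
have Ci0 i : 0 < Ci i by rewrite /Ci; case: cid2.
have CiP i b x : `|FT b (v i) x| <= Ci i * maj x ^+ 2 by rewrite /Ci; case: cid2.
have pin : 0 < pi ^+ n :> R by rewrite exprn_gt0 // pi_gt0.
pose C := \sum_i Ci i * pi ^+ n * (2 ^+ (r * T) * 4).
have C0 : 0 <= C by apply: sumr_ge0 => i _; rewrite !mulr_ge0 ?exprn_ge0 ?pi_ge0 ?(ltW (Ci0 i)).
exists (C + 1); first by rewrite ltr_wpDl.
move=> A f e lf e0 sm j.
have [cg gA _] := LamB_dil T lf.
set g := dil T f in cg gA *.
have k0 := @ka_gt0 R s.
set t : R := 2 ^- j.+1.
have tt0 : 0 < t := pow2V_gt0 _.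
have tt1 : t <= 1 by rewrite /t invf_le1 ?exprn_gt0 // exprn_ege1 // ler1n.
have ta : 0 < t * tau by rewrite mulr_gt0.
have ta1 : t * tau <= 1 by rewrite mulr_ile1 ?(ltW t0) ?(ltW tt0).
have he (i : 'I_n) : enorm ((t * tau) *: evec R i) = t * tau.
  by rewrite enormZ enorm_evec mulr1 ger0_norm // ltW.
have y0k : powR (t * tau) s <= ka ^+ j.+1.
  by rewrite powR_dyadic_ge ?(ltW ta) // -/t ler_piMr // ltW.
apply: (@eq_far _ _ _ (fun x => \sum_i conv (FT a (v i)) t (diffk r ((t * tau) *: evec R i) g) x)).
  by move=> x; rewrite -(H _ _ _ _ cg gA).
have b0 : 0 < 2 ^+ (r * T) * (2 * e * ka ^+ j.+1) by rewrite !mulr_gt0 ?exprn_gt0.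
have fi i : far (Ci i * pi ^+ n * (2 ^+ (r * T) * 4) * (e * ka ^+ j.+1)) (conv (FT a (v i)) t (diffk r ((t * tau) *: evec R i) g)).
  have fd : far (2 ^+ (r * T) * (2 * e * ka ^+ j.+1)) (diffk r ((t * tau) *: evec R i) g).
    apply: (@eq_far _ _ _ (fun x => diffk r (2 ^+ T *: ((t * tau) *: evec R i)) f (2 ^+ T *: x))).
      by move=> x; rewrite diffk_scale.
    apply: (@far_scale _ _ _ _ (2 ^+ T)); first by rewrite exprn_gt0.
    apply: diffk_pow2_far; apply: far_le (_ : 2 * e * powR (t * tau) s <= _) _.
      by rewrite ler_wpM2l // mulr_ge0 // ltW.
    by have := @diffk_far A f e ((t * tau) *: evec R i) lf e0 sm; rewrite he ta ta1; apply.
  have [D D0 gD] := FT_multiplier_good n0 (mv i).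
  have := @conv_far R n (Ci i) (FT a (v i)) t _ _ _ _ (gD a).1 (CiP i a) (@continuous_diffk _ _ r _ _ cg)
    (@diffk_bound _ _ r ((t * tau) *: evec R i) g _ gA) (ltW b0) b0 fd.
  by apply: far_le; apply: le_of_eq; ring.
apply: far_le (far_bigsum _ fi).
rewrite -mulr_suml -/C [leRHS]mulrAC -mulrA [ka ^+ _ * e]mulrC [leRHS]mulrC [leLHS]mulrC ler_wpM2l //.
  by rewrite mulr_ge0 ?exprn_ge0 // ltW.
by rewrite lerDl.
Qed.

(** Finitely many pieces are small far away, and the rest of the series is uniformly small. *)
Lemma high_far T : exists2 C : R, 0 < C & forall A f e, LamB s A f -> 0 < e -> small f e ->
  far (C * e) (fun x => dil T f x - LPR 0 (dil T f) x).
Proof.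
have [C C0 H] := LPR_far T; have k1 : 0 < 1 - ka by rewrite subr_gt0 ka_lt1.
have k0 := @ka_gt0 R s; have k01 := ka1 s0.
exists (C / (1 - ka) + 1); first by rewrite ltr_wpDl // divr_ge0 // ltW.
move=> A f e lf e0 sm; have Hj := H A f e lf e0 sm.
have [A' lg] : exists A' : R, LamB s A' (dil T f) by eexists; exact: LamB_dil lf.
move: lg Hj; set g := dil T f => lg Hj.
have [cg gA _] := lg; have A0 := LamB_ge0 lg; have CL0 := CL_gt0 n0 eta_LP s0.
have T0 : 0 <= CL n0 eta_LP s0 * A' / (1 - ka) by rewrite !mulr_ge0 ?invr_ge0 ?(ltW CL0) ?(ltW k1).
have [J hJ] := geo_choose k01 T0 e0.
apply: (@eq_far _ _ _ (fun x => \sum_(j < J) LPR j.+1 g x + (g x - \sum_(j < J.+1) LPR j g x))).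
  by move=> x; rewrite big_ord_recl /=; ring.
rewrite mulrDl mul1r; apply: farD.
  apply: far_le (far_bigsum _ (fun j : 'I_J => Hj j)).
  rewrite -mulr_sumr [leRHS]mulrAC ler_wpM2l ?mulr_ge0 ?(ltW C0) ?(ltW e0) //.
  apply: (@le_trans _ _ (\sum_(j < J) ka ^+ j)).
    by apply: ler_sum => j _; rewrite exprS ler_piMl ?exprn_ge0 ?(ltW k0) // ltW // ka_lt1.
  exact: geo_sum_le1.
exists 0 => x _.
have tl := geo_tail J.+1 k01 (fun j => LPR_le n0 eta_LP s0 lg j x) (@LPR_cvg R n n0 eta eta_LP A' g x cg gA).
apply: (le_trans tl); have := hJ J.+1 (leqnSn _); apply: le_trans; apply: le_of_eq; ring.
Qed.

(** The difference of the kernel carries the factor [|h|], and only values of [g] near [x] matter.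
    Thus the Lipschitz constant follows the size [a] at infinity, while the global bound [A] affects
    only the radius. *)
Lemma low_lip : exists2 C : R, 0 < C & forall A g a e, continuous g -> (forall y, `|g y| <= A) ->
  0 <= a -> 0 < e -> far a g -> exists rho : R, forall x h, rho < enorm x -> enorm h <= 1 ->
  `|LPR 0 g (x + h) - LPR 0 g x| <= C * enorm h * (a + e).
Proof.
have mu := lpb_multiplier eta_LP 0.
have [C C0 HC] := diffk_FT_decay 1 2 n0 mu; have [D D0 gD] := FT_multiplier_good n0 mu.
exists (C * pi ^+ n); first by rewrite mulr_gt0 // exprn_gt0 // pi_gt0.
move=> A g a e cg gA a0 e0 [rho H]; have A0 : 0 <= A by apply: le_trans (gA 0).
have [Z Z0 hZ] := sqr_tail A0 e0.
exists (rho + n%:R * Z + 1) => x h hx h1.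
have -> : LPR 0 g (x + h) - LPR 0 g x = diff1 h (LPR 0 g) (x + 2^-1 *: h).
  rewrite /diff1 addrK -addrA -scalerDl (_ : 2^-1 + 2^-1 = 1 :> R) ?scale1r //; by field.
have -> : diff1 h (LPR 0 g) (x + 2^-1 *: h) = conv (diff1 h (FT 0 (lpb eta 0))) 1 g (x + 2^-1 *: h).
  rewrite (_ : LPR 0 g = conv (FT 0 (lpb eta 0)) 1 g); last by rewrite -[LPR 0 g]/(conv _ (2 ^- 0) g) expr0 invr1.
  by rewrite (conv_diff1 _ _ _ (gD 0) cg gA) scale1r (diff1_conv _ _ _ (gD 0) cg gA).
have hK z : `|diff1 h (FT 0 (lpb eta 0)) z| <= C * enorm h * maj z ^+ 2.
  by have := HC 0 h z h1; rewrite expr1.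
have Ch0 : 0 <= C * enorm h by rewrite mulr_ge0 ?enorm_ge0 // ltW.
apply: (le_trans (@conv_tail R n (C * enorm h) A a Z _ 1 1 g _ (@continuous_diff1 _ _ h _ (gD 0).1) hK cg gA a0 Z0 _)); last first.
  by rewrite [leLHS](_ : _ = C * pi ^+ n * enorm h * (a + A * (1 + Z ^+ 2) ^- 1)) ?ler_wpM2l ?mulr_ge0 ?exprn_ge0 ?pi_ge0 ?(ltW C0) ?enorm_ge0 ?lerD2l //; ring.
move=> z iz; apply: H; rewrite scale1r.
have e1 := enorm_inbox iz.
have e2 := enormD (x + 2^-1 *: h - z) (z - 2^-1 *: h); have e3 := enormD z (- (2^-1 *: h)).
rewrite enormN enormZ ger0_norm ?invr_ge0 // in e3.
rewrite (_ : x + _ - z + _ = x) in e2; last by rewrite addrA subrK addrK.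
have : 2^-1 * enorm h <= 1 by lra.
lra.
Qed.

Lemma zpt_near T x : enorm (x - 2 ^- T *: zpt R (flr T x)) <= n%:R * 2 ^- T.
Proof.
have pT : 0 < 2 ^+ T :> R by rewrite exprn_gt0.
apply: enorm_inbox => i; rewrite !mxE.
have /andP[h1 h2] := floor_itv (2 ^+ T * x 0 i); rewrite intrD in h2.
rewrite -(ler_pM2l pT) -{1}(gtr0_norm pT) -normrM mulrBr mulrA mulfV ?gt_eqF // mul1r.
by rewrite ler_norml; apply/andP; split; lra.
Qed.

Section ScalingFunction.
Context (phi : 'rV[R]_n -> R) (cphi : continuous phi) (sphi : compact_support phi) (iphi : RI phi != 0).

Lemma phi_good : exists C : R, good C phi.
Proof.
have [B HB] := sphi.
have sp : csupp `|B| phi.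
  move=> x nb; apply: HB; rewrite ltNge; apply/negP => h; apply: nb.
  by apply: inbox_le (inbox_enorm x); apply: le_trans h (ler_norm _).
have [M HM] := csupp_continuous_bounded n0 cphi sp.
by eexists; exact: (csupp_good (normr_ge0 B) cphi sp HM).
Qed.

(* Far away f differs by O(e) from its mollification Phi at scale 2^T, which is nearly constant on unit scale; hence
   the coefficient at k determines Phi near k, and halving the bound on f costs only O(e + c). *)
Lemma far_step : exists2 K : R, 0 < K & forall A f a e c, LamB s A f -> 0 < e -> small f e -> 0 <= c -> 0 <= a ->
  (exists rho : R, forall k, rho < enorm (zpt R k) -> `|conv phi (-1) f (zpt R k)| <= c) ->
  far a f -> far (a / 2 + K * (e + c)) f.
Proof.
have [Cp gphi] := phi_good; have Cp0 := good_ge0 gphi.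
have [B HB] := sphi.
have [C1 C10 lip] := low_lip.
pose m := `|RI phi|; have m0 : 0 < m by rewrite normr_gt0.
have pin : 0 < pi ^+ n :> R by rewrite exprn_gt0 // pi_gt0.
have half01 : 0 <= (2^-1 : R) < 1 by rewrite invr_ge0 ler0n /= invf_lt1 ?ltr1n.
have [Q EQ] : exists Q : R, Q = Cp * pi ^+ n / m by eexists.
have Q0 : 0 <= Q by rewrite EQ !mulr_ge0 ?invr_ge0 ?(ltW pin) ?(ltW m0).
(* [V] collects what [2 ^- T] has to beat: the contraction by one half, and the displacements
   [2 ^- T |B|] and [n 2 ^- T], which must not exceed 1. *)
have [V EV] : exists V : R, V = C1 * (n%:R + Q * `|B|) + `|B| + n%:R by eexists.
have V1 : 0 <= C1 * (n%:R + Q * `|B|) by rewrite mulr_ge0 ?addr_ge0 ?mulr_ge0 // ltW.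
have V0 : 0 <= V by rewrite EV !addr_ge0.
have h2 : 0 < 2^-1 :> R by rewrite invr_gt0.
have [T hT] := geo_choose half01 V0 h2.
have {}hT := hT T (leqnn _); rewrite exprVn in hT.
have t0 : 0 < 2 ^- T :> R := pow2V_gt0 _.
have [C2 C20 hi] := high_far T.
exists (C2 + Q * C2 + m^-1 + 1).
  by rewrite ltr_wpDl // addr_ge0 ?invr_ge0 ?(ltW m0) // addr_ge0 ?mulr_ge0 ?(ltW C20).
move=> A f a e c lf e0 sm c0 a0 [rc Hc] fa.
have hf := hi A f e lf e0 sm.
have [cg gA _] := LamB_dil T lf; have [cf fA _] := lf.
have p2 : 0 < 2 ^+ T :> R by rewrite exprn_gt0.
have fg : far a (dil T f) by apply: far_scale.
have [r1 Hl] := lip _ (dil T f) a e cg gA a0 e0 fg.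
set Phi := LPR 0 (dil T f) in hf Hl.
have [r2 Hh] := hf.
have ae0 : 0 <= a + e by rewrite addr_ge0 // ltW.
have [t Et] : exists t : R, t = 2 ^- T by eexists.
rewrite -Et in t0 hT.
have tB : t * `|B| <= 1.
  have : 0 <= t * (C1 * (n%:R + Q * `|B|)) by rewrite mulr_ge0 // ltW.
  have : 0 <= t * n%:R by rewrite mulr_ge0 // ltW.
  move: hT; rewrite EV; lra.
have tn : n%:R * t <= 1.
  have : 0 <= t * (C1 * (n%:R + Q * `|B|)) by rewrite mulr_ge0 // ltW.
  have : 0 <= t * `|B| by rewrite mulr_ge0 // ltW.
  move: hT; rewrite EV; lra.
have tb : t * (C1 * (n%:R + Q * `|B|)) <= 2^-1.
  have : 0 <= t * n%:R by rewrite mulr_ge0 // ltW.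
  have : 0 <= t * `|B| by rewrite mulr_ge0 // ltW.
  move: hT; rewrite EV; lra.
have PhiB : exists rho : R, forall k, rho < enorm (t *: zpt R k) ->
    `|Phi (t *: zpt R k)| <= c / m + Q * (C2 * e + C1 * (t * `|B|) * (a + e)).
  exists (Num.max r1 (Num.max (r2 + 1) (t * rc))) => k; rewrite !gt_max => /and3P[k1 k2 k3].
  have kc : `|conv phi (-1) f (zpt R k)| <= c.
    by apply: Hc; move: k3; rewrite enormZ gtr0_norm // ltr_pM2l.
  set b := C2 * e + C1 * (t * `|B|) * (a + e).
  have b0 : 0 <= b by rewrite addr_ge0 // !mulr_ge0 // ltW.
  set P := Phi (t *: zpt R k).
  (* On the support of [phi] the function is close to the constant [P], so the coefficient is close
     to [P * RI phi], and dividing by [m] bounds [P]. *)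
  have fb z : enorm z <= `|B| -> `|f (zpt R k + z) - P| <= b.
    move=> zB; have E : f (zpt R k + z) = dil T f (t *: zpt R k + t *: z).
      by rewrite /dil -scalerDr scalerA Et mulfV ?gt_eqF // scale1r.
    have tz : enorm (t *: z) <= t * `|B| by rewrite enormZ gtr0_norm // ler_pM2l.
    rewrite E -(subrK (Phi (t *: zpt R k + t *: z)) (dil T f _)) -addrA.
    rewrite (le_trans (ler_normD _ _)) // lerD //.
      apply: Hh; have := enormD (t *: zpt R k + t *: z) (- (t *: z)); rewrite addrK enormN.
      by move: k2 tz tB; lra.
    apply: (le_trans (Hl _ _ k1 (le_trans tz tB))).
    by rewrite ler_wpM2r // ler_wpM2l // ltW.
  have gf := @good_convM R n Cp A phi (-1) f (zpt R k) gphi cf fA.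
  have gP : good (`|P| * Cp) (fun z => P * phi z) by exact: goodZ.
  have E : conv phi (-1) f (zpt R k) - P * RI phi = RI (fun z => phi z * (f (zpt R k + z) - P)).
    rewrite -(RIZ P gphi) /conv -(RIB gf gP); apply: eq_RI => z.
    by rewrite scaleN1r opprK; ring.
  have gd : good (b * Cp) (fun z => phi z * (f (zpt R k + z) - P)).
    split.
      apply: continuous_mulf => //; apply: continuous_addf; last exact: continuous_cstf.
      have E1 : (fun z : 'rV[R]_n => f (zpt R k + z)) = (fun z => f (z + zpt R k)).
        by apply/funext => z; rewrite addrC.
      by rewrite E1; exact: continuous_shiftv.
    move=> z; case: (leP (enorm z) `|B|) => zB.
      have [_ ph] := gphi; rewrite normrM mulrC -mulrA ler_pM //; exact: fb.
    rewrite HB; last by apply: le_lt_trans zB; exact: ler_norm.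
    by rewrite mul0r normr0 !mulr_ge0 // maj_ge0.
  have hR := RI_bound gd.
  have Pm : `|P| * m <= c + b * Cp * pi ^+ n.
    rewrite -normrM -(subrK (conv phi (-1) f (zpt R k)) (P * RI phi)) (le_trans (ler_normD _ _)) //.
    by rewrite addrC lerD // distrC E.
  have := Pm; rewrite -ler_pdivlMr // => /le_trans; apply.
  by apply: le_of_eq; rewrite EQ; field; rewrite gt_eqF.
have [r3 H3] := PhiB.
have fgnew : far (a / 2 + (C2 + Q * C2 + m^-1 + 1) * (e + c)) (dil T f).
  exists (Num.max r1 (Num.max r2 (r3 + 1)) + 1) => x hx.
  set k := flr T x; have xk := zpt_near T x; rewrite -/k -Et in xk.
  have xk1 := le_trans xk tn.
  have hx' : Num.max r1 (Num.max r2 (r3 + 1)) < enorm (t *: zpt R k).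
    have := enormD (x - t *: zpt R k) (t *: zpt R k); rewrite subrK; move: hx xk1; lra.
  move: hx'; rewrite !gt_max => /and3P[k1 k2 k3].
  have x2 : r2 < enorm x.
    by move: hx; rewrite -ltrBrDr !gt_max => /and3P[_ h _]; move: h; lra.
  have B1 : `|dil T f x - Phi x| <= C2 * e by exact: Hh.
  have B2 : `|Phi x - Phi (t *: zpt R k)| <= C1 * (n%:R * t) * (a + e).
    have := Hl (t *: zpt R k) (x - t *: zpt R k) k1 xk1; rewrite [t *: _ + _]addrC subrK => /le_trans; apply.
    by rewrite ler_wpM2r // ler_wpM2l // ltW.
  have k3' : r3 < enorm (t *: zpt R k) by move: k3; lra.
  have B3 := H3 k k3'.
  have tri : `|dil T f x| <= `|dil T f x - Phi x| + (`|Phi x - Phi (t *: zpt R k)| + `|Phi (t *: zpt R k)|).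
    have := ler_normD (dil T f x - Phi x) (Phi x); rewrite subrK.
    have := ler_normD (Phi x - Phi (t *: zpt R k)) (Phi (t *: zpt R k)); rewrite subrK; lra.
  apply: (le_trans tri).
  have step : C2 * e + (C1 * (n%:R * t) * (a + e) + (c / m + Q * (C2 * e + C1 * (t * `|B|) * (a + e)))) =
    t * (C1 * (n%:R + Q * `|B|)) * (a + e) + (C2 + Q * C2) * e + m^-1 * c by ring.
  apply: (le_trans (lerD B1 (lerD B2 B3))); rewrite step.
  have s1 := ler_wpM2r ae0 tb.
  have s2 : 0 <= (C2 + Q * C2) * c by rewrite mulr_ge0 // addr_ge0 ?mulr_ge0 // ltW.
  have s3 : 0 <= m^-1 * e by rewrite mulr_ge0 ?invr_ge0 // ltW.
  rewrite mulrDr !(mulrDl _ 1) !mul1r !(mulrDl _ m^-1); move: s1 s2 s3 (ltW e0) c0; lra.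
apply: (@eq_far _ _ _ (fun x => dil T f (t *: x))); last exact: far_scale.
by move=> x; rewrite /dil scalerA Et mulfV ?gt_eqF // scale1r.
Qed.

(** [far_step] is iterated from the global bound [A]: the map [a -> a / 2 + K (e + c)] drives the
    bound towards its fixed point [2 K (e + c)]. *)
Lemma LPR0_far : exists2 C : R, 0 < C & forall A f e c, LamB s A f -> 0 < e -> small f e -> 0 <= c ->
  (exists rho : R, forall k, rho < enorm (zpt R k) -> `|conv phi (-1) f (zpt R k)| <= c) ->
  far (C * (e + c)) (LPR 0 f).
Proof.
have [K K0 H] := far_step; have mu := lpb_multiplier eta_LP 0.
have [D D0 gD] := FT_multiplier_good n0 mu; have [C C0 HC] := FT_multiplier_decay 2 n0 mu.
have pin : 0 < pi ^+ n :> R by rewrite exprn_gt0 // pi_gt0.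
exists (C * pi ^+ n * (2 * K + 2)); first by rewrite !mulr_gt0 // addr_gt0 ?mulr_gt0.
move=> A f e c lf e0 sm c0 coef; have A0 := LamB_ge0 lf; have [cf fA _] := lf.
have ec0 : 0 <= e + c by rewrite addr_ge0 // ltW.
have K2 : 0 <= 2 * K * (e + c) by rewrite !mulr_ge0 // ltW.
have it N : far (A * 2^-1 ^+ N + 2 * K * (e + c)) f.
  elim: N => [|N IH].
    by exists 0 => x _; rewrite expr0 mulr1 (le_trans (fA x)) // lerDl.
  have q' : 0 <= A * 2^-1 ^+ N by rewrite mulr_ge0 // exprn_ge0 // invr_ge0.
  have := H A f _ e c lf e0 sm c0 (addr_ge0 q' K2) coef IH; apply: far_le.
  rewrite exprSr; lra.
have half01 : 0 <= (2^-1 : R) < 1 by rewrite invr_ge0 ler0n /= invf_lt1 ?ltr1n.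
have [N hN] := geo_choose half01 A0 e0.
have fN : far ((2 * K + 1) * (e + c)) f.
  by apply: far_le (it N); have := hN N (leqnn _); lra.
have p1 : 0 <= (2 * K + 1) * (e + c) by rewrite mulr_ge0 // addr_ge0 // mulr_ge0 // ltW.
have := @conv_far R n C _ (2 ^- 0) A _ _ f (gD 0).1 (HC 0) cf fA p1 e0 fN; apply: far_le.
rewrite -[leRHS]mulrA ler_wpM2l ?mulr_ge0 ?(ltW C0) ?(ltW pin) //; lra.
Qed.

End ScalingFunction.

End FarLow.

(** * The integral of the scaling function *)

Section Tent.
Context {R : realType} {n : nat}.
Implicit Types (x v : 'rV[R]_n).

Lemma maj_box (B : R) x : inbox B x -> 1 <= (1 + B ^+ 2) ^+ n * maj x.
Proof.
move=> bx; have -> : (1 + B ^+ 2) ^+ n = \prod_(k < n) (1 + B ^+ 2) by rewrite prodr_const card_ord.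
rewrite /maj -big_split /=; apply: (big_ind (fun z => 1 <= z)) => //.
  by move=> a b a1 b1; exact: mulr_ege1.
move=> k _; have B0 : 0 <= B by apply: le_trans (bx k).
rewrite ler_pdivlMr ?ltr_pwDl ?sqr_ge0 // mul1r.
by rewrite lerD2l -real_normK ?num_real // lerXn2r ?nnegrE.
Qed.

(** A compactly supported Lipschitz test function with positive integral. *)
Definition tent x : R := Num.max (1 - \sum_i `|x 0 i|) 0.

Lemma tent_ge0 x : 0 <= tent x. Proof. by rewrite le_max lexx orbT. Qed.

Lemma tent_le1 x : tent x <= 1.
Proof. by rewrite ge_max ler01 andbT lerBlDr lerDl sumr_ge0. Qed.

Lemma tent_norm x : `|tent x| <= 1.
Proof. by rewrite ger0_norm ?tent_ge0 // tent_le1. Qed.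

Lemma tent_csupp : csupp 1 tent.
Proof.
move=> x nb; have [i hi] : exists i, 1 < `|x 0 i|.
  by apply: contrapT => /forallNP H; apply: nb => i; rewrite leNgt; apply/negP; exact: H.
rewrite /tent; apply/max_idPr; rewrite (bigD1 i) //= subr_le0 (le_trans (ltW hi)) // lerDl sumr_ge0 //.
Qed.

Lemma continuous_tent : continuous tent.
Proof.
apply: continuous_maxr0; apply: continuous_addf; first exact: continuous_cstf.
apply: continuous_oppf; apply: continuous_sumf => i _.
by apply: continuous_normf; exact: continuous_coord.
Qed.

Lemma tent_lip x v (t : R) : inbox t v -> `|tent (x + v) - tent x| <= n%:R * t.
Proof.
move=> iv.
have key : `|(\sum_i `|(x + v) 0 i|) - \sum_i `|x 0 i| | <= n%:R * t.
  rewrite -sumrB (le_trans (ler_norm_sum _ _ _)) // -[n in leRHS]card_ord mulr_natl -sumr_const.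
  apply: ler_sum => i _; rewrite (le_trans (ler_dist_dist _ _)) // mxE addrAC subrr add0r.
  exact: iv.
have mx (a b : R) : `|Num.max a 0 - Num.max b 0| <= `|a - b|.
  have h1 := ler_norm (a - b); have h2 := ler_norm (b - a); rewrite distrC in h2.
  have h3 := normr_ge0 (a - b).
  by rewrite ler_norml; case: (leP a 0) => ha; case: (leP b 0) => hb; apply/andP; split; lra.
apply: (le_trans (mx _ _)); rewrite (_ : _ - _ = - ((\sum_i `|(x + v) 0 i|) - \sum_i `|x 0 i|)); last by ring.
by rewrite normrN.
Qed.

Lemma tent_good : good (1 * (1 + 1 ^+ 2) ^+ n) tent.
Proof. by apply: csupp_good; [exact: ler01|exact: continuous_tent|exact: tent_csupp|exact: tent_norm]. Qed.

Lemma RI_tent_gt0 : 0 < RI tent.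
Proof.
rewrite -lte_fin -(intn_RI tent_good tent_ge0).
have half01 : 0 <= (2^-1 : R) < 1 by rewrite invr_ge0 ler0n /= invf_lt1 ?ltr1n.
have h20 : 0 < 2^-1 :> R by rewrite invr_gt0.
have [M hM] := geo_choose half01 (ler0n R n) h20; have {}hM := hM M (leqnn _); rewrite exprVn in hM.
have pM : 0 < 2 ^+ M :> R by rewrite exprn_gt0.
pose w (k : 'rV[int]_n) : \bar R := ((2^-1)%:E * ((k == 0)%:R : R)%:E)%E.
apply: (@lt_le_trans _ _ (lat M w)).
  have -> : lat M w = ((2^-1)%:E * ((2 ^- M) ^+ n)%:E)%E.
    rewrite latZ ?(ltW h20) //.
    have := @lat_anc R n M M 0 (leqnn _); rewrite subnn.
    by under eq_fun do rewrite anc0; move=> ->.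
  by rewrite -EFinM lte_fin mulr_gt0 // exprn_gt0 // invr_gt0.
apply: intn_ge_lat => [k|x]; first by rewrite mule_ge0 // lee_fin // ltW.
rewrite /w -EFinM lee_fin; case: eqP => [/rowP fx|_]; last by rewrite mulr0 tent_ge0.
rewrite mulr1 /tent le_max; apply/orP; left.
suff : \sum_i `|x 0 i| <= n%:R * 2 ^- M by move: hM; lra.
rewrite -[n in leRHS]card_ord mulr_natl -sumr_const; apply: ler_sum => i _.
have := fx i; rewrite !mxE => fi; have /andP[a1 a2] := floor_itv (2 ^+ M * x 0 i).
rewrite fi in a1 a2; rewrite -(ler_pM2l pM) mulfV ?gt_eqF // -{1}(gtr0_norm pM) -normrM.
by rewrite ger0_norm //; move: a2; rewrite add0r => /ltW.
Qed.

End Tent.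

(** * The wavelet expansion of the tent function *)

Section Expansion.
Context {R : realType} {n : nat} (n0 : (0 < n)%N).
Context (phi : 'rV[R]_n -> R) (psi : 'I_(2 ^ n - 1) -> 'rV[R]_n -> R).
Local Notation I := (option ('I_(2 ^ n - 1) * nat)).
Implicit Types (x : 'rV[R]_n) (k : 'rV[int]_n) (ix : I).

(** Together with [lev] and [amp] this gives translates of the scaling function and wavelets one
    common format, [wavE]. *)
Definition gen ix : 'rV[R]_n -> R := if ix is Some p then psi p.1 else phi.
Definition lev ix : nat := if ix is Some p then p.2 else 0%N.
Definition amp ix : R := if ix is Some p then powR 2 (p.2%:R * n%:R / 2) else 1.
Local Notation wav := (wav_fun phi psi).

Lemma wavE ix k x : wav ix k x = amp ix * gen ix ((2 ^+ lev ix : R) *: x - zpt R k).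
Proof. by case: ix => [[l j]|] //=; rewrite expr0 scale1r mul1r. Qed.

Lemma amp_gt0 ix : 0 < amp ix.
Proof. by case: ix => [[l j]|] //=; rewrite powR_gt0. Qed.

Lemma amp_sqr ix : amp ix * amp ix = (2 ^+ lev ix) ^+ n.
Proof.
case: ix => [[l j]|] /=; last by rewrite mulr1 expr0 expr1n.
rewrite -powRD ?pnatr_eq0 ?implybT // (_ : _ + _ = (j * n)%N%:R); last by rewrite natrM; field.
by rewrite powR_mulrn // exprM.
Qed.

Context (S : nat) (M : R) (M0 : 0 <= M).
Context (cgen : forall ix, continuous (gen ix)) (sgen : forall ix, csupp S%:R (gen ix)).
Context (bgen : forall ix x, `|gen ix x| <= M) (Cg : R) (gen_good : forall ix, good Cg (gen ix)).
Context (mom : forall l, RI (psi l) = 0).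
Context (ortho : forall ix k ix' k', RI (fun x => wav ix k x * wav ix' k' x) = ((ix == ix') && (k == k'))%:R).

Lemma wav_good ix k : exists C, good C (wav ix k).
Proof.
have p0 : 0 < 2 ^+ lev ix :> R by rewrite exprn_gt0.
have [D gD] := good_affine (- zpt R k) p0 (gen_good ix).
exists (`|amp ix| * D); apply: eq_good (goodZ (amp ix) gD) => x; by rewrite wavE.
Qed.

Lemma wav_norm ix k x : `|wav ix k x| <= amp ix * M.
Proof. by rewrite wavE normrM gtr0_norm ?amp_gt0 // ler_wpM2l // ltW ?amp_gt0. Qed.

Lemma wav_supp ix k x : wav ix k x != 0 -> inbox S%:R ((2 ^+ lev ix : R) *: x - zpt R k).
Proof.
move=> h; apply: contrapT => nb; move/eqP: h; apply.
by rewrite wavE sgen // mulr0.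
Qed.

Definition wcoef ix k : R := RI (fun x => tent x * wav ix k x).

Lemma wcoef_out ix k : ~ near (2 ^ lev ix + S) k 0 -> wcoef ix k = 0.
Proof.
move=> nk; rewrite /wcoef -[RHS](@RI0 R n); apply: eq_RI => x.
have [wx|/wav_supp wx] := eqVneq (wav ix k x) 0; first by rewrite wx mulr0.
case: (pselect (inbox 1 x)) => [bx|nb]; last by rewrite tent_csupp ?mul0r.
exfalso; apply: nk => i; rewrite mxE subr0 -(ler_int R) intr_norm.
have := wx i; rewrite !mxE => h1; have h2 := bx i.
have p0 : 0 < 2 ^+ lev ix :> R by rewrite exprn_gt0.
rewrite PoszD intrD -!pmulrn natrX.
have := ler_normB (2 ^+ lev ix * x 0 i) (2 ^+ lev ix * x 0 i - (k 0 i)%:~R).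
rewrite subKr normrM gtr0_norm // => h3; apply: (le_trans h3); rewrite lerD //.
by rewrite ler_piMr // ltW.
Qed.

(** A finite list containing every index with a nonzero coefficient; [undup] ensures that each
    occurs once, as orthonormality requires. *)
Definition wks ix : seq 'rV[int]_n := undup (boxseq (2 ^ lev ix + S)).

Lemma mem_wks ix k : near (2 ^ lev ix + S) k 0 -> k \in wks ix.
Proof. by move=> h; rewrite mem_undup; exact: mem_boxseq. Qed.

Lemma wks_near ix k : k \in wks ix -> near (2 ^ lev ix + S) k 0.
Proof.
rewrite mem_undup => /mapP[f _ ->] i; rewrite !mxE subr0 ler_norml.
have := ltn_ord (f i); move: (f i : nat) => m; rewrite ltnS => hm.
by apply/andP; split; move: hm; clear; lia.
Qed.

Definition wpart ix x : R := \sum_(k <- wks ix) wcoef ix k * wav ix k x.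

Lemma wpart_csupp ix : csupp (2 * S + 1)%N%:R (wpart ix).
Proof.
move=> x nb; rewrite /wpart big_seq big1 // => k /wks_near kn.
have [->|/wav_supp wx] := eqVneq (wav ix k x) 0; first by rewrite mulr0.
exfalso; apply: nb => i; have := wx i; rewrite !mxE => h1.
have := kn i; rewrite mxE subr0 -(ler_int R) intr_norm PoszD intrD -!pmulrn natrX => h2.
have p1 : 1 <= 2 ^+ lev ix :> R by rewrite exprn_ege1 // ler1n.
have p0 : 0 < 2 ^+ lev ix :> R by apply: lt_le_trans p1.
have := ler_normD (2 ^+ lev ix * x 0 i - (k 0 i)%:~R) (k 0 i)%:~R; rewrite subrK normrM gtr0_norm // => h3.
rewrite -(ler_pM2l p0) natrD natrM.
have : S%:R <= 2 ^+ lev ix * S%:R :> R by rewrite ler_peMl.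
by move: h1 h2 h3; lra.
Qed.

Lemma continuous_wpart ix : continuous (wpart ix).
Proof.
apply: continuous_sumf => k _; apply: continuous_mulf; first exact: continuous_cstf.
by have [C []] := wav_good ix k.
Qed.

Lemma wpart_bounded ix : exists2 C : R, 0 <= C & forall x, `|wpart ix x| <= C.
Proof.
exists (\sum_(k <- wks ix) `|wcoef ix k| * (amp ix * M)).
  by apply: sumr_ge0 => k _; rewrite !mulr_ge0 // ltW // amp_gt0.
move=> x; rewrite (le_trans (ler_norm_sum _ _ _)) //; apply: ler_sum => k _.
by rewrite normrM ler_wpM2l // wav_norm.
Qed.

Lemma wpart_good ix : exists C, good C (wpart ix).
Proof.
have [C _ HC] := wpart_bounded ix; eexists.
exact: (csupp_good (ler0n _ _) (@continuous_wpart ix) (@wpart_csupp ix) HC).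
Qed.

(** The zero mean of [psi] permits subtracting the tent's value at one point of the support, and the
    Lipschitz bound gives the factor [2 ^- j]. *)
Lemma wcoef_le l j k : `|wcoef (Some (l, j)) k| <= (amp (Some (l, j)))^-1 * (n%:R * S%:R * Cg * pi ^+ n * 2^-1 ^+ j).
Proof.
set ix := Some (l, j); have a0 := amp_gt0 ix.
have p0 : 0 < 2 ^+ j :> R by rewrite exprn_gt0.
pose F y := tent (2 ^- j *: (y + zpt R k)) * gen ix y.
have ct : continuous (fun y : 'rV[R]_n => tent (2 ^- j *: (y + zpt R k))).
  apply: (@continuous_compf _ _ _ tent (fun y : 'rV[R]_n => 2 ^- j *: (y + zpt R k))) => //; first exact: continuous_tent.
  apply: rV_continuous => i; apply: (@eq_continuous _ _ (fun y : 'rV[R]_n => 2 ^- j * (y 0 i + zpt R k 0 i))).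
    by move=> y; rewrite !mxE.
  apply: continuous_mulf; first exact: continuous_cstf.
  by apply: continuous_addf; [exact: continuous_coord|exact: continuous_cstf].
have gF : good (Cg * 1) F.
  by apply: eq_good (goodM (gen_good ix) ct (fun y => tent_norm _)) => y; rewrite mulrC.
have E : wcoef ix k = (amp ix)^-1 * RI F.
  have -> : wcoef ix k = amp ix * RI (fun x => F ((2 ^+ j : R) *: x + - zpt R k)).
    have [D gD] := good_affine (- zpt R k) p0 gF.
    rewrite /wcoef -(RIZ _ gD); apply: eq_RI => x; rewrite wavE /F subrK scalerA mulVf ?gt_eqF // scale1r.
    by rewrite mulrCA.
  rewrite (RI_affine _ p0 gF) mulrA; congr (_ * _).
  have := amp_sqr ix; rewrite /= exprAC => <-; field.
  by rewrite gt_eqF.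
rewrite E normrM ger0_norm ?invr_ge0 ?(ltW a0) // ler_wpM2l ?invr_ge0 ?(ltW a0) //.
pose c := tent (2 ^- j *: zpt R k).
have -> : RI F = RI (fun y => F y - c * gen ix y).
  by rewrite (RIB gF (goodZ c (gen_good ix))) (RIZ _ (gen_good ix)) /= mom mulr0 subr0.
have gd : good (n%:R * S%:R * 2^-1 ^+ j * Cg) (fun y => F y - c * gen ix y).
  split.
    apply: continuous_addf; first by case: gF.
    by apply: continuous_oppf; apply: continuous_mulf => //; exact: continuous_cstf.
  move=> y; rewrite /F -mulrBl normrM.
  case: (pselect (inbox S%:R y)) => [by_|nb]; last first.
    by rewrite (sgen _ nb) normr0 mulr0 !mulr_ge0 ?exprn_ge0 ?invr_ge0 ?maj_ge0 ?(good_ge0 (gen_good ix)).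
  have [_ gg] := gen_good ix; rewrite -[leRHS]mulrA ler_pM //.
  have iv : inbox (S%:R * 2^-1 ^+ j) (2 ^- j *: y).
    by move=> i; rewrite mxE normrM exprVn ger0_norm ?invr_ge0 ?(ltW p0) // mulrC ler_wpM2r ?invr_ge0 ?(ltW p0).
  by have := tent_lip (2 ^- j *: zpt R k) iv; rewrite -scalerDr [zpt R k + y]addrC mulrA.
by apply: (le_trans (RI_bound gd)); apply: le_of_eq; ring.
Qed.

(** At a given point at most [(2 S + 3) ^ n] translates at one level are nonzero, and their
    amplitude cancels against that of the coefficient. *)
Lemma wpart_le : exists2 C : R, 0 <= C & forall l j x, `|wpart (Some (l, j)) x| <= C * 2^-1 ^+ j.
Proof.
have [C1 EC1] : exists C1 : R, C1 = n%:R * S%:R * Cg * pi ^+ n by eexists.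
have Cg0 : 0 <= Cg := good_ge0 (gen_good None).
have C10 : 0 <= C1 by rewrite EC1 !mulr_ge0 ?exprn_ge0 ?pi_ge0.
exists ((size (boxseq (n := n) S.+1))%:R * (C1 * M)); first by rewrite !mulr_ge0.
move=> l j x; set ix := Some (l, j).
have a0 := amp_gt0 ix.
rewrite (le_trans (ler_norm_sum _ _ _)) //.
pose k0 := flr j x.
have nk k : wav ix k x != 0 -> near S.+1 k k0.
  move=> /wav_supp wx i; have := wx i; rewrite !mxE /= => h.
  have /andP[f1 f2] := floor_itv (2 ^+ j * x 0 i).
  rewrite -(ler_int R) intr_norm intrB -[(S.+1)%:~R]/(S.+1%:R) -natr1.
  rewrite intrD in f2; move: h; rewrite !ler_norml => /andP[h1 h2].
  by apply/andP; split; lra.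
pose D := C1 * M * 2^-1 ^+ j.
have D0 : 0 <= D by rewrite !mulr_ge0 ?exprn_ge0 ?invr_ge0.
pose F := [seq k <- wks ix | wav ix k x != 0].
apply: (@le_trans _ _ (\sum_(k <- F) D)).
  rewrite /F big_filter [leRHS]big_mkcond; apply: ler_sum => k _.
  have [->|_] := eqVneq (wav ix k x) 0; first by rewrite mulr0 normr0.
  rewrite normrM; apply: (le_trans (ler_pM (normr_ge0 _) (normr_ge0 _) (wcoef_le l j k) (wav_norm ix k x))).
  rewrite -EC1 /D -/ix; apply: le_of_eq; field; by rewrite gt_eqF.
rewrite big_const_seq count_predT iter_addr_0 -[leLHS]mulr_natl -mulrA -/D ler_wpM2r // ler_nat.
rewrite -(size_map (fun v => v + k0) (boxseq S.+1)); apply: uniq_leq_size.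
  by rewrite filter_uniq // undup_uniq.
move=> k; rewrite mem_filter => /andP[/nk kk _]; apply/mapP; exists (k - k0); last by rewrite subrK.
by apply: mem_boxseq => i; have := kk i; rewrite !mxE subr0.
Qed.

Lemma RI_wpart_wav ix ix' k' : RI (fun x => wpart ix x * wav ix' k' x) = (ix == ix')%:R * wcoef ix' k'.
Proof.
have /choice [D gD] : forall k, exists C : R, good C (fun x => wcoef ix k * (wav ix k x * wav ix' k' x)).
  move=> k; have [C gC] := wav_good ix k; have [C' [cw _]] := wav_good ix' k'.
  by eexists; apply: goodZ; apply: goodM gC cw (wav_norm ix' k').
transitivity (\sum_(k <- wks ix) wcoef ix k * ((ix == ix') && (k == k'))%:R).
  transitivity (RI (fun x => \sum_(k <- wks ix) wcoef ix k * (wav ix k x * wav ix' k' x))).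
    by apply: eq_RI => x; rewrite /wpart mulr_suml; apply: eq_bigr => k _; rewrite mulrA.
  rewrite (@RI_sum _ _ _ _ _ D) //; apply: eq_bigr => k _; rewrite -ortho.
  have [C gC] := wav_good ix k; have [C' [cw _]] := wav_good ix' k'.
  exact: (RIZ _ (goodM gC cw (wav_norm ix' k'))).
have [<-|ne] := eqVneq ix ix'; last by rewrite mul0r big1 // => k _; rewrite mulr0.
rewrite mul1r /=; case: (boolP (k' \in wks ix)) => kin.
  rewrite (bigD1_seq k') ?undup_uniq //= eqxx mulr1 big1 ?addr0 // => k /negPf ->.
  by rewrite mulr0.
have -> : wcoef ix k' = 0 by apply: wcoef_out => h; move/negP: kin; apply; exact: mem_wks.
rewrite big_seq big1 // => k kin'; case: eqP => [E|_]; last by rewrite mulr0.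
by rewrite -E kin' in kin.
Qed.

Lemma RI_wpart ix : RI (gen ix) = 0 -> RI (wpart ix) = 0.
Proof.
move=> g0; have p0 : 0 < 2 ^+ lev ix :> R by rewrite exprn_gt0.
have /choice [D gD] : forall k, exists C : R, good C (fun x => wcoef ix k * wav ix k x).
  by move=> k; have [C gC] := wav_good ix k; eexists; apply: goodZ; exact: gC.
rewrite (@RI_sum _ _ _ _ _ D) // big1 // => k _.
have [C gC] := wav_good ix k; rewrite (RIZ _ gC).
have -> : RI (wav ix k) = amp ix * ((2 ^+ lev ix) ^- n * RI (gen ix)).
  have [E gE] := good_affine (- zpt R k) p0 (gen_good ix).
  rewrite -(RI_affine (- zpt R k) p0 (gen_good ix)) -(RIZ _ gE).
  by apply: eq_RI => x; rewrite wavE.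
by rewrite g0 !mulr0.
Qed.

(** Indices are shifted by one: 0 is the scaling part, [j + 1] gathers the wavelets of level [j]. *)
Definition wsum (j : nat) x : R :=
  if j is j'.+1 then \sum_l wpart (Some (l, j')) x else wpart None x.

Lemma continuous_wsum j : continuous (wsum j).
Proof.
case: j => [|j]; first exact: continuous_wpart.
by apply: continuous_sumf => l _; exact: continuous_wpart.
Qed.

Lemma wsum_csupp j : csupp (2 * S + 1)%N%:R (wsum j).
Proof.
by move=> x nb; case: j => [|j] /=; [rewrite wpart_csupp|rewrite big1 // => l _; rewrite wpart_csupp].
Qed.

Lemma wsum_le : exists2 C : R, 0 <= C & forall j x, `|wsum j x| <= C * 2^-1 ^+ j.
Proof.
have [C1 C10 H1] := wpart_bounded None; have [C2 C20 H2] := wpart_le.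
have N2 : 0 <= 2 * (2 ^ n - 1)%N%:R * C2 by rewrite !mulr_ge0.
exists (C1 + 2 * (2 ^ n - 1)%N%:R * C2); first by rewrite addr_ge0.
case=> [|j] x /=; first by rewrite expr0 mulr1 (le_trans (H1 x)) // lerDl.
rewrite (le_trans (ler_norm_sum _ _ _)) //.
apply: (@le_trans _ _ (\sum_(l < 2 ^ n - 1) C2 * 2^-1 ^+ j)); first by apply: ler_sum => l _; exact: H2.
rewrite sumr_const card_ord -[leLHS]mulr_natl exprS.
have p0 : 0 <= (2^-1 : R) ^+ j by rewrite exprn_ge0 ?invr_ge0.
have : 0 <= C1 * (2^-1 * 2^-1 ^+ j) by rewrite !mulr_ge0 ?invr_ge0.
set y := (2^-1 : R) ^+ j in p0 *; have -> : (C1 + 2 * (2 ^ n - 1)%N%:R * C2) * (2^-1 * y) =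
  C1 * (2^-1 * y) + (2 ^ n - 1)%N%:R * (C2 * y) by field.
by rewrite lerDr.
Qed.

Lemma RI_wsum_wav j ix k : RI (fun x => wsum j x * wav ix k x) =
  (j == (if ix is Some p then p.2.+1 else 0%N))%:R * wcoef ix k.
Proof.
case: j => [|j] /=; first by rewrite RI_wpart_wav; case: ix => [[l j]|] //=; rewrite ?eqxx.
have /choice [D gD] : forall l, exists C : R, good C (fun x => wpart (Some (l, j)) x * wav ix k x).
  move=> l; have [C gC] := wpart_good (Some (l, j)); have [C' [cw _]] := wav_good ix k.
  by eexists; apply: goodM gC cw (wav_norm ix k).
transitivity (\sum_l RI (fun x => wpart (Some (l, j)) x * wav ix k x)).
  rewrite -(@RI_sum _ _ _ _ _ D) //; apply: eq_RI => x; exact: mulr_suml.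
under eq_bigr do rewrite RI_wpart_wav.
rewrite -mulr_suml; congr (_ * _); case: ix {D gD} => [[l' j']|] /=; last by rewrite big1.
have [->|ne] := eqVneq j j'.
  rewrite eqxx (bigD1 l') //= eqxx big1 ?addr0 // => l nl.
  by case: eqP => // -[E]; rewrite E eqxx in nl.
by rewrite eqSS (negPf ne) big1 // => l _; case: eqP => // -[_ E]; rewrite E eqxx in ne.
Qed.

Context (complete : forall g, L2fun g -> (forall ix k, Rintn (fun x => g x * wav ix k x) = 0) ->
  intn (fun x => (g x ^+ 2)%:E) = 0%E).

(* If phi had integral zero, so would every wavelet, hence also the tent function,
   whose wavelet expansion converges uniformly on a fixed compact set. *)
Lemma RI_scaling_neq0 : RI phi != 0.
Proof.
apply/negP => /eqP phi0.
have gen0 ix : RI (gen ix) = 0 by case: ix => [[l j]|] //=.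
have [C C0 HC] := wsum_le.
have half01 : 0 <= (2^-1 : R) < 1 by rewrite invr_ge0 ler0n /= invf_lt1 ?ltr1n.
pose T N x := \sum_(j < N) wsum j x.
have /choice [G cG] : forall x, exists y : R, T N x @[N --> \oo] --> y.
  by move=> x; exists (limn (T ^~ x)); exact: (geo_series_cvg half01 (HC ^~ x)).
have h1 : 1 - 2^-1 = 2^-1 :> R by field.
have tl J x : `|G x - T J x| <= 2 * C * 2^-1 ^+ J.
  apply: (le_trans (geo_tail J half01 (HC ^~ x) (cG x))); rewrite h1 invrK; apply: le_of_eq; ring.
have cT J : continuous (T J) by apply: continuous_sumf => j _; exact: continuous_wsum.
have contG : continuous G.
  move=> x; apply/(@cvgrPdist_lt R R _ _ (nbhs_filter x)) => e e0.
  have e30 : 0 < e / 4 by rewrite divr_gt0.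
  have TD : 0 <= 2 * C by rewrite mulr_ge0.
  have [J /(_ J (leqnn J)) hJ] := geo_choose half01 TD e30.
  have /(@cvgrPdist_lt R R _ _ (nbhs_filter x)) /(_ _ e30) := cT J x.
  apply: filterS => y hy; have := tl J x; have := tl J y.
  have -> : G x - G y = (G x - T J x) + (T J x - T J y) - (G y - T J y) by ring.
  have := ler_normB ((G x - T J x) + (T J x - T J y)) (G y - T J y).
  have := ler_normD (G x - T J x) (T J x - T J y).
  move: hy hJ; lra.
pose B : R := (2 * S + 1)%N%:R; have B0 : 0 <= B by [].
have B1 : 1 <= B by rewrite ler1n addn1.
have sT N : csupp B (T N) by move=> x nb; rewrite /T big1 // => j _; rewrite wsum_csupp.
have st : csupp B (@tent R n) by move=> x nb; apply: tent_csupp => h; apply: nb; exact: inbox_le h.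
have T0 x : T 0%N x = 0 by rewrite /T big_ord0.
have GB x : `|G x| <= 2 * C by have := tl 0%N x; rewrite T0 subr0 expr0 mulr1.
have TB N x : `|T N x| <= 4 * C.
  have := tl N x; have := GB x; have := ler_normB (G x) (G x - T N x); rewrite subKr.
  have : 2 * C * 2^-1 ^+ N <= 2 * C by rewrite ler_piMr ?mulr_ge0 // exprn_ile1 ?invr_ge0 // invf_le1 // ler1n.
  lra.
have sG : csupp B G.
  move=> x nb; have c0 : (fun _ : nat => 0 : R) N @[N --> \oo] --> (0 : R) by exact: cvg_cst.
  have cx : T N x @[N --> \oo] --> (0 : R).
    by apply: cvg_trans c0; apply: near_eq_cvg; near=> N; rewrite sT.
  exact: (norm_cvg_unique (cG x) cx).
pose E N x := tent x - T N x.
pose g x := tent x - G x.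
have Cb : 0 <= 1 + 4 * C by rewrite addr_ge0 // mulr_ge0.
have EB N x : `|E N x| <= 1 + 4 * C.
  by rewrite (le_trans (ler_normB _ _)) // lerD // tent_norm.
have gB x : `|g x| <= 1 + 4 * C.
  by rewrite (le_trans (ler_normB _ _)) // lerD ?tent_norm // (le_trans (GB x)) // ler_wpM2r // ler_nat.
have cE N : continuous (E N) by apply: continuous_addf; [exact: continuous_tent|exact: continuous_oppf].
have cg : continuous g by apply: continuous_addf; [exact: continuous_tent|exact: continuous_oppf].
have sE N : csupp B (E N) by move=> x nb; rewrite /E st // sT // subr0.
have sg : csupp B g by move=> x nb; rewrite /g st // sG // subr0.
have gdE N := csupp_good B0 (@cE N) (sE N) (EB N).
have gdg := csupp_good B0 cg sg gB.
have Ecv x : E N x @[N --> \oo] --> g x by apply: cvgB; [exact: cvg_cst|exact: cG].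
have orth ix k : RI (fun x => g x * wav ix k x) = 0.
  have [C' [cw _]] := wav_good ix k.
  have lim : RI (fun x => E N x * wav ix k x) @[N --> \oo] --> RI (fun x => g x * wav ix k x).
    apply: RI_dct.
    - by move=> N; exact: goodM (gdE N) cw (wav_norm ix k).
    - exact: goodM gdg cw (wav_norm ix k).
    - by move=> x; apply: cvgM; [exact: Ecv|exact: cvg_cst].
  pose m := if ix is Some p then p.2.+1 else 0%N.
  have ev N : (m < N)%N -> RI (fun x => E N x * wav ix k x) = 0.
    move=> mN; have gt := goodM tent_good cw (wav_norm ix k).
    have /choice [D gD] : forall j, exists C : R, good C (fun x => wsum j x * wav ix k x).
      move=> j; have gj := csupp_good B0 (@continuous_wsum j) (@wsum_csupp j) (fun x => HC j x).
      by eexists; exact: (goodM gj cw (wav_norm ix k)).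
    have gs := @good_sum _ _ 'I_N (index_enum 'I_N) xpredT (fun j => D j) (fun j x => wsum j x * wav ix k x) (fun j _ => gD j).
    transitivity (RI (fun x => tent x * wav ix k x - \sum_(j < N) wsum j x * wav ix k x)).
      by apply: eq_RI => x; rewrite /E mulrBl mulr_suml.
    rewrite (RIB gt gs) (@RI_sum _ _ _ _ _ (fun j : 'I_N => D j)) //.
    under eq_bigr do rewrite RI_wsum_wav -/m.
    rewrite (bigD1 (Ordinal mN)) //= eqxx mul1r big1 ?addr0 ?subrr // => j jm.
    by case: eqP => [jE|_]; [case/eqP: jm; exact/val_inj|rewrite mul0r].
  have c0 : (fun _ : nat => 0 : R) N @[N --> \oo] --> (0 : R) by exact: cvg_cst.
  have cx : RI (fun x => E N x * wav ix k x) @[N --> \oo] --> (0 : R).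
    by apply: cvg_trans c0; apply: near_eq_cvg; near=> N; rewrite ev //; near: N; exact: nbhs_infty_gt.
  exact: (norm_cvg_unique lim cx).
have gg2 := goodM gdg cg gB.
have g2E : (fun x => (g x ^+ 2)%:E) = (fun x => (g x * g x)%:E) by apply/funext => x; rewrite expr2.
have g2i : intn (fun x => (g x ^+ 2)%:E) = (RI (fun x => g x * g x))%:E.
  by rewrite g2E; apply: intn_RI gg2 _ => x; rewrite -expr2 sqr_ge0.
have g20 : RI (fun x => g x * g x) = 0.
  apply/eqP; rewrite -eqe -g2i complete //.
    split; last by rewrite g2i ltry.
    move=> U oU; apply: sub_sigma_algebra; move/continuousP: cg; exact.
  move=> ix k; have [C' [cw _]] := wav_good ix k.
  by rewrite (Rintn_RI (goodM gdg cw (wav_norm ix k))) orth.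
(* Passing from [RI (g ^ 2) = 0] to [RI g = 0] without almost-everywhere arguments:
   [|g| <= e maj + (D / e) g ^ 2] holds pointwise, and [e] is arbitrary. *)
have gI : RI g = 0.
  pose D := (1 + B ^+ 2) ^+ n; have D0 : 0 < D by rewrite exprn_gt0 // ltr_wpDr // sqr_ge0.
  have bd (e : R) : 0 < e -> `|RI g| <= e * pi ^+ n.
    move=> e0; have ng := good_norm gdg.
    have gm := goodZ e (@good_maj R n).
    have gz := goodZ (D / e) gg2.
    apply: (le_trans (RI_norm gdg)).
    have -> : e * pi ^+ n = RI (fun x => e * maj x + D / e * (g x * g x)).
      by rewrite (RID gm gz) (RIZ _ (@good_maj R n)) RI_maj (RIZ _ gg2) g20 mulr0 addr0.
    apply: (RI_le ng (goodD gm gz)) => x.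
    case: (pselect (inbox B x)) => [bx|nb]; last first.
      by rewrite /g st // sG // subrr normr0 mul0r mulr0 addr0 mulr_ge0 ?maj_ge0 // ltW.
    have mD := maj_box bx; rewrite -/D in mD.
    have p1 : 0 <= D / e * (g x * g x) by rewrite mulr_ge0 ?divr_ge0 ?(ltW D0) ?(ltW e0) // -expr2 sqr_ge0.
    case: (leP `|g x| (e * maj x)) => h; first by rewrite (le_trans h) // lerDl.
    apply: (@le_trans _ _ (D / e * (g x * g x))); last by rewrite lerDr mulr_ge0 ?maj_ge0 // ltW.
    rewrite -expr2 -real_normK ?num_real // expr2 mulrA ler_peMl //.
    rewrite mulrAC ler_pdivlMr // mul1r; apply: (@le_trans _ _ (D * (e * maj x))).
      by rewrite mulrCA ler_peMr // ltW.
    by rewrite ler_wpM2l ?(ltW D0) // ltW.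
  apply/eqP; rewrite -normr_le0; apply/ler_addgt0Pr => e e0; rewrite add0r.
  have pin : 0 < pi ^+ n :> R by rewrite exprn_gt0 // pi_gt0.
  have := bd _ (divr_gt0 e0 pin); by rewrite divfK ?gt_eqF.
(* All partial sums have integral 0, so subtracting them never lowers the integral of the tent. *)
have IE N : RI (E N) = RI (@tent R n).
  have /choice [D gD] : forall j, exists C : R, good C (wsum j).
    by move=> j; eexists; exact: (csupp_good B0 (@continuous_wsum j) (@wsum_csupp j) (fun x => HC j x)).
  have gs := @good_sum _ _ 'I_N (index_enum 'I_N) xpredT (fun j => D j) (fun j x => wsum j x) (fun j _ => gD j).
  rewrite (RIB tent_good gs) (@RI_sum _ _ _ _ _ (fun j : 'I_N => D j)) // big1 ?subr0 // => j _.
  case: (nat_of_ord j) => [|j'] /=; first exact: RI_wpart.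
  have /choice [D' gD'] : forall l, exists C : R, good C (wpart (Some (l, j'))) by move=> l; exact: wpart_good.
  by rewrite (@RI_sum _ _ _ _ _ D') // big1 // => l _; apply: RI_wpart.
have lim2 : RI (E N) @[N --> \oo] --> RI g by apply: RI_dct => //.
have c0 : (fun _ : nat => RI (@tent R n)) N @[N --> \oo] --> RI (@tent R n) by exact: cvg_cst.
have cx : RI (E N) @[N --> \oo] --> RI (@tent R n).
  by apply: cvg_trans c0; apply: near_eq_cvg; near=> N; rewrite IE.
have := norm_cvg_unique lim2 cx; rewrite gI => t0.
by have := @RI_tent_gt0 R n; rewrite -t0 ltxx.
Unshelve. all: by end_near. Qed.

End Expansion.

(** * The scaling function of a Daubechies system has nonzero integral *)

Section Daubechies.
Context {R : realType} {n : nat} (n0 : (0 < n)%N).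
Implicit Types (u : 'rV[R]_n -> R).

Lemma compact_support_data u : continuous u -> compact_support u ->
  exists S : nat, exists2 M : R, 0 <= M & csupp S%:R u /\ forall x, `|u x| <= M.
Proof.
move=> cu [B HB]; have S0 : 0 <= `|B| by [].
have sp : csupp (Num.bound `|B|)%:R u.
  move=> x nb; apply: HB; rewrite ltNge; apply/negP => h; apply: nb.
  apply: inbox_le (inbox_enorm x); apply: (le_trans h); apply: (le_trans (ler_norm _)).
  exact/ltW/archi_boundP.
have [M HM] := csupp_continuous_bounded n0 cu sp.
by exists (Num.bound `|B|), M => //; exact: le_trans (HM 0).
Qed.

Lemma Ck_continuous k u : Ck k u -> continuous u.
Proof. by case=> _ /(_ [::] isT). Qed.

Lemma daubechies_RI_neq0 (L : nat) phi (psi : 'I_(2 ^ n - 1) -> 'rV[R]_n -> R) : daubechies L phi psi -> RI phi != 0.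
Proof.
move=> [[Cphi sphi] Cpsi mom ortho complete].
have cphi := Ck_continuous Cphi.
have cpsi l : continuous (psi l) by case: (Cpsi l) => h _; exact: Ck_continuous h.
have [S1 [M1 M10 [sp1 bd1]]] := compact_support_data cphi sphi.
have /choice [F HF] : forall l, exists p : nat * R, [/\ 0 <= p.2, csupp p.1%:R (psi l) & forall x, `|psi l x| <= p.2].
  move=> l; have [S [M M0 [sp bd]]] := compact_support_data (@cpsi l) (Cpsi l).2.
  by exists (S, M).
pose S := (S1 + \sum_l (F l).1)%N; pose M := M1 + \sum_l (F l).2.
have F0 : 0 <= \sum_l (F l).2 by apply: sumr_ge0 => l _; case: (HF l).
have M0 : 0 <= M by rewrite addr_ge0.
have cgen ix : continuous (gen phi psi ix) by case: ix => [[l j]|] //=.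
have csup_le (b c : R) u : b <= c -> csupp b u -> csupp c u.
  by move=> bc su x nb; apply: su => h; apply: nb; exact: inbox_le h.
have sgen ix : csupp S%:R (gen phi psi ix).
  case: ix => [[l j]|] /=; last by apply: csup_le sp1; rewrite ler_nat leq_addr.
  case: (HF l) => _ h _; apply: csup_le h; rewrite ler_nat /S (bigD1 l) //= addnCA; exact: leq_addr.
have bgen ix x : `|gen phi psi ix x| <= M.
  case: ix => [[l j]|] /=; last by rewrite (le_trans (bd1 x)) // lerDl.
  case: (HF l) => _ _ h; rewrite (le_trans (h x)) // /M (bigD1 l) //= addrCA lerDl addr_ge0 //.
  by apply: sumr_ge0 => l' _; case: (HF l').
have ggen ix := csupp_good (ler0n R S) (@cgen ix) (sgen ix) (bgen ix).
have momR l : RI (psi l) = 0.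
  have := mom l (fun _ => 0%N); rewrite big1 // => /(_ (leq0n _)) <-.
  rewrite -(Rintn_RI (ggen (Some (l, 0%N)))); congr Rintn; apply/funext => x /=.
  by rewrite /monomial big1 ?mul1r.
have orthoR ix k ix' k' : RI (fun x => wav_fun phi psi ix k x * wav_fun phi psi ix' k' x) = ((ix == ix') && (k == k'))%:R.
  have := ortho ix k ix' k'; have [C gC] := wav_good ggen ix k; have [C' [cw _]] := wav_good ggen ix' k'.
  by rewrite (Rintn_RI (goodM gC cw (wav_norm bgen ix' k'))) => ->; case: ifP.
exact: (RI_scaling_neq0 M0 cgen sgen bgen ggen momR orthoR complete).
Qed.

End Daubechies.

(** * The equivalences *)

Section Equivalences.
Context {R : realType} {n : nat} (n0 : (0 < n)%N).
Context (s : R) (s0 : 0 < s) (r : nat) (sr : s < r%:R) (q : R) (q0 : 0 < q).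
Implicit Types (f g h : 'rV[R]_n -> R) (x : 'rV[R]_n) (A B C e t : R).

(** Testing against real [t] above [E] replaces infima by competitors with real bounds; an infinite
    [E] is immediate. *)
Lemma le_scale_ereal (X E : \bar R) C : 0 < C -> (0 <= E)%E ->
  (forall t, (E < t%:E)%E -> (X <= (C * t)%:E)%E) -> (X <= C%:E * E)%E.
Proof.
move=> C0; case: E => [v| |] // v0 H; last by rewrite gt0_muley ?lte_fin // leey.
apply/lee_addgt0Pr => d d0; have vt : (v%:E < (v + d / C)%:E)%E by rewrite lte_fin ltrDl divr_gt0.
have := H _ vt; rewrite -EFinM -EFinD => /le_trans; apply; rewrite lee_fin mulrDr lerD2l.
by rewrite mulrC divfK // gt_eqF.
Qed.

Lemma Lam_norm_ge0 f : continuous f -> (0 <= Lam_norm s f)%E.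
Proof.
move=> cf; rewrite leNgt; apply/negP => neg.
have [v v0 lv] : exists2 v : R, v < 0 & (Lam_norm s f <= v%:E)%E.
  by move: neg; case: (Lam_norm s f) => [v| |] // hv; [exists v|exists (-1); rewrite ?ltrN10 ?leNye].
by have := LamB_ge0 (Lam_norm_LamB n0 cf lv); rewrite leNgt v0.
Qed.

Lemma inLambda_LamB f : inLambda s f -> exists A, LamB s A f.
Proof.
move=> [cf [_ lt]]; have [A lA] : exists A : R, (Lam_norm s f <= A%:E)%E.
  by move: lt; case: (Lam_norm s f) => [v| |] // _; [exists v|exists 0; rewrite leNye].
by exists A; exact: Lam_norm_LamB.
Qed.

Lemma LamB_inLambda A f : LamB s A f -> inLambda s f.
Proof.
move=> lf; have [cf fA _] := lf; split => //; split.
  apply: (@le_lt_trans _ _ A%:E); last exact: ltry.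
  by apply: ge_ereal_sup => _ [x _ <-]; rewrite lee_fin.
exact: le_lt_trans (LamB_norm_le lf) (ltry _).
Qed.

Lemma LamB_sub A B f g : LamB s A f -> LamB s B g -> LamB s (A + B) (fun y => f y - g y).
Proof.
move=> [cf fA dA] [cg gB dB]; split.
- by apply: continuous_addf => //; exact: continuous_oppf.
- by move=> x; rewrite (le_trans (ler_normB _ _)) // lerD.
- by move=> x y yy; rewrite diffkBf (le_trans (ler_normB _ _)) // mulrDl lerD ?dA ?dB.
Qed.

Lemma yint_mono (S S' : set ('rV[R]_n * R)) x (b : R) :
  (forall y, 0 < y <= b -> S (x, y) -> S' (x, y)) -> (yint S x b <= yint S' x b)%E.
Proof.
move=> H; rewrite /yint integral_mkcond [leRHS]integral_mkcond; apply: ge0_le_integralT => y.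
  by apply: erestrict_ge0 => z /= /andP[z0 _]; rewrite lee_fin divr_ge0 // ltW.
rewrite /patch; case: ifPn => // /set_mem /= yb; have [y0 _] := andP yb.
rewrite lee_fin ler_wpM2r ?invr_ge0 ?(ltW y0) // !indicE ler_nat.
case: (boolP ((x, y) \in S)) => // /set_mem yS.
by rewrite mem_set //; exact: H.
Qed.

(** The differences of [f - g] are at most [2 ^ r t y ^ s], which fits between the thresholds with
    factors 4 and 2. *)
Lemma Sset_transfer f g t : LamB s t (fun y => f y - g y) -> 0 < t ->
  forall x y, 0 < y <= 1 -> Sset r s f (4 * 2 ^+ r * t) (x, y) -> Sset r s g (2 * 2 ^+ r * t) (x, y).
Proof.
move=> lh t0 x y y01 /SsetP[y0 [h hy big]]; apply/SsetP; split => //; exists h => //.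
have h01 : 0 < enorm h <= 1 by rewrite hy.
have dh := LamB_diffk s0 sr lh x h01; rewrite diffkBf hy in dh.
have := ler_normD (diffk r h f x - diffk r h g x) (diffk r h g x); rewrite subrK => tri.
have ys := powR_ge0 y s; have P0 : 0 <= 2 ^+ r * t * powR y s by rewrite !mulr_ge0 ?exprn_ge0 // ltW.
move: big tri dh P0; rewrite -!mulrA; lra.
Qed.

Lemma distLam_ge0 f (V : set ('rV[R]_n -> R)) : continuous f -> (0 <= distLam s f V)%E.
Proof.
move=> cf; apply: le_ereal_inf_tmp => _ [g [_ [cg _]] <-]; apply: Lam_norm_ge0.
by apply: continuous_addf => //; exact: continuous_oppf.
Qed.

Lemma distLam_lt f (V : set ('rV[R]_n -> R)) t : continuous f -> (distLam s f V < t%:E)%E ->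
  0 < t /\ exists g, [/\ V g, exists A, LamB s A g & LamB s t (fun y => f y - g y)].
Proof.
move=> cf lt; split; first by rewrite -lte_fin; exact: le_lt_trans (distLam_ge0 V cf) lt.
have [_ [g [Vg gL] <-] ltg] := ereal_inf_lt lt; exists g; split => //; first exact: inLambda_LamB.
apply: (Lam_norm_LamB n0 _ (ltW ltg)); case: gL => cg _.
by apply: continuous_addf => //; exact: continuous_oppf.
Qed.

(** The competitor is [f - G], at distance [Lam_norm s G] from [f]; the factor 2 is that of
    [LamB_norm_le]. *)
Lemma distLam_le A B f (G : 'rV[R]_n -> R) (V : set ('rV[R]_n -> R)) : LamB s A f -> LamB s B G ->
  V (fun y => f y - G y) -> (distLam s f V <= (2 * B)%:E)%E.
Proof.
move=> lf lG VG; apply: le_trans (LamB_norm_le lG); apply: ereal_inf_lbound.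
exists (fun y => f y - G y).
  by split => //; apply: LamB_inLambda; exact: LamB_sub lf lG.
by congr Lam_norm; apply/funext => y /=; rewrite subKr.
Qed.

Section Coefficients.
Context (phi : 'rV[R]_n -> R) (cphi : continuous phi) (sphi : compact_support phi).

(** The scale [-1] turns the convolution into a correlation with [phi]. *)
Lemma coef_conv A f k : continuous f -> (forall y, `|f y| <= A) ->
  Rintn (fun x => phi (x - zpt R k) * f x) = conv phi (-1) f (zpt R k).
Proof.
move=> cf fA; have [Cp gp] := phi_good n0 cphi sphi.
have gF := good_convM (-1) (zpt R k) gp cf fA.
have [D gD] := good_affine (- zpt R k) ltr01 gp.
have gD' : good D (fun x => phi (x - zpt R k)) by apply: eq_good gD => x; rewrite scale1r.
rewrite (Rintn_RI (goodM gD' cf fA)) /conv -(RI_shift (- zpt R k) gF); apply: eq_RI => x.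
by rewrite scaleN1r opprK [zpt R k + _]addrC subrK.
Qed.

Lemma phi_maj2 : exists2 C : R, 0 <= C & forall z, `|phi z| <= C * maj z ^+ 2.
Proof.
have [S [M M0 [sS bM]]] := compact_support_data n0 cphi sphi.
pose D : R := (1 + S%:R ^+ 2) ^+ n; have D0 : 0 <= D by rewrite exprn_ge0 // addr_ge0 ?sqr_ge0.
exists (M * D ^+ 2); first by rewrite mulr_ge0 ?sqr_ge0.
move=> z; case: (pselect (inbox S%:R z)) => [bz|nb]; last first.
  by rewrite sS // normr0 !mulr_ge0 ?exprn_ge0 ?maj_ge0.
by rewrite -mulrA -exprMn (le_trans (bM z)) // ler_peMr // exprn_ege1 // maj_box.
Qed.

(** Lattice points of arbitrarily large norm exist because [n > 0], so none of the suprema is taken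
    over the empty set. *)
Lemma coef_limsup_ge0 f : (0 <= coef_limsup phi f)%E.
Proof.
apply: le_ereal_inf_tmp => _ [N _ <-].
pose k : 'rV[int]_n := const_mx N.+1%:Z.
apply: (@le_trans _ _ (`|Rintn (fun x => phi (x - zpt R k) * f x)|)%:E); first by rewrite lee_fin.
apply: ereal_sup_ubound; exists k => //=.
apply: (@lt_le_trans _ _ `|zpt R k 0 (Ordinal n0)|); last exact: coord_le_enorm.
by rewrite !mxE -pmulrn normr_nat ltr_nat.
Qed.

Lemma coef_limsup_far A f e : continuous f -> (forall y, `|f y| <= A) ->
  far e (conv phi (-1) f) -> (coef_limsup phi f <= e%:E)%E.
Proof.
move=> cf fA [rho H]; pose N := Num.bound `|rho|.
apply: (@le_trans _ _ (ereal_sup [set (`|Rintn (fun x => phi (x - zpt R k) * f x)|)%:E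
    | k in [set k : 'rV[int]_n | N%:R < enorm (zpt R k)]])).
  by apply: ereal_inf_lbound; exists N.
apply: ge_ereal_sup => _ [k /= Nk <-]; rewrite lee_fin (coef_conv k cf fA); apply: H.
apply: le_lt_trans Nk; apply: (le_trans (ler_norm _)); exact/ltW/archi_boundP.
Qed.

Lemma coef_limsup_lt A f t : continuous f -> (forall y, `|f y| <= A) -> (coef_limsup phi f < t%:E)%E ->
  exists rho : R, forall k : 'rV[int]_n, rho < enorm (zpt R k) -> `|conv phi (-1) f (zpt R k)| <= t.
Proof.
move=> cf fA lt; have [_ [N _ <-] ltN] := ereal_inf_lt lt; exists N%:R => k kN.
rewrite -(coef_conv k cf fA) -lee_fin; apply: le_trans (ltW ltN).
by apply: ereal_sup_ubound; exists k.
Qed.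

End Coefficients.

Lemma distLam_inF_equiv (phi eta : 'rV[R]_n -> R) (p : R) : continuous phi -> compact_support phi -> RI phi != 0 ->
  0 < p -> LP_eta eta -> exists C : R, 0 < C /\ forall f, inLambda s f ->
    (distLam s f [set g | inF eta s p q g] <= C%:E * (epsA r s p q f + coef_limsup phi f))%E /\
    (epsA r s p q f + coef_limsup phi f <= C%:E * distLam s f [set g | inF eta s p q g])%E.
Proof.
move=> cphi sphi iphi p0 eta_LP.
have a0 : 0 < p / q by rewrite divr_gt0.
have [C2 C20 H2] := clipping_inF n0 eta_LP s0 sr q0 p0.
have [CF CF0 HF] := LPR0_far n0 eta_LP s0 sr q0 p0 cphi sphi iphi.
have [Cp Cp0 Hp] := phi_maj2 cphi sphi.
have pin : 0 <= pi ^+ n :> R by rewrite exprn_ge0 // pi_ge0.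
have D20 : 0 < 4 * 2 ^+ r :> R by rewrite mulr_gt0 // exprn_gt0.
have D30 : 0 <= Cp * pi ^+ n * 3 by rewrite !mulr_ge0.
have [U EU] : exists U : R, U = 2 * (C2 * (1 + CF)) by eexists.
have U0 : 0 < U by rewrite EU !mulr_gt0 // addr_gt0.
have W0 : 0 < U + (4 * 2 ^+ r + Cp * pi ^+ n * 3) by rewrite addr_gt0 // ltr_pwDl.
have eA0 f : (0 <= epsA r s p q f)%E.
  by apply: le_ereal_inf_tmp => _ [e [e0 _] <-]; rewrite lee_fin ltW.
exists (U + (4 * 2 ^+ r + Cp * pi ^+ n * 3)); split => // f fL.
have [A lf] := inLambda_LamB fL; have [cf fA _] := lf.
have c0 := coef_limsup_ge0 phi f.
split.
  apply: le_scale_ereal => //; first exact: adde_ge0.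
  move=> t; move: c0 (eA0 f); case Ee : (epsA r s p q f) => [a| |] //; case Ec : (coef_limsup phi f) => [c| |] //.
  rewrite !lee_fin -EFinD lte_fin => c0 a00 act.
  (* Half of the slack [t - a - c] goes to each of the two infima. *)
  have d0 : 0 < (t - a - c) / 2 by rewrite divr_gt0 //; lra.
  set d := (t - a - c) / 2 in d0.
  have lt1 : (epsA r s p q f < (a + d)%:E)%E by rewrite Ee lte_fin ltrDl.
  have lt2 : (coef_limsup phi f < (c + d)%:E)%E by rewrite Ec lte_fin ltrDl.
  have [_ [e [e0 Ioo] <-]] := ereal_inf_lt lt1; rewrite lte_fin => ed.
  have coef := coef_limsup_lt cphi sphi cf fA lt2.
  have cd0 : 0 <= c + d by rewrite addr_ge0 // ltW.
  have fr := HF A f e (c + d) lf e0 Ioo cd0 coef.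
  have ec0 : 0 <= e + (c + d) by rewrite addr_ge0 // ltW.
  have b00 : 0 <= CF * (e + (c + d)) by rewrite mulr_ge0 // ltW.
  have [G lG gF] := H2 A f e _ lf e0 b00 Ioo fr.
  apply: (le_trans (distLam_le lf lG gF)); rewrite lee_fin.
  have tE : e + (c + d) <= t by rewrite /d; move: ed; rewrite /d; lra.
  have t0 : 0 <= t by apply: le_trans tE.
  apply: (@le_trans _ _ (U * t)); last by rewrite ler_wpM2r // lerDl ltW // ltr_pwDl.
  rewrite EU -!mulrA ler_wpM2l // ler_wpM2l ?(ltW C20) //.
  apply: (@le_trans _ _ ((1 + CF) * (e + (c + d)))); last by rewrite ler_wpM2l // addr_ge0 // ltW.
  rewrite mulrDl mul1r lerD2r; move: cd0; lra.
apply: le_scale_ereal => //; first exact: distLam_ge0.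
move=> t lt; have [t0 [g [gF [Ag lg] lh]]] := distLam_lt cf lt.
apply: (@le_trans _ _ ((4 * 2 ^+ r * t)%:E + (Cp * pi ^+ n * 3 * t)%:E)%E); last first.
  by rewrite -EFinD lee_fin -mulrDl ler_wpM2r ?(ltW t0) // lerDr ltW.
apply: leeD.
  have e0 : 0 < 4 * 2 ^+ r * t by rewrite mulr_gt0.
  have e0' : 0 < 2 * 2 ^+ r * t by rewrite !mulr_gt0 // exprn_gt0.
  apply: ereal_inf_lbound; exists (4 * 2 ^+ r * t) => //; split => //.
  apply: le_lt_trans (Sset_inF n0 eta_LP s0 sr q0 p0 lg gF e0').
  apply: intn_le => x; first exact: poweR_ge0.
  apply: gt0_ler_poweR; rewrite ?(ltW a0) ?in_itv /= ?leey ?andbT ?yint_ge0 //.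
  by apply: yint_mono => y; exact: Sset_transfer.
(* For the coefficients: [g] vanishes at infinity, so [f] is at most [2 t] far away, and its
   averages against [phi] are of order [t]. *)
have [_ hB _] := lh.
have [rho Hg] := inF_vanish n0 eta_LP s0 q0 p0 lg gF t0.
have ff : far (2 * t) f.
  exists rho => x /Hg gx; have := ler_normD (f x - g x) (g x); rewrite subrK.
  by move: gx (hB x); lra.
have t20 : 0 <= 2 * t by rewrite mulr_ge0 // ltW.
have := @conv_far R n Cp phi (-1) A (2 * t) t f cphi Hp cf fA t20 t0 ff.
rewrite (_ : _ * (2 * t + t) = Cp * pi ^+ n * 3 * t); last by ring.
exact: coef_limsup_far.
Qed.

Lemma distLam_inFinf_equiv (eta : 'rV[R]_n -> R) : LP_eta eta -> exists C : R, 0 < C /\ forall f, inLambda s f ->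
    (distLam s f [set g | inFinf eta s q g] <= C%:E * epsB r s f)%E /\
    (epsB r s f <= C%:E * distLam s f [set g | inFinf eta s q g])%E.
Proof.
move=> eta_LP; have [C2 C20 H2] := clipping_inFinf n0 eta_LP s0 sr q0.
have D20 : 0 < 4 * 2 ^+ r :> R by rewrite mulr_gt0 // exprn_gt0.
have eB0 f : (0 <= epsB r s f)%E.
  by apply: le_ereal_inf_tmp => _ [e [e0 _] <-]; rewrite lee_fin ltW.
exists (2 * C2 + 4 * 2 ^+ r); split; first by rewrite addr_gt0 // mulr_gt0.
move=> f fL; have [A lf] := inLambda_LamB fL; have [cf fA _] := lf.
have W0 : 0 < 2 * C2 + 4 * 2 ^+ r by rewrite addr_gt0 // mulr_gt0.
split; apply: le_scale_ereal => //; last 2 first.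
- exact: distLam_ge0.
- move=> t lt; have [t0 [g [gF [Ag lg] lh]]] := distLam_lt cf lt.
  have e0 : 0 < 4 * 2 ^+ r * t by rewrite mulr_gt0.
  have e0' : 0 < 2 * 2 ^+ r * t by rewrite !mulr_gt0 // exprn_gt0.
  apply: (@le_trans _ _ (4 * 2 ^+ r * t)%:E); last first.
    by rewrite lee_fin ler_wpM2r ?(ltW t0) // lerDr mulr_ge0 // ltW.
  apply: ereal_inf_lbound; exists (4 * 2 ^+ r * t) => //; split => //.
  apply: le_lt_trans (Sset_inFinf n0 eta_LP s0 sr q0 lg gF e0').
  apply: ge_ereal_sup => _ [[j m] _ <-] /=.
  apply: (@le_trans _ _ ((2 ^+ (j * n) : R)%:E * intn (fun x => (\1_(dcube R j m) x : R)%:E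
      * yint (Sset r s g (2 * 2 ^+ r * t)) x (2 ^- j)))%E); last first.
    by apply: ereal_sup_ubound; exists (j, m).
  rewrite lee_wpmul2l ?lee_fin ?exprn_ge0 //; apply: intn_le => x.
    by rewrite mule_ge0 ?lee_fin ?yint_ge0.
  rewrite lee_wpmul2l ?lee_fin //; apply: yint_mono => y /andP[y0 yj]; apply: Sset_transfer => //.
  by rewrite y0 (le_trans yj) // invf_le1 ?exprn_gt0 // exprn_ege1 // ler1n.
move=> t lt; have [_ [e [e0 Moo] <-]] := ereal_inf_lt lt; rewrite lte_fin => et.
have [G lG gF] := H2 A f e lf e0 Moo.
apply: (le_trans (distLam_le lf lG gF)); rewrite lee_fin mulrA ler_pM ?mulr_ge0 ?(ltW C20) ?(ltW e0) ?(ltW et) //.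
by rewrite lerDl ltW.
Qed.

End Equivalences.

Unset Implicit Arguments.

Theorem mainTheorem15 (R : realType) (n : nat) (s q : R) (r L : nat)
  (phi : 'rV[R]_n -> R) :
  (0 < n)%N -> 0 < s -> 0 < q -> s < r%:R -> daubechies_scaling L phi ->
  (* (a) *)
  (forall (p : R) (eta : 'rV[R]_n -> R), 0 < p -> LP_eta eta ->
     Num.max s (n%:R * (Num.max p^-1 (Num.max q^-1 1) - 1) - s) < L%:R ->
     r%:R - 1 <= (L%:R : R) ->
     exists C : R, 0 < C /\
       forall f : 'rV[R]_n -> R, inLambda s f ->
         (distLam s f [set g | inF eta s p q g]
            <= C%:E * (epsA r s p q f + coef_limsup phi f))%E /\
         (epsA r s p q f + coef_limsup phi f
            <= C%:E * distLam s f [set g | inF eta s p q g])%E) /\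
  (* (b) *)
  (forall eta : 'rV[R]_n -> R, LP_eta eta ->
     Num.max s (n%:R * (Num.max q^-1 1 - 1) - s) < L%:R ->
     r%:R - 1 <= (L%:R : R) ->
     exists C : R, 0 < C /\
       forall f : 'rV[R]_n -> R, inLambda s f ->
         (distLam s f [set g | inFinf eta s q g] <= C%:E * epsB r s f)%E /\
         (epsB r s f <= C%:E * distLam s f [set g | inFinf eta s q g])%E).
Proof.
move=> n0 s0 q0 sr [psi dphi]; have iphi := daubechies_RI_neq0 n0 dphi.
have [[/Ck_continuous cphi sphi] _ _ _ _] := dphi.
split; first by move=> p eta p0 eta_LP _ _; exact: distLam_inF_equiv.
by move=> eta eta_LP _ _; exact: distLam_inFinf_equiv.
Qed.
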